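(* Let $G$ be a simple geodesic ray on a convex polyhedron $P$. Then $G$ is dense in $P$.
   Context: A polyhedron $P$ is a compact surface, i.e. a 2-dimensional manifold obtained by gluing finitely many Euclidean triangles along their edges by length-preserving maps, with the induced intrinsic distance $d$; it is flat except at finitely many conical points, called vertices. The curvature of a vertex $v$ is $2\pi$ minus the total angle around $v$. $P$ is convex if it is homeomorphic to the sphere and all its vertices have positive curvature. A geodesic is a map $G:I\to P$, $I\subset\mathbb{R}$ an interval, such that for any $t\in I$ and any $s\in I$ close enough to $t$, $d(G(s),G(t))=|s-t|$. It is a geodesic ray if $I\neq\mathbb{R}$ is unbounded. A geodesic $G$ is simple if it admits no proper self-intersection, that is, there are no $t_1,t_2$ with $G(t_1)=G(t_2)$ but $G'(t_1)\neq G'(t_2)$, where $G'(t)$ is the direction of $G$ at $G(t)$. $G$ is dense in $P$ if its image is a dense subset of $P$.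
   Formalization: Rays that wind forever around a closed geodesic are excluded: a simple closed geodesic traversed endlessly (e.g. a cube's mid-section square) is a simple geodesic ray by the definition but is not dense. Geodesic is read as local isometry, since the literal wording admits broken lines. *)

(* Defs.v *)
From Stdlib Require Export Relations.
From mathcomp Require Export all_boot all_order all_algebra.
From mathcomp Require Export all_classical all_reals all_analysis.
Set Implicit Arguments.
Unset Strict Implicit.
Unset Printing Implicit Defensive.
Export Order.TTheory GRing.Theory Num.Theory numFieldNormedType.Exports.
Local Open Scope classical_set_scope.
Local Open Scope ring_scope.

(* The library norm on row vectors is the sup norm, hence the following. *)
Definition edot (R : realType) (n : nat) (u v : 'rV[R]_n) : R :=
  \sum_(i < n) u 0 i * v 0 i.
Definition enorm (R : realType) (n : nat) (u : 'rV[R]_n) : R :=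
  Num.sqrt (edot u u).

(* Edge [(t, i)] of the triangle [t] runs from corner [i] to corner [ordS i].
   [mate] pairs the edges; for each pair there are only two length-preserving
   bijections, the affine ones, and [flip] tells which of them is the gluing.
   As every edge is glued to exactly one other edge, the result of the gluing is
   a closed surface. *)
Record gluing (R : realType) := Gluing {
  face : finType;
  corner : face -> 'I_3 -> 'rV[R]_2;
  cornerP : forall t : face,
    row_free (\matrix_(i < 2) (corner t (lift ord0 i) - corner t ord0));
  mate : face * 'I_3 -> face * 'I_3;
  flip : face * 'I_3 -> bool;
  mateK : involutive mate;
  mate_neq : forall e : face * 'I_3, mate e != e;
  flip_mate : forall e : face * 'I_3, flip (mate e) = flip e;
  mate_length : forall e : face * 'I_3,
    enorm (corner (mate e).1 (ordS (mate e).2) - corner (mate e).1 (mate e).2)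
    = enorm (corner e.1 (ordS e.2) - corner e.1 e.2) }.

Section Gluing.
Context (R : realType) (S : gluing R).

Definition in_face (t : face S) (p : 'rV[R]_2) : Prop :=
  exists w : 'I_3 -> R, [/\ forall i, 0 <= w i, \sum_i w i = 1
    & p = \sum_i w i *: corner t i].

Definition edge_pt (e : face S * 'I_3) (s : R) : 'rV[R]_2 :=
  (1 - s) *: corner e.1 e.2 + s *: corner e.1 (ordS e.2).

Definition glued_along_edge (x y : face S * 'rV[R]_2) : Prop :=
  exists (e : face S * 'I_3) (s : R), [/\ 0 <= s <= 1,
    x = (e.1, edge_pt e s)
  & y = ((mate e).1, edge_pt (mate e) (if flip e then 1 - s else s))].

Definition glued : face S * 'rV[R]_2 -> face S * 'rV[R]_2 -> Prop :=
  clos_refl_sym_trans _ glued_along_edge.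

(* [polyline x y l]: in the glued surface, x and y are joined by a path of
   length l which is a concatenation of segments, each inside one triangle. *)
Inductive polyline : face S * 'rV[R]_2 -> face S * 'rV[R]_2 -> R -> Prop :=
| polyline_refl x : polyline x x 0
| polyline_glue x y z l : glued x y -> polyline y z l -> polyline x z l
| polyline_segment t p q z l : in_face t p -> in_face t q ->
    polyline (t, q) z l -> polyline (t, p) z (enorm (q - p) + l).

Definition corner_angle (c : face S * 'I_3) : R :=
  let u := corner c.1 (ordS c.2) - corner c.1 c.2 in
  let v := corner c.1 (ordS (ordS c.2)) - corner c.1 c.2 in
  acos (edot u v / (enorm u * enorm v)).

End Gluing.

(* A metric space identified, through the projection [proj], with the quotient
   of the disjoint union of the triangles by the gluing, the distance being the
   intrinsic one. The value of [proj t] outside the triangle [t] is irrelevant.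
   An infimum over an empty set of paths is +oo, so the space is connected. *)
Record polyhedron (R : realType) := Polyhedron {
  carrier :> metricType R;
  pieces : gluing R;
  proj : face pieces -> 'rV[R]_2 -> carrier;
  proj_surj : forall x : carrier,
    exists (t : face pieces) (p : 'rV[R]_2), in_face t p /\ proj t p = x;
  proj_glued : forall (t t' : face pieces) (p p' : 'rV[R]_2),
    in_face t p -> in_face t' p' ->
    (proj t p = proj t' p' <-> glued (t, p) (t', p'));
  proj_dist : forall (t t' : face pieces) (p p' : 'rV[R]_2),
    in_face t p -> in_face t' p' ->
    (mdist (proj t p) (proj t' p'))%:E
    = ereal_inf [set l%:E | l in polyline (t, p) (t', p')] }.

Section Polyhedron.
Context (R : realType) (P : polyhedron R).

Definition is_corner (x : P) : Prop :=
  exists c : face (pieces P) * 'I_3, proj c.1 (corner c.1 c.2) = x.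

(* Only used at images of corners of triangles; the total angle at any other
   point is 2 pi. *)
Definition curvature (x : P) : R :=
  2 * pi - \sum_(c : face (pieces P) * 'I_3 | proj c.1 (corner c.1 c.2) == x)
             corner_angle c.

(* A corner of a triangle at which the total angle is 2 pi is not conical. *)
Definition is_vertex (x : P) : Prop := is_corner x /\ curvature x != 0.

Definition homeomorphic_to_sphere : Prop :=
  exists (f : P -> 'rV[R]_3) (g : 'rV[R]_3 -> P),
    [/\ continuous f,
        {within [set u | enorm u = 1], continuous g},
        forall x, enorm (f x) = 1,
        forall x, g (f x) = x
      & forall u, enorm u = 1 -> f (g u) = u].

Definition convex_polyhedron : Prop :=
  homeomorphic_to_sphere /\ forall v : P, is_vertex v -> 0 < curvature v.

(* A map I -> P is represented by a map R -> P whose values outside I are never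
   used. The distance condition is required of all pairs of parameters near
   [t0]: required of the pairs (t0, t) only, it would also hold for every
   broken line parametrized by arc length. *)
Definition geodesic (I : set R) (G : R -> P) : Prop :=
  is_interval I /\
  forall t0, I t0 -> exists2 e : R, 0 < e &
    forall s t, I s -> I t -> `|s - t0| < e -> `|t - t0| < e ->
      mdist (G s) (G t) = `|s - t|.

Definition geodesic_ray (I : set R) (G : R -> P) : Prop :=
  [/\ geodesic I G, I <> setT & ~ (has_lbound I /\ has_ubound I)].

(* An isometry [phi] from a Euclidean disc, identifying the tangent plane at
   the flat point [x] with the plane. *)
Definition flat_chart (x : P) (phi : 'rV[R]_2 -> P) : Prop :=
  exists r : R, [/\ 0 < r, phi 0 = x,
    forall u v, enorm u < r -> enorm v < r ->
      mdist (phi u) (phi v) = enorm (u - v)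
  & forall y, mdist x y < r -> exists2 u, enorm u < r & phi u = y].

(* The direction G'(t), read in a chart centred at G(t), is the vector v. *)
Definition has_direction (phi : 'rV[R]_2 -> P) (I : set R) (G : R -> P)
    (t : R) (v : 'rV[R]_2) : Prop :=
  \forall h \near (0 : R), I (t + h) -> G (t + h) = phi (h *: v).

(* On a convex polyhedron a geodesic meets a vertex at most at the ends of I, so
   the self-intersections of a ray are at flat points. *)
Definition simple_geodesic (I : set R) (G : R -> P) : Prop :=
  ~ exists (t1 t2 : R) (phi : 'rV[R]_2 -> P) (v1 v2 : 'rV[R]_2),
      [/\ I t1 /\ I t2, G t1 = G t2, flat_chart (G t1) phi,
          has_direction phi I G t1 v1 /\ has_direction phi I G t2 v2
        & v1 <> v2].

(* For unbounded I: G runs for ever around a closed geodesic. If that closed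
   geodesic is simple then G has no proper self-intersection either. *)
Definition periodic_geodesic (I : set R) (G : R -> P) : Prop :=
  exists2 T : R, 0 < T & forall t, I t -> I (t + T) -> G (t + T) = G t.

End Polyhedron.

(* Main.v *)
(* Every point of [P] has polar coordinates on a cone: developing the triangles around it and lifting
   polylines to the universal cover of the cone bounds distances from below.

   In a flat chart, simplicity makes any two distinct strands of [G] disjoint, hence their limits, the
   leaves, never cross transversally, and the leaves fill the limit set [L] of [G]. Suppose that [L] is
   not all of [P]. Since curvature is positive, distances to an invariant subset of [L] are concave along
   strands of [G] that stay close to it; [G] would have to be periodic if a leaf closed up or passed
   three times through one point. On the other hand, a ball disjoint from [L] gives a leaf with a ball
   tangent to it and disjoint from [L]. In a flat strip along a leaf the pairs (foot, radius) of such
   free balls form a convex set: the largest free radius is locally concave, and being positive on a half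
   of the leaf that meets no vertex it does not decrease there. That half returns infinitely often near
   some limit leaf, and two leaves on the same side of a limit leaf cannot both keep a free ball on their
   far sides; so it passes three times through one point, a contradiction. *)

(* The obstacle is the vertices. [G] avoids them in its interior, since two rays from a vertex make
   an angle less than pi, but limits of its strands do run through them. Such a leaf makes an angle
   of exactly pi on the side from which the strands come, which forces the total angle to be at
   least pi; and no strand close to the vertex enters the remaining sector, of angle less than pi,
   for it would cross the leaf. So a half disc bounded by the leaf does at a vertex what a disc does
   at a flat point, and one notion of [box] covers both. The remaining sector, if not empty,
   supplies a free ball tangent to the leaf just behind the vertex.

   Limits are taken along ultrafilters: one ultrafilter of times defines a whole leaf, and
   compactness of the sphere makes it converge.

   Three passages through a point are excluded, rather than two, because a leaf may pass in two
   directions: among three, two agree, and the arc between them closes up. A closed arc is an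
   invariant set, the distance to it vanishes along [G] by concavity, and [G] repeats itself on
   it. *)
Require Import Defs.
From mathcomp Require Import ring lra.
Set Implicit Arguments.
Unset Strict Implicit.
Unset Printing Implicit Defensive.
Set Default Proof Using "All".
Local Open Scope classical_set_scope.
Local Open Scope ring_scope.
(* [lra] is superlinear in the number of hypotheses: try it first on those mentioning only
   variables of the goal, then on those sharing a variable with the goal. *)
Ltac foreign_variable T :=
  match T with context [?x] =>
    is_var x; lazymatch goal with |- context [x] => fail | _ => idtac end end.
Ltac shares_variable T :=
  match T with context [?x] =>
    is_var x; lazymatch type of x with realType => fail | _ => lazymatch goal with |- context [x] => idtac end end end.
Ltac drop_foreign := repeat match goal with
  | H : is_true ?T |- _ => foreign_variable T; clear H
  | H : ?a = ?b |- _ => foreign_variable (a, b); clear H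
  end.
Ltac drop_unrelated := repeat match goal with
  | H : is_true ?T |- _ => tryif shares_variable T then fail else clear H
  | H : ?a = ?b |- _ => tryif shares_variable (a, b) then fail else clear H
  end.
Ltac rlra := lazymatch goal with
  | |- _ -> False => lra
  | |- False => lra
  | _ => first [solve [intros; drop_foreign; lra] | solve [intros; drop_unrelated; lra] | lra]
  end.
(** * Plane geometry *)

Section RealInduction.
Context (R : realType).

(** Local statements are propagated along a segment by openness to the right and closedness from the
    left. This carries uniqueness of geodesics, invariance of arcs and persistence of free balls
    alike. *)
Lemma real_induction (U : R) (Q : R -> Prop) : 0 <= U ->
  Q 0 ->
  (forall u : R, 0 <= u < U -> (forall v : R, 0 <= v <= u -> Q v) ->
     exists2 e : R, 0 < e & forall v : R, u < v < u + e -> v <= U -> Q v) ->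
  (forall u : R, 0 < u <= U -> (forall v : R, 0 <= v < u -> Q v) -> Q u) ->
  forall u : R, 0 <= u <= U -> Q u.
Proof.
move=> U0 Q0 Qr Ql u uU; apply: contrapT => nQ.
pose A := [set s | 0 <= s <= U /\ forall v, 0 <= v <= s -> Q v].
have A0 : A 0.
  split; first by rewrite lexx U0.
  by move=> v; rewrite -eq_le => /eqP <-.
have Aub s : A s -> s <= u.
  move=> [_ h]; rewrite leNgt; apply/negP => us; apply: nQ; apply: h.
  by case/andP: uU => -> _; exact: ltW.
have hs : has_sup A by split; [exists 0 | exists u].
set s := sup A.
have s0 : 0 <= s by apply: ub_le_sup => //; exists u.
have su : s <= u by apply: ge_sup => //; exists 0.
have sU : s <= U by case/andP: uU => _; apply: le_trans.
have hlt v : 0 <= v < s -> Q v.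
  case/andP => v0 vs.
  have [w Aw vw] := sup_adherent (eps := s - v) (ltac:(by rewrite subr_gt0)) hs.
  rewrite -/s in vw.
  case: Aw => _; apply; rewrite v0 /=; lra.
have Qs : Q s.
  have [s00|/eqP s1] := eqVneq s 0; first by rewrite s00.
  apply: Ql => //; rewrite sU andbT lt_neqAle s0 andbT eq_sym; exact/eqP.
have hle v : 0 <= v <= s -> Q v.
  case/andP => v0; rewrite le_eqVlt => /orP[/eqP -> //|vs].
  by apply: hlt; rewrite v0 vs.
have : s < U \/ s = U by move: sU; rewrite le_eqVlt => /orP[/eqP|]; [right|left].
case=> [sU'|sU']; last first.
  apply: nQ; apply: hle; move: uU => /andP[-> ]; by rewrite -sU'.
have [e e0 he] := Qr s (ltac:(by rewrite s0 sU')) hle.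
pose w := Num.min (s + e / 2) U.
have sw : s < w by rewrite lt_min sU' andbT; lra.
have wU : w <= U by rewrite ge_min lexx orbT.
have we : w <= s + e / 2 by rewrite ge_min lexx.
have Aw : A w.
  split; first by rewrite wU andbT (le_trans s0 (ltW sw)).
  move=> v /andP[v0 vw]; have [vs|vs] := leP v s; first by apply: hle; rewrite v0.
  apply: he; last exact: le_trans wU.
  by rewrite vs; lra.
have : w <= s by apply: ub_le_sup => //; exists u.
by rewrite leNgt sw.
Qed.

End RealInduction.

Section Plane.
Context (R : realType).
Implicit Types r s t u v x dl U : R.
Implicit Types z w e a b p q : R * R.

Definition nm z : R := Num.sqrt (z.1 ^+ 2 + z.2 ^+ 2).
Definition pd z w : R := nm (z.1 - w.1, z.2 - w.2).
Definition mv z (u : R) e : R * R := (z.1 + u * e.1, z.2 + u * e.2).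
Definition dotp z w : R := z.1 * w.1 + z.2 * w.2.

Lemma nm_ge0 z : 0 <= nm z. Proof. exact: sqrtr_ge0. Qed.
Lemma nm_sqr z : nm z ^+ 2 = z.1 ^+ 2 + z.2 ^+ 2.
Proof. by rewrite sqr_sqrtr // addr_ge0 // sqr_ge0. Qed.
Lemma nm_le z (x : R) : 0 <= x -> (nm z <= x) = (z.1 ^+ 2 + z.2 ^+ 2 <= x ^+ 2).
Proof. by move=> x0; rewrite -nm_sqr ler_pXn2r // nnegrE nm_ge0. Qed.
Lemma nm_lt z (x : R) : 0 <= x -> (nm z < x) = (z.1 ^+ 2 + z.2 ^+ 2 < x ^+ 2).
Proof. by move=> x0; rewrite -nm_sqr ltr_pXn2r // nnegrE nm_ge0. Qed.
Lemma nm_ge z (x : R) : 0 <= x -> (x <= nm z) = (x ^+ 2 <= z.1 ^+ 2 + z.2 ^+ 2).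
Proof. by move=> x0; rewrite leNgt nm_lt // leNgt. Qed.
Lemma nm_eq z (x : R) : 0 <= x -> z.1 ^+ 2 + z.2 ^+ 2 = x ^+ 2 -> nm z = x.
Proof. by move=> x0 h; rewrite /nm h sqrtr_sqr ger0_norm. Qed.
Lemma nm_eq1 e : nm e = 1 <-> e.1 ^+ 2 + e.2 ^+ 2 = 1.
Proof. split=> [h|h]; first by rewrite -nm_sqr h expr1n. by apply: nm_eq => //; rewrite expr1n. Qed.
Lemma nm_fst z : `|z.1| <= nm z.
Proof. by rewrite nm_ge // real_normK ?num_real // lerDl sqr_ge0. Qed.
Lemma nm_snd z : `|z.2| <= nm z.
Proof. by rewrite nm_ge // real_normK ?num_real // lerDr sqr_ge0. Qed.
Lemma nm_le_sum z : nm z <= `|z.1| + `|z.2|.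
Proof.
rewrite nm_le ?addr_ge0 //.
rewrite sqrrD !real_normK ?num_real // -addrA lerD2l addrC lerDl.
by rewrite mulrn_wge0 // mulr_ge0.
Qed.

Lemma dotp_le z w : dotp z w <= nm z * nm w.
Proof.
have h : dotp z w ^+ 2 <= (nm z * nm w) ^+ 2.
  rewrite exprMn !nm_sqr /dotp.
  have := sqr_ge0 (z.1 * w.2 - z.2 * w.1); nra.
have [h0|h0] := leP (dotp z w) 0.
  by apply: le_trans h0 _; rewrite mulr_ge0 // nm_ge0.
by move: h; rewrite ler_pXn2r // nnegrE ?mulr_ge0 ?nm_ge0 // ltW.
Qed.
Lemma dotp_norm z w : `|dotp z w| <= nm z * nm w.
Proof.
rewrite ler_norml dotp_le andbT lerNl.
have -> : - dotp z w = dotp (- z.1, - z.2) w by rewrite /dotp /=; ring.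
by apply: le_trans (dotp_le _ _) _; rewrite /nm /= !sqrrN.
Qed.

Lemma nmD z w : nm (z.1 + w.1, z.2 + w.2) <= nm z + nm w.
Proof.
rewrite nm_le ?addr_ge0 ?nm_ge0 //=.
have := dotp_le z w; rewrite (sqrrD (nm z)) !nm_sqr /dotp; lra.
Qed.
Lemma nmZ (u : R) z : nm (u * z.1, u * z.2) = `|u| * nm z.
Proof.
apply: nm_eq; first by rewrite mulr_ge0 ?nm_ge0.
by rewrite [RHS]exprMn nm_sqr real_normK ?num_real //=; ring.
Qed.
Lemma nmN z : nm (- z.1, - z.2) = nm z. Proof. by rewrite /nm /= !sqrrN. Qed.

Lemma pd_ge0 z w : 0 <= pd z w. Proof. exact: nm_ge0. Qed.
Lemma pdC z w : pd z w = pd w z.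
Proof. rewrite /pd -nmN /=; congr nm; congr pair; ring. Qed.
Lemma pdzz z : pd z z = 0.
Proof. by rewrite /pd !subrr; apply: nm_eq => //=; rewrite expr0n addr0. Qed.
Lemma pd_tri w z p : pd z p <= pd z w + pd w p.
Proof.
apply: le_trans (nmD _ _) => /=; rewrite le_eqVlt; apply/orP; left; apply/eqP.
by rewrite /pd; congr nm; congr pair; ring.
Qed.
Lemma pd_eq0 z w : pd z w = 0 -> z = w.
Proof.
move=> h; have := nm_sqr (z.1 - w.1, z.2 - w.2); rewrite -/(pd z w) h expr0n /= => /esym/eqP.
rewrite paddr_eq0 ?sqr_ge0 // !sqrf_eq0 !subr_eq0 => /andP[/eqP h1 /eqP h2].
by case: z w h1 h2 {h} => ? ? [? ?] /= -> ->.
Qed.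
Lemma pd0 z : pd z (0, 0) = nm z.
Proof. by rewrite /pd !subr0; case: z. Qed.
Lemma pd0l z : pd (0, 0) z = nm z. Proof. by rewrite pdC pd0. Qed.
Lemma pd_sqr z w : pd z w ^+ 2 = (z.1 - w.1) ^+ 2 + (z.2 - w.2) ^+ 2.
Proof. by rewrite nm_sqr. Qed.
Lemma pd_fst z w : `|z.1 - w.1| <= pd z w. Proof. exact: (nm_fst (_, _)). Qed.
Lemma pd_mv z (u v : R) e : pd (mv z u e) (mv z v e) = `|u - v| * nm e.
Proof. by rewrite -nmZ /pd /mv /=; congr nm; congr pair; ring. Qed.
Lemma pd_mv1 z (u v : R) e : nm e = 1 -> pd (mv z u e) (mv z v e) = `|u - v|.
Proof. by move=> e1; rewrite pd_mv e1 mulr1. Qed.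
Lemma mv0 z e : mv z 0 e = z. Proof. by rewrite /mv !mul0r !addr0; case: z. Qed.
Lemma mvD z (u v : R) e : mv (mv z u e) v e = mv z (u + v) e.
Proof. by rewrite /mv /=; congr pair; ring. Qed.
Lemma mvN z (u : R) e : mv z u (- e.1, - e.2) = mv z (- u) e.
Proof. by rewrite /mv /=; congr pair; ring. Qed.
Lemma pd_mvz z (u : R) e : nm e = 1 -> pd (mv z u e) z = `|u|.
Proof. by move=> e1; rewrite -{2}(mv0 z e) pd_mv1 // subr0. Qed.
Lemma pd_mv_mv z w (u : R) e f : pd (mv z u e) (mv w u f) <= pd z w + `|u| * pd e f.
Proof.
rewrite /pd -nmZ /=; apply: le_trans (nmD _ _) => /=.
by rewrite le_eqVlt /mv /=; apply/orP; left; apply/eqP; congr nm; congr pair; ring.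
Qed.
Lemma nm_mv z (u : R) e : nm e = 1 -> nm (mv z u e) <= nm z + `|u|.
Proof. by move=> e1; apply: le_trans (nmD _ (_, _)) _; rewrite nmZ e1 mulr1. Qed.
Lemma nm_mv_sqr z (u : R) e : nm e = 1 -> nm (mv z u e) ^+ 2 = nm z ^+ 2 + 2 * u * dotp z e + u ^+ 2.
Proof.
move=> /nm_eq1 e1; rewrite !nm_sqr /mv /dotp /=.
transitivity (z.1 ^+ 2 + z.2 ^+ 2 + 2 * u * (z.1 * e.1 + z.2 * e.2) + u ^+ 2 * (e.1 ^+ 2 + e.2 ^+ 2)); first by ring.
by rewrite e1 mulr1.
Qed.
Lemma nm_pd z w : nm z <= nm w + pd z w.
Proof. by rewrite -(pd0 z) -(pd0 w) addrC; exact: pd_tri. Qed.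

(** By polarization the distances from [c 0] and [c s] give scalar products, and the equality case
    of Cauchy-Schwarz puts [c u] on the line through these two points; [s = d0 / 2] is an arbitrary
    reference. *)
Lemma isom_line (c : R -> R * R) (d0 : R) : 0 < d0 ->
  (forall s t : R, `|s| < d0 -> `|t| < d0 -> pd (c s) (c t) = `|s - t|) ->
  exists2 e, nm e = 1 & forall u : R, `|u| < d0 -> c u = mv (c 0) u e.
Proof.
move=> d0p h; pose s := d0 / 2.
have s0 : 0 < s by rewrite /s; lra.
have sd : `|s| < d0 by rewrite gtr0_norm // /s; lra.
have zd : `|0 : R| < d0 by rewrite normr0.
pose e := (((c s).1 - (c 0).1) / s, ((c s).2 - (c 0).2) / s).
have hs2 : ((c s).1 - (c 0).1) ^+ 2 + ((c s).2 - (c 0).2) ^+ 2 = s ^+ 2.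
  by rewrite -pd_sqr h // subr0 real_normK ?num_real.
exists e.
  apply/nm_eq1; rewrite /e /= !exprMn -mulrDl hs2 -exprMn mulfV ?expr1n //; lra.
move=> u ud.
have hu2 : ((c u).1 - (c 0).1) ^+ 2 + ((c u).2 - (c 0).2) ^+ 2 = u ^+ 2.
  by rewrite -pd_sqr h // subr0 real_normK ?num_real.
have hsu2 : ((c u).1 - (c s).1) ^+ 2 + ((c u).2 - (c s).2) ^+ 2 = (u - s) ^+ 2.
  by rewrite -pd_sqr h // real_normK ?num_real.
set a1 := (c u).1 - (c 0).1 in hu2 *; set a2 := (c u).2 - (c 0).2 in hu2 *.
set b1 := (c s).1 - (c 0).1 in hs2 *; set b2 := (c s).2 - (c 0).2 in hs2 *.
have hdot : a1 * b1 + a2 * b2 = u * s.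
  move: hsu2; rewrite -(subrK (c 0).1 (c u).1) -(subrK (c 0).1 (c s).1) -(subrK (c 0).2 (c u).2) -(subrK (c 0).2 (c s).2) -/a1 -/a2 -/b1 -/b2; nra.
have hz : (s * a1 - u * b1) ^+ 2 + (s * a2 - u * b2) ^+ 2 = 0.
  transitivity (s ^+ 2 * (a1 ^+ 2 + a2 ^+ 2) + u ^+ 2 * (b1 ^+ 2 + b2 ^+ 2) - 2 * s * u * (a1 * b1 + a2 * b2)); first by ring.
  by rewrite hdot hs2 hu2; ring.
move/eqP: hz; rewrite paddr_eq0 ?sqr_ge0 // !sqrf_eq0 !subr_eq0 => /andP[/eqP k1 /eqP k2].
have sn : s != 0 by lra.
rewrite /mv /e /= -/b1 -/b2.
have q1 : u * (b1 / s) = a1 by rewrite mulrA -k1 mulrAC mulfV // mul1r.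
have q2 : u * (b2 / s) = a2 by rewrite mulrA -k2 mulrAC mulfV // mul1r.
by rewrite q1 q2 /a1 /a2 !(addrC (_ (c 0))) !subrK; case: (c u).
Qed.

(** Two values determine an affine map. They are taken at negative parameters because, where a
    continuation is to be shown unique, only the past is known. *)
Lemma mv_inj z w e f (d0 : R) : 0 < d0 ->
  (forall u : R, - d0 < u < 0 -> mv z u e = mv w u f) -> z = w /\ e = f.
Proof.
move=> d0p h.
have [h1 h2] : mv z (- d0 / 2) e = mv w (- d0 / 2) f by apply: h; lra.
have [h3 h4] : mv z (- d0 / 4) e = mv w (- d0 / 4) f by apply: h; lra.
have k1 : e.1 = f.1.
  have : (d0 / 4) * (e.1 - f.1) = 0 by lra.
  by move/eqP; rewrite mulf_eq0 subr_eq0 => /orP[/eqP ?|/eqP //]; lra.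
have k2 : e.2 = f.2.
  have : (d0 / 4) * (e.2 - f.2) = 0 by lra.
  by move/eqP; rewrite mulf_eq0 subr_eq0 => /orP[/eqP ?|/eqP //]; lra.
rewrite k1 in h1 h3; rewrite k2 in h2 h4.
have m1 : z.1 = w.1 by lra.
have m2 : z.2 = w.2 by lra.
by case: z w e f m1 m2 k1 k2 {h h1 h2 h3 h4} => [? ?] [? ?] [? ?] [? ?] /= -> -> -> ->.
Qed.

End Plane.

(** * Polar coordinates in the plane *)

Section Polar.
Context (R : realType).
Implicit Types r s t u v x y a b dl U : R.
Implicit Types z w e f : R * R.

Definition pol r a : R * R := (r * cos a, r * sin a).
(** At the origin the quotient is 0 and the angle [pi / 2]: the radius vanishes there, and the bound
    of [arg_nneg] remains valid. *)
Definition arg z : R := if 0 <= z.2 then acos (z.1 / nm z) else - acos (z.1 / nm z).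

Lemma nm_pol r a : 0 <= r -> nm (pol r a) = r.
Proof. by move=> r0; apply: nm_eq => //=; rewrite !exprMn -mulrDr cos2Dsin2 mulr1. Qed.

Lemma nm0 z : nm z = 0 -> z = (0, 0).
Proof. by move=> h; apply: pd_eq0; rewrite pd0. Qed.
Lemma nm00 : nm (0, 0) = 0 :> R.
Proof. by apply: nm_eq => //=; rewrite expr0n addr0. Qed.
Lemma nm_gt0 z : z.1 != 0 -> 0 < nm z.
Proof.
move=> z1; rewrite lt_neqAle nm_ge0 andbT eq_sym; apply/eqP => /nm0 h.
by rewrite h eqxx in z1.
Qed.

Lemma nm_div z : -1 <= z.1 / nm z <= 1.
Proof.
rewrite -ler_norml; have [->|h] := eqVneq (nm z) 0; first by rewrite invr0 mulr0 normr0.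
have h0 : 0 < nm z by rewrite lt_neqAle nm_ge0 eq_sym h.
by rewrite normrM normfV (ger0_norm (nm_ge0 z)) ler_pdivrMr // mul1r nm_fst.
Qed.

Lemma pol_arg z : pol (nm z) (arg z) = z.
Proof.
have [h|h] := eqVneq (nm z) 0; first by rewrite /pol h !mul0r (nm0 h).
have h0 : 0 < nm z by rewrite lt_neqAle nm_ge0 eq_sym h.
have hs : nm z * Num.sqrt (1 - (z.1 / nm z) ^+ 2) = `|z.2|.
  rewrite -{1}(ger0_norm (nm_ge0 z)) -{1}sqrtr_sqr -sqrtrM ?sqr_ge0 // mulrBr mulr1 -exprMn.
  by rewrite mulrCA mulfV // mulr1 nm_sqr addrC addKr sqrtr_sqr.
have ha := nm_div z.
rewrite /pol /arg; case: ifP => hz.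
  rewrite acosK ?in_itv //= sin_acos // hs mulrCA mulfV // mulr1 ger0_norm //; by case: z {h h0 hs hz ha}.
rewrite cosN sinN acosK ?in_itv //= sin_acos // mulrN hs mulrCA mulfV // mulr1 ltr0_norm ?opprK; last by rewrite ltNge hz.
by case: z {h h0 hs hz ha}.
Qed.

Lemma arg_range z : `|arg z| <= pi.
Proof.
have ha := nm_div z; have h1 := acos_ge0 ha; have h2 := acos_lepi ha.
by rewrite /arg; case: ifP => _; rewrite ?normrN ger0_norm.
Qed.

Lemma arg_nneg z : 0 <= z.1 -> `|arg z| <= pi / 2.
Proof.
move=> z1; have ha := nm_div z; have h1 := acos_ge0 ha; have h2 := acos_lepi ha.
have -> : `|arg z| = acos (z.1 / nm z) by rewrite /arg; case: ifP => _; rewrite ?normrN ger0_norm.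
rewrite leNgt; apply/negP => h.
have : cos (acos (z.1 / nm z)) < cos (pi / 2).
  have := pi_gt0 R => pp.
  by rewrite ltr_cos // in_itv /=; apply/andP; split => //; lra.
rewrite acosK ?in_itv //= cos_pihalf ltNge; move/negP; apply.
by rewrite divr_ge0 ?nm_ge0.
Qed.

Lemma arg_pos z : 0 < z.1 -> `|arg z| < pi / 2.
Proof.
move=> z1; have ha := nm_div z; have h1 := acos_ge0 ha; have h2 := acos_lepi ha.
have z10 : 0 < nm z by apply: nm_gt0; rewrite gt_eqF.
have -> : `|arg z| = acos (z.1 / nm z) by rewrite /arg; case: ifP => _; rewrite ?normrN ger0_norm.
rewrite ltNge; apply/negP => h.
have : cos (acos (z.1 / nm z)) <= cos (pi / 2).
  have := pi_gt0 R => pp.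
  rewrite leNgt; apply/negP; rewrite ltr_cos ?in_itv /=; [lra| |]; apply/andP; split => //; lra.
rewrite acosK ?in_itv //= cos_pihalf leNgt; move/negP; apply.
by rewrite divr_gt0.
Qed.

Lemma arg_polK r a : 0 < r -> `|a| < pi -> arg (pol r a) = a.
Proof.
move=> r0 ha; rewrite /arg nm_pol ?(ltW r0) //= (mulrC r (cos a)) mulfK ?gt_eqF //.
have [a0|a0] := leP 0 a.
  rewrite ger0_norm // in ha.
  rewrite ifT; last by rewrite mulr_ge0 ?(ltW r0) // sin_ge0_pi // a0 ltW.
  by rewrite cosK // in_itv /= a0 ltW.
rewrite ltr0_norm // in ha.
rewrite ifF; last first.
  apply/negbTE; rewrite -ltNge pmulr_rlt0 // -oppr_gt0 -sinN sin_gt0_pi //.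
  by rewrite ha oppr_gt0 a0.
by rewrite cosKN ?opprK //; apply/andP; split; lra.
Qed.

Lemma cos_le_abs x y : `|x| <= pi -> 0 <= y <= pi -> cos y <= cos x -> `|x| <= y.
Proof.
move=> hx hy; rewrite -(cos_norm x) => h; rewrite leNgt; apply/negP => hlt.
move: h; rewrite leNgt ltr_cos ?hlt // in_itv /= ?normr_ge0 //.
Qed.


Lemma cos_lt x y : 0 <= x -> y <= pi -> x < y -> cos y < cos x.
Proof. by move=> x0 yp xy; rewrite ltr_cos // in_itv /=; apply/andP; split => //; lra. Qed.

Lemma cos_le x y : 0 <= x -> y <= pi -> x <= y -> cos y <= cos x.
Proof.
by move=> x0 yp; rewrite le_eqVlt => /orP[/eqP -> //|xy]; apply: ltW; exact: cos_lt.
Qed.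

Lemma cos_pos_small x : `|x| < 3 * (pi / 2) -> 0 < cos x -> `|x| < pi / 2.
Proof.
have p0 := pi_gt0 R.
move=> hx; rewrite -(cos_norm x) ltNge => h; rewrite ltNge; apply/negP => h2.
move/negP: h; apply.
have -> : `|x| = (`|x| - pi) + pi by ring.
rewrite cosDpi oppr_le0; apply: cos_ge0_pihalf; apply/andP; split; lra.
Qed.

Definition rotz a z : R * R := (cos a * z.1 - sin a * z.2, sin a * z.1 + cos a * z.2).

Lemma pol_rot r a b : pol r (a + b) = rotz a (pol r b).
Proof. by rewrite /pol /rotz cosD sinD /=; congr pair; ring. Qed.

Lemma pd_rot a z w : pd (rotz a z) (rotz a w) = pd z w.
Proof.
apply: nm_eq; first exact: pd_ge0.
rewrite pd_sqr /=; have := cos2Dsin2 a => h.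
transitivity ((cos a ^+ 2 + sin a ^+ 2) * ((z.1 - w.1) ^+ 2 + (z.2 - w.2) ^+ 2)); first by ring.
by rewrite h mul1r.
Qed.
Lemma nm_rot a z : nm (rotz a z) = nm z.
Proof. by rewrite -(pd0 z) -(pd_rot a) -pd0 /rotz /= !mulr0 subrr addr0. Qed.

Lemma pd_polD r s a b c : pd (pol r (c + a)) (pol s (c + b)) = pd (pol r a) (pol s b).
Proof. by rewrite !pol_rot pd_rot. Qed.

Lemma pd_pol_sqr r s a b : pd (pol r a) (pol s b) ^+ 2 = r ^+ 2 + s ^+ 2 - 2 * r * s * cos (a - b).
Proof.
rewrite pd_sqr /= cosB.
have h1 := cos2Dsin2 a; have h2 := cos2Dsin2 b.
transitivity (r ^+ 2 * (cos a ^+ 2 + sin a ^+ 2) + s ^+ 2 * (cos b ^+ 2 + sin b ^+ 2) - 2 * r * s * (cos a * cos b + sin a * sin b)); first by ring.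
by rewrite h1 h2; ring.
Qed.

Lemma pd_pol_eq r s a b r' s' a' b' : cos (a - b) = cos (a' - b') -> r = r' -> s = s' ->
  pd (pol r a) (pol s b) = pd (pol r' a') (pol s' b').
Proof.
move=> h -> ->; apply: (@nm_eq _ (_, _)); first exact: pd_ge0.
by rewrite -pd_sqr !pd_pol_sqr h.
Qed.

Lemma periodic_int (T : Type) (f : R -> T) t : (forall x, f (x + t) = f x) -> forall (k : int) x, f (x + k%:~R * t) = f x.
Proof.
move=> h; have hn n x : f (x + n%:R * t) = f x.
  elim: n x => [|n IH] x; first by rewrite mul0r addr0.
  by rewrite -natr1 mulrDl mul1r addrA h IH.
move=> [n|n] x; first exact: hn.
by rewrite NegzE mulrNz mulNr -[in RHS](subrK (n.+1%:R * t) x) hn.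
Qed.

(** Rounding to a nearest multiple. With [t] the total angle of a cone it selects the representative
    of an angle closest to a given direction. *)
Lemma near_int t x : 0 < t -> exists k : int, `|x + k%:~R * t| <= t / 2.
Proof.
move=> t0; exists (- Num.floor (x / t + 1 / 2)).
have h1 := floor_le (x / t + 1 / 2); have h2 := floorD1_gt (x / t + 1 / 2).
set k := Num.floor _ in h1 h2 *.
rewrite intrD in h2.
have hx : x = x / t * t by rewrite mulfVK // gt_eqF.
rewrite mulrNz mulNr ler_norml; apply/andP; split; rewrite {1}hx.
  have : 0 <= (x / t + 1 / 2 - k%:~R) * t by rewrite mulr_ge0 ?(ltW t0) // subr_ge0.
  lra.
have : 0 <= (k%:~R + 1 - (x / t + 1 / 2)) * t by rewrite mulr_ge0 ?(ltW t0) // subr_ge0 ltW.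
lra.
Qed.

End Polar.

Section Frames.
Context (R : realType).
Implicit Types r s t u v x y a b dl U : R.
Implicit Types z w e f p q : R * R.

(* The direct isometry taking the vertical axis to the line through [p] directed by [e]. *)
Definition fr p e z : R * R := (p.1 + z.1 * e.2 + z.2 * e.1, p.2 - z.1 * e.1 + z.2 * e.2).

Lemma pd_fr p e z w : nm e = 1 -> pd (fr p e z) (fr p e w) = pd z w.
Proof.
move=> /nm_eq1 e1; apply: nm_eq; first exact: pd_ge0.
rewrite pd_sqr /=.
transitivity ((e.1 ^+ 2 + e.2 ^+ 2) * ((z.1 - w.1) ^+ 2 + (z.2 - w.2) ^+ 2)); first by ring.
by rewrite e1 mul1r.
Qed.
Lemma fr_onto p e w : nm e = 1 -> exists z, fr p e z = w.
Proof.
move=> /nm_eq1 e1.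
exists ((w.1 - p.1) * e.2 - (w.2 - p.2) * e.1, (w.1 - p.1) * e.1 + (w.2 - p.2) * e.2).
rewrite /fr /= [RHS]surjective_pairing; congr pair.
  transitivity (p.1 + (w.1 - p.1) * (e.1 ^+ 2 + e.2 ^+ 2)); first by ring.
  by rewrite e1; ring.
transitivity (p.2 + (w.2 - p.2) * (e.1 ^+ 2 + e.2 ^+ 2)); first by ring.
by rewrite e1; ring.
Qed.
Lemma fr_0u p e u : fr p e (0, u) = mv p u e.
Proof. by rewrite /fr /mv /=; congr pair; ring. Qed.
Lemma fr_00 p e : fr p e (0, 0) = p.
Proof. by rewrite fr_0u mv0. Qed.

Lemma nm_between z u v e dl : nm z < dl -> nm (mv z u e) < dl -> 0 <= v * u -> `|v| <= `|u| -> nm (mv z v e) < dl.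
Proof.
have [->|u0] := eqVneq u 0.
  by rewrite normr0 normr_le0 => h _ _ /eqP ->; rewrite mv0.
move=> h1 h2 h3 h4; pose l := v / u.
have l0 : 0 <= l by rewrite /l (_ : v / u = (v * u) / u ^+ 2) ?divr_ge0 ?sqr_ge0 //; field.
have l1 : l <= 1.
  rewrite -(ger0_norm l0) /l normrM normfV ler_pdivrMr ?mul1r // normr_gt0 //.
have -> : mv z v e = ((1 - l) * z.1 + l * (mv z u e).1, (1 - l) * z.2 + l * (mv z u e).2).
  have lu : l * u = v by rewrite /l divfK.
  by rewrite /mv /= -lu; congr pair; ring.
apply: le_lt_trans (nmD ((1 - l) * z.1, (1 - l) * z.2) (l * (mv z u e).1, l * (mv z u e).2)) _.
rewrite (nmZ (1 - l) z) (nmZ l (mv z u e)) !ger0_norm //; last by lra.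
have [l1'|l1'] := eqVneq l 1; first by rewrite l1' subrr mul0r mul1r add0r.
have h5 : 0 < 1 - l by rewrite subr_gt0 lt_neqAle l1'.
have h6 : (1 - l) * nm z < (1 - l) * dl by rewrite ltr_pM2l.
have h7 : l * nm (mv z u e) <= l * dl by rewrite ler_wpM2l // ltW.
lra.
Qed.

End Frames.

(** * Perpendicular feet on lines *)

Section Feet.
Context (R : realType).
Implicit Types (z w e f : R * R).

Lemma nm_0u (u : R) : nm (0, u) = `|u|.
Proof. by apply: nm_eq => //=; rewrite real_normK ?num_real //; ring. Qed.

(** First-order condition at a nearest point: the squared distance changes by [x ^+ 2 - 2 * x * p],
    which is negative for a small [x] of the sign of [p]. *)
Lemma perp_foot z w f (dl : R) : 0 < dl -> nm f = 1 ->
  (forall x : R, `|x| < dl -> pd z w <= pd z (mv w x f)) -> (z.1 - w.1) * f.1 + (z.2 - w.2) * f.2 = 0.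
Proof.
move=> dl0 /nm_eq1 f1 h; set p := _ + _.
have key (x : R) : `|x| < dl -> 0 <= x ^+ 2 - 2 * x * p.
  move=> /h; rewrite -ler_sqr ?nnegrE ?pd_ge0 // !pd_sqr /mv /= -subr_ge0.
  suff -> : (z.1 - (w.1 + x * f.1)) ^+ 2 + (z.2 - (w.2 + x * f.2)) ^+ 2 - ((z.1 - w.1) ^+ 2 + (z.2 - w.2) ^+ 2) = x ^+ 2 - 2 * x * p by [].
  transitivity (x ^+ 2 * (f.1 ^+ 2 + f.2 ^+ 2) - 2 * x * p); first by rewrite /p; ring.
  by rewrite f1 mulr1.
apply/eqP; apply/negPn/negP => pn.
have p0 : 0 < `|p| by rewrite normr_gt0.
(* The test displacement is [k * p]: the second bound keeps it below [dl], and [k <= 1 < 2] makes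
   the change negative. *)
pose k := Num.min 1 (dl / (2 * `|p|)).
have k0 : 0 < k by rewrite lt_min ltr01 divr_gt0 // mulr_gt0.
have [k1 k2] : k <= 1 /\ k <= dl / (2 * `|p|) by split; rewrite /k ge_min lexx ?orbT.
have hk : `|k * p| < dl.
  rewrite normrM (gtr0_norm k0); have : k * `|p| <= dl / (2 * `|p|) * `|p| by rewrite ler_pM2r.
  by rewrite (_ : dl / (2 * `|p|) * `|p| = dl / 2); [lra|field; rewrite gt_eqF].
have := key _ hk.
have -> : (k * p) ^+ 2 - 2 * (k * p) * p = (k * p ^+ 2) * (k - 2) by ring.
have pp : 0 < k * p ^+ 2 by rewrite mulr_gt0 // lt_neqAle sqr_ge0 andbT eq_sym sqrf_eq0.
rewrite pmulr_rge0 //; lra.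
Qed.


(** The projection of the first line on the second moves with speed [c], the cosine of their angle,
    and the signed distance is affine with slope the sine [h]. This affine function is the source of
    the concavity of the distance to an invariant set. *)
Lemma perp_frame z w e f : nm e = 1 -> nm f = 1 -> (z.1 - w.1) * f.1 + (z.2 - w.2) * f.2 = 0 ->
  exists H h c : R, [/\ h = e.1 * f.2 - e.2 * f.1, `|c| <= 1 & forall x : R, pd (mv z x e) (mv w (x * c) f) = `|H + x * h|].
Proof.
move=> /nm_eq1 e12 /nm_eq1 f12 dot0.
exists ((z.1 - w.1) * f.2 - (z.2 - w.2) * f.1), (e.1 * f.2 - e.2 * f.1), (e.1 * f.1 + e.2 * f.2).
set h := e.1 * f.2 - _; set H := (z.1 - _) * _ - _; set c := e.1 * f.1 + _.
have hc : c ^+ 2 + h ^+ 2 = 1.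
  by transitivity ((e.1 ^+ 2 + e.2 ^+ 2) * (f.1 ^+ 2 + f.2 ^+ 2)); [rewrite /c /h; ring|rewrite e12 f12 mulr1].
split => // [|x].
  by rewrite -(@ler_pXn2r _ 2) ?nnegrE // expr1n real_normK ?num_real //; have := sqr_ge0 h; lra.
have zw1 : z.1 - w.1 = H * f.2.
  transitivity ((z.1 - w.1) * (f.1 ^+ 2 + f.2 ^+ 2) - ((z.1 - w.1) * f.1 + (z.2 - w.2) * f.2) * f.1).
    by rewrite f12 dot0; ring.
  by rewrite /H; ring.
have zw2 : z.2 - w.2 = - H * f.1.
  transitivity ((z.2 - w.2) * (f.1 ^+ 2 + f.2 ^+ 2) - ((z.1 - w.1) * f.1 + (z.2 - w.2) * f.2) * f.2).
    by rewrite f12 dot0; ring.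
  by rewrite /H; ring.
have ee1 : e.1 = c * f.1 + h * f.2.
  by transitivity (e.1 * (f.1 ^+ 2 + f.2 ^+ 2)); [rewrite f12 mulr1|rewrite /c /h; ring].
have ee2 : e.2 = c * f.2 - h * f.1.
  by transitivity (e.2 * (f.1 ^+ 2 + f.2 ^+ 2)); [rewrite f12 mulr1|rewrite /c /h; ring].
have d1 : (mv z x e).1 - (mv w (x * c) f).1 = (H + x * h) * f.2.
  by transitivity ((z.1 - w.1) + x * (e.1 - c * f.1)); [rewrite /mv /=; ring|rewrite zw1 ee1; ring].
have d2 : (mv z x e).2 - (mv w (x * c) f).2 = - (H + x * h) * f.1.
  by transitivity ((z.2 - w.2) + x * (e.2 - c * f.2)); [rewrite /mv /=; ring|rewrite zw2 ee2; ring].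
apply: nm_eq => //; rewrite d1 d2 real_normK ?num_real //=.
by transitivity ((H + x * h) ^+ 2 * (f.1 ^+ 2 + f.2 ^+ 2)); [ring|rewrite f12 mulr1].
Qed.

(** Transversal zeros being forbidden, the affine function keeps its sign or vanishes identically,
    so its absolute value is affine too. *)
Lemma abs_affine (H h rho : R) : 0 < rho -> (forall x0 : R, `|x0| <= rho -> H + x0 * h = 0 -> h = 0) ->
  exists m : R, forall x : R, `|x| <= rho -> `|H + x * h| <= `|H| + m * x.
Proof.
move=> rho0 meet; have [H0|Hn] := eqVneq H 0.
  have h0 : h = 0 by apply: (meet 0); rewrite ?normr0 ?(ltW rho0) // H0 mul0r addr0.
  by exists 0 => x _; rewrite h0 mul0r mulr0 !addr0.
pose si : R := if 0 <= H then 1 else -1.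
have siH : si * H = `|H| by rewrite /si; case: ifP => h1; [rewrite ger0_norm // mul1r|rewrite ltr0_norm ?mulN1r // ltNge h1].
have sin : `|si| = 1 by rewrite /si; case: ifP => _; rewrite ?normrN normr1.
exists (si * h) => x xr.
have e5 : `|H| + si * h * x = si * (H + x * h) by rewrite -siH; ring.
rewrite e5 -[leLHS]mul1r -sin -normrM ger0_norm // leNgt; apply/negP => neg.
have Hp : 0 < `|H| by rewrite normr_gt0.
have hn : h != 0 by apply/eqP => h0; move: neg; rewrite h0 mulr0 addr0 siH; lra.
have : h = 0.
  apply: (meet (- (H / h))); last by rewrite mulNr divfK // subrr.
  rewrite normrN normrM normfV ler_pdivrMr ?normr_gt0 //.
  apply: (le_trans (y := `|x| * `|h|)); last by rewrite ler_wpM2r.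
  have h1 : `|H| < - (si * h * x) by move: neg; rewrite -e5; lra.
  apply: (le_trans (ltW h1)); apply: le_trans (ler_norm _) _.
  by rewrite normrN !normrM sin mul1r mulrC.
by move/eqP: hn.
Qed.

End Feet.
(** * Charts and local geodesics *)

Section Ultra.
Context (T : Type) (F : set_system T).
Hypothesis uF : UltraFilter F.

Lemma uf_and (A B : T -> Prop) : F A -> F B -> F (fun t => A t /\ B t).
Proof. by have := @ultra_proper _ _ uF => pF; exact: filterI. Qed.
Lemma uf_mono (A B : T -> Prop) : (forall t, A t -> B t) -> F A -> F B.
Proof. by have := @ultra_proper _ _ uF => pF; exact: filterS. Qed.
Lemma uf_ex (A : T -> Prop) : F A -> exists t, A t.
Proof. by have := @ultra_proper _ _ uF => pF; exact: filter_ex. Qed.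
Lemma uf_em (A : T -> Prop) : F A \/ F (fun t => ~ A t).
Proof. exact: in_ultra_setVsetC. Qed.
Lemma uf_true : F (fun _ => True).
Proof. by have := @ultra_proper _ _ uF => pF; exact: filterT. Qed.
Lemma uf_all (A : T -> Prop) : (forall t, A t) -> F A.
Proof. by move=> h; apply: uf_mono uf_true => t _. Qed.
Lemma uf_or (A B : T -> Prop) : F (fun t => A t \/ B t) -> F A \/ F B.
Proof.
move=> h; case: (uf_em A) => [?|h']; [by left|right].
by apply: uf_mono (uf_and h h') => t /= [[]].
Qed.

(** The limit is the supremum of the thresholds that [f] reaches along [F]; an ultrafilter decides
    every threshold. *)
Lemma uf_real (R : realType) (f : T -> R) (M : R) : F (fun t => `|f t| <= M) ->
  exists l : R, `|l| <= M /\ forall e : R, 0 < e -> F (fun t => `|f t - l| < e).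
Proof.
move=> hM.
pose A : set R := fun x : R => F (fun t => x <= f t).
have A0 : A (- M) by apply: uf_mono hM => t; rewrite ler_norml => /andP[].
have Aub x : A x -> x <= M.
  move=> Ax; have [t [h1 h2]] := uf_ex (uf_and Ax hM).
  by move: h2; rewrite ler_norml => /andP[_]; apply: le_trans.
have hs : has_sup A by split; [exists (- M)|exists M].
exists (sup A); split.
  rewrite ler_norml; apply/andP; split; first by apply: ub_le_sup => //; exists M.
  by apply: ge_sup => //; exists (- M).
move=> e e0.
have [x Ax hx] := sup_adherent e0 hs.
have : ~ A (sup A + e).
  move=> h; have : sup A + e <= sup A by apply: ub_le_sup => //; exists M.
  rlra.
case: (uf_em (fun t => sup A + e <= f t)) => // hn _.
apply: uf_mono (uf_and Ax hn) => t /= [h1 /negP h2].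
by rewrite ltr_norml; move: h2; rewrite -ltNge => h2; apply/andP; split; rlra.
Qed.

End Ultra.

Section Metric.
Context (R : realType) (X : Type).
Implicit Types r s t u v dl U : R.
Variable d : X -> X -> R.
Hypothesis dxx : forall x, d x x = 0.
Hypothesis dC : forall x y, d x y = d y x.
Hypothesis dtri : forall y x z, d x z <= d x y + d y z.
Hypothesis deq : forall x y, d x y = 0 -> x = y.

Lemma d_ge0 x y : 0 <= d x y.
Proof. have := dtri y x x; rewrite dxx (dC y x); rlra. Qed.

Lemma d_lt_eq x y : (forall e, 0 < e -> d x y < e) -> x = y.
Proof.
move=> h; apply: deq; apply/eqP; rewrite eq_le d_ge0 andbT leNgt; apply/negP => h0.
by have := h _ h0; rewrite ltxx.
Qed.

(** [E] is a chart at [z], isometric on a disc and onto a metric ball. Elsewhere its values are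
    unconstrained, so that one total map can be a chart at many points. *)
Definition good (E : R * R -> X) z := exists2 r, 0 < r &
  (forall a b, pd a z < r -> pd b z < r -> d (E a) (E b) = pd a b) /\
  (forall p, d (E z) p < r -> exists2 a, pd a z < r & E a = p).

Definition flat p := exists E z, good E z /\ E z = p.

Definition lgeo (c : R -> X) (t : R) := exists2 e, 0 < e &
  forall s u, `|s - t| < e -> `|u - t| < e -> d (c s) (c u) = `|s - u|.

Definition line_at (c : R -> X) (s : R) E z e (dl : R) :=
  forall u, `|u| < dl -> c (s + u) = E (mv z u e).

Lemma good_near E z : good E z -> exists2 r, 0 < r & forall w, pd w z < r -> good E w.
Proof.
move=> [r r0 [hi ho]]; exists (r / 2); first by rlra.
move=> w wz; exists (r / 2); first by rlra.
have wr : pd w z < r by rlra.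
split.
  move=> a b ha hb; apply: hi.
    by apply: le_lt_trans (pd_tri w _ _) _; rlra.
  by apply: le_lt_trans (pd_tri w _ _) _; rlra.
move=> p hp; have [|a ha hap] := ho p.
  apply: le_lt_trans (dtri (E w) _ _) _; rewrite hi ?pdzz //; rewrite (pdC z); rlra.
exists a => //; rewrite -hap in hp; rewrite pdC -hi //.
Qed.

Lemma good_lgeo E z e : good E z -> nm e = 1 -> lgeo (fun u => E (mv z u e)) 0.
Proof.
move=> [r r0 [hi ho]] e1; exists r => // s u; rewrite !subr0 => hs hu.
by rewrite hi ?pd_mv1 ?pd_mvz.
Qed.

Lemma good_lgeo_at E z e u : good E (mv z u e) -> nm e = 1 -> lgeo (fun u => E (mv z u e)) u.
Proof.
move=> [r r0 [hi ho]] e1; exists r => // s v hs hv.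
by rewrite hi ?pd_mv1.
Qed.

(** Pulled back by the chart the geodesic becomes an isometric curve in the plane, hence straight by
    [isom_line]. *)
Lemma line_local E z c t : good E z -> lgeo c t -> c t = E z ->
  exists2 e, nm e = 1 & exists2 dl, 0 < dl & line_at c t E z e dl.
Proof.
move=> [r r0 [hi ho]] [e e0 hc] ct.
pose k := Num.min e r.
have k0 : 0 < k by rewrite lt_min e0 r0.
have ke : k <= e by rewrite ge_min lexx.
have kr : k <= r by rewrite ge_min lexx orbT.
have hx u : exists a, `|u| < k -> pd a z < r /\ E a = c (t + u).
  have [uk|uk] := ltP `|u| k; last by exists z.
  have [|a az ea] := ho (c (t + u)).
    rewrite -ct hc ?subrr ?normr0 //; last by rewrite addrC addKr; rlra.
    by rewrite opprD addrA subrr sub0r normrN; rlra.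
  by exists a.
have [f hf] := choice hx.
have [|e' e'1 he'] := @isom_line _ f k k0.
  move=> s u hs hu; have [a1 a2] := hf _ hs; have [b1 b2] := hf _ hu.
  rewrite -hi // a2 b2 hc; last 2 first.
  - by rewrite addrC addKr; rlra.
  - by rewrite addrC addKr; rlra.
  by congr `|_|; ring.
exists e' => //; exists k => // u uk.
have [_ <-] := hf _ uk; rewrite he' //; congr (E (mv _ _ _)).
have [b1 b2] := hf 0 (ltac:(by rewrite normr0)).
by apply: pd_eq0; rewrite -hi ?pdzz // b2 addr0 ct dxx.
Qed.

Lemma line_at_uniq c s E z e f (dl dl' : R) : good E z -> 0 < dl -> 0 < dl' -> nm e = 1 -> nm f = 1 ->
  (forall u, - dl < u <= 0 -> c (s + u) = E (mv z u e)) ->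
  (forall u, - dl' < u <= 0 -> c (s + u) = E (mv z u f)) -> e = f.
Proof.
move=> [r r0 [hi ho]] dl0 dl'0 e1 f1 h1 h2.
pose k := Num.min r (Num.min dl dl').
have k0 : 0 < k by rewrite !lt_min r0 dl0 dl'0.
have [kr kdl kdl'] : [/\ k <= r, k <= dl & k <= dl'].
  by split; rewrite /k !ge_min lexx ?orbT.
suff [] : z = z /\ e = f by [].
apply: (@mv_inj _ z z e f k) => // u /andP[u1 u2].
have nu : `|u| < r by rewrite ltr0_norm; rlra.
apply: pd_eq0; rewrite -hi ?pd_mvz //.
by rewrite -h1 ?h2 ?dxx //; apply/andP; split; rlra.
Qed.

Definition germ (c c' : R -> X) u := exists2 dl, 0 < dl & forall x, `|x| < dl -> c (u + x) = c' (u + x).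

Definition lcont (c : R -> X) u := forall e, 0 < e ->
  exists2 dl, 0 < dl & forall v, u - dl < v <= u -> d (c v) (c u) < e.

Lemma lgeo_lcont c u : lgeo c u -> lcont c u.
Proof.
move=> [e e0 h] x x0; exists (Num.min e x); first by rewrite lt_min e0 x0.
move=> v /andP[v1 v2].
have [k1 k2] : Num.min e x <= e /\ Num.min e x <= x by split; rewrite ge_min lexx ?orbT.
have nv : `|v - u| = u - v by rewrite ler0_norm; [ring|rlra].
rewrite h ?subrr ?normr0 //; rewrite nv; rlra.
Qed.

(** The curves are treated unequally: [c'] is known to be a geodesic through flat points, whereas
    [c] may be a leaf, which could run into a vertex. By left continuity [c] reaches the same flat
    point as [c'], so it is straight there too, and the common past forces the direction. *)
Lemma uniq c c' U : 0 <= U ->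
  (forall u, 0 <= u <= U -> lcont c u) ->
  (forall u, 0 <= u <= U -> flat (c u) -> lgeo c u) ->
  (forall u, 0 <= u <= U -> lgeo c' u) ->
  (forall u, 0 <= u <= U -> flat (c' u)) ->
  germ c c' 0 -> forall u, 0 <= u <= U -> germ c c' u.
Proof.
move=> U0 hl hc hc' hfl g0; apply: (real_induction (Q := germ c c')) => //.
  move=> u /andP[u0 uU] hv.
  have [dl dl0 h] := hv u (ltac:(by rewrite u0 lexx)).
  exists dl => // v /andP[v1 v2] _.
  exists (Num.min (u + dl - v) (dl + v - u)); first by rewrite lt_min; apply/andP; split; rlra.
  move=> x; rewrite lt_min !ltr_norml => /andP[/andP[x1 x2] /andP[x3 x4]].
  have -> : v + x = u + (v - u + x) by ring.
  by apply: h; rewrite ltr_norml; apply/andP; split; rlra.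
move=> u /andP[u0 uU] hv.
have uU' : 0 <= u <= U by rewrite (ltW u0) uU.
have cu : c u = c' u.
  apply: d_lt_eq => e e0.
  have e2 : 0 < e / 2 by rlra.
  have [a a0 ha] := hl u uU' _ e2.
  have [b b0 hb] := lgeo_lcont (hc' u uU') e2.
  pose v := Num.max 0 (u - Num.min a b / 2).
  have ab0 : 0 < Num.min a b by rewrite lt_min a0 b0.
  have [aba abb] : Num.min a b <= a /\ Num.min a b <= b by split; rewrite ge_min lexx ?orbT.
  have vu : v < u by rewrite gt_max u0; rlra.
  have v0 : 0 <= v by rewrite le_max lexx.
  have v1 : u - Num.min a b / 2 <= v by rewrite le_max lexx orbT.
  have [dl dl0 hdl] := hv v (ltac:(by rewrite v0 vu)).
  have cv : c v = c' v by have := hdl 0; rewrite normr0 addr0; apply.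
  apply: le_lt_trans (dtri (c v) _ _) _.
  have := ha v (ltac:(by apply/andP; split; rlra)).
  have := hb v (ltac:(by apply/andP; split; rlra)).
  rewrite -cv (dC (c u)); rlra.
have [E [z [gE Ez]]] := hfl u uU'.
have fl : flat (c u) by exists E, z; rewrite cu.
have [e e1 [a a0 ha]] := line_local gE (hc u uU' fl) (ltac:(by rewrite cu Ez)).
have [f f1 [b b0 hb]] := line_local gE (hc' u uU') (esym Ez).
have ef : e = f.
  pose k := Num.min u (Num.min a b).
  have k0 : 0 < k by rewrite !lt_min u0 a0 b0.
  have [k1 k2 k3] : [/\ k <= u, k <= a & k <= b] by split; rewrite /k !ge_min lexx ?orbT.
  apply: (@line_at_uniq c u E z e f k k) => // v /andP[v1 v2].
    by apply: ha; rewrite ler0_norm //; rlra.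
  have -> : c (u + v) = c' (u + v).
    have [->|vn0] := eqVneq v 0; first by rewrite addr0.
    have vlt : v < 0 by rewrite lt_neqAle vn0.
    have [dl dl0 hdl] := hv (u + v) (ltac:(by apply/andP; split; rlra)).
    by have := hdl 0; rewrite normr0 addr0; apply.
  by apply: hb; rewrite ler0_norm //; rlra.
exists (Num.min a b); first by rewrite lt_min a0 b0.
move=> x; rewrite lt_min => /andP[x1 x2].
by rewrite ha // hb // ef.
Qed.

Lemma lgeo_shift c t u : lgeo c (t + u) -> lgeo (fun x => c (t + x)) u.
Proof.
move=> [e e0 h]; exists e => // s v hs hv; rewrite h.
- by congr `|_|; ring.
- by rewrite (_ : t + s - (t + u) = s - u) //; ring.
- by rewrite (_ : t + v - (t + u) = v - u) //; ring.
Qed.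
Lemma lgeo_opp c t : lgeo c (- t) -> lgeo (fun x => c (- x)) t.
Proof.
move=> [e e0 h]; exists e => // s v hs hv; rewrite h.
- by rewrite -normrN; congr `|_|; ring.
- by rewrite (_ : - s - - t = - (s - t)) ?normrN //; ring.
- by rewrite (_ : - v - - t = - (v - t)) ?normrN //; ring.
Qed.

Definition wgeo (c : R -> X) u :=
  [/\ lcont c u, lcont (fun x => c (- x)) (- u) & (flat (c u) -> lgeo c u)].

Lemma lgeo_wgeo c u : lgeo c u -> wgeo c u.
Proof.
move=> h; split => //; first exact: lgeo_lcont.
by apply: lgeo_lcont; apply: lgeo_opp; rewrite opprK.
Qed.

Lemma line_fwd c t E z e U dl : 0 <= U -> 0 < dl -> nm e = 1 ->
  line_at c t E z e dl ->
  (forall u, 0 <= u <= U -> good E (mv z u e)) ->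
  (forall u, 0 <= u <= U -> wgeo c (t + u)) ->
  forall u, 0 <= u <= U -> exists2 dl', 0 < dl' & line_at c (t + u) E (mv z u e) e dl'.
Proof.
move=> U0 dl0 e1 h gE wc u uU.
have [|||||dl' dl'0 h'] := @uniq (fun u => c (t + u)) (fun u => E (mv z u e)) U U0 _ _ _ _ _ u uU.
- move=> v vU x x0; have [lc _ _] := wc v vU; have [b b0 hb] := lc x x0; exists b => // w /andP[w1 w2].
  by apply: hb; apply/andP; split; rlra.
- by move=> v vU fl; apply: lgeo_shift; have [_ _] := wc v vU; apply.
- by move=> v vU; apply: good_lgeo_at => //; exact: gE.
- by move=> v vU; exists E, (mv z v e); split => //; exact: gE.
- by exists dl => // x xd; rewrite !add0r; exact: h.
by exists dl' => // x xd; rewrite -addrA h' // mvD.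
Qed.

Lemma line_bwd c t E z e U dl : 0 <= U -> 0 < dl -> nm e = 1 ->
  line_at c t E z e dl ->
  (forall u, 0 <= u <= U -> good E (mv z (- u) e)) ->
  (forall u, 0 <= u <= U -> wgeo c (t - u)) ->
  forall u, 0 <= u <= U -> exists2 dl', 0 < dl' & line_at c (t - u) E (mv z (- u) e) e dl'.
Proof.
move=> U0 dl0 e1 h gE wc u uU.
pose e' := (- e.1, - e.2).
have [|||dl' dl'0 h'] := @line_fwd (fun x => c (- x)) (- t) E z e' U dl U0 dl0 (ltac:(by rewrite nmN)) _ _ _ u uU.
- by move=> x xd; rewrite opprD opprK mvN; apply: h; rewrite normrN.
- by move=> v vU; rewrite mvN; exact: gE.
- move=> v vU; have [h1 h2 h3] := wc v vU.
  have e3 : - (- t + v) = t - v by ring.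
  split.
  + by rewrite (_ : - t + v = - (t - v)) //; ring.
  + move=> x x0; have [b b0 hb] := h1 x x0; exists b => // w hw; rewrite !opprK.
    by rewrite e3 in hw *; exact: hb.
  + by rewrite e3 => fl; apply: lgeo_opp; rewrite e3; exact: h3.
exists dl' => // x xd.
have -> : t - u + x = - (- t + u + - x) by ring.
by rewrite h' ?normrN // !mvN; congr (E (mv (mv _ _ _) _ _)); ring.
Qed.

(** As long as the line stays in a region of good points, the chart itself provides the comparison
    geodesic for [uniq], in both directions. *)
Lemma line_conv c t E z (Om : R * R -> Prop) : Om z -> c t = E z -> lgeo c t ->
  (forall w, Om w -> good E w) ->
  exists2 e, nm e = 1 & (exists2 dl, 0 < dl & line_at c t E z e dl) /\
   forall u, (forall v, 0 <= v * u -> `|v| <= `|u| -> Om (mv z v e) /\ wgeo c (t + v)) ->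
   exists2 dl, 0 < dl & line_at c (t + u) E (mv z u e) e dl.
Proof.
move=> Oz ct gc gE; have [e e1 [dl dl0 hl]] := line_local (gE _ Oz) gc ct.
exists e => //; split; first by exists dl.
move=> u hu; have [u0|u0] := leP 0 u.
  apply: (@line_fwd c t E z e u dl) => //; rewrite ?lexx ?u0 //.
    by move=> v /andP[v0 vu]; apply: gE; apply: (proj1 (hu v _ _)); rewrite ?mulr_ge0 // !ger0_norm.
  by move=> v /andP[v0 vu]; apply: (proj2 (hu v _ _)); rewrite ?mulr_ge0 // !ger0_norm.
rewrite -(opprK u).
have mu0 : 0 <= - u by rlra.
apply: (@line_bwd c t E z e (- u) dl mu0 dl0 e1 hl); last by rewrite mu0 lexx.
  by move=> v /andP[v0 vu]; apply: gE; apply: (proj1 (hu (- v) _ _)); [nra|rewrite normrN ger0_norm // ltr0_norm].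
by move=> v /andP[v0 vu]; apply: (proj2 (hu (- v) _ _)); [nra|rewrite normrN ger0_norm // ltr0_norm].
Qed.

Lemma lgeo_lip c (U : R) : (forall t, 0 <= t <= U -> lgeo c t) ->
  forall s t, 0 <= s -> s <= t -> t <= U -> d (c s) (c t) <= t - s.
Proof.
move=> h s t s0 st tU.
have h0 : 0 <= t - s by rlra.
suff : forall u, 0 <= u <= t - s -> d (c s) (c (s + u)) <= u.
  move=> /(_ (t - s)); rewrite lexx h0 => /(_ isT); rewrite (_ : s + (t - s) = t) //; ring.
apply: (real_induction h0) => //=; first by rewrite addr0 dxx.
- move=> u /andP[u0 ut] hu.
  have [e e0 he] := h (s + u) (ltac:(by apply/andP; split; rlra)).
  exists e => // v /andP[v1 v2] _.
  apply: le_trans (dtri (c (s + u)) _ _) _.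
  have := hu u (ltac:(by rewrite u0 lexx)).
  have hv : s + v - (s + u) = v - u by ring.
  have -> : d (c (s + u)) (c (s + v)) = v - u.
    rewrite he; first by rewrite distrC hv ger0_norm; rlra.
      by rewrite subrr normr0.
    by rewrite hv ger0_norm; rlra.
  rlra.
- move=> u /andP[u0 ut] hu; rewrite leNgt; apply/negP => hlt.
  pose e := d (c s) (c (s + u)) - u.
  have e0 : 0 < e by rewrite /e; rlra.
  have [dl dl0 hl] := lgeo_lcont (h (s + u) (ltac:(by apply/andP; split; rlra))) e0.
  pose w := Num.min u dl / 2.
  have w0 : 0 < Num.min u dl by rewrite lt_min u0 dl0.
  have [w1 w2] : Num.min u dl <= u /\ Num.min u dl <= dl by split; rewrite ge_min lexx ?orbT.
  have := hl (s + (u - w)) (ltac:(by rewrite /w; apply/andP; split; rlra)).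
  have := hu (u - w) (ltac:(by rewrite /w; apply/andP; split; rlra)).
  have := dtri (c (s + (u - w))) (c s) (c (s + u)); rewrite /e /w; rlra.
Qed.

Definition det (e f : R * R) : R := e.1 * f.2 - e.2 * f.1.
Definition sc (a : R) (e : R * R) : R * R := (a * e.1, a * e.2).

Lemma det_le e f : `|det e f| <= nm e * nm f.
Proof.
have -> : det e f = dotp e (f.2, - f.1) by rewrite /det /dotp /=; ring.
apply: le_trans (dotp_norm _ _) _; rewrite /nm /= sqrrN.
by rewrite (addrC (f.2 ^+ 2)).
Qed.

Lemma det0_par e f : nm e = 1 -> nm f = 1 -> det e f = 0 -> f = e \/ f = (- e.1, - e.2).
Proof.
move=> /nm_eq1 e1 /nm_eq1 f1; case: e e1 => a b /= e1; case: f f1 => x y /= f1; rewrite /det /= => h.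
have hk : (a * x + b * y) ^+ 2 = 1.
  have : (a ^+ 2 + b ^+ 2) * (x ^+ 2 + y ^+ 2) = (a * x + b * y) ^+ 2 + (a * y - b * x) ^+ 2 by ring.
  by rewrite h e1 f1 expr0n addr0 mulr1.
have hx : x = (a * x + b * y) * a.
  have : (a ^+ 2 + b ^+ 2) * x = (a * x + b * y) * a - b * (a * y - b * x) by ring.
  by rewrite h e1 mul1r mulr0 subr0.
have hy : y = (a * x + b * y) * b.
  have : (a ^+ 2 + b ^+ 2) * y = (a * x + b * y) * b + a * (a * y - b * x) by ring.
  by rewrite h e1 mul1r mulr0 addr0.
move/eqP: hk; rewrite sqrf_eq1 => /orP[] /eqP hk; rewrite hk in hx hy; [left|right].
  by rewrite hx hy !mul1r.
by rewrite hx hy !mulN1r.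
Qed.

(** Transversality is an open condition. The first bound on [ep] keeps the determinant above
    [D / 2]; with the second, Cramer's formulas put the intersection at parameters below [dl]. *)
Lemma cross_lines z e f (dl : R) : nm e = 1 -> nm f = 1 -> det e f != 0 -> 0 < dl ->
  exists2 ep, 0 < ep & forall z1 z2 e1 e2, pd z1 z < ep -> pd z2 z < ep -> pd e1 e < ep ->
    pd e2 f < ep -> nm e1 = 1 -> nm e2 = 1 ->
    det e1 e2 != 0 /\ exists u1 u2, [/\ `|u1| < dl, `|u2| < dl & mv z1 u1 e1 = mv z2 u2 e2].
Proof.
move=> ne nf D0 dl0; pose D := `|det e f|.
have Dp : 0 < D by rewrite normr_gt0.
pose ep := Num.min (D / 4) (dl * D / 8).
have ep0 : 0 < ep by rewrite lt_min; apply/andP; split; [rlra|apply: divr_gt0 => //; exact: mulr_gt0].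
have [k1 k2] : ep <= D / 4 /\ ep <= dl * D / 8 by split; rewrite ge_min lexx ?orbT.
exists ep => // z1 z2 e1 e2 hz1 hz2 he1 he2 n1 n2.
have hD : D / 2 < `|det e1 e2|.
  have E1 : det e1 e2 = det e f + (det (e1.1 - e.1, e1.2 - e.2) e2 + det e (e2.1 - f.1, e2.2 - f.2)).
    by rewrite /det /=; ring.
  have h1 := det_le (e1.1 - e.1, e1.2 - e.2) e2; rewrite n2 mulr1 -/(pd e1 e) in h1.
  have h2 := det_le e (e2.1 - f.1, e2.2 - f.2); rewrite ne mul1r -/(pd e2 f) in h2.
  have h3 := ler_normD (det (e1.1 - e.1, e1.2 - e.2) e2) (det e (e2.1 - f.1, e2.2 - f.2)).
  have h4 := lerB_normD (det e f) (det (e1.1 - e.1, e1.2 - e.2) e2 + det e (e2.1 - f.1, e2.2 - f.2)).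
  rewrite -E1 -/D in h4; rlra.
have dn : det e1 e2 != 0 by rewrite -normr_gt0; rlra.
split => //.
pose w := (z2.1 - z1.1, z2.2 - z1.2).
have nw : nm w < ep + ep.
  rewrite -/(pd z2 z1); apply: le_lt_trans (pd_tri z _ _) _; rewrite (pdC z); rlra.
have hb h : nm h = 1 -> `|det w h / det e1 e2| < dl.
  move=> nh; rewrite normrM normfV ltr_pdivrMr; last by rlra.
  have := det_le w h; rewrite nh mulr1 => hh.
  apply: le_lt_trans hh _; apply: lt_le_trans nw _.
  have : dl * (D / 2) <= dl * `|det e1 e2| by rewrite ler_pM2l //; rlra.
  rlra.
exists (det w e2 / det e1 e2), (det w e1 / det e1 e2); split; [exact: hb|exact: hb|].
move: dn; rewrite /mv /w /det /= => dn.
by congr pair; field.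
Qed.

Variable g : R -> X.
Hypothesis gl : forall t, 0 <= t -> lgeo g t.
(** Simplicity read in charts. The directions are equal and not only parallel: passing twice through
    a point in opposite directions counts as a self-intersection. *)
Hypothesis gs : forall E z t1 t2 e1 e2 dl, 0 <= t1 -> 0 <= t2 -> 0 < dl -> good E z ->
  nm e1 = 1 -> nm e2 = 1 -> line_at g t1 E z e1 dl -> line_at g t2 E z e2 dl -> e1 = e2.
(** Compactness, as convergence along ultrafilters. *)
Hypothesis cpt : forall (T : Type) (F : set_system T), UltraFilter F -> forall f : T -> X,
  exists p, forall e : R, 0 < e -> F (fun i => d (f i) p < e).

Definition strand_at (t tau : R) E z e dl := forall u, `|u| < dl -> g (t + tau * u) = E (mv z u e).

(* At a flat point [c s], [c] is a segment and a limit of segments of [g] with arbitrarily late parameters;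
   no condition at the other points. *)
Definition tl (c : R -> X) (s : R) := forall E z, good E z -> c s = E z ->
  exists2 e, nm e = 1 & exists2 dl, 0 < dl & line_at c s E z e dl /\
  forall ep, 0 < ep -> exists t tau z' e', [/\ dl <= t, tau = 1 \/ tau = -1, pd z' z < ep,
     pd e' e < ep & nm e' = 1 /\ strand_at t tau E z' e' dl].

(** [g] approximates itself; [dl] is cut down to [t] so that the strand uses nonnegative parameters
    only. *)
Lemma g_tl t : 0 < t -> tl g t.
Proof.
move=> t0 E z gE gt; have [e e1 [dl dl0 h]] := line_local gE (gl (ltW t0)) gt.
exists e => //; exists (Num.min dl t); first by rewrite lt_min dl0 t0.
have [k1 k2] : Num.min dl t <= dl /\ Num.min dl t <= t by split; rewrite ge_min lexx ?orbT.
split; first by move=> u hu; apply: h; rlra.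
move=> ep ep0; exists t, 1, z, e; split => //; [by left|by rewrite pdzz|by rewrite pdzz|split => //].
by move=> u hu; rewrite mul1r; apply: h; rlra.
Qed.

Lemma tl_lgeo c s : tl c s -> flat (c s) -> lgeo c s.
Proof.
move=> h [E [z [gE Ez]]]; have [e e1 [dl dl0 [hl _]]] := h _ _ gE (esym Ez).
have [r r0 hr] := good_lgeo gE e1.
have k0 : 0 < Num.min dl r by rewrite lt_min dl0 r0.
exists (Num.min dl r) => // u v; rewrite !lt_min => /andP[u1 u2] /andP[v1 v2].
have hh w : w = s + (w - s) by ring.
rewrite (hh u) (hh v) !hl // hr ?subr0 //; congr `|_|; ring.
Qed.

Lemma tl_opp c s : tl c s -> tl (fun x => c (- x)) (- s).
Proof.
move=> h E z gE; rewrite opprK => cs; have [e e1 [dl dl0 [hl ha]]] := h _ _ gE cs.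
exists (- e.1, - e.2); first by rewrite nmN.
exists dl => //; split.
  by move=> u hu; rewrite mvN opprD opprK; apply: hl; rewrite normrN.
move=> ep ep0; have [t [tau [z' [e' [h1 h2 h3 h4 [h5 h6]]]]]] := ha _ ep0.
exists t, (- tau), z', (- e'.1, - e'.2); split => //.
- by case: h2 => ->; [right|left]; rewrite ?opprK.
- by rewrite /pd /= -!opprD; rewrite (nmN (_, _)).
split; first by rewrite nmN.
move=> u hu; rewrite mvN -h6 ?normrN //; congr g; ring.
Qed.

Lemma tl_shift c a s : tl c (a + s) -> tl (fun x => c (a + x)) s.
Proof.
move=> h E z gE cs; have [e e1 [dl dl0 [hl ha]]] := h _ _ gE cs.
exists e => //; exists dl => //; split => //.
by move=> u hu; rewrite addrA; exact: hl.
Qed.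

Lemma strand_shift t tau E z e dl u1 dl' : tau = 1 \/ tau = -1 -> dl <= t -> 0 < dl' -> `|u1| + dl' <= dl ->
  nm e = 1 ->
  strand_at t tau E z e dl -> 0 <= t + tau * u1 /\ line_at g (t + tau * u1) E (mv z u1 e) (sc tau e) dl'.
Proof.
move=> ht hdl d0 hu ne h; have hu1 := ler_norm u1; have hu2 := ler_norm (- u1); rewrite normrN in hu2.
split; first by case: ht => ->; rlra.
move=> x hx.
have -> : t + tau * u1 + x = t + tau * (u1 + tau * x).
  by rewrite mulrDr mulrA (_ : tau * tau = 1) ?mul1r ?addrA //; case: ht => ->; ring.
rewrite h; last first.
  apply: le_lt_trans (ler_normD _ _) _.
  by rewrite normrM (_ : `|tau| = 1) ?mul1r; [rlra|case: ht => ->; rewrite ?normrN normr1].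
by congr E; rewrite /mv /sc /=; congr pair; ring.
Qed.

(** If the directions were transversal, the strands approximating the two curves would meet
    transversally near [z], against [gs]. As [g] and all leaves satisfy [tl], this excludes
    crossings between any two of them. *)
Lemma cross c c' s s' E z e f dl dl' : tl c s -> tl c' s' -> good E z -> c s = E z -> c' s' = E z ->
  nm e = 1 -> nm f = 1 -> 0 < dl -> 0 < dl' ->
  line_at c s E z e dl -> line_at c' s' E z f dl' -> f = e \/ f = (- e.1, - e.2).
Proof.
move=> h h' gE cs cs' ne nf dl0 dl'0 hl hl'.
have [e1 ne1 [a a0 [ha haa]]] := h _ _ gE cs.
have [f1 nf1 [b b0 [hb hbb]]] := h' _ _ gE cs'.
have E1 : e1 = e.
  apply: (line_at_uniq gE a0 dl0 ne1 ne) => u /andP[u1 u2]; [apply: ha|apply: hl]; rewrite ler0_norm //; rlra.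
have F1 : f1 = f.
  apply: (line_at_uniq gE b0 dl'0 nf1 nf) => u /andP[u1 u2]; [apply: hb|apply: hl']; rewrite ler0_norm //; rlra.
subst e1 f1.
have [D0|D0] := eqVneq (det e f) 0; first exact: det0_par.
exfalso.
have [r r0 hr] := good_near gE.
(* Half of the available lengths, so that around the meeting point each strand is still a segment of
   half-length [k]. *)
pose k := Num.min r (Num.min a b) / 2.
have k0 : 0 < Num.min r (Num.min a b) by rewrite !lt_min r0 a0 b0.
have [kr ka kb] : [/\ k <= r / 2, k <= a / 2 & k <= b / 2].
  rewrite /k; split; rewrite ler_pM2r ?invr_gt0 // !ge_min lexx ?orbT //.
have kk0 : 0 < k by rewrite /k; rlra.
have [ep ep0 hep] := cross_lines z ne nf D0 kk0.
pose q := Num.min ep (r / 2).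
have q0 : 0 < q by rewrite lt_min ep0; rlra.
have [q1 q2] : q <= ep /\ q <= r / 2 by split; rewrite ge_min lexx ?orbT.
have [t1 [ta1 [z1 [e1 [g1 g2 g3 g4 [g5 g6]]]]]] := haa _ q0.
have [t2 [ta2 [z2 [e2 [m1 m2 m3 m4 [m5 m6]]]]]] := hbb _ q0.
have [D' [u1 [u2 [v1 v2 v3]]]] := hep z1 z2 e1 e2 (lt_le_trans g3 q1) (lt_le_trans m3 q1) (lt_le_trans g4 q1) (lt_le_trans m4 q1) g5 m5.
have gw : good E (mv z1 u1 e1).
  apply: hr; apply: le_lt_trans (pd_tri z1 _ _) _; rewrite pd_mvz //; rlra.
have [|n1 n2] := @strand_shift t1 ta1 E z1 e1 a u1 k g2 g1 kk0 _ g5 g6; first by rlra.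
have [|n3 n4] := @strand_shift t2 ta2 E z2 e2 b u2 k m2 m1 kk0 _ m5 m6; first by rlra.
rewrite -v3 in n4.
have nsc tau e0 : tau = 1 \/ tau = -1 -> nm e0 = 1 -> nm (sc tau e0) = 1.
  by move=> ht ne0; rewrite /sc nmZ ne0 mulr1; case: ht => ->; rewrite ?normrN normr1.
have := gs n1 n3 kk0 gw (nsc _ _ g2 g5) (nsc _ _ m2 m5) n2 n4.
move=> [i1 i2]; move/eqP: D'; apply.
have t21 : ta2 * ta2 = 1 by case: m2 => ->; ring.
have j1 : e2.1 = ta2 * (ta1 * e1.1) by rewrite i1 mulrA t21 mul1r.
have j2 : e2.2 = ta2 * (ta1 * e1.2) by rewrite i2 mulrA t21 mul1r.
by rewrite /det j1 j2; ring.
Qed.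

(** One ultrafilter of times tending to infinity serves for all [s], so the limit is a curve and no
    subsequences have to be extracted. *)
Definition leafF (F : set_system R) (ga : R -> X) :=
  [/\ UltraFilter F, (forall T, F (fun t => T < t)) & forall s e, 0 < e -> F (fun t => d (g (t + s)) (ga s) < e)].
Definition leaf ga := exists F, leafF F ga.

Definition Lim p := forall e T, 0 < e -> exists t, T < t /\ d (g t) p < e.

Lemma g_lip s t : 0 <= s -> 0 <= t -> d (g s) (g t) <= `|s - t|.
Proof.
move=> s0 t0; have [st|ts] := leP s t.
  rewrite ler0_norm; last by rlra.
  by rewrite opprB; apply: (@lgeo_lip g t) => //; move=> u /andP[u0 _]; exact: gl.
rewrite dC gtr0_norm; last by rlra.
by apply: (@lgeo_lip g s) => //; [move=> u /andP[u0 _]; exact: gl|rlra].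
Qed.

Lemma leaf_lip ga s t : leaf ga -> d (ga s) (ga t) <= `|s - t|.
Proof.
move=> [F [uF hF hg]]; rewrite leNgt; apply/negP => h.
pose e := (d (ga s) (ga t) - `|s - t|) / 2.
have e0 : 0 < e by rewrite /e; rlra.
have [x [[h1 h2] h3]] := uf_ex uF (uf_and uF (uf_and uF (hg s _ e0) (hg t _ e0)) (hF (`|s| + `|t|))).
have n1 := ler_norm (- s); have n2 := ler_norm (- t); rewrite !normrN in n1 n2.
have n3 := normr_ge0 s; have n4 := normr_ge0 t.
have := g_lip (s := x + s) (t := x + t) (ltac:(rlra)) (ltac:(rlra)).
rewrite (_ : x + s - (x + t) = s - t); last by ring.
have := dtri (g (x + s)) (ga s) (ga t); have := dtri (g (x + t)) (g (x + s)) (ga t).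
rewrite (dC (ga s) (g _)); move: h1 h2; rewrite /e; rlra.
Qed.

Lemma lip_lcont c : (forall s t, d (c s) (c t) <= `|s - t|) -> forall u, lcont c u.
Proof.
move=> h u e e0; exists e => // v /andP[v1 v2]; apply: le_lt_trans (h _ _) _.
rewrite ler0_norm; rlra.
Qed.

Lemma leaf_Lim ga s : leaf ga -> Lim (ga s).
Proof.
move=> [F [uF hF hg]] e T e0.
by have [x [h1 h2]] := uf_ex uF (uf_and uF (hF (T - s)) (hg s e e0)); exists (x + s); split => //; rlra.
Qed.

(** The late times at which [g] is close to [p] generate a proper filter; any ultrafilter above it
    defines a leaf, by compactness at each [s]. *)
Lemma leaf_ex p : Lim p -> exists2 ga, leaf ga & ga 0 = p.
Proof.
move=> Lp.
pose B (i : R * R) := (fun t : R => i.1 < t /\ d (g t) p < i.2) : set R.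
pose D := (fun i : R * R => 0 < i.2) : set (R * R).
have fF : Filter (filter_from D B).
  apply: filter_from_filter; first by exists (0, 1); rewrite /D /=.
  move=> i j Di Dj; exists (Num.max i.1 j.1, Num.min i.2 j.2); first by rewrite /D /= lt_min Di Dj.
  by move=> t []; rewrite /= gt_max lt_min => /andP[h1 h2] /andP[h3 h4]; split; split.
have pF : ProperFilter (filter_from D B).
  by apply: filter_from_proper => // i Di; have [t ht] := Lp i.2 i.1 Di; exists t.
have [F [uF sF]] := ultraFilterLemma pF.
have hx s : exists q, forall e : R, 0 < e -> F (fun t => d (g (t + s)) q < e).
  exact: (cpt uF (fun t => g (t + s))).
have [ga hga] := choice hx.
exists ga.
  exists F; split => //; move=> T.
  apply: (uf_mono uF (A := B (T, 1))); first by move=> t [].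
  by apply: sF; exists (T, 1) => //; rewrite /D /=.
apply: d_lt_eq => e e0.
have e20 : 0 < e / 2 by rlra.
have h1 : F (B (0, e / 2)) by apply: sF; exists (0, e / 2).
have [t [[_ h2] h3]] := uf_ex uF (uf_and uF h1 (hga 0 _ e20)).
move: h2 h3 => /=; rewrite addr0; have := dtri (g t) (ga 0) p; rewrite (dC (ga 0) (g _)); rlra.
Qed.

(** Strands near [ga s] are segments in the chart, and their directions, being unit vectors,
    converge along [F]. A strand starts within [r / 4] of [z] and is followed for [r / 4], inside
    the disc of radius [r / 2] whose points are all good. *)
Lemma leaf_strand F ga s E z r : leafF F ga -> 0 < r ->
  (forall a b, pd a z < r -> pd b z < r -> d (E a) (E b) = pd a b) ->
  (forall p, d (E z) p < r -> exists2 a, pd a z < r & E a = p) ->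
  ga s = E z ->
  exists2 e, nm e = 1 & line_at ga s E z e (r / 4) /\
   forall ep, 0 < ep -> F (fun t => exists z' e', [/\ pd z' z < ep, pd e' e < ep, nm e' = 1 & line_at g (t + s) E z' e' (r / 4)]).
Proof.
move=> [uF hF hg] r0 hi ho gz.
have gE w : pd w z < r / 2 -> good E w.
  move=> hw; exists (r / 2); first by rlra.
  split.
    by move=> a b ha hb; apply: hi; apply: le_lt_trans (pd_tri w _ _) _; rlra.
  move=> p hp; have hwr : pd w z < r by rlra.
  have [|a ha hap] := ho p.
    apply: le_lt_trans (dtri (E w) _ _) _; rewrite hi ?pdzz // (pdC z); rlra.
  exists a => //; rewrite pdC -hi // hap //.
pose A t := d (g (t + s)) (E z) < r / 4 /\ r + 1 - s < t.
have hA : F A by apply: uf_and => //; rewrite -gz; apply: hg; rlra.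
have hx t : exists ze : (R * R) * (R * R), A t -> [/\ pd ze.1 z = d (g (t + s)) (E z), nm ze.2 = 1 & line_at g (t + s) E ze.1 ze.2 (r / 4)].
  have [[h1 h2]|h] := EM (A t); last by exists (z, z).
  have [|a ha hag] := ho (g (t + s)); first by rewrite dC; rlra.
  have haz : pd a z = d (g (t + s)) (E z) by rewrite -hag hi // pdzz.
  have [||e e1 [_ hl]] := @line_conv g (t + s) E a (fun w => pd w z < r / 2) _ (esym hag) _ gE.
  - by rewrite haz; rlra.
  - by apply: gl; rlra.
  exists (a, e) => _; split => //= u hu.
  have [|dl dl0 hdl] := hl u.
    move=> v hv vu; split.
      apply: le_lt_trans (pd_tri a _ _) _; rewrite pd_mvz // haz; rlra.
    apply: lgeo_wgeo; apply: gl; have := ler_norm (- v); rewrite normrN; rlra.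
  by have := hdl 0; rewrite normr0 addr0 mv0; apply.
have [f hf] := choice hx.
have b1 : F (fun t => `|(f t).2.1| <= 1).
  by apply: (uf_mono uF _ hA) => t /hf[_ h _]; rewrite -h; exact: nm_fst.
have b2 : F (fun t => `|(f t).2.2| <= 1).
  by apply: (uf_mono uF _ hA) => t /hf[_ h _]; rewrite -h; exact: nm_snd.
have [x [_ hx1]] := uf_real uF b1; have [y [_ hy1]] := uf_real uF b2.
have he ep : 0 < ep -> F (fun t => A t /\ pd (f t).2 (x, y) < ep).
  move=> ep0; have ep2 : 0 < ep / 2 by rlra.
  apply: (uf_mono uF _ (uf_and uF hA (uf_and uF (hx1 _ ep2) (hy1 _ ep2)))) => t [At [k1 k2]].
  by split => //; apply: le_lt_trans (nm_le_sum _) _ => /=; rlra.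
have e1 : nm (x, y) = 1.
  apply/eqP; rewrite -subr_eq0 -normr_le0 leNgt; apply/negP => h.
  have [t [At ht]] := uf_ex uF (he _ h).
  have [_ n1 _] := hf _ At.
  have k1 := nm_pd (x, y) (f t).2; have k2 := nm_pd (f t).2 (x, y).
  rewrite n1 pdC in k1; rewrite n1 in k2.
  by move: ht; rewrite ltr_normr => /orP[]; rlra.
exists (x, y) => //.
have hz ep : 0 < ep -> F (fun t => [/\ A t, pd (f t).2 (x, y) < ep & pd (f t).1 z < ep]).
  move=> ep0; apply: (uf_mono uF _ (uf_and uF (he _ ep0) (hg s _ ep0))) => t [[At k1] k2].
  by split => //; have [-> _ _] := hf _ At; rewrite -gz.
split.
  move=> u hu; apply: d_lt_eq => ep ep0.
  have k0 : 0 < Num.min (ep / 8) (Num.min (r / 4) (ep / (8 * r))).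
    by rewrite !lt_min !divr_gt0 // mulr_gt0.
  set k := Num.min _ _ in k0.
  have [k1 k2 k3] : [/\ k <= ep / 8, k <= r / 4 & k <= ep / (8 * r)].
    by split; rewrite /k !ge_min lexx ?orbT.
  have [t [[At h2 h3] h4]] := uf_ex uF (uf_and uF (hz _ k0) (hg (s + u) _ k0)).
  have [_ n1 hl] := hf _ At.
  apply: le_lt_trans (dtri (g (t + (s + u))) _ _) _.
  rewrite (dC (ga _)) addrA hl // hi; last 2 first.
  - by apply: le_lt_trans (pd_tri (f t).1 _ _) _; rewrite pd_mvz //; rlra.
  - by rewrite pd_mvz //; rlra.
  have := pd_mv_mv (f t).1 z u (f t).2 (x, y).
  rewrite addrA hl // in h4.
  have : `|u| * pd (f t).2 (x, y) <= r * (ep / (8 * r)).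
    apply: ler_pM => //; [exact: pd_ge0|rlra|rlra].
  have -> : r * (ep / (8 * r)) = ep / 8 by field; rlra.
  rlra.
move=> ep ep0; apply: (uf_mono uF _ (hz _ ep0)) => t [At h1 h2].
by have [_ h3 h4] := hf _ At; exists (f t).1, (f t).2; split.
Qed.

Lemma leaf_tl ga s : leaf ga -> tl ga s.
Proof.
move=> [F hF] E z [r r0 [hi ho]] gz.
have [e e1 [h1 h2]] := leaf_strand hF r0 hi ho gz.
exists e => //; exists (r / 4); first by rlra.
split => // ep ep0; have [uF hT hg] := hF.
have [t [ht [z' [e' [k1 k2 k3 k4]]]]] := uf_ex uF (uf_and uF (hT (r / 4 - s)) (h2 _ ep0)).
exists (t + s), 1, z', e'; split => //; [rlra|by left|split => //].
by move=> u hu; rewrite mul1r; exact: k4.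
Qed.

(** * Cone points *)

(* Polar coordinates [(a, f)] around [x], where the total angle is [th]. *)
Definition cone x (th r : R) (Phi : R -> R -> X) :=
  [/\ 0 < r, 0 < th, (forall f, Phi 0 f = x), (forall a f, Phi a (f + th) = Phi a f) &
   (forall a b f h, 0 <= a < r -> 0 <= b < r -> `|f - h| <= th / 2 ->
      d (Phi a f) (Phi b h) = pd (pol a f) (pol b h)) /\
   (forall p, d x p < r -> exists a f, 0 <= a < r /\ Phi a f = p)].

Section Cone.
Variables (x : X) (th r : R) (Phi : R -> R -> X).
Hypothesis cP : cone x th r Phi.
Hypothesis thlt : th <= 2 * pi.

Lemma cone_r0 : 0 < r. Proof. by case: cP. Qed.
Lemma cone_th0 : 0 < th. Proof. by case: cP. Qed.

Lemma cone_int (k : int) a f : Phi a (f + k%:~R * th) = Phi a f.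
Proof. by case: cP => _ _ _ h _; exact: (periodic_int (h a)). Qed.

Lemma cone_near p f : d x p < r -> exists a h, [/\ 0 <= a < r, `|h - f| <= th / 2 & Phi a h = p].
Proof.
move=> hp; have [_ _ _ _ [_ ho]] := cP; have [a [h [ha hh]]] := ho p hp.
have [k hk] := near_int (h - f) cone_th0.
exists a, (h + k%:~R * th); split => //; last by rewrite cone_int.
by rewrite addrAC.
Qed.

Lemma cone_d0 a f : 0 <= a < r -> d x (Phi a f) = a.
Proof.
move=> /andP[a0 ar]; have [_ _ h0 _ [hd _]] := cP.
have t2 : `|f - f| <= th / 2 by have := cone_th0; rewrite subrr normr0; rlra.
have a0r : 0 <= a < r by rewrite a0.
have r0 : 0 <= (0 : R) < r by rewrite lexx cone_r0.
rewrite -(h0 f) (hd _ _ _ _ r0 a0r t2) /pol !mul0r pd0l; exact: nm_pol.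
Qed.

(** Reduction of the angle to at most [th / 2] can only decrease it, and the law of cosines is
    monotone: distances on the cone do not exceed those in the plane. *)
Lemma cone_le a b f h : 0 <= a < r -> 0 <= b < r -> `|f - h| <= pi ->
  d (Phi a f) (Phi b h) <= pd (pol a f) (pol b h).
Proof.
move=> ha hb hfh; have [_ _ _ _ [hd _]] := cP.
have [le|gt] := leP `|f - h| (th / 2); first by rewrite hd.
have [k hk] := near_int (f - h) cone_th0.
rewrite -(cone_int k a f) hd //; last by rewrite addrAC.
have p0 := pi_gt0 R.
have c1 : cos (f - h) <= cos (f + k%:~R * th - h).
  by rewrite -(cos_norm (f - h)) -(cos_norm (f + _ - h)); apply: cos_le; rewrite // addrAC; rlra.
rewrite -ler_sqr ?nnegrE ?pd_ge0 // !pd_pol_sqr.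
have : 0 <= 2 * a * b * (cos (f + k%:~R * th - h) - cos (f - h)).
  case/andP: ha => ha _; case/andP: hb => hb _.
  by rewrite mulr_ge0 // ?subr_ge0 // !mulr_ge0.
rlra.
Qed.

(** Used as a chart on the half plane of nonnegative abscissa, rolled onto the cone: the horizontal
    axis falls on the ray [f], the vertical axis on the rays [f + pi / 2] and [f - pi / 2]. *)
Definition psi (f : R) (z : R * R) := Phi (nm z) (f + arg z).

Lemma nm_bounds z : nm z < r -> 0 <= nm z < r.
Proof. by move=> ->; rewrite nm_ge0. Qed.

Lemma psi_d f z : nm z < r -> d x (psi f z) = nm z.
Proof. by move=> /nm_bounds h; exact: cone_d0. Qed.

Lemma psi_le f z w : nm z < r -> nm w < r -> 0 <= z.1 -> 0 <= w.1 -> d (psi f z) (psi f w) <= pd z w.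
Proof.
move=> hz hw z1 w1; apply: le_trans (cone_le (nm_bounds hz) (nm_bounds hw) _) _.
  have h1 := arg_nneg z1; have h2 := arg_nneg w1.
  rewrite (_ : f + arg z - (f + arg w) = arg z - arg w); last by ring.
  apply: le_trans (ler_normB _ _) _; rlra.
by rewrite pd_polD !pol_arg.
Qed.

Lemma psi_rot f c w : 0 < nm w -> `|arg w - c| < pi -> psi (f + c) (rotz (- c) w) = psi f w.
Proof.
move=> w0 h; rewrite /psi nm_rot; congr Phi.
rewrite -{1}(pol_arg w) -pol_rot arg_polK //; first by ring.
by rewrite addrC.
Qed.

(** With the chosen [k], the law of cosines keeps the angle between two points of the disc at most
    [th / 2], where [Phi] is isometric. For surjectivity, the representative of an angle nearest to
    that of [z] falls in the half plane because its cosine is positive. *)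
Lemma psi_good f z : th < 2 * pi -> 0 < z.1 -> nm z < r -> good (psi f) z.
Proof.
move=> thl z1 zr; have [_ th0' _ _ [hd _]] := cP; have p0 := pi_gt0 R.
pose m := nm z; have m0 : 0 < m by apply: nm_gt0; rewrite gt_eqF.
pose c := cos (th / 2).
have c1 : c < 1.
  by rewrite -[1]cos0; apply: cos_lt; rlra.
have cm1 : -1 <= c by exact: cos_geN1.
pose k := Num.min (Num.min (z.1) (r - m)) (m * (1 - c) / 8).
have k0 : 0 < k by rewrite !lt_min z1 subr_gt0 zr divr_gt0 ?mulr_gt0 //; rlra.
have [kz kr km] : [/\ k <= z.1, k <= r - m & k <= m * (1 - c) / 8].
  by rewrite /k; split; rewrite !ge_min lexx ?orbT.
have near a : pd a z < k -> [/\ 0 < a.1, nm a < r & m / 2 <= nm a].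
  move=> ha; have h1 := pd_fst a z; have h2 := ler_norm (z.1 - a.1); rewrite distrC in h2.
  have h3 := nm_pd a z; have h4 := nm_pd z a; rewrite (pdC z) in h4; rewrite -/m in h3 h4.
  split; [rlra|rlra|]. nra.
have ang a b : 0 < a.1 -> 0 < b.1 -> nm a < r -> nm b < r -> m / 2 <= nm a -> m / 2 <= nm b -> pd a b < 2 * k ->
   `|arg a - arg b| <= th / 2.
  move=> a1 b1 ar br am bm hab.
  have h1 := arg_pos a1; have h2 := arg_pos b1.
  apply: cos_le_abs; [by apply: le_trans (ler_normB _ _) _; rlra|by apply/andP; split; rlra|].
  have h3 : pd a b ^+ 2 = nm a ^+ 2 + nm b ^+ 2 - 2 * nm a * nm b * cos (arg a - arg b).
    by rewrite -pd_pol_sqr !pol_arg.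
  have h4 : pd a b ^+ 2 < (2 * k) ^+ 2 by rewrite ltr_sqr ?nnegrE ?pd_ge0 //; rlra.
  have h5 : m / 2 * (m / 2) <= nm a * nm b by apply: ler_pM => //; rlra.
  have h6 : (2 * k) ^+ 2 <= (1 - c) * (m / 2 * (m / 2)).
    have h7 : k ^+ 2 <= (m * (1 - c) / 8) ^+ 2 by rewrite ler_sqr ?nnegrE; rlra.
    have h8 : 0 <= m ^+ 2 * ((1 - c) * (1 + c)) by rewrite mulr_ge0 ?sqr_ge0 // mulr_ge0; rlra.
    nra.
  have h9 := sqr_ge0 (nm a - nm b).
  rewrite leNgt; apply/negP => hlt.
  have h10 : (1 - c) * (m / 2 * (m / 2)) <= (1 - c) * (nm a * nm b) by rewrite ler_pM2l //; rlra.
  have h11 : 0 < nm a * nm b by nra.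
  have h12 : 0 < (nm a * nm b) * (c - cos (arg a - arg b)) by rewrite mulr_gt0 // subr_gt0.
  nra.
have iso a b : pd a z < k -> pd b z < k -> d (psi f a) (psi f b) = pd a b.
  move=> ha hb; have [a1 ar am] := near _ ha; have [b1 br bm] := near _ hb.
  rewrite hd ?nm_bounds //; first by rewrite pd_polD !pol_arg.
  rewrite (_ : f + arg a - (f + arg b) = arg a - arg b); last by ring.
  apply: ang => //; apply: le_lt_trans (pd_tri z _ _) _; rewrite (pdC z b); rlra.
exists k => //; split => // p hp.
have hxp : d x p < r.
  apply: le_lt_trans (dtri (psi f z) _ _) _; rewrite psi_d // -/m; rlra.
have [a [h [ha hh hap]]] := cone_near (f + arg z) hxp.
have hdp : d (psi f z) p = pd z (pol a (h - f)).
  rewrite -hap hd ?nm_bounds //; last by rewrite distrC.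
  rewrite -[in RHS](pol_arg z) -(pd_polD (nm z) a (arg z) (h - f) f).
  by congr (pd _ (pol _ _)); ring.
exists (pol a (h - f)); first by rewrite pdC -hdp.
have ha0 : 0 <= a by case/andP: ha.
have hk : pd (pol a (h - f)) z < k by rewrite pdC -hdp.
have [q1 q2 q3] := near _ hk.
rewrite /psi; rewrite (nm_pol _ ha0).
have a0 : 0 < a by rewrite nm_pol // in q3; rlra.
rewrite -{}hap; congr Phi.
have hc : 0 < cos (h - f) by move: q1; rewrite /pol /= pmulr_rgt0.
have hz := arg_pos z1.
have : `|h - f| < pi / 2.
  apply: cos_pos_small => //.
  have -> : h - f = (h - (f + arg z)) + arg z by ring.
  apply: le_lt_trans (ler_normD _ _) _; rlra.
move=> hhf; rewrite arg_polK //; [ring|rlra].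
Qed.


End Cone.

Lemma arg_r0 a : 0 < a -> arg (a, 0) = 0 :> R.
Proof.
move=> a0; have -> : (a, 0) = pol a 0 by rewrite /pol cos0 sin0 mulr1 mulr0.
by rewrite arg_polK // normr0 pi_gt0.
Qed.
Lemma nm_r0 a : 0 <= a -> nm (a, 0) = a :> R.
Proof. by move=> a0; apply: nm_eq => //=; rewrite expr0n addr0. Qed.
Lemma cos_near1 (e : R) : 0 < e -> exists2 dl, 0 < dl & forall x : R, `|x| < dl -> 1 - e < cos x.
Proof.
move=> e0; have /cvgrPdist_lt h := @continuous_cos R 0.
have /nbhs_ballP [dl /= dl0 hd] := h e e0.
exists dl => // x hx; have := hd x; rewrite /ball /= sub0r normrN cos0 => /(_ hx).
by rewrite ltr_norml; rlra.
Qed.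
Lemma cone_shrink x th r r' Phi : th <= 2 * pi -> 0 < r' <= r -> cone x th r Phi -> cone x th r' Phi.
Proof.
move=> thle /andP[r0 rr] [h1 h2 h3 h4 [h5 h6]]; split => //; split.
  move=> a b f h /andP[a0 ar] /andP[b0 br]; apply: h5; apply/andP; split => //; rlra.
move=> p hp; have hp' : d x p < r by rlra.
have [a [f [/andP[a0 ar] hf]]] := h6 p hp'.
exists a, f; split => //; rewrite a0 /=.
have r0' : 0 < r by rlra.
have cP : cone x th r Phi by split.
by rewrite -(cone_d0 cP thle f (a := a)) ?hf // a0 ar.
Qed.

Variable V : X -> Prop.
Hypothesis cV : forall v : X, V v -> exists (th r : R) Phi, th < 2 * pi /\ cone v th r Phi.

(** Points at distance [u] on either side of [v] would be [2 * u] apart, which requires an angle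
    [pi] between them, while two rays from [v] make an angle of at most [th / 2]. *)
Lemma V_nogeo (v : X) (c : R -> X) t : V v -> lgeo c t -> c t = v -> False.
Proof.
move=> /cV [th [r [Phi [thl cP]]]] [e e0 hc] ct.
have [r0 th0 _ _ [hd _]] := cP; have p0 := pi_gt0 R.
have thle : th <= 2 * pi by exact: ltW.
pose u := Num.min e r / 2.
have m0 : 0 < Num.min e r by rewrite lt_min e0 r0.
have [m1 m2] : Num.min e r <= e /\ Num.min e r <= r by split; rewrite ge_min lexx ?orbT.
have u0 : 0 < u by rewrite /u; rlra.
have ue : `|u| < e by rewrite gtr0_norm // /u; rlra.
have q1 : t + u - t = u by ring.
have q2 : t - u - t = - u by ring.
have q3 : t + u - (t - u) = 2 * u by ring.
have tt : `|t - t| < e by rewrite subrr normr0.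
have tp : `|t + u - t| < e by rewrite q1.
have tm : `|t - u - t| < e by rewrite q2 normrN.
have d1 : d v (c (t + u)) = u by rewrite -ct dC hc // q1 gtr0_norm.
have d2 : d v (c (t - u)) = u by rewrite -ct dC hc // q2 normrN gtr0_norm.
have d3 : d (c (t + u)) (c (t - u)) = 2 * u.
  by rewrite hc // q3 gtr0_norm // mulr_gt0.
have ur : u < r by rewrite /u; rlra.
have [a [f [ha _ hf]]] := cone_near cP thle (p := c (t + u)) 0 (ltac:(by rewrite d1)).
have [b [h [hb hfh hh]]] := cone_near cP thle (p := c (t - u)) f (ltac:(by rewrite d2)).
have au : a = u by rewrite -d1 -hf (cone_d0 cP thle).
have bu : b = u by rewrite -d2 -hh (cone_d0 cP thle).
subst a b.
have : pd (pol u h) (pol u f) ^+ 2 = (2 * u) ^+ 2.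
  by rewrite -hd // hf hh dC d3.
rewrite pd_pol_sqr => hk.
have hcos : cos (h - f) = -1.
  have : u ^+ 2 * (cos (h - f) + 1) = 0 by rlra.
  by move/eqP; rewrite mulf_eq0 sqrf_eq0 => /orP[/eqP|/eqP]; rlra.
have : cos pi < cos `|h - f| by apply: cos_lt => //; rlra.
by rewrite cospi cos_norm hcos ltxx.
Qed.

Lemma V_notflat (v : X) : V v -> flat v -> False.
Proof.
move=> Vv [E [z [gE Ez]]].
have e1 : nm (1, 0) = 1 :> R by rewrite nm_r0.
by apply: (V_nogeo Vv (good_lgeo gE e1)); rewrite mv0.
Qed.

(** * Strands and leaves near a vertex *)

Section Vertex.
Variables (v : X) (th r : R) (Phi : R -> R -> X).
Hypothesis Vv : V v.
Hypothesis cP : cone v th r Phi.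
Hypothesis thl : th < 2 * pi.
Hypothesis r8 : r <= 1 / 8.
Lemma thle : th <= 2 * pi. Proof. exact: ltW. Qed.
Lemma vr0 : 0 < r. Proof. by case: cP. Qed.
Lemma vth0 : 0 < th. Proof. by case: cP. Qed.
Local Notation psi := (psi Phi).

Lemma psi_per (k : int) f z : psi (f + k%:~R * th) z = psi f z.
Proof. by rewrite /psi addrAC (cone_int cP thle). Qed.
Lemma psi_r0 f a : 0 < a -> psi f (a, 0) = Phi a f.
Proof. by move=> a0; rewrite /psi nm_r0 ?(ltW a0) // arg_r0 // addr0. Qed.

(** A strand passing [v] at distance [ep]: in the chart around the ray [f] of its closest point it
    is the vertical line of abscissa [ep], run upwards or downwards. [t1] is the time of closest
    approach, bounded below by [1 / 8 >= r] so that the whole chord has positive times. *)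
Definition vstr (f ep t1 tau : R) := [/\ 0 < ep, 1 / 8 <= t1, (tau = 1 \/ tau = -1) &
  forall u, nm (ep, u) < r -> g (t1 + u) = psi f (ep, tau * u)].

Lemma g_notV t : 0 <= t -> g t <> v.
Proof. by move=> t0 gt; exact: (V_nogeo Vv (gl t0) gt). Qed.

(** Seen from its point at distance [q] the strand is a line not directed at the apex. In the chart
    centred on the ray of its foot this line is vertical and can be followed along the whole
    chord. *)
Lemma vstrand t : 1 <= t -> d v (g t) < r -> exists f ep t1 tau : R,
  vstr f ep t1 tau /\ nm (ep, t - t1) = d v (g t).
Proof.
move=> t1 hr; have r0 := vr0; have r8' := r8.
have t0 : 0 <= t by rlra.
pose q := d v (g t).
have q0 : 0 < q.
  rewrite lt_neqAle d_ge0 andbT; apply/eqP => h; apply: (g_notV t0); apply: deq; rewrite dC -/q; exact: esym.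
have [a [al [ha _ hal]]] := cone_near cP thle 0 hr.
have aq : a = q by rewrite /q -hal (cone_d0 cP thle).
subst a.
have nz0 : nm (q, 0) = q by rewrite nm_r0 // ltW.
pose Om (w : R * R) := 0 < w.1 /\ nm w < r.
have gE f w : Om w -> good (psi f) w by move=> [w1 wr]; exact: (psi_good cP thle).
have Oz : Om (q, 0) by split => //=; rewrite nz0.
have Egt : g t = psi al (q, 0) by rewrite psi_r0.
have [e e1 [_ hl]] := line_conv Oz Egt (gl t0) (gE al).
have e12 : e.1 ^+ 2 + e.2 ^+ 2 = 1 by apply/nm_eq1.
have gw u : `|u| < r -> wgeo g (t + u).
  move=> hu; apply: lgeo_wgeo; apply: gl; have := ler_norm (- u); rewrite normrN; rlra.
(* A horizontal direction is radial, and the strand would run into [v]. *)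
have e2n : e.2 != 0.
  apply/eqP => e20.
  have e11 : e.1 * e.1 = 1 by move: e12; rewrite e20; nra.
  have ne1 : `|e.1| = 1.
    by apply/eqP; rewrite -(@eqrXn2 _ 2) // expr1n real_normK ?num_real //; apply/eqP; rewrite expr2.
  have hpt u : 0 <= u < q -> g (t - e.1 * u) = psi al (q - u, 0).
    move=> /andP[u0 uq].
    have [|dl dl0 hdl] := hl (- (e.1 * u)).
      rewrite normrN normrM ne1 mul1r (ger0_norm u0) => w hw1 hw2.
      split; last by apply: gw; rlra.
      have hew : `|w * e.1| <= u by rewrite normrM ne1 mulr1.
      have := ler_norm (- (w * e.1)); have := ler_norm (w * e.1); rewrite normrN => k1 k2.
      have hs : w * e.1 <= 0 by nra.
      split; rewrite /mv /=; first by rlra.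
      by rewrite e20 mulr0 addr0 nm_r0; rlra.
    have := hdl 0; rewrite normr0 addr0 mv0 => -> //; congr (psi al _).
    by rewrite /mv /= e20 mulr0 addr0; congr pair; rewrite mulNr mulrAC e11 mul1r.
  have hv : g (t - e.1 * q) = v.
    apply: d_lt_eq => ep ep0.
    pose u := Num.max 0 (q - ep / 4).
    have u1 : 0 <= u by rewrite le_max lexx.
    have u2 : q - ep / 4 <= u by rewrite le_max lexx orbT.
    have u3 : u < q by rewrite gt_max q0; rlra.
    have hb x : 0 <= x <= q -> 0 <= t - e.1 * x.
      by move=> /andP[x0 xq]; have := ler_norm (e.1 * x); rewrite normrM ne1 mul1r (ger0_norm x0); rlra.
    apply: le_lt_trans (dtri (g (t - e.1 * u)) _ _) _.
    have hu : 0 <= u < q by rewrite u1.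
    rewrite (dC _ v) (hpt u hu) (psi_d cP thle) nm_r0; try rlra.
    have := g_lip (hb q (ltac:(by rewrite lexx ltW))) (hb u (ltac:(by rewrite u1 ltW))).
    rewrite (hpt u hu) (_ : t - e.1 * q - (t - e.1 * u) = e.1 * (u - q)); last by ring.
    rewrite normrM ne1 mul1r ltr0_norm; rlra.
  have hq : 0 <= t - e.1 * q.
    by have := ler_norm (e.1 * q); rewrite normrM ne1 mul1r (gtr0_norm q0); rlra.
  exact: (g_notV hq hv).
have e21 : 0 < e.2 ^+ 2 by rewrite lt_neqAle sqr_ge0 andbT eq_sym sqrf_eq0.
(* The parameter and the position of the foot of the perpendicular from the apex. *)
pose u0 := - (q * e.1); pose f := mv (q, 0) u0 e.
pose ep := q * `|e.2|.
have ep0 : 0 < ep by rewrite mulr_gt0 // normr_gt0.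
have ep2 : ep ^+ 2 = q ^+ 2 * e.2 ^+ 2 by rewrite /ep exprMn real_normK ?num_real.
have f1 : f.1 = q * e.2 ^+ 2.
  by rewrite /f /mv /u0 /=; transitivity (q * (e.1 ^+ 2 + e.2 ^+ 2) - q * e.1 ^+ 2); [rewrite e12|]; ring.
have f2 : f.2 = - (q * e.1 * e.2) by rewrite /f /mv /u0 /=; ring.
have nf : nm f = ep.
  apply: nm_eq; first exact: ltW.
  rewrite f1 f2 ep2.
  by transitivity (q ^+ 2 * e.2 ^+ 2 * (e.1 ^+ 2 + e.2 ^+ 2)); [ring|rewrite e12 mulr1].
have he1 : `|e.1| <= 1 by rewrite -e1; exact: nm_fst.
have he2 : `|e.2| <= 1 by rewrite -e1; exact: nm_snd.
have epq : ep <= q by rewrite /ep ger_pMr.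
have hu0 : `|u0| <= q by rewrite /u0 normrN normrM (gtr0_norm q0) ger_pMr.
have hq : q < r by [].
have [|dl dl0 hdl] := hl u0.
  move=> w hw1 hw2; split; last by apply: gw; rlra.
  split; last first.
    apply: (nm_between (u := u0)) => //; first by rewrite nz0.
    by rewrite -/f nf; rlra.
  rewrite /mv /=.
  have : `|w * e.1| <= q * e.1 ^+ 2.
    rewrite normrM -real_normK ?num_real // expr2 mulrA ler_wpM2r //.
    by apply: le_trans hw2 _; rewrite /u0 normrN normrM (gtr0_norm q0).
  have := ler_norm (- (w * e.1)); rewrite normrN => k1 k2.
  have : 0 < q * e.2 ^+ 2 by rewrite mulr_gt0.
  have : q * (e.1 ^+ 2 + e.2 ^+ 2) = q by rewrite e12 mulr1.
  rlra.
have gtu : g (t + u0) = psi al f.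
  by have := hdl 0; rewrite normr0 addr0 mv0; apply.
pose ff := al + arg f.
have tu0 : 7 / 8 <= t + u0 by have := ler_norm (- u0); rewrite normrN; rlra.
have E0 : g (t + u0) = psi ff (ep, 0).
  by rewrite psi_r0 // gtu /psi nf.
have Oe : Om (ep, 0) by split => //=; rewrite nm_r0; rlra.
have tu0' : 0 <= t + u0 by rlra.
have [e' e'1 [[dl2 dl20 hdl2] hl2]] := line_conv Oe E0 (gl tu0') (gE ff).
have e'12 : e'.1 ^+ 2 + e'.2 ^+ 2 = 1 by apply/nm_eq1.
(* The distance to [v] is the norm in both charts. In the old one it has no first-order term at the
   foot, so in the new one [ep * e'.1] vanishes. *)
have e'10 : e'.1 = 0.
  pose x := Num.min (Num.min dl dl2) (r - ep) / 2.
  have m0 : 0 < Num.min (Num.min dl dl2) (r - ep) by rewrite !lt_min dl0 dl20; rlra.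
  have [m1 m2 m3] : [/\ x < dl, x < dl2 & x < r - ep].
    have : Num.min (Num.min dl dl2) (r - ep) <= dl by rewrite !ge_min lexx.
    have : Num.min (Num.min dl dl2) (r - ep) <= dl2 by rewrite !ge_min lexx orbT.
    have : Num.min (Num.min dl dl2) (r - ep) <= r - ep by rewrite !ge_min lexx orbT.
    by rewrite /x; split; rlra.
  have x0 : 0 < x by rewrite /x; rlra.
  have k1 := hdl x (ltac:(by rewrite gtr0_norm)); have k2 := hdl2 x (ltac:(by rewrite gtr0_norm)).
  have n1 : nm (mv f x e) < r.
    apply: le_lt_trans (nm_mv _ _ e1) _; rewrite nf gtr0_norm //; rlra.
  have n2 : nm (mv (ep, 0) x e') < r.
    apply: le_lt_trans (nm_mv _ _ e'1) _; rewrite nm_r0 ?(ltW ep0) // gtr0_norm //; rlra.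
  have : nm (mv f x e) ^+ 2 = nm (mv (ep, 0) x e') ^+ 2.
    by rewrite -(psi_d cP thle al n1) -(psi_d cP thle ff n2) -k1 -k2.
  have h2 : dotp f e = 0 by rewrite /dotp f1 f2; ring.
  have h3 : dotp (ep, 0) e' = ep * e'.1 by rewrite /dotp /=; ring.
  rewrite (nm_mv_sqr f x e1) (nm_mv_sqr (ep, 0) x e'1) h2 h3 nf nm_r0 ?(ltW ep0) // => hh.
  have : (x * ep) * e'.1 = 0 by rlra.
  by move/eqP; rewrite mulf_eq0 (gt_eqF (mulr_gt0 x0 ep0)) => /eqP.
have e'2 : e'.2 = 1 \/ e'.2 = -1.
  by move/eqP: e'12; rewrite e'10 expr0n add0r sqrf_eq1 => /orP[] /eqP ->; [left|right].
exists ff, ep, (t + u0), e'.2; split; last first.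
  rewrite opprD addrA subrr sub0r /u0 opprK; apply: nm_eq; first exact: ltW.
  transitivity (q ^+ 2 * (e.1 ^+ 2 + e.2 ^+ 2)); last by rewrite e12 mulr1.
  by rewrite [LHS]/= ep2; ring.
split => //; first by rlra.
move=> u hu.
have hur : `|u| < r by apply: le_lt_trans hu; exact: (nm_snd (ep, u)).
have hmv w : mv (ep, 0) w e' = (ep, e'.2 * w) by rewrite /mv /= e'10 mulr0 addr0 add0r mulrC.
have [|dl3 dl30 hdl3] := hl2 u.
  move=> w hw1 hw2; rewrite hmv; split.
    split => //=; apply: le_lt_trans hu; rewrite -ler_sqr ?nnegrE ?nm_ge0 // !nm_sqr /= lerD2l.
    by rewrite exprMn (_ : e'.2 ^+ 2 = 1) ?mul1r; [rewrite -(real_normK (num_real w)) -(real_normK (num_real u)) ler_sqr ?nnegrE|case: e'2 => ->; rewrite ?sqrrN expr1n].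
  apply: lgeo_wgeo; apply: gl; have := ler_norm (- w); rewrite normrN; rlra.
by have := hdl3 0; rewrite normr0 addr0 mv0 hmv; apply.
Qed.

(** The strand crosses the ray [f + b] at distance [ep / cos b]. The chart is the one around that
    ray, so that several crossings of the same ray can be compared. *)
Lemma strand_rot f ep t1 tau b : vstr f ep t1 tau -> `|b| < pi / 2 -> ep < r * cos b ->
  exists t2 dl : R, [/\ 0 < t2, 0 < dl & line_at g t2 (psi (f + b)) (ep / cos b, 0) (rotz (- b) (0, tau)) dl].
Proof.
move=> [ep0 t18 ht hs] hb hep; have r8' := r8; have p0 := pi_gt0 R.
have cb : 0 < cos b by apply: cos_gt0_pihalf; rewrite -ltr_norml.
pose q := ep / cos b; pose y := q * sin b.
have q0 : 0 < q by rewrite divr_gt0.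
have qr : q < r by rewrite /q ltr_pdivrMr.
have hpol : (ep, y) = pol q b by rewrite /pol /y; congr pair; rewrite /q divfK // gt_eqF.
have t2 : tau * tau = 1 by case: ht => ->; ring.
have ty : tau * (tau * y) = y by rewrite mulrA t2 mul1r.
have nty : nm (ep, tau * y) = q.
  apply: nm_eq; first exact: ltW.
  by rewrite /= exprMn (expr2 tau) t2 mul1r -(nm_sqr (ep, y)) hpol nm_pol // ltW.
exists (t1 + tau * y), (r - q); split; [|by rlra|].
  have := ler_norm (- (tau * y)); have := nm_snd (ep, tau * y); rewrite normrN nty /=; rlra.
move=> x hx.
have nx : nm (ep, tau * y + x) < r.
  have -> : (ep, tau * y + x) = mv (ep, tau * y) x (0, 1) by rewrite /mv /= mulr0 mulr1 addr0.
  apply: le_lt_trans (nm_mv _ _ _) _; last by rewrite nty; rlra.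
  by apply: nm_eq => //=; ring.
rewrite -addrA hs // mulrDr ty.
have hw : 0 < (ep, y + tau * x).1 by [].
rewrite -(psi_rot cP thle f (c := b)).
- congr (psi _ _).
  have e1 : rotz (- b) (ep, y) = (q, 0).
    by rewrite hpol -pol_rot addNr /pol cos0 sin0 mulr1 mulr0.
  rewrite /rotz /= in e1; case: e1 => e1 e2.
  by rewrite /mv /rotz /= -/q; congr pair; rlra.
- by apply: nm_gt0; rewrite gt_eqF.
- by have := arg_pos hw => ha; apply: le_lt_trans (ler_normB _ _) _; rlra.
Qed.

Lemma Lim_near e : Lim v -> 0 < e -> exists2 t, 1 <= t & d v (g t) < e.
Proof. by move=> L e0; have [t [h1 h2]] := L e 1 e0; exists t; rewrite 1?dC // ltW. Qed.

(** A strand close to [v] sweeps an angle close to [pi]. If [th] were smaller it would meet the ray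
    opposite to its foot from both sides, at angles [th / 2] and [- (th / 2)]: the same point in two
    directions. *)
Lemma theta_ge : Lim v -> pi <= th.
Proof.
move=> L; rewrite leNgt; apply/negP => hth; have p0 := pi_gt0 R; have r0 := vr0; have th0 := vth0.
have hb : `|th / 2| < pi / 2 by rewrite gtr0_norm; rlra.
have cb : 0 < cos (th / 2) by apply: cos_gt0_pihalf; rewrite -ltr_norml.
have [t t1 ht] := Lim_near L (mulr_gt0 r0 cb).
have c1 := cos_le1 (th / 2).
have hr : d v (g t) < r by nra.
have [f [ep [t2 [tau [hs hn]]]]] := vstrand t1 hr.
have hep : ep < r * cos (th / 2).
  by apply: le_lt_trans ht; rewrite -hn; apply: le_trans (ler_norm _) _; exact: (nm_fst (ep, _)).
have [ta [dla [ta0 dla0 hla]]] := strand_rot hs hb hep.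
have [tb [dlb [tb0 dlb0 hlb]]] := strand_rot hs (b := - (th / 2)) (ltac:(by rewrite normrN)) (ltac:(by rewrite cosN)).
rewrite cosN in hlb.
have k0 : 0 < Num.min dla dlb by rewrite lt_min dla0 dlb0.
have [ep0 _ htau _] := hs.
have gz : good (psi (f + th / 2)) (ep / cos (th / 2), 0).
  apply: (psi_good cP thle) => //=; first by rewrite divr_gt0.
  by rewrite nm_r0 ?divr_ge0 ?ltW // ltr_pdivrMr.
have ntau : nm (0, tau) = 1 by apply: nm_eq => //=; case: htau => ->; ring.
have hE : rotz (- (th / 2)) (0, tau) = rotz (th / 2) (0, tau).
  apply: (gs (ltW ta0) (ltW tb0) k0 gz); rewrite ?nm_rot //.
    by move=> x; rewrite lt_min => /andP[hx _]; exact: hla.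
  move=> x; rewrite lt_min => /andP[_ hx]; rewrite hlb // opprK.
  by rewrite -(psi_per 1) mul1r; congr (psi _ _); rlra.
move: hE => [].
rewrite !mulr0 sinN cosN => hh _.
have s0 : 0 < sin (th / 2) by apply: sin_gt0_pi; apply/andP; split; rlra.
have : sin (th / 2) * tau = 0 by rlra.
by move/eqP; rewrite mulf_eq0 (gt_eqF s0) => /eqP; case: htau => ->; rlra.
Qed.


Implicit Types (ep tau eta a : R).
(** Apart from the slack in [c], the difference of the two sides is the square of
    [p * sin x - q * sin y]. *)
Lemma cos_law_bound (x y p q c : R) : 0 <= p -> 0 <= q -> c <= - (cos x * cos y - sin x * sin y) ->
  (p * cos x + q * cos y) ^+ 2 <= p ^+ 2 + q ^+ 2 - 2 * p * q * c.
Proof.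
move=> p0 q0 cb; have hs := sqr_ge0 (p * sin x - q * sin y).
have h1 : 0 <= (p * q) * (- (cos x * cos y - sin x * sin y) - c) by rewrite mulr_ge0 ?mulr_ge0 // subr_ge0.
have h2 : p ^+ 2 * (cos x ^+ 2 + sin x ^+ 2) = p ^+ 2 by rewrite cos2Dsin2 mulr1.
have h3 : q ^+ 2 * (cos y ^+ 2 + sin y ^+ 2) = q ^+ 2 by rewrite cos2Dsin2 mulr1.
rlra.
Qed.

(** When the angle in the chart exceeds [th / 2], the shortest way goes round the other side of [v],
    through an angle at least [pi] minus the angles of [z] and [w] with the horizontal axis; the law
    of cosines then gives at least the sum of the abscissas. *)
Lemma psi_pd f z w : pi <= th -> 0 <= z.1 -> 0 <= w.1 -> nm z < r -> nm w < r ->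
  d (psi f z) (psi f w) = pd z w \/ z.1 + w.1 <= d (psi f z) (psi f w).
Proof.
move=> thp z1 w1 zr wr; have [_ _ _ _ [hd _]] := cP; have p0 := pi_gt0 R; have thl' := thl.
have az := arg_nneg z1; have aw := arg_nneg w1.
pose D := arg z - arg w.
have hD : `|D| <= `|arg z| + `|arg w| := ler_normB _ _.
have [le|gt] := leP `|D| (th / 2).
  left; rewrite hd ?(nm_bounds cP thle) //; first by rewrite pd_polD !pol_arg.
  by rewrite (_ : f + arg z - (f + arg w) = D) // /D; ring.
right; pose be := th - `|D|.
have [k hk] : exists k : int, `|D + k%:~R * th| = be.
  have [D0|D0] := leP 0 D.
    exists (-1)%Z; rewrite /be (ger0_norm D0) mulN1r distrC ger0_norm //.
    by have := ler_norm D; rlra.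
  exists 1%Z; rewrite /be (ltr0_norm D0) mul1r opprK addrC ger0_norm //.
  by have := ler_norm (- D); rewrite normrN; rlra.
have d2 : d (psi f z) (psi f w) ^+ 2 = nm z ^+ 2 + nm w ^+ 2 - 2 * nm z * nm w * cos be.
  have e3 : f + arg z + k%:~R * th - (f + arg w) = D + k%:~R * th by rewrite /D; ring.
  rewrite /psi -(cone_int cP thle k _ (f + arg z)) hd ?(nm_bounds cP thle) //; last by rewrite e3 hk /be; rlra.
  by rewrite pd_pol_sqr e3 -cos_norm hk.
have cb : cos be <= - cos (`|arg z| + `|arg w|).
  have -> : - cos (`|arg z| + `|arg w|) = cos (pi - (`|arg z| + `|arg w|)).
    by rewrite cosB cospi sinpi mulN1r mul0r addr0.
  by apply: cos_le; rewrite /be; rlra.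
have hc (x : R * R) : x.1 = nm x * cos `|arg x| by rewrite cos_norm -{1}(pol_arg x).
rewrite -ler_sqr ?nnegrE ?addr_ge0 ?d_ge0 // d2 (hc z) (hc w).
rewrite (cosD `|arg z|) in cb.
by apply: cos_law_bound => //; exact: nm_ge0.
Qed.

Lemma sqr_eq (x y : R) : 0 <= x -> 0 <= y -> x ^+ 2 = y ^+ 2 -> x = y.
Proof. by move=> x0 y0 /eqP; rewrite eqrXn2 // => /eqP. Qed.

Lemma abs_sin (x : R) : `|x| <= pi / 2 -> `|sin x| = cos (pi / 2 - `|x|).
Proof.
move=> hx; have p0 := pi_gt0 R; rewrite cosB cos_pihalf sin_pihalf mul0r add0r mul1r.
have hs : 0 <= sin `|x| by apply: sin_ge0_pi; rewrite normr_ge0 /=; apply: le_trans hx _; rlra.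
rewrite -(ger0_norm hs); have [x0|x0] := leP 0 x; first by rewrite (ger0_norm x0).
by rewrite (ltr0_norm x0) sinN normrN.
Qed.

Lemma arg_axis (y : R) tau : 0 < y -> tau = 1 \/ tau = -1 -> nm (0, tau * y) = y /\ arg (0, tau * y) = tau * (pi / 2).
Proof.
move=> y0 ht; have p0 := pi_gt0 R.
have e : (0, tau * y) = pol y (tau * (pi / 2)).
  by rewrite /pol; case: ht => ->; rewrite ?mulN1r ?mul1r ?cosN ?sinN cos_pihalf sin_pihalf; congr pair; ring.
rewrite e nm_pol ?(ltW y0) //; split => //; apply: arg_polK => //.
have tn : `|tau| = 1 by case: ht => ->; rewrite ?normrN normr1.
by rewrite normrM tn mul1r gtr0_norm; rlra.
Qed.

(** The half disc leaves out a sector of angle [th - pi]. For a point in the half of this sector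
    next to a boundary ray, the foot on that ray is a nearest point of the half disc, and interior
    points are strictly farther. *)
Lemma psi_out f a eta tau : 0 < a < r -> 0 < eta <= (th - pi) / 2 -> tau = 1 \/ tau = -1 ->
  d (Phi a (f + tau * (pi / 2 + eta))) (psi f (0, tau * (a * cos eta))) = a * sin eta /\
  forall z, 0 <= z.1 -> nm z < r -> a * sin eta <= d (Phi a (f + tau * (pi / 2 + eta))) (psi f z) /\
    (0 < z.1 -> a * sin eta < d (Phi a (f + tau * (pi / 2 + eta))) (psi f z)).
Proof.
move=> /andP[a0 ar] /andP[e0 e1] ht; have [_ _ _ _ [hd _]] := cP; have p0 := pi_gt0 R; have thl' := thl.
have ce : 0 < cos eta by apply: cos_gt0_pihalf; apply/andP; split; rlra.
have se : 0 < sin eta by apply: sin_gt0_pi; apply/andP; split; rlra.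
have ce1 := cos_le1 eta; have cs := cos2Dsin2 eta.
have tn : `|tau| = 1 by case: ht => ->; rewrite ?normrN normr1.
have haa : 0 <= a < r by rewrite (ltW a0).
split.
  have y0 : 0 < a * cos eta by exact: mulr_gt0.
  have yr : a * cos eta < r by apply: le_lt_trans ar; rewrite ger_pMr.
  have [n1 n2] := arg_axis y0 ht.
  have e3 : f + tau * (pi / 2 + eta) - (f + tau * (pi / 2)) = tau * eta by ring.
  rewrite /psi n1 n2 hd //; last 2 first.
  - by rewrite (ltW y0).
  - by rewrite e3 normrM tn mul1r gtr0_norm //; rlra.
  apply: sqr_eq; [exact: pd_ge0|by rewrite ltW // mulr_gt0|].
  rewrite pd_pol_sqr e3 -(cos_norm (tau * eta)) normrM tn mul1r (gtr0_norm e0).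
  transitivity (a ^+ 2 * (1 - cos eta ^+ 2)); first by ring.
  by rewrite -cs; ring.
move=> z z1 zr; have az := arg_nneg z1.
have [k hk] := near_int (f + tau * (pi / 2 + eta) - (f + arg z)) vth0.
set an := `|_| in hk.
pose ga := eta + (pi / 2 - `|arg z|).
have e3 : f + tau * (pi / 2 + eta) + k%:~R * th - (f + arg z) = f + tau * (pi / 2 + eta) - (f + arg z) + k%:~R * th by ring.
have d2 : d (Phi a (f + tau * (pi / 2 + eta))) (psi f z) ^+ 2 = a ^+ 2 + nm z ^+ 2 - 2 * a * nm z * cos an.
  rewrite /psi -(cone_int cP thle k _ (f + tau * (pi / 2 + eta))) hd ?(nm_bounds cP thle) //; last by rewrite e3.
  by rewrite pd_pol_sqr e3 -cos_norm.
(* [ga] is the angle measured across the boundary ray; the other way round is no shorter because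
   [eta] is at most half of the left-out sector. *)
have hga : ga <= an.
  have e4 : f + tau * (pi / 2 + eta) - (f + arg z) = tau * (pi / 2 + eta) - arg z by ring.
  have nt : `|tau * (pi / 2 + eta)| = pi / 2 + eta by rewrite normrM tn mul1r gtr0_norm //; rlra.
  have [k0|k0] := eqVneq k 0.
    have := lerB_normD (tau * (pi / 2 + eta)) (- arg z); rewrite /an e4 k0 mul0r addr0 nt normrN /ga; rlra.
  have k1 : 1 <= `|k%:~R : R|.
    rewrite -intr_norm -[1]/(1%:~R) ler_int; move: k0; rewrite -normr_gt0; by case: `|k|.
  have h1 : th <= `|k%:~R * th| by rewrite normrM (gtr0_norm vth0) ler_peMl // ltW // vth0.
  have h2 : `|k%:~R * th| <= an + `|tau * (pi / 2 + eta) - arg z|.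
    rewrite (_ : k%:~R * th = (f + tau * (pi / 2 + eta) - (f + arg z) + k%:~R * th) - (tau * (pi / 2 + eta) - arg z)); last by ring.
    exact: ler_normB.
  have h3 := ler_normB (tau * (pi / 2 + eta)) (arg z); rewrite nt in h3.
  rewrite /ga; rlra.
have an0 : an <= pi by rlra.
have ga0 : 0 <= ga by rewrite /ga; rlra.
have ega : eta <= ga by rewrite /ga; rlra.
have cga : cos an <= cos eta.
  by apply: (le_trans (y := cos ga)); [exact: cos_le|apply: cos_le => //; [exact: ltW|exact: le_trans hga an0]].
have cgas : 0 < z.1 -> cos an < cos eta.
  move=> z10; have hz := arg_pos z10.
  have ega' : eta < ga by rewrite /ga; rlra.
  by apply: (le_lt_trans (y := cos ga)); [exact: cos_le|apply: cos_lt => //; [exact: ltW|exact: le_trans hga an0]].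
have sa0 : 0 <= a * sin eta by rewrite ltW // mulr_gt0.
have key : a ^+ 2 * (1 - cos eta ^+ 2) <= d (Phi a (f + tau * (pi / 2 + eta))) (psi f z) ^+ 2 /\
  (0 < z.1 -> a ^+ 2 * (1 - cos eta ^+ 2) < d (Phi a (f + tau * (pi / 2 + eta))) (psi f z) ^+ 2).
  rewrite d2; have n0 := nm_ge0 z; move: (nm z) n0 (cos an) cga cgas => q q0 c c1 c2.
  have a2 : 0 < a ^+ 2 by rewrite exprn_gt0.
  have ce2 : 0 < cos eta ^+ 2 by rewrite exprn_gt0.
  have [c0|c0] := leP c 0.
    have h1 : 0 <= a * q * (- c) by rewrite mulr_ge0 ?mulr_ge0 ?oppr_ge0 // ltW.
    have h2 : 0 < a ^+ 2 * cos eta ^+ 2 by rewrite mulr_gt0.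
    have h3 := sqr_ge0 q.
    by split=> [|_]; rlra.
  have h1 := sqr_ge0 (q - a * c).
  have h2 : c ^+ 2 <= cos eta ^+ 2 by rewrite ler_sqr ?nnegrE // ltW.
  split=> [|z10].
    have h3 : 0 <= a ^+ 2 * (cos eta ^+ 2 - c ^+ 2) by rewrite mulr_ge0 ?subr_ge0 // ltW.
    rlra.
  have h3 : 0 < a ^+ 2 * (cos eta ^+ 2 - c ^+ 2).
    by rewrite mulr_gt0 // subr_gt0 ltr_sqr ?nnegrE ?(ltW c0) ?(ltW ce) // c2.
  rlra.
have e5 : (a * sin eta) ^+ 2 = a ^+ 2 * (1 - cos eta ^+ 2) by rewrite -cs; ring.
case: key => k1 k2; split=> [|z10].
  by rewrite -ler_sqr ?nnegrE ?d_ge0 // e5.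
by rewrite -ltr_sqr ?nnegrE ?d_ge0 // e5 k2.
Qed.

Lemma psi_00 f : psi f (0, 0) = v.
Proof. by rewrite /psi nm00; case: cP. Qed.

Lemma psi_cover f p : pi <= th -> d v p < r ->
  (exists w, [/\ 0 <= w.1, nm w = d v p & psi f w = p]) \/
  (exists a eta tau : R, [/\ 0 < a < r, 0 < eta <= (th - pi) / 2, tau = 1 \/ tau = -1 & p = Phi a (f + tau * (pi / 2 + eta))]).
Proof.
move=> thp hp; have p0 := pi_gt0 R; have thl' := thl.
have [a [h [ha hh hap]]] := cone_near cP thle f hp.
have ad : a = d v p by rewrite -hap (cone_d0 cP thle).
have [a0 ar] := andP ha.
have [az|an0] := eqVneq a 0.
  left; exists (0, 0); rewrite nm00 psi_00 -ad; split => //; apply: deq; by rewrite -ad.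
have ap : 0 < a by rewrite lt_neqAle eq_sym an0.
have [le|gt] := leP `|h - f| (pi / 2).
  left; exists (pol a (h - f)); rewrite nm_pol // -ad; split => //.
    by rewrite mulr_ge0 //; apply: cos_ge0_pihalf; rewrite -ler_norml.
  rewrite /psi nm_pol // arg_polK //; last by rlra.
  by rewrite -hap; congr Phi; ring.
right; exists a, (`|h - f| - pi / 2), (if 0 <= h - f then 1 else -1); split.
- by rewrite ap.
- by apply/andP; split; rlra.
- by case: ifP => _; [left|right].
rewrite -hap; congr Phi; case: ifP => h0.
  by rewrite (ger0_norm h0); ring.
by rewrite ltr0_norm; [ring|rewrite ltNge h0].
Qed.
Lemma vstrand_red t : 1 <= t -> d v (g t) < r -> exists f ep t1 tau : R,
  [/\ vstr f ep t1 tau, nm (ep, t - t1) = d v (g t) & `|f| <= th / 2].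
Proof.
move=> t1 hr; have [f [ep [t2 [tau [[h1 h2 h3 h4] hn]]]]] := vstrand t1 hr.
have [k hk] := near_int f vth0.
exists (f + k%:~R * th), ep, t2, tau; split => //; split => // u hu.
by rewrite psi_per h4.
Qed.

Lemma psi_cont f h z w : nm z < r -> nm w < r -> 0 <= z.1 -> 0 <= w.1 -> `|f - h| <= pi ->
  d (psi f z) (psi h w) <= pd z w + pd (pol (nm w) f) (pol (nm w) h).
Proof.
move=> zr wr z1 w1 hf; apply: le_trans (dtri (psi f w) _ _) _; apply: lerD.
  exact: (psi_le cP thle).
have e : f + arg w - (h + arg w) = f - h by ring.
apply: le_trans (cone_le cP thle (nm_bounds cP thle wr) (nm_bounds cP thle wr) _) _; first by rewrite e.
by rewrite (pd_pol_eq (a' := f) (b' := h) (r' := nm w) (s' := nm w)) // e.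
Qed.

Lemma pd_small (q e : R) : 0 <= q <= 1 -> 0 < e -> exists2 dl, 0 < dl & forall f h : R, `|f - h| < dl -> pd (pol q f) (pol q h) < e.
Proof.
move=> /andP[q0 q1] e0; have [|dl dl0 hd] := cos_near1 (e := e ^+ 2 / 2).
  by rewrite divr_gt0 // exprn_gt0.
exists dl => // f h /hd hc.
rewrite -ltr_sqr ?nnegrE ?pd_ge0 ?(ltW e0) // pd_pol_sqr.
have h1 : q * q <= 1 by apply: mulr_ile1.
have h2 := cos_le1 (f - h).
have h3 : (q * q) * (1 - cos (f - h)) <= 1 - cos (f - h) by rewrite ler_piMl // subr_ge0.
nra.
Qed.

(** The feet of the approximating strands tend to [v] and their rays to a ray [h], so the vertical
    lines tend to the vertical axis: the leaf makes an angle [pi] at [v] on the side from which the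
    strands come. *)
Lemma leaf_vertex ga s : leaf ga -> ga s = v -> pi <= th -> exists h tau : R, [/\ tau = 1 \/ tau = -1,
  (forall x : R, `|x| < r -> ga (s + x) = psi h (0, tau * x)) &
  forall e, 0 < e -> exists f ep t1 ta : R, [/\ vstr f ep t1 ta, ep < e & `|f - h| < e]].
Proof.
move=> [F [uF hF hg]] gv thp; have r0 := vr0; have r8' := r8; have p0 := pi_gt0 R.
pose A t := 1 - s < t /\ d (g (t + s)) v < r.
have hx t : exists q : (R * R) * (R * R), A t ->
   [/\ vstr q.1.1 q.1.2 q.2.1 q.2.2, nm (q.1.2, t + s - q.2.1) = d v (g (t + s)) & `|q.1.1| <= th / 2].
  have [[h1 h2]|h] := EM (A t); last by exists ((0, 0), (0, 0)).
  have t1 : 1 <= t + s by rlra.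
  have [f [ep [t2 [tau h3]]]] := vstrand_red t1 (ltac:(by rewrite dC)).
  by exists ((f, ep), (t2, tau)).
have [q hq] := choice hx.
have hA : F A by apply: uf_and => //; rewrite -gv; apply: hg.
have hAe e : 0 < e -> F (fun t => A t /\ d (g (t + s)) v < e).
  by move=> e0; apply: uf_and => //; rewrite -gv; apply: hg.
have bf : F (fun t => `|(q t).1.1| <= th / 2) by apply: (uf_mono uF (A := A) _ hA) => t /hq[].
have [h [_ hh]] := uf_real uF bf.
have [tau [htau hFt]] : exists tau : R, (tau = 1 \/ tau = -1) /\ F (fun t => (q t).2.2 = tau).
  have : F (fun t => (q t).2.2 = 1 \/ (q t).2.2 = -1) by apply: (uf_mono uF (A := A) _ hA) => t /hq[[]].
  by move/(uf_or uF) => [k|k]; [exists 1|exists (-1)]; split => //; [left|right].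
exists h, tau; split => //.
- move=> x xr; apply: d_lt_eq => e e0.
  have xx : 0 <= `|x| <= 1 by rewrite normr_ge0; rlra.
  have e4 : 0 < e / 4 by rlra.
  have [dl dl0 hdl] := pd_small xx e4.
  have m0 : 0 < Num.min (Num.min (e / 8) ((r - `|x|) / 2)) r.
    by rewrite !lt_min r0 andbT; apply/andP; split; rlra.
  set m := Num.min _ _ in m0.
  have [m1 m2 m3] : [/\ m <= e / 8, m <= (r - `|x|) / 2 & m <= r] by rewrite /m; split; rewrite !ge_min lexx ?orbT.
  have dl1 : 0 < Num.min dl pi by rewrite lt_min dl0.
  have [t [[At dt] [ht [hf hd]]]] := uf_ex uF (uf_and uF (hAe _ m0) (uf_and uF hFt (uf_and uF (hh _ dl1) (hg (s + x) _ e4)))).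
  have [hv hn _] := hq _ At; move: hv hn hf ht; case: (q t) => [[f ep] [t1 ta]] /= hv hn hf ht.
  subst ta; have [ep0 _ _ hs] := hv.
  rewrite dC in dt; rewrite -hn in dt.
  have h1 : ep < m by apply: le_lt_trans dt; apply: le_trans (ler_norm _) _; exact: (nm_fst (ep, _)).
  have h2 : `|t + s - t1| < m by apply: le_lt_trans dt; exact: (nm_snd (ep, _)).
  pose u := x + (t + s - t1).
  have hu : nm (ep, u) < r.
    apply: le_lt_trans (nm_le_sum _) _; rewrite /= (gtr0_norm ep0).
    by have := ler_normD x (t + s - t1); rewrite -/u; rlra.
  have gE : g (t + (s + x)) = psi f (ep, tau * u) by rewrite -hs //; congr g; rewrite /u; ring.
  have nt y : nm (0, tau * y) = `|y|.
    by apply: nm_eq => //=; case: htau => ->; rewrite real_normK ?num_real //; ring.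
  have hu' : nm (ep, tau * u) < r.
    by move: hu; rewrite /nm /= exprMn (_ : tau ^+ 2 = 1) ?mul1r //; case: htau => ->; ring.
  rewrite lt_min in hf; have [hf1 hf2] := andP hf.
  apply: le_lt_trans (dtri (g (t + (s + x))) _ _) _; rewrite (dC (ga _)).
  have h4 := psi_cont (f := f) (h := h) (z := (ep, tau * u)) (w := (0, tau * x)) hu' (ltac:(by rewrite nt)) (ltW ep0) (lexx 0) (ltW hf2).
  have h5 := hdl _ _ hf1; rewrite -[in pol _ _](nt x) -[in pol `|x| _](nt x) in h5.
  rewrite -gE in h4.
  have h6 : pd (ep, tau * u) (0, tau * x) <= ep + `|t + s - t1|.
    apply: le_trans (nm_le_sum _) _; rewrite /= subr0 (gtr0_norm ep0) -mulrBr normrM.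
    rewrite (_ : u - x = t + s - t1); last by rewrite /u; ring.
    by case: htau => ->; rewrite ?normrN normr1 mul1r.
  rlra.
- move=> e e0; have m0 : 0 < Num.min e r by rewrite lt_min e0.
  have [t [[At dt] hf]] := uf_ex uF (uf_and uF (hAe _ m0) (hh _ e0)).
  have [hv hn _] := hq _ At; move: hv hn hf; case: (q t) => [[f ep] [t1 ta]] /= hv hn hf.
  exists f, ep, t1, ta; split => //; have [ep0 _ _ _] := hv.
  rewrite dC -hn lt_min in dt; have [dt1 _] := andP dt.
  apply: le_lt_trans dt1; apply: le_trans (ler_norm _) _; exact: (nm_fst (ep, _)).
Qed.
Section VertexLeaf.
Variables (ga0 : R -> X) (h tau0 : R).
Hypothesis lg0 : leaf ga0.
Hypothesis thp : pi <= th.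
Hypothesis t01 : tau0 = 1 \/ tau0 = -1.
Hypothesis hga0 : forall x : R, `|x| < r -> ga0 x = psi h (0, tau0 * x).

Lemma leaf_radius a (si : R) : 0 < a < r -> si = 1 \/ si = -1 -> exists2 dl, 0 < dl &
  line_at ga0 (tau0 * si * a) (psi (h + si * (pi / 2))) (a, 0) (tau0 * si, 0) dl.
Proof.
move=> /andP[a0 ar] hsi; have t01' := t01; have p0 := pi_gt0 R.
have tt : tau0 * tau0 = 1 by case: t01' => ->; ring.
have ss : si * si = 1 by case: hsi => ->; ring.
have nts : `|tau0 * si| = 1 by rewrite normrM; case: t01' => ->; case: hsi => ->; rewrite ?normrN normr1 ?mulr1.
exists (Num.min a (r - a)); first by rewrite lt_min a0 subr_gt0.
move=> u; rewrite lt_min => /andP[u1 u2].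
pose y := a + tau0 * si * u.
have yu : `|tau0 * si * u| = `|u| by rewrite normrM nts mul1r.
have y0 : 0 < y by have := ler_norm (- (tau0 * si * u)); rewrite normrN yu /y; rlra.
have yr : y < r by have := ler_norm (tau0 * si * u); rewrite yu /y; rlra.
have e1 : tau0 * si * a + u = tau0 * (si * y).
  by rewrite /y; transitivity (tau0 * si * a + (tau0 * tau0) * (si * si) * u); [rewrite tt ss; ring|ring].
have [n1 n2] := arg_axis y0 hsi.
rewrite e1 hga0; last by rewrite normrM normrM; case: t01' => ->; case: hsi => ->; rewrite ?normrN normr1 ?mul1r gtr0_norm.
rewrite mulrA tt mul1r -(psi_rot cP thle h (c := si * (pi / 2))); last 2 first.
- by rewrite n1.
- by rewrite n2 subrr normr0.
congr (psi _ _); rewrite /rotz /mv /= !mulr0 sub0r addr0 add0r cosN sinN.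
rewrite /y; by case: hsi => ->; rewrite ?mulN1r ?mul1r ?cosN ?sinN cos_pihalf sin_pihalf; congr pair; ring.
Qed.

(** A strand sweeps the angles below [B], with [cos B = ep / r], on both sides of its foot. If the
    foot were off the ray [h] by more than [pi / 2 - B], the strand would cross a ray of the leaf;
    the bound by [sin (th / 2)] extends this to feet in the sector behind the leaf. *)
Lemma strand_dir f ep t1 tau : vstr f ep t1 tau -> ep < r * sin (th / 2) ->
  exists (k : int) (dlt : R), [/\ f = h + dlt + k%:~R * th, `|dlt| < pi / 2 & r * `|sin dlt| <= ep].
Proof.
move=> hv hep; have [ep0 _ ht _] := hv; have p0 := pi_gt0 R; have r0 := vr0; have thl' := thl; have thp' := thp.
have th0 := vth0.
have sp : 0 < sin (th / 2) by apply: sin_gt0_pi; apply/andP; split; rlra.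
have s1 := sin_le1 (th / 2).
have er : ep / r < sin (th / 2) by rewrite ltr_pdivrMr // mulrC.
have er0 : 0 < ep / r by rewrite divr_gt0.
pose B := acos (ep / r).
have cB : cos B = ep / r by rewrite acosK // in_itv /=; apply/andP; split; rlra.
have B0 : 0 <= B by apply: acos_ge0; apply/andP; split; rlra.
have Bp : B < pi / 2.
  rewrite ltNge; apply/negP => hB; have : cos B <= cos (pi / 2).
    by apply: cos_le => //; [rlra|apply: acos_lepi; apply/andP; split; rlra].
  rewrite cos_pihalf cB; rlra.
have Bt : th / 2 - pi / 2 < B.
  rewrite ltNge; apply/negP => hB; have : cos (th / 2 - pi / 2) <= cos B by apply: cos_le => //; rlra.
  rewrite cB cosB cos_pihalf sin_pihalf; rlra.
have [k hk] := near_int (f - h) th0.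
pose de := f - h + k%:~R * th; rewrite -/de in hk.
have ef : f = h + de + (- k)%:~R * th by rewrite /de rmorphN /=; ring.
have [hle|hgt] := leP `|de| (pi / 2 - B).
  have hB0 : B != 0.
    apply/eqP => h0; move: cB; rewrite h0 cos0; rlra.
  have Bpos : 0 < B by rewrite lt_neqAle eq_sym hB0.
  exists (- k)%Z, de; split => //; first by rlra.
  rewrite abs_sin; last by rlra.
  have -> : ep = r * cos B by rewrite cB mulrC divfK // gt_eqF.
  rewrite ler_pM2l //.
  by apply: cos_le => //; have := normr_ge0 de; rlra.
exfalso.
have [si [hsi hde]] : exists si : R, (si = 1 \/ si = -1) /\ de = si * `|de|.
  have [d0|d0] := leP 0 de; [exists 1|exists (-1)]; split; [by left|by rewrite ger0_norm // mul1r|by right|by rewrite ltr0_norm //; ring].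
pose b := si * (pi / 2) - de.
have nb : `|b| < B.
  have -> : b = si * (pi / 2 - `|de|) by rewrite /b {1}hde; ring.
  rewrite normrM (_ : `|si| = 1) ?mul1r; last by case: hsi => ->; rewrite ?normrN normr1.
  by rewrite ltr_norml; apply/andP; split; rlra.
have cb : cos B < cos b by rewrite -(cos_norm b); apply: cos_lt => //; rlra.
have cb0 : 0 < cos b by rlra.
have hepb : ep < r * cos b by rewrite mulrC -ltr_pdivrMr // -cB.
have [t2 [dl [t20 dl0 hl]]] := strand_rot hv (lt_trans nb Bp) hepb.
pose a := ep / cos b.
have a0 : 0 < a by rewrite divr_gt0.
have ar : a < r by rewrite /a ltr_pdivrMr.
have [dl' dl'0 hl'] := leaf_radius (a := a) (ltac:(by rewrite a0)) hsi.
have hl2 : line_at g t2 (psi (h + si * (pi / 2))) (a, 0) (rotz (- b) (0, tau)) dl.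
  move=> u hu; rewrite hl // -(psi_per k); congr (psi _ _); rewrite /b /de; ring.
have gd : good (psi (h + si * (pi / 2))) (a, 0).
  by apply: (psi_good cP thle) => //=; rewrite nm_r0 // ltW.
have t01' := t01.
have n1 : nm (tau0 * si, 0) = 1 by apply: nm_eq => //=; case: t01' => ->; case: hsi => ->; ring.
have n2 : nm (rotz (- b) (0, tau)) = 1.
  by rewrite nm_rot; apply: nm_eq => //=; case: ht => ->; ring.
have c1 : ga0 (tau0 * si * a) = psi (h + si * (pi / 2)) (a, 0).
  by have := hl' 0; rewrite normr0 addr0 mv0; apply.
have c2 : g t2 = psi (h + si * (pi / 2)) (a, 0).
  by have := hl2 0; rewrite normr0 addr0 mv0; apply.
have := cross (leaf_tl lg0) (g_tl t20) gd c1 c2 n1 n2 dl'0 dl0 hl' hl2.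
rewrite /rotz /= !mulr0 cosN sinN add0r => -[] [_]; rewrite ?oppr0 => hh.
  have : cos b * tau = 0 by rlra.
  by move/eqP; rewrite mulf_eq0 (gt_eqF cb0) => /eqP; case: ht => ->; rlra.
have : cos b * tau = 0 by rlra.
by move/eqP; rewrite mulf_eq0 (gt_eqF cb0) => /eqP; case: ht => ->; rlra.
Qed.

Lemma strand_frame f ep t1 tau : vstr f ep t1 tau -> ep < r * sin (th / 2) ->
  exists dlt : R, [/\ `|dlt| < pi / 2, r * `|sin dlt| <= ep &
    forall u : R, nm (ep, u) < r -> g (t1 + u) = psi h (rotz dlt (ep, tau * u))].
Proof.
move=> hv hep; have [k [de [h1 h2 h3]]] := strand_dir hv hep.
exists de; split => // u hu; have [ep0 _ _ hs] := hv.
have w1 : 0 < (ep, tau * u).1 by [].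
have haw := arg_pos w1.
rewrite hs // h1 psi_per -(psi_rot cP thle (h + de) (c := - de)).
- by rewrite opprK; congr (psi _ _); ring.
- by apply: nm_gt0; rewrite gt_eqF.
- by rewrite opprK; apply: le_lt_trans (ler_normD _ _) _; rlra.
Qed.

End VertexLeaf.
End Vertex.

(** * Boxes around limit points *)

Hypothesis flV : forall x, ~ V x -> flat x.

Definition Om (b : bool) (z : R * R) := b \/ 0 < z.1.
Definition clO (b : bool) (z : R * R) := b \/ 0 <= z.1.
Lemma Om_clO b z : Om b z -> clO b z.
Proof. by case=> h; [left|right; exact: ltW]. Qed.

(* Around a point [y] of the limit set, [E] charts a disc if [y] is flat, a half disc if [y] is a
   vertex (then [b] is false); the vertical axis is the leaf through [y], and no strand of [g]
   meets the part of the neighbourhood of a vertex left out of the chart. *)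
Record box y E r b : Prop := Box {
  bx_r : 0 < r <= 1 / 8;
  bx_0 : E (0, 0) = y;
  bx_good : forall z, Om b z -> nm z < r -> good E z;
  bx_le : forall z w, clO b z -> clO b w -> nm z < r -> nm w < r -> d (E z) (E w) <= pd z w;
  bx_pd : forall z w, clO b z -> clO b w -> nm z < r -> nm w < r ->
    d (E z) (E w) = pd z w \/ b = false /\ z.1 + w.1 <= d (E z) (E w);
  bx_nm : forall z, clO b z -> nm z < r -> d y (E z) = nm z;
  bx_cov : forall p, d y p < r -> (exists w, [/\ clO b w, nm w = d y p & E w = p]) \/
    (exists u : R, [/\ `|u| < r, d p (E (0, u)) < d y p & forall z, Om b z -> nm z < r -> d p (E (0, u)) < d p (E z)]);
  bx_g : forall t, 1 <= t -> d y (g t) < r -> exists z e dl, [/\ Om b z, nm z = d y (g t) & g t = E z] /\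
    [/\ nm e = 1, 0 < dl, line_at g t E z e dl & `|e.1| <= 4 * `|z.1| / r];
  bx_b : b = false -> V y;
  bx_alt : b = false -> (forall u : R, `|u| < r -> E (0, - u) = E (0, u)) \/
    (forall tau e : R, tau = 1 \/ tau = -1 -> 0 < e -> exists (u a : R) p, [/\ 0 < u < e, 0 < a < e, d y p < e,
      d p (E (0, tau * u)) = a & forall z, clO b z -> nm z < r -> a <= d p (E z)]) }.

(** The chart is turned so that the leaf through [y] is the vertical axis. A strand violating the
    slope bound would reach the axis within [r / 4] and cross the leaf, which is known to be
    straight up to [r0 / 4]; hence [r <= r0 / 8]. *)
Lemma box_flat y (rho : R) : Lim y -> flat y -> 0 < rho -> exists E r, r <= rho /\ box y E r true.
Proof.
move=> Ly [E0 [z0 [[r0 r00 [hi ho]] Ez]]] rho0.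
have [ga0 lg0 g00] := leaf_ex Ly; have [F hF] := lg0.
have g0E0 : ga0 0 = E0 z0 by rewrite g00 Ez.
have [e e1 [hl0 _]] := leaf_strand hF r00 hi ho g0E0.
pose E w := E0 (fr z0 e w).
have fz a : pd (fr z0 e a) z0 = nm a by rewrite -{2}(fr_00 z0 e) pd_fr // pd0.
have iso a b : nm a < r0 -> nm b < r0 -> d (E a) (E b) = pd a b by move=> ha hb; rewrite /E hi ?fz ?pd_fr.
have E00 : E (0, 0) = y by rewrite /E fr_00.
have onto p : d y p < r0 -> exists2 a, nm a < r0 & E a = p.
  rewrite -Ez => /ho[a ha hap]; have [w hw] := fr_onto z0 a e1; exists w; last by rewrite /E hw.
  by rewrite -fz hw.
have Eax (x : R) : `|x| < r0 / 4 -> E (0, x) = ga0 x by move=> hx; rewrite /E fr_0u -hl0 // add0r.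
have gdr w : nm w < r0 / 2 -> good E w.
  move=> hw; exists (r0 / 2); first by rlra.
  have sm a : pd a w < r0 / 2 -> nm a < r0 by move=> ha; have := nm_pd a w; rlra.
  split; first by move=> a b ha hb; apply: iso; exact: sm.
  move=> p hp; have [|a ha hap] := onto p.
    apply: le_lt_trans (dtri (E w) _ _) _; rewrite -E00 iso ?pd0l; [rlra|rewrite nm00; rlra|rlra].
  by exists a => //; rewrite pdC -iso // ?hap //; rlra.
pose r := Num.min (Num.min (r0 / 8) (1 / 8)) rho.
have rr : 0 < r by rewrite !lt_min rho0 andbT; apply/andP; split; rlra.
have [r1 r2 r3] : [/\ r <= r0 / 8, r <= 1 / 8 & r <= rho] by rewrite /r; split; rewrite !ge_min lexx ?orbT.
have iso' a b : nm a < r -> nm b < r -> d (E a) (E b) = pd a b by move=> ha hb; apply: iso; rlra.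
have dy z : nm z < r -> d y (E z) = nm z.
  by move=> hz; rewrite -E00 iso' ?pd0l // nm00.
have cv p : d y p < r -> exists w, [/\ clO true w, nm w = d y p & E w = p].
  move=> hp; have [|a ha hap] := onto p; first by rlra.
  by exists a; split => //; [left|rewrite -hap -E00 iso ?pd0l // nm00].
exists E, r; split => //; split => //.
- by rewrite rr.
- by move=> z _ hz; apply: gdr; rlra.
- by move=> z w _ _ hz hw; rewrite iso'.
- by move=> z w _ _ hz hw; left; rewrite iso'.
- by move=> z _; exact: dy.
- by move=> p /cv; left.
- move=> t t1 ht; have [z [_ nz Egt]] := cv _ ht.
  have t0 : 0 <= t by rlra.
  have hzr : nm z < r by rewrite nz.
  have Oz : nm z < r0 / 2 by rlra.
  have [f f1 [_ hl]] := @line_conv g t E z (fun w => nm w < r0 / 2) Oz (esym Egt) (gl t0) gdr.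
  have hl2 u : `|u| <= r -> exists2 dl, 0 < dl & line_at g (t + u) E (mv z u f) f dl.
    move=> hu; apply: hl => v _ hv; split; first by have := nm_mv z v f1; rlra.
    by apply: lgeo_wgeo; apply: gl; have := ler_norm (- v); rewrite normrN; rlra.
  exists z, f, r; split; first by split => //; left.
  split => //.
    move=> u hu; have [dl dl0 hdl] := hl2 u (ltW hu).
    by have := hdl 0; rewrite normr0 addr0 mv0; apply.
  rewrite leNgt; apply/negP => hst.
  have fn : f.1 != 0.
    by apply/eqP => f0; move: hst; rewrite f0 normr0 ltNge !mulr_ge0 ?invr_ge0 // ltW.
  have fp : 0 < `|f.1| by rewrite normr_gt0.
  pose x0 := - (z.1 / f.1).
  have hx0 : `|x0| < r / 4.
    rewrite normrN normrM normfV ltr_pdivrMr //.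
    move: hst; rewrite ltr_pdivrMr //; rlra.
  have [dl dl0 hdl] := hl2 x0 (ltac:(rlra)).
  pose v := z.2 + x0 * f.2.
  have mvx : mv z x0 f = (0, v) by rewrite /mv /x0 mulNr divfK // subrr.
  have nv : `|v| < r + r / 4.
    have := nm_mv z x0 f1; rewrite mvx => h; have := nm_snd (0, v); rewrite /=; rlra.
  rewrite mvx in hdl.
  have tx0 : 0 < t + x0 by have := ler_norm (- x0); rewrite normrN; rlra.
  have k0 : 0 < r0 / 4 - `|v| by rlra.
  have n01 : nm (0, 1) = 1 :> R by apply: nm_eq => //=; ring.
  have hlv : line_at ga0 v E (0, v) (0, 1) (r0 / 4 - `|v|).
    move=> x hx; rewrite -Eax; last by apply: le_lt_trans (ler_normD _ _) _; rlra.
    by rewrite /mv /= mulr0 mulr1 addr0.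
  have c1 : g (t + x0) = E (0, v) by have := hdl 0; rewrite normr0 addr0 mv0; apply.
  have c2 : ga0 v = E (0, v) by rewrite Eax //; rlra.
  have gv : good E (0, v) by apply: gdr; apply: le_lt_trans (nm_le_sum _) _; rewrite /= normr0; rlra.
  have := cross (g_tl tx0) (leaf_tl lg0) gv c1 c2 f1 n01 dl0 k0 hdl hlv.
  by case=> h1; move/eqP: fn; apply; have := congr1 fst h1 => /=; rlra.
Qed.

Lemma box_vertex y (rho : R) : Lim y -> V y -> 0 < rho -> exists E r, r <= rho /\ box y E r false.
Proof.
move=> Ly Vy rho0; have [th [r0 [Phi [thl cP0]]]] := cV Vy.
have r00 : 0 < r0 by case: cP0.
have thl0 : th <= 2 * pi by exact: ltW.
pose r1 := Num.min (Num.min r0 (1 / 8)) rho.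
have r10 : 0 < r1 by rewrite !lt_min r00 rho0 andbT /=; rlra.
have [r1a r8 r1c] : [/\ r1 <= r0, r1 <= 1 / 8 & r1 <= rho] by rewrite /r1; split; rewrite !ge_min lexx ?orbT.
have cP : cone y th r1 Phi by apply: cone_shrink cP0 => //; rewrite r10.
have thp := theta_ge Vy cP thl r8 Ly; have p0 := pi_gt0 R.
have [ga0 lg0 g00] := leaf_ex Ly.
have [h [tau0 [t01 hga _]]] := leaf_vertex Vy cP thl r8 lg0 g00 thp.
have hga0 x : `|x| < r1 -> ga0 x = psi Phi h (0, tau0 * x) by move=> /hga; rewrite add0r.
have sp : 0 < sin (th / 2) by apply: sin_gt0_pi; apply/andP; split; rlra.
have s1 := sin_le1 (th / 2).
(* The factor [1 / 4] bounds the inclination of a strand, so that its abscissa stays above [ep / 2];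
   the other factor makes [strand_frame] applicable. *)
pose r := r1 * Num.min (1 / 4) (sin (th / 2) / 2).
have m0 : 0 < Num.min (1 / 4) (sin (th / 2) / 2) by rewrite lt_min; apply/andP; split; rlra.
have rr : 0 < r by rewrite mulr_gt0.
have ra : r <= r1 / 4.
  have : r <= r1 * (1 / 4) by rewrite ler_pM2l // ge_min lexx.
  rlra.
have rb : r < r1 * sin (th / 2).
  have : r <= r1 * (sin (th / 2) / 2) by rewrite ler_pM2l // ge_min lexx orbT.
  have : 0 < r1 * sin (th / 2) by rewrite mulr_gt0.
  rlra.
have rlt : r < r1 by rlra.
have nm1 z : nm z < r -> nm z < r1 by rlra.
have cl z : clO false z -> 0 <= z.1 by case.
have om z : Om false z -> 0 < z.1 by case.
exists (psi Phi h), r; split; first by rlra.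
split => //.
- by rewrite rr; rlra.
- exact: (psi_00 Vy cP thl r8).
- by move=> z /om hz /nm1 zr; exact: (psi_good cP thl0).
- by move=> z w /cl hz /cl hw /nm1 zr /nm1 wr; exact: (psi_le cP thl0).
- move=> z w /cl hz /cl hw /nm1 zr /nm1 wr.
  by case: (psi_pd Vy cP thl r8 h thp hz hw zr wr) => k; [left|right].
- by move=> z /cl hz /nm1 zr; exact: (psi_d cP thl0).
- move=> p hp.
  have [[w [w1 w2 w3]]|[a [eta [tau [ha heta ht hpe]]]]] := psi_cover Vy cP thl r8 h thp (lt_trans hp rlt).
    by left; exists w; split => //; right.
  right; have [k1 k2] := psi_out Vy cP thl r8 h ha heta ht.
  have [a0 ar] := andP ha.
  have ad : d y p = a by rewrite hpe (cone_d0 cP thl0) // ar ltW.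
  have ce : 0 < cos eta by apply: cos_gt0_pihalf; apply/andP; split; rlra.
  exists (tau * (a * cos eta)); split.
    rewrite normrM (_ : `|tau| = 1) ?mul1r; last by case: ht => ->; rewrite ?normrN normr1.
    rewrite gtr0_norm ?mulr_gt0 //; apply: le_lt_trans hp; rewrite ad ger_pMr //; exact: cos_le1.
    rewrite {1}hpe k1 ad gtr_pMr //; have := cos2Dsin2 eta.
    have ce2 : 0 < cos eta ^+ 2 by rewrite exprn_gt0.
    have := sin_le1 eta => h1 h2; rewrite lt_neqAle h1 andbT; apply/eqP => h3; move: h2; rewrite h3; rlra.
  move=> z /om z1 /nm1 zr; rewrite hpe k1.
  by have [_] := k2 z (ltW z1) zr; apply.
- move=> t t1 ht.
  have [f [ep [t2 [tau [hv hn]]]]] := vstrand Vy cP thl r8 t1 (lt_trans ht rlt).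
  have [ep0 _ htau _] := hv.
  rewrite -hn in ht *; pose u := t - t2; rewrite -/u in ht *.
  have epr : ep < r by apply: le_lt_trans ht; apply: le_trans (ler_norm _) _; exact: (nm_fst (ep, _)).
  have ur : `|u| < r by apply: le_lt_trans ht; exact: (nm_snd (ep, u)).
  have [de [d1 d2 d3]] := strand_frame Vy cP thl r8 lg0 thp t01 hga0 hv (lt_trans epr rb).
  have cd0 : 0 < cos de by apply: cos_gt0_pihalf; rewrite -ltr_norml.
  have csd := cos2Dsin2 de.
  have tn : `|tau| = 1 by case: htau => ->; rewrite ?normrN normr1.
  have q1 : r1 * `|sin de| <= r1 * (1 / 4) by rlra.
  have q2 : `|sin de| <= 1 / 4 by rewrite ler_pM2l // in q1.
  have q3 : 3 / 4 <= cos de.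
    have : `|sin de| ^+ 2 <= (1 / 4) ^+ 2 by rewrite ler_sqr ?nnegrE //; rlra.
    rewrite real_normK ?num_real // => q4.
    by rewrite -ler_sqr ?nnegrE ?(ltW cd0) //; rlra.
  have tus : `|tau * u * sin de| <= ep / 4.
    rewrite normrM normrM tn mul1r.
    have : `|u| * `|sin de| <= (r1 / 4) * `|sin de| by rewrite ler_wpM2r //; rlra.
    rlra.
  have hz1 : ep / 2 <= (rotz de (ep, tau * u)).1.
    rewrite /rotz /=; have : ep * (3 / 4) <= ep * cos de by rewrite ler_pM2l.
    have := ler_norm (tau * u * sin de); rlra.
  exists (rotz de (ep, tau * u)), (rotz de (0, tau)), (r1 - nm (ep, u)); split.
    split; first by right; rlra.
      by rewrite nm_rot /nm /= exprMn (_ : tau ^+ 2 = 1) ?mul1r //; case: htau => ->; ring.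
    by rewrite -d3; [congr g; rewrite /u; ring|rlra].
  split.
  + by rewrite nm_rot; apply: nm_eq => //=; case: htau => ->; ring.
  + rlra.
  + move=> x hx; rewrite (_ : t + x = t2 + (u + x)); last by rewrite /u; ring.
    rewrite d3; first by congr (psi _ _); rewrite /rotz /mv /=; congr pair; ring.
    have -> : (ep, u + x) = mv (ep, u) x (0, 1) by rewrite /mv /= mulr0 mulr1 addr0.
    apply: le_lt_trans (nm_mv _ _ _) _; first by apply: nm_eq => //=; ring.
    rlra.
  + have -> : `|(rotz de (0, tau)).1| = `|sin de|.
      by rewrite /rotz /= mulr0 sub0r normrN normrM tn mulr1.
    move: hz1; set Z := (rotz de _).1 => hz1.
    have Z0 : 0 <= Z by rlra.
    rewrite ler_pdivlMr // (ger0_norm Z0).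
    have : `|sin de| * r <= `|sin de| * r1 by rewrite ler_wpM2l //; rlra.
    rlra.
(* For [th = pi] the two boundary rays of the half disc coincide and the leaf turns back on itself.
   For [th > pi] the points of the bisector of the left-out sector are centres of balls tangent to
   either boundary ray. *)
- move=> _; have [hth|hth] := eqVneq th pi.
    left => u ur; have [u0|u0] := eqVneq u 0; first by rewrite u0 oppr0.
    have per f z : psi Phi (f + th) z = psi Phi f z by have := psi_per Vy cP thl r8 1 f z; rewrite mul1r.
    have key (y' : R) : 0 < y' -> psi Phi h (0, - y') = psi Phi h (0, y').
      move=> y0; have [n1 n2] := arg_axis Vy cP thl r8 y0 (or_introl erefl).
      have [n3 n4] := arg_axis Vy cP thl r8 y0 (or_intror erefl).
      rewrite mul1r in n1 n2; rewrite mulN1r in n3 n4.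
      rewrite -(per h (0, - y')) /psi n1 n2 n3 n4 hth; congr Phi; rlra.
    have [uneg|upos] := ltP u 0; first by have := key (- u); rewrite opprK => <- //; rlra.
    by apply: key; rewrite lt_neqAle eq_sym u0.
  right => tau e ht e0.
  have thp' : pi < th by rewrite lt_neqAle eq_sym hth.
  pose a := Num.min (r1 / 2) (e / 2).
  have a0 : 0 < a by rewrite lt_min; apply/andP; split; rlra.
  have [a1 a2] : a <= r1 / 2 /\ a <= e / 2 by split; rewrite /a ge_min lexx ?orbT.
  pose eta := (th - pi) / 2.
  have heta : 0 < eta <= (th - pi) / 2 by rewrite lexx andbT /eta; rlra.
  have [eta0 _] := andP heta.
  have ce : 0 < cos eta by apply: cos_gt0_pihalf; apply/andP; split; rewrite /eta; rlra.
  have se : 0 < sin eta by apply: sin_gt0_pi; apply/andP; split; rewrite /eta; rlra.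
  have ce1 := cos_le1 eta; have se1 := sin_le1 eta.
  have har : 0 < a < r1 by rewrite a0; rlra.
  have [k1 k2] := psi_out Vy cP thl r8 h har heta ht.
  have k3 : a * cos eta <= a by rewrite ger_pMr.
  have k4 : a * sin eta <= a by rewrite ger_pMr.
  exists (a * cos eta), (a * sin eta), (Phi a (h + tau * (pi / 2 + eta))); split => //.
  + by rewrite mulr_gt0 //; rlra.
  + by rewrite mulr_gt0 //; rlra.
  + by rewrite (cone_d0 cP thl0); [rlra|apply/andP; split; rlra].
  + by move=> z /cl hz /nm1 zr; have [] := k2 z hz zr.
Qed.

Lemma box_ex y (rho : R) : Lim y -> 0 < rho -> exists E r b, r <= rho /\ box y E r b.
Proof.
move=> Ly rho0; have [Vy|nVy] := EM (V y).
  by have [E [r h]] := box_vertex Ly Vy rho0; exists E, r, false.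
by have [E [r h]] := box_flat Ly (flV nVy) rho0; exists E, r, true.
Qed.
(** * Invariant subsets of the limit set *)

Section Sequences.

Lemma cluster (f : nat -> X) : exists p, forall e : R, 0 < e -> forall N : nat, exists n : nat, (N <= n)%N /\ d (f n) p < e.
Proof.
have [F [uF sF]] := @ultraFilterLemma _ (\oo%classic : set_system nat) _.
have [p hp] := cpt uF f.
exists p => e e0 N.
have hN : F (fun n : nat => (N <= n)%N) by apply: sF; exists N.
by have [n [h1 h2]] := uf_ex uF (uf_and uF hN (hp e e0)); exists n.
Qed.

Lemma small_inv (e : R) : 0 < e -> exists N : nat, forall n : nat, (N <= n)%N -> n.+1%:R^-1 < e.
Proof.
move=> e0; exists (Num.bound e^-1) => n hn.
rewrite -[e]invrK ltf_pV2 ?posrE ?invr_gt0 //.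
apply: lt_le_trans (archi_boundP _) _; first by rewrite ltW // invr_gt0.
by rewrite ler_nat ltnW.
Qed.

Variable K : X -> Prop.
Hypothesis Kcl : forall p, (forall e : R, 0 < e -> exists q, K q /\ d p q < e) -> K p.

Lemma nearest q0 p : K q0 -> exists q, K q /\ forall q', K q' -> d p q <= d p q'.
Proof.
move=> Kq0; pose A := [set x : R | exists q, K q /\ d p q = x].
have hA : has_inf A.
  by split; [exists (d p q0), q0|exists 0 => x [q [_ <-]]; exact: d_ge0].
have hn (n : nat) : exists q, K q /\ d p q < inf A + n.+1%:R^-1.
  have n0 : 0 < n.+1%:R^-1 :> R by rewrite invr_gt0.
  by have [x [q [Kq <-]] hx] := inf_adherent n0 hA; exists q.
have [f hf] := choice hn.
have [q hq] := cluster f.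
exists q; split.
  by apply: Kcl => e e0; have [n [_ h]] := hq e e0 0%N; exists (f n); split; [case: (hf n)|rewrite dC].
move=> q' Kq'; rewrite leNgt; apply/negP => hlt.
have e0 : 0 < (d p q - d p q') / 2 by rewrite divr_gt0 // subr_gt0.
have [N hN] := small_inv e0.
have [n [Nn hd]] := hq _ e0 N.
have [_ h1] := hf n; have h2 := hN n Nn.
have h3 : inf A <= d p q' by apply: ge_inf; [case: hA|exists q'].
by move: h1 h2 hd (dtri (f n) p q); set x := _^-1 => h1 h2 h4 h5; rlra.
Qed.

(** A Lebesgue number for the balls of radius [r y]; it also bounds below the radius of the ball
    that is used. *)
Lemma lebesgue (r : X -> R) : (forall y, K y -> 0 < r y) ->
  exists2 rho : R, 0 < rho & forall q, K q -> exists y, [/\ K y, d y q < r y & rho <= r y].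
Proof.
move=> r0; have [//|hn] := EM (exists2 rho : R, 0 < rho & forall q, K q -> exists y, [/\ K y, d y q < r y & rho <= r y]).
have hx (n : nat) : exists q, K q /\ forall y, K y -> d y q < r y -> r y < n.+1%:R^-1.
  have [//|h] := EM (exists q, K q /\ forall y, K y -> d y q < r y -> r y < n.+1%:R^-1).
  exfalso; apply: hn; exists (n.+1%:R^-1); first by rewrite invr_gt0.
  move=> q Kq; have [//|h2] := EM (exists y, [/\ K y, d y q < r y & n.+1%:R^-1 <= r y]).
  exfalso; apply: h; exists q; split => // y Ky hy; rewrite ltNge; apply/negP => h3.
  by apply: h2; exists y.
have [f hf] := choice hx; have [q hq] := cluster f.
have Kq : K q.
  by apply: Kcl => e e0; have [n [_ h]] := hq e e0 0%N; exists (f n); split; [case: (hf n)|rewrite dC].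
have [N hN] := small_inv (r0 q Kq).
have [n [Nn hd]] := hq _ (r0 q Kq) N.
have [_ h1] := hf n; rewrite dC in hd; by have := lt_trans (h1 q Kq hd) (hN n Nn); rewrite ltxx.
Qed.

End Sequences.

(** Where [F] is small it is bounded above by affine functions, as a concave function is. A negative
    slope would persist and drive [F] below zero, so [F] does not decrease while small; having
    arbitrarily small values arbitrarily late, it must have been zero before. *)
Lemma conc_zero (F : R -> R) (T dl eta : R) : 0 < dl -> 0 < eta ->
  (forall t, T <= t -> 0 <= F t) ->
  (forall t, T + dl <= t -> F t < eta -> exists m : R, forall x : R, `|x| <= dl -> F (t + x) <= F t + m * x) ->
  (forall e T' : R, 0 < e -> exists t, T' < t /\ F t < e) ->
  forall t, T + dl <= t -> F t = 0.
Proof.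
move=> dl0 eta0 F0 hF hl.
have dd : `|dl| <= dl by rewrite gtr0_norm.
have md : `|- dl| <= dl by rewrite normrN.
(* The bounds at two points at distance [dl], each evaluated at the other, show that slopes
   decrease; so a negative slope is inherited at every further step. *)
have claim t m : T + dl <= t -> F t < eta -> (forall x : R, `|x| <= dl -> F (t + x) <= F t + m * x) -> 0 <= m.
  move=> tT Ft hm; rewrite leNgt; apply/negP => m0.
  have H (n : nat) : F (t + n%:R * dl) <= F t + n%:R * (m * dl) /\
      exists m', m' <= m /\ forall x : R, `|x| <= dl -> F (t + n%:R * dl + x) <= F (t + n%:R * dl) + m' * x.
    elim: n => [|n [IH [m' [m'm hm']]]].
      by rewrite !mul0r !addr0; split => //; exists m.
    have n0 : 0 <= n%:R * dl by rewrite mulr_ge0 // ltW.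
    have mdl : m * dl < 0 by rewrite nmulr_rlt0.
    have nm0 : n%:R * (m * dl) <= 0 by rewrite mulr_ge0_le0 // ltW.
    have e1 : t + n.+1%:R * dl = t + n%:R * dl + dl by rewrite -natr1; ring.
    have h1 := hm' _ dd.
    have h2 : m' * dl <= m * dl by rewrite ler_pM2r.
    have h3 : F (t + n%:R * dl + dl) <= F t + n.+1%:R * (m * dl) by rewrite -natr1; rlra.
    rewrite e1; split => //.
    have [||m2 hm2] := hF (t + n%:R * dl + dl).
    - rlra.
    - rewrite -natr1 in h3; rlra.
    exists m2; split => //.
    have := hm2 _ md; rewrite addrK => h4.
    have : m2 * dl <= m' * dl by rlra.
    rewrite ler_pM2r // => h5; rlra.
  have mdl : 0 < - (m * dl) by rewrite oppr_gt0 nmulr_rlt0.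
  have Ft0 : 0 <= F t by apply: F0; rlra.
  have := archi_boundP (divr_ge0 Ft0 (ltW mdl)); set n := Num.bound _ => hn.
  rewrite ltr_pdivrMr // in hn.
  have [h1 _] := H n.
  have n0 : 0 <= n%:R * dl by rewrite mulr_ge0 // ltW.
  have : 0 <= F (t + n%:R * dl) by apply: F0; rlra.
  rlra.
move=> t0 t0T; apply/eqP; rewrite eq_le F0 ?andbT; last by rlra.
rewrite leNgt; apply/negP => hpos.
have [|t [t0t Ft]] := hl (Num.min eta (F t0)) t0; first by rewrite lt_min eta0.
rewrite lt_min in Ft; have [Ft1 Ft2] := andP Ft.
have q0 : 0 <= (t - t0) / dl by rewrite divr_ge0 // ltW // subr_gt0.
have := archi_boundP q0; set n := Num.bound _ => hn.
rewrite ltr_pdivrMr // in hn.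
have n0 : 0 < n%:R :> R by rewrite ltr0n lt0n; apply/eqP => n0; move: hn; rewrite n0 mul0r; rlra.
(* Equal steps of length at most [dl] lead back from [t] to [t0]; on the way [F] never exceeds
   [F t], hence stays below [eta]. *)
pose x := (t - t0) / n%:R.
have x0 : 0 < x by rewrite divr_gt0 // subr_gt0.
have xd : x <= dl by rewrite /x ler_pdivrMr // mulrC ltW.
have H (k : nat) : (k <= n)%N -> F (t - k%:R * x) <= F t.
  elim: k => [|k IH] kn; first by rewrite mul0r subr0.
  have h1 := IH (ltnW kn).
  have kx : k.+1%:R * x <= t - t0.
    have -> : t - t0 = n%:R * x by rewrite /x mulrC divfK // gt_eqF.
    by rewrite ler_pM2r // ler_nat.
  rewrite -natr1 in kx *.
  have Tk : T + dl <= t - k%:R * x by rlra.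
  have Fk : F (t - k%:R * x) < eta by rlra.
  have [m hm] := hF _ Tk Fk.
  have m0 := claim _ _ Tk Fk hm.
  have := hm (- x) (ltac:(by rewrite normrN gtr0_norm)).
  have : 0 <= m * x by rewrite mulr_ge0 // ltW.
  rewrite (_ : t - k%:R * x - x = t - (k%:R + 1) * x); last by ring.
  rlra.
have := H n (leqnn n).
have -> : t - n%:R * x = t0 by rewrite /x mulrC divfK ?gt_eqF //; ring.
rlra.
Qed.

(** * Segments of strands and leaves in a box *)

Section BoxLines.
Variables (y : X) (E : R * R -> X) (r : R) (b : bool).
Hypothesis bx : box y E r b.

Lemma box_gt0 : 0 < r /\ r <= 1 / 8. Proof. by case: bx => /andP. Qed.

Lemma box_inj z w : clO b z -> clO b w -> nm z < r -> nm w < r -> E z = E w -> Om b z -> w = z.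
Proof.
move=> cz cw zr wr e oz; apply: pd_eq0; rewrite pdC.
case: (bx_pd bx cz cw zr wr) => [<-|[hb h]]; first by rewrite e dxx.
rewrite e dxx in h; rewrite hb in oz cw.
by case: cw => // w1; case: oz => // z1; rlra.
Qed.

(** The purpose of the constant 4 in the slope bound: within [r / 4] the abscissa changes by at most
    its own amount, so a segment does not pass to the other side of the axis. *)
Lemma steep_half z x e : nm z < r / 4 -> nm e = 1 -> `|e.1| <= 4 * `|z.1| / r -> `|x| < r / 4 -> `|x * e.1| <= `|z.1|.
Proof.
move=> zr e1 st xr; have [r0 _] := box_gt0.
rewrite normrM; apply: (le_trans (y := r / 4 * (4 * `|z.1| / r))); first by apply: ler_pM => //; exact: ltW.
by rewrite (_ : r / 4 * (4 * `|z.1| / r) = `|z.1|) //; field; rewrite gt_eqF.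
Qed.

Lemma steep_half' z x e : nm z < r / 4 -> nm e = 1 -> `|e.1| <= 4 * `|z.1| / r -> `|x| < r / 4 -> 0 < z.1 -> `|x * e.1| < z.1.
Proof.
move=> zr e1 st xr z0; have [r0 _] := box_gt0; rewrite (gtr0_norm z0) in st.
have [-> |en] := eqVneq e.1 0; first by rewrite mulr0 normr0.
rewrite normrM; apply: (lt_le_trans (y := r / 4 * `|e.1|)); first by rewrite ltr_pM2r // normr_gt0.
apply: (le_trans (y := r / 4 * (4 * z.1 / r))); first by rewrite ler_pM2l //; rlra.
by rewrite (_ : r / 4 * (4 * z.1 / r) = z.1) //; field; rewrite gt_eqF.
Qed.

Lemma clO_mv z x e : clO b z -> nm z < r / 4 -> nm e = 1 -> `|e.1| <= 4 * `|z.1| / r -> `|x| < r / 4 ->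
  clO b (mv z x e) /\ nm (mv z x e) < r / 2.
Proof.
move=> cz zr e1 st xr; split; last by have := nm_mv z x e1; rlra.
case: cz => [->|z0]; first by left.
have := steep_half zr e1 st xr; have := ler_norm (- (x * e.1)); rewrite normrN (ger0_norm z0) => h1 h2.
by right; rewrite /mv /=; rlra.
Qed.

Lemma Om_mv z x e : Om b z -> nm z < r / 4 -> nm e = 1 -> `|e.1| <= 4 * `|z.1| / r -> `|x| < r / 4 ->
  Om b (mv z x e).
Proof.
move=> oz zr e1 st xr.
case: oz => [->|z0]; first by left.
have := steep_half' zr e1 st xr z0; have := ler_norm (- (x * e.1)); rewrite normrN => h1 h2.
by right; rewrite /mv /=; rlra.
Qed.

(** The slope bound keeps the line where all points are good, so the germ given by [bx_g] continues
    over the fixed length [r / 4]. *)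
Lemma box_strand t : 1 <= t -> d y (g t) < r / 4 -> exists z e,
  [/\ Om b z, nm z = d y (g t), nm e = 1 & `|e.1| <= 4 * `|z.1| / r] /\
  forall x : R, `|x| < r / 4 -> g (t + x) = E (mv z x e).
Proof.
move=> t1 ht; have [r0 r8] := box_gt0.
have ht' : d y (g t) < r by rlra.
have [z [e [dl [[oz nz Eg] [e1 dl0 hl st]]]]] := bx_g bx t1 ht'.
exists z, e; split => // x xr; have zr : nm z < r / 4 by rewrite nz.
have gE u : `|u| < r / 4 -> good E (mv z u e).
  move=> ur; apply: (bx_good bx); first exact: Om_mv.
  by have [_ h] := clO_mv (Om_clO oz) zr e1 st ur; rlra.
have gw u : `|u| < r / 4 -> wgeo g (t + u).
  move=> ur; apply: lgeo_wgeo; apply: gl; have := ler_norm (- u); rewrite normrN; rlra.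
have [x0|x0] := leP 0 x.
  have [|||dl' dl'0 hl'] := @line_fwd g t E z e x dl x0 dl0 e1 hl _ _ x; rewrite ?x0 ?lexx //.
  - by move=> u /andP[u0 ux]; apply: gE; rewrite ger0_norm //; rewrite ger0_norm // in xr; rlra.
  - by move=> u /andP[u0 ux]; apply: gw; rewrite ger0_norm //; rewrite ger0_norm // in xr; rlra.
  by have := hl' 0; rewrite normr0 addr0 mv0; apply.
have mx0 : 0 <= - x by rlra.
rewrite ltr0_norm // in xr.
have [|||dl' dl'0 hl'] := @line_bwd g t E z e (- x) dl mx0 dl0 e1 hl _ _ (- x); rewrite ?mx0 ?lexx //.
- by move=> u /andP[u0 ux]; apply: gE; rewrite normrN ger0_norm //; rlra.
- by move=> u /andP[u0 ux]; apply: gw; rewrite normrN ger0_norm //; rlra.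
by have := hl' 0; rewrite normr0 addr0 mv0 !opprK; apply.
Qed.

(** Position, direction and slope bound of [box_strand] pass to the limit, except that [z] may end
    up on the axis: hence [clO] in place of [Om]. *)
Lemma box_leaf ga s : leaf ga -> d y (ga s) < r / 4 -> exists z e,
  [/\ clO b z, nm z = d y (ga s), nm e = 1 & `|e.1| <= 4 * `|z.1| / r] /\
  forall x : R, `|x| < r / 4 -> ga (s + x) = E (mv z x e).
Proof.
move=> lg hs; have [r0 r8] := box_gt0; have [F [uF hF hg]] := lg.
pose A t := 1 - s < t /\ d y (g (t + s)) < r / 4.
have hA : F A.
  have m0 : 0 < r / 4 - d y (ga s) by rewrite subr_gt0.
  apply: (uf_mono uF _ (uf_and uF (hF (1 - s)) (hg s _ m0))) => t [h1 h2]; split => //.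
  by apply: le_lt_trans (dtri (ga s) _ _) _; rewrite (dC (ga s)); rlra.
have hx t : exists q : (R * R) * (R * R), A t ->
   [/\ Om b q.1, nm q.1 = d y (g (t + s)), nm q.2 = 1 & `|q.2.1| <= 4 * `|q.1.1| / r] /\
   forall x : R, `|x| < r / 4 -> g (t + s + x) = E (mv q.1 x q.2).
  have [[h1 h2]|h] := EM (A t); last by exists ((0, 0), (0, 0)).
  have t1 : 1 <= t + s by rlra.
  by have [z [e h3]] := box_strand t1 h2; exists (z, e).
have [q hq] := choice hx.
have b1 : F (fun t => `|(q t).1.1| <= r / 4).
  by apply: (uf_mono uF _ hA) => t At; have [[_ h _ _] _] := hq _ At; have := nm_fst (q t).1; case: At => _; rlra.
have b2 : F (fun t => `|(q t).1.2| <= r / 4).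
  by apply: (uf_mono uF _ hA) => t At; have [[_ h _ _] _] := hq _ At; have := nm_snd (q t).1; case: At => _; rlra.
have b3 : F (fun t => `|(q t).2.1| <= 1).
  by apply: (uf_mono uF _ hA) => t At; have [[_ _ <- _] _] := hq _ At; exact: nm_fst.
have b4 : F (fun t => `|(q t).2.2| <= 1).
  by apply: (uf_mono uF _ hA) => t At; have [[_ _ <- _] _] := hq _ At; exact: nm_snd.
have [z1 [_ l1]] := uf_real uF b1; have [z2 [_ l2]] := uf_real uF b2.
have [e1 [_ l3]] := uf_real uF b3; have [e2 [_ l4]] := uf_real uF b4.
pose z := (z1, z2); pose e := (e1, e2).
have near ep : 0 < ep -> exists t, [/\ A t, pd (q t).1 z < ep, pd (q t).2 e < ep & d (g (t + s)) (ga s) < ep].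
  move=> ep0; have ep2 : 0 < ep / 2 by rlra.
  have [t [At [[k1 k2] [[k3 k4] k5]]]] := uf_ex uF (uf_and uF hA (uf_and uF (uf_and uF (l1 _ ep2) (l2 _ ep2))
    (uf_and uF (uf_and uF (l3 _ ep2) (l4 _ ep2)) (hg s _ ep0)))).
  exists t; split => //.
    by apply: le_lt_trans (nm_le_sum _) _ => /=; rlra.
  by apply: le_lt_trans (nm_le_sum _) _ => /=; rlra.
have nearx ep x : 0 < ep -> exists t, [/\ A t, pd (q t).1 z < ep, pd (q t).2 e < ep & d (g (t + s + x)) (ga (s + x)) < ep].
  move=> ep0; have ep2 : 0 < ep / 2 by rlra.
  have [t [At [[k1 k2] [[k3 k4] k5]]]] := uf_ex uF (uf_and uF hA (uf_and uF (uf_and uF (l1 _ ep2) (l2 _ ep2))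
    (uf_and uF (uf_and uF (l3 _ ep2) (l4 _ ep2)) (hg (s + x) _ ep0)))).
  exists t; split => //; last by rewrite -addrA.
    by apply: le_lt_trans (nm_le_sum _) _ => /=; rlra.
  by apply: le_lt_trans (nm_le_sum _) _ => /=; rlra.
have eqlim (x x' : R) : (forall ep, 0 < ep -> `|x - x'| < ep) -> x = x'.
  move=> h; apply/eqP; rewrite -subr_eq0 -normr_le0 leNgt; apply/negP => h0.
  by have := h _ h0; rewrite ltxx.
have nz : nm z = d y (ga s).
  apply: eqlim => ep ep0; have ep2 : 0 < ep / 2 by rlra.
  have [t [At k1 _ k2]] := near _ ep2.
  have [[_ h _ _] _] := hq _ At.
  have k3 := nm_pd z (q t).1; have k4 := nm_pd (q t).1 z; rewrite (pdC z) in k3.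
  have k5 := dtri (ga s) y (g (t + s)); have k6 := dtri (g (t + s)) y (ga s); rewrite (dC (ga s)) in k5.
  by rewrite ltr_norml; apply/andP; split; rlra.
have ne : nm e = 1.
  apply: eqlim => ep ep0; have [t [At _ k1 _]] := near _ ep0.
  have [[_ _ h _] _] := hq _ At.
  have k3 := nm_pd e (q t).2; have k4 := nm_pd (q t).2 e; rewrite (pdC e) in k3.
  by rewrite ltr_norml; apply/andP; split; rlra.
have cz : clO b z.
  have [hb|hb] := EM b; [by left|right]; rewrite leNgt; apply/negP => h.
  have h0 : 0 < - z.1 by rewrite oppr_gt0.
  have [t [At k1 _ _]] := near _ h0.
  have [[[//|h2] _ _ _] _] := hq _ At.
  have := pd_fst (q t).1 z; have := ler_norm ((q t).1.1 - z.1); rlra.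
have st : `|e.1| <= 4 * `|z.1| / r.
  rewrite leNgt; apply/negP => h.
  pose ga' := `|e.1| - 4 * `|z.1| / r.
  have ga0 : 0 < ga' by rewrite subr_gt0.
  have m0 : 0 < Num.min (ga' / 4) (ga' * r / 16) by rewrite lt_min !divr_gt0 ?mulr_gt0.
  have [t [At k1 k2 _]] := near _ m0.
  rewrite !lt_min in k1 k2; have [_ k1'] := andP k1; have [k2' _] := andP k2.
  have [[_ _ _ h3] _] := hq _ At.
  have h4 := le_lt_trans (pd_fst (q t).1 z) k1'; have h5 := le_lt_trans (pd_fst (q t).2 e) k2'.
  have h6 : `|(q t).1.1| <= `|z.1| + ga' * r / 16 by have := ler_normD ((q t).1.1 - z.1) z.1; rewrite subrK; rlra.
  have h7 : `|e.1| <= `|(q t).2.1| + ga' / 4.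
    by have := ler_normB (q t).2.1 ((q t).2.1 - e.1); rewrite opprB addrC subrK; rlra.
  have h8 : 4 * `|(q t).1.1| / r <= 4 * `|z.1| / r + ga' / 4.
    rewrite ler_pdivrMr // (_ : (4 * `|z.1| / r + ga' / 4) * r = 4 * `|z.1| + ga' * r / 4); first by rlra.
    by field; rewrite gt_eqF.
  rewrite /ga' in h6 h7 h8 *; rlra.
exists z, e; split => // x xr.
have zr : nm z < r / 4 by rewrite nz.
have [c1 c2] := clO_mv cz zr ne st xr.
apply: d_lt_eq => ep ep0; have ep4 : 0 < ep / 4 by rlra.
have [t [At k1 k2 k3]] := nearx _ x ep4.
have [[om1 h1 h2 h3] h4] := hq _ At.
have qr : nm (q t).1 < r / 4 by rewrite h1; case: At.
have [c3 c4] := clO_mv (Om_clO om1) qr h2 h3 xr.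
apply: le_lt_trans (dtri (g (t + s + x)) _ _) _; rewrite (dC (ga _)) h4 //.
rewrite h4 // in k3.
have c4' : nm (mv (q t).1 x (q t).2) < r by rlra.
have c2' : nm (mv z x e) < r by rlra.
have k5 := bx_le bx c3 c1 c4' c2'.
have k6 := pd_mv_mv (q t).1 z x (q t).2 e.
have k7 : `|x| * pd (q t).2 e <= 1 * (ep / 4).
  by apply: ler_pM => //; [exact: pd_ge0|rlra|exact: ltW].
rlra.
Qed.

End BoxLines.
(** At abscissa zero the slope bound leaves only the vertical direction. *)
Lemma box_center y E r b ga s : box y E r b -> leaf ga -> ga s = y -> exists tau : R, (tau = 1 \/ tau = -1) /\
  forall x : R, `|x| < r / 4 -> ga (s + x) = E (0, tau * x).
Proof.
move=> bx lg gs0; have [r0 _] := box_gt0 bx.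
have hs : d y (ga s) < r / 4 by rewrite gs0 dxx; rlra.
have [z [e [[cz nz e1 st] hx]]] := box_leaf bx lg hs.
have z0 : z = (0, 0) by apply: nm0; rewrite nz gs0 dxx.
have e0 : e.1 = 0.
  by apply/eqP; rewrite -normr_eq0 eq_le normr_ge0 andbT; move: st; rewrite z0 /= normr0 mulr0 mul0r.
have e2 : e.2 = 1 \/ e.2 = -1.
  by move/nm_eq1/eqP: e1; rewrite e0 expr0n add0r sqrf_eq1 => /orP[] /eqP ->; [left|right].
exists e.2; split => // x xr; rewrite hx //; congr E.
by rewrite z0 /mv /= e0 mulr0 !add0r mulrC.
Qed.

Lemma box_axis y E r b : box y E r b -> Lim y -> exists ga (tau : R), [/\ leaf ga, ga 0 = y, tau = 1 \/ tau = -1 &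
  forall x : R, `|x| < r / 4 -> ga x = E (0, tau * x)].
Proof.
move=> bx Ly; have [ga lg g0] := leaf_ex Ly; have [tau [ht hx]] := box_center bx lg g0.
by exists ga, tau; split => // x /hx; rewrite add0r.
Qed.

Section Invariant.
Variables (K : X -> Prop) (q0 : X).
Hypothesis KL : forall p, K p -> Lim p.
Hypothesis Kcl : forall p, (forall e : R, 0 < e -> exists q, K q /\ d p q < e) -> K p.
Hypothesis Kinv : forall ga s s', leaf ga -> K (ga s) -> K (ga s').

(** The factor 64 leaves room: points at distance of order [rho] from [q] are still well inside the
    part of the box where strands and leaves are straight. *)
Lemma box_cover (rmax : R) : 0 < rmax -> exists2 rho : R, 0 < rho & forall q, K q -> exists y E r b,
  [/\ K y, box y E r b, d y q < r / 64, 64 * rho <= r & r <= rmax].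
Proof.
move=> rm0; have hx y : exists r : R, K y -> 0 < r /\ exists E b, 64 * r <= rmax /\ box y E (64 * r) b.
  have [Ky|nK] := EM (K y); last by exists 0.
  have [E [r [b [rr bx]]]] := box_ex (KL Ky) rm0.
  have [r0 _] := box_gt0 bx.
  exists (r / 64) => _; split; first by rlra.
  by exists E, b; rewrite mulrC divfK.
have [r hr] := choice hx.
have r0 y : K y -> 0 < r y by case/hr.
have [rho rho0 h] := lebesgue Kcl r0.
exists rho => // q Kq; have [y [Ky h1 h2]] := h q Kq.
have [_ [E [b [rr bx]]]] := hr y Ky.
exists y, E, (64 * r y), b; split => //; last by rlra.
by rewrite mulrC mulKf.
Qed.

Hypothesis Kq0 : K q0.

(** The leaf through the nearest point [q] stays in [K]. If the distance to [q] is not the one in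
    the chart, the box is at a vertex and the distance is at least [z.1]; the axis, also in [K], is
    then as near and serves instead. *)
Lemma foot_curve q y E r b w0 f0 ga z t : K q -> (forall q', K q' -> d (g t) q <= d (g t) q') ->
  K y -> box y E r b -> Om b z -> nm z < r / 32 -> g t = E z -> leaf ga -> ga 0 = q ->
  clO b w0 -> nm w0 < r / 64 -> nm f0 = 1 -> `|f0.1| <= 4 * `|w0.1| / r -> (forall x : R, `|x| < r / 4 -> ga x = E (mv w0 x f0)) ->
  exists k s w f, [/\ leaf k, nm f = 1 & pd z w = d (g t) q] /\
   forall x : R, `|x| < r / 8 -> [/\ clO b (mv w x f), nm (mv w x f) < r, K (k (s + x)) & k (s + x) = E (mv w x f)].
Proof.
move=> Kq hmin Ky bx oz zr Egt lg ga0 cw0 w0r f01 stw0 hw0; have [r0 r8] := box_gt0 bx.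
have [r4 zr1 w0r1 w04] : [/\ 0 < r / 4, nm z < r, nm w0 < r & nm w0 < r / 4] by split; rlra.
have Eq : q = E w0 by have := hw0 0; rewrite normr0 mv0 ga0; apply.
case: (bx_pd bx (Om_clO oz) cw0 zr1 w0r1) => [hd|[hb hd]].
  exists ga, 0, w0, f0; split; first by rewrite Egt Eq.
  move=> x xr; have x4 : `|x| < r / 4 by rlra.
  have [c1 c2] := clO_mv bx cw0 w04 f01 stw0 x4.
  split => //; [rlra| |by rewrite add0r; exact: hw0].
  by apply: (Kinv (s := 0)); rewrite ?ga0.
have [ka [tau [lka ka0 ht hka]]] := box_axis bx (KL Ky).
have tn : `|tau| = 1 by case: ht => ->; rewrite ?normrN normr1.
have t2 : tau * tau = 1 by case: ht => ->; ring.
have z1 : 0 < z.1 by case: oz; rewrite ?hb.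
have w1 : 0 <= w0.1 by case: cw0; rewrite ?hb.
have z2r : `|z.2| < r / 32 by apply: le_lt_trans (nm_snd z) zr.
have Kka x : K (ka x) by apply: (Kinv (s := 0)); rewrite ?ka0.
have e3 (x : R) : tau * (tau * z.2 + x) = z.2 + tau * x by rewrite mulrDr mulrA t2 mul1r.
have nb (x : R) : `|x| < r / 8 -> `|z.2 + tau * x| < r / 4.
  by move=> xr; apply: le_lt_trans (ler_normD _ _) _; rewrite normrM tn; rlra.
have hax (x : R) : `|x| < r / 8 -> ka (tau * z.2 + x) = E (0, z.2 + tau * x).
  by move=> xr; rewrite hka ?e3 //; apply: le_lt_trans (ler_normD _ _) _; rewrite normrM tn; rlra.
have ca x : clO b (0, x) by right.
have pz : pd z (0, z.2) = z.1.
  by rewrite /pd /= subrr subr0; apply: nm_eq; [exact: ltW|rewrite /=; ring].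
have z2r1 : nm (0, z.2) < r by rewrite nm_0u; rlra.
have F1 : d (g t) q <= z.1.
  have h0 := hax 0; rewrite mulr0 !addr0 normr0 in h0.
  apply: le_trans (hmin _ (Kka (tau * z.2))) _; rewrite h0; last by rlra.
  by rewrite Egt -[leRHS]pz; apply: (bx_le bx) => //; exact: Om_clO.
exists ka, (tau * z.2), (0, z.2), (0, tau); split.
  split => //; first by rewrite nm_0u.
  rewrite pz; move: hd; rewrite -Egt -Eq; rlra.
move=> x xr; have mvx : mv (0, z.2) x (0, tau) = (0, z.2 + tau * x).
  by rewrite /mv /= mulr0 addr0 mulrC.
rewrite mvx; split => //; last exact: hax.
by rewrite nm_0u; have := nb x xr; rlra.
Qed.

(** A zero of the distance is a meeting point of the strand with a leaf, where the two are
    parallel. *)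
Lemma foot_cross E r b y z e w f k s t rho H h (c : R) : box y E r b -> Om b z -> nm z < r / 32 -> nm e = 1 -> `|e.1| <= 4 * `|z.1| / r ->
  (forall x : R, `|x| < r / 4 -> g (t + x) = E (mv z x e)) -> leaf k -> nm f = 1 ->
  (forall x : R, `|x| < r / 8 -> k (s + x) = E (mv w x f)) -> 1 <= t -> 64 * rho <= r ->
  h = e.1 * f.2 - e.2 * f.1 -> `|c| <= 1 -> (forall x : R, pd (mv z x e) (mv w (x * c) f) = `|H + x * h|) ->
  forall x0 : R, `|x0| <= rho -> H + x0 * h = 0 -> h = 0.
Proof.
move=> bx oz zr e1 st hz lk f1 hk t1 hr hE c1 pdx x0 xr h0; have [r0 r8] := box_gt0 bx.
have xc : `|x0 * c| <= `|x0| by rewrite normrM ler_piMr.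
have [x4 tx k0 z4] : [/\ `|x0| < r / 4, 0 < t + x0, 0 < r / 16 & nm z < r / 4].
  by have := ler_norm (- x0); rewrite normrN => ?; split; rlra.
pose p := mv z x0 e.
have pw : mv w (x0 * c) f = p.
  by apply: pd_eq0; rewrite pdC pdx h0 normr0.
have gp : good E p.
  have := nm_mv z x0 e1; rewrite -/p => np.
  by apply: (bx_good bx); [exact: (Om_mv bx)|rlra].
have l1 : line_at g (t + x0) E p e (r / 16).
  by move=> u hu; rewrite -addrA hz ?mvD //; apply: le_lt_trans (ler_normD _ _) _; rlra.
have l2 : line_at k (s + x0 * c) E p f (r / 16).
  move=> u hu; rewrite -addrA hk; last by apply: le_lt_trans (ler_normD _ _) _; rlra.
  by rewrite -mvD pw.
have n0 : `|0 : R| < r / 16 by rewrite normr0.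
have p1 : g (t + x0) = E p by have := l1 0 n0; rewrite addr0 mv0.
have p2 : k (s + x0 * c) = E p by have := l2 0 n0; rewrite addr0 mv0.
have := cross (g_tl tx) (leaf_tl lk) gp p1 p2 e1 f1 k0 k0 l1 l2.
by rewrite hE => -[] -> /=; ring.
Qed.

(** Near [t] the distance to [K] is at most the distance to one line contained in [K], with equality
    at [t], and that distance is affine. *)
Lemma supergradient rho t q y E r b : 0 < rho -> K q -> (forall q', K q' -> d (g t) q <= d (g t) q') ->
  K y -> box y E r b -> d y q < r / 64 -> 64 * rho <= r -> 1 <= t -> d (g t) q < rho ->
  exists m : R, forall x : R, `|x| <= rho -> exists q', K q' /\ d (g (t + x)) q' <= d (g t) q + m * x.
Proof.
move=> rho0 Kq hmin Ky bx hq hr t1 hF; have [r0 r8] := box_gt0 bx.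
have yt : d y (g t) < r / 32 by apply: le_lt_trans (dtri q _ _) _; rewrite (dC q); rlra.
have hgt : d y (g t) < r / 4 by rlra.
have [z [e [[oz nz e1 st] hz]]] := box_strand bx t1 hgt; rewrite -nz in yt.
have [ga lg ga0] := leaf_ex (KL Kq).
have hga : d y (ga 0) < r / 4 by rewrite ga0; rlra.
have [w0 [f0 [[cw0 nw0 f01 stw0] hw0]]] := box_leaf bx lg hga.
have w0r : nm w0 < r / 64 by rewrite nw0 ga0.
have r40 : `|0 : R| < r / 4 by rewrite normr0; rlra.
have Egt : g t = E z by have := hz 0 r40; rewrite addr0 mv0.
have hw0' (x : R) : `|x| < r / 4 -> ga x = E (mv w0 x f0) by move=> /hw0; rewrite add0r.
have [k [s [w [f [[lk f1 hpd] hk]]]]] := foot_curve Kq hmin Ky bx oz yt Egt lg ga0 cw0 w0r f01 stw0 hw0'.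
have r80 : 0 < r / 8 by rlra.
have dot0 : (z.1 - w.1) * f.1 + (z.2 - w.2) * f.2 = 0.
  apply: (perp_foot r80 f1) => x xr; have [q1 q2 q3 q4] := hk x xr.
  have zr1 : nm z < r by rlra.
  by rewrite hpd; apply: le_trans (hmin _ q3) _; rewrite q4 Egt; apply: (bx_le bx) => //; exact: Om_clO.
have [H [h [c [hE c1 pdx]]]] := perp_frame e1 f1 dot0.
have hk' (x : R) : `|x| < r / 8 -> k (s + x) = E (mv w x f) by case/hk.
have cr := foot_cross bx oz yt e1 st hz lk f1 hk' t1 hr hE c1 pdx.
have FH : d (g t) q = `|H|.
  by have := pdx 0; rewrite !mul0r !mv0 addr0 -hpd.
have [m hm] := abs_affine rho0 cr.
exists m => x xr; have xc : `|x * c| <= `|x| by rewrite normrM ler_piMr.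
have [x8 x4 z4] : [/\ `|x * c| < r / 8, `|x| < r / 4 & nm z < r / 4] by split; rlra.
have [b1 b2 b3 b4] := hk _ x8.
exists (k (s + x * c)); split => //; rewrite FH; apply: le_trans (hm x xr); rewrite -pdx b4 hz //.
have [q1 q2] := clO_mv bx (Om_clO oz) z4 e1 st x4.
have q3 : nm (mv z x e) < r by rlra.
exact: (bx_le bx).
Qed.

(** The distance from [g] to [K] satisfies [conc_zero]: it becomes small at late times because [K]
    consists of limit points. *)
Lemma g_invariant t : 2 <= t -> K (g t).
Proof.
move=> t2; have [rho rho0 hc] := box_cover ltr01.
have hn (u : R) : exists q, K q /\ forall q', K q' -> d (g u) q <= d (g u) q' by exact: (nearest Kcl _ Kq0).
have [nr hnr] := choice hn.
pose F (u : R) := d (g u) (nr u).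
have [y [E [r [b [_ bx _ hr _]]]]] := hc _ Kq0; have [_ r8] := box_gt0 bx.
have F0 : F t = 0.
  apply: (conc_zero (T := 1) (dl := rho) (eta := rho)) => //; last by rlra.
  - by move=> u _; exact: d_ge0.
  - move=> u u1 Fu; have [Kn hmin] := hnr u.
    have [y' [E' [r' [b' [Ky' bx' h1 h2 _]]]]] := hc _ Kn.
    have [|m hm] := supergradient rho0 Kn hmin Ky' bx' h1 h2 _ Fu; first by rlra.
    exists m => x /hm[q' [Kq' hq']]; apply: le_trans hq'.
    by have [_] := hnr (u + x); apply.
  - move=> e T' e0; have [u [h1 h2]] := KL Kq0 T' e0; exists u; split => //.
    by apply: le_lt_trans h2; have [_] := hnr u; apply.
by have [Kn _] := hnr t; rewrite (deq F0).
Qed.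

End Invariant.
Lemma Lim_closed p : (forall e : R, 0 < e -> exists q, Lim q /\ d p q < e) -> Lim p.
Proof.
move=> h e T e0; have e2 : 0 < e / 2 by rlra.
have [q [Lq hq]] := h _ e2; have [t [tT ht]] := Lq _ T e2.
exists t; split => //; apply: le_lt_trans (dtri q _ _) _; rewrite (dC q); rlra.
Qed.

Lemma real_cluster (f : nat -> R) (M : R) : (forall n, `|f n| <= M) -> exists l : R,
  forall e : R, 0 < e -> forall N : nat, exists n : nat, (N <= n)%N /\ `|f n - l| < e.
Proof.
move=> hM; have [F [uF sF]] := @ultraFilterLemma _ (\oo%classic : set_system nat) _.
have [l [_ hl]] := uf_real uF (uf_all uF hM).
exists l => e e0 N.
have hN : F (fun n : nat => (N <= n)%N) by apply: sF; exists N.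
by have [n [h1 h2]] := uf_ex uF (uf_and uF hN (hl e e0)); exists n.
Qed.

(** In a box around the common point both leaves are the axis. *)
Lemma leaf_switch ga la s s' : leaf ga -> leaf la -> ga s = la s' -> exists (dl ep : R), [/\ 0 < dl, ep = 1 \/ ep = -1 &
  forall x : R, `|x| < dl -> la (s' + x) = ga (s + ep * x)].
Proof.
move=> lg ll e; have [E [r [b [_ bx]]]] := box_ex (leaf_Lim s lg) (ltr01 : (0 : R) < 1).
have [r0 _] := box_gt0 bx.
have [t1 [h1 k1]] := box_center bx lg erefl; have [t2 [h2 k2]] := box_center bx ll (esym e).
exists (r / 4), (t1 * t2); split; first by rlra.
  by case: h1 => ->; case: h2 => ->; rewrite ?mulr1 ?mul1r ?mulrNN ?mulN1r ?mulr1 ?opprK; [left|right|right|left].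
move=> x xr; rewrite k2 // k1; last by rewrite normrM; case: h1 => ->; case: h2 => ->; rewrite ?mulr1 ?mul1r ?mulrN1 ?normrN ?normr1 ?mul1r.
by congr (E (_, _)); rewrite !mulrA; congr (_ * _); case: h1 => ->; ring.
Qed.

Lemma arc_closed ga (s1 s2 : R) : leaf ga -> s1 <= s2 ->
  forall p, (forall e : R, 0 < e -> exists q, (exists s, s1 <= s <= s2 /\ q = ga s) /\ d p q < e) ->
  exists s, s1 <= s <= s2 /\ p = ga s.
Proof.
move=> lg s12 p h.
have hx (n : nat) : exists s, s1 <= s <= s2 /\ d p (ga s) < n.+1%:R^-1.
  have n0 : 0 < n.+1%:R^-1 :> R by rewrite invr_gt0.
  by have [q [[s [hs ->]] hq]] := h _ n0; exists s.
have [f hf] := choice hx.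
have [|l hl] := @real_cluster f (`|s1| + `|s2|).
  move=> n; have [/andP[h1 h2] _] := hf n.
  have := ler_norm s2; have := ler_norm (- s1); have := normr_ge0 s1; have := normr_ge0 s2; rewrite normrN ler_norml => *.
  by apply/andP; split; rlra.
have l1 : s1 <= l.
  rewrite leNgt; apply/negP => hlt; have e0 : 0 < s1 - l by rewrite subr_gt0.
  have [n [_ h1]] := hl _ e0 0%N; have [/andP[h2 _] _] := hf n; have := ler_norm (f n - l); rlra.
have l2 : l <= s2.
  rewrite leNgt; apply/negP => hlt; have e0 : 0 < l - s2 by rewrite subr_gt0.
  have [n [_ h1]] := hl _ e0 0%N; have [/andP[_ h2] _] := hf n; have := ler_norm (- (f n - l)); rewrite normrN; rlra.
exists l; split; first by rewrite l1.
apply: d_lt_eq => e e0; have e2 : 0 < e / 2 by rlra.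
have [N hN] := small_inv e2; have [n [Nn h1]] := hl _ e2 N; have [_ h2] := hf n.
apply: le_lt_trans (dtri (ga (f n)) _ _) _; have := leaf_lip (f n) l lg.
have := lt_trans h2 (hN n Nn); rlra.
Qed.

(* [gp]: no two distinct strands of [g] coincide, that is, [g] is not periodic. *)
Hypothesis gp : forall t T dl : R, 1 <= t -> 0 < T -> 0 < dl -> (forall x : R, `|x| < dl -> g (t + T + x) = g (t + x)) -> False.

(** The arc from [s1] to [s2] closes up, so it is invariant and contains [g] from time 2 on. The
    points of [g] at integer times accumulate on it; near an accumulation point the strands run
    along the axis of a box, and among three of them two have the same direction, so [g] repeats
    itself. *)
Lemma leaf_period ga (s1 s2 : R) : leaf ga -> s1 < s2 ->
  (exists2 dl : R, 0 < dl & forall x : R, `|x| < dl -> ga (s1 + x) = ga (s2 + x)) -> False.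
Proof.
move=> lg s12 [dl dl0 hdl].
pose K p := exists s, s1 <= s <= s2 /\ p = ga s.
have KL p : K p -> Lim p by move=> [s [_ ->]]; exact: leaf_Lim.
have Kcl := arc_closed lg (ltW s12).
have loc la s : leaf la -> K (la s) -> exists2 e : R, 0 < e & forall x : R, `|x| < e -> K (la (s + x)).
  move=> ll [si [/andP[h1 h2] hs]].
  have [e1 [ep [e10 hep h]]] := leaf_switch lg ll (esym hs).
  have en x : `|ep * x| = `|x| by rewrite normrM; case: hep => ->; rewrite ?normrN normr1 mul1r.
  have m0 : 0 < s2 - s1 by rewrite subr_gt0.
  have Kmid u : s1 <= si + u <= s2 -> K (ga (si + u)) by move=> hu; exists (si + u).
  (* At an end of the arc the coincidence of germs continues the leaf at the other end. *)
  have [a [a0 ha]] : exists a : R, 0 < a /\ forall u : R, `|u| < a -> K (ga (si + u)).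
    have bnd : 0 < Num.min dl (s2 - s1) by rewrite lt_min dl0.
    have [e2|n1] := eqVneq si s1.
      exists (Num.min dl (s2 - s1)); split => // u; rewrite lt_min => /andP[u1 u2].
      have := ler_norm u; have := ler_norm (- u); rewrite normrN => v1 v2.
      have [u0|u0] := leP 0 u; first by apply: Kmid; rewrite e2; apply/andP; split; rlra.
      rewrite e2 hdl //; exists (s2 + u); split => //; apply/andP; split; rlra.
    have [e2|n2] := eqVneq si s2.
      exists (Num.min dl (s2 - s1)); split => // u; rewrite lt_min => /andP[u1 u2].
      have := ler_norm u; have := ler_norm (- u); rewrite normrN => v1 v2.
      have [u0|u0] := leP u 0; first by apply: Kmid; rewrite e2; apply/andP; split; rlra.
      rewrite e2 -hdl //; exists (s1 + u); split => //; apply/andP; split; rlra.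
    have q1 : s1 < si by rewrite lt_neqAle eq_sym n1.
    have q2 : si < s2 by rewrite lt_neqAle n2.
    exists (Num.min (si - s1) (s2 - si)); split; first by rewrite lt_min !subr_gt0 q1.
    move=> u; rewrite lt_min => /andP[u1 u2].
    have := ler_norm u; have := ler_norm (- u); rewrite normrN => v1 v2.
    by apply: Kmid; apply/andP; split; rlra.
  exists (Num.min e1 a); first by rewrite lt_min e10.
  by move=> x; rewrite lt_min => /andP[x1 x2]; rewrite h //; apply: ha; rewrite en.
have Kinv la s s' : leaf la -> K (la s) -> K (la s').
  move=> ll Ks.
  have main (si : R) (U : R) : si = 1 \/ si = -1 -> 0 <= U -> K (la (s + si * U)).
    move=> hsi U0; have sn u : `|si * u| = `|u| by rewrite normrM; case: hsi => ->; rewrite ?normrN normr1 mul1r.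
    apply: (real_induction (U := U) (Q := fun u => K (la (s + si * u))) U0) => //; last by rewrite lexx U0.
    - by rewrite mulr0 addr0.
    - move=> u /andP[u0 uU] hu; have [|e e0 he] := loc la _ ll (hu u _); first by rewrite u0 lexx.
      exists e => // v /andP[v1 v2] _.
      have -> : s + si * v = s + si * u + si * (v - u) by ring.
      by apply: he; rewrite sn gtr0_norm; rlra.
    - move=> u /andP[u0 uU] hu; apply: Kcl => e e0.
      pose v := Num.max 0 (u - e / 2).
      have [v0 v1] : 0 <= v /\ u - e / 2 <= v by split; rewrite /v le_max lexx ?orbT.
      have vu : v < u by rewrite /v gt_max u0; rlra.
      exists (la (s + si * v)); split; first by apply: hu; rewrite v0.
      apply: le_lt_trans (leaf_lip _ _ ll) _.
      by rewrite (_ : s + si * u - (s + si * v) = si * (u - v)) ?sn ?gtr0_norm; [rlra|rlra|ring].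
  have [h|h] := leP s s'.
    have := main 1 (s' - s) (or_introl erefl); rewrite mul1r (addrC s) subrK; apply; rlra.
  have := main (-1) (s - s') (or_intror erefl); rewrite mulN1r (_ : s + - (s - s') = s'); [apply; rlra|ring].
have Kq0 : K (ga s1) by exists s1; rewrite lexx ltW.
have hg := g_invariant KL Kcl Kinv Kq0.
have hx (n : nat) : exists s, s1 <= s <= s2 /\ g (n%:R + 2) = ga s.
  by have [|s hs] := hg (n%:R + 2); [rewrite lerDr|exists s].
have [f hf] := choice hx.
have [|l hl] := @real_cluster f (`|s1| + `|s2|).
  move=> n; have [/andP[h1 h2] _] := hf n.
  have := ler_norm s2; have := ler_norm (- s1); have := normr_ge0 s1; have := normr_ge0 s2; rewrite normrN ler_norml => *.
  by apply/andP; split; rlra.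
have [E [r [b [_ bx]]]] := box_ex (leaf_Lim l lg) (ltr01 : (0 : R) < 1).
have [r0 r8] := box_gt0 bx; have [tau [ht hE]] := box_center bx lg erefl.
(* A point of the arc with parameter near [l] is on the axis of the box, where the slope bound makes
   the strand vertical; the shift [v] brings it to the centre. *)
have key (N : nat) : exists (n : nat) (ep v : R), [/\ (N <= n)%N, ep = 1 \/ ep = -1, `|v| < r / 32 &
    forall x : R, `|x| < r / 8 -> g (n%:R + 2 + v + x) = E (0, ep * x)].
  have r32 : 0 < r / 32 by rlra.
  have [n [Nn hn]] := hl _ r32 N; have [_ hgn] := hf n.
  have n0 : 0 <= n%:R :> R by [].
  have t1 : 1 <= n%:R + 2 :> R by rlra.
  pose v := tau * (f n - l).
  have tn : `|tau| = 1 by case: ht => ->; rewrite ?normrN normr1.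
  have vr : `|v| < r / 32 by rewrite normrM tn mul1r.
  have nv : nm (0, v) = `|v| by apply: nm_eq => //=; rewrite real_normK ?num_real //; ring.
  have gE : g (n%:R + 2) = E (0, v).
    by rewrite hgn -hE; [congr ga; ring|rlra].
  have cv : clO b (0, v) by right.
  have dv : d (ga l) (g (n%:R + 2)) = `|v| by rewrite gE (bx_nm bx) // nv //; rlra.
  have dv4 : d (ga l) (g (n%:R + 2)) < r / 4 by rewrite dv; rlra.
  have [z [e [[oz nz e1 st] hz]]] := box_strand bx t1 dv4.
  have zv : (0, v) = z.
    apply: (box_inj bx (Om_clO oz) cv); rewrite ?nv; [rlra|rlra| |exact: oz].
    by rewrite -gE; have := hz 0; rewrite normr0 addr0 mv0 => ->; [|rlra].
  rewrite -zv /= in st hz.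
  have e0 : e.1 = 0 by apply/eqP; rewrite -normr_eq0 eq_le normr_ge0 andbT; move: st; rewrite normr0 mulr0 mul0r.
  have e2 : e.2 = 1 \/ e.2 = -1.
    by move/nm_eq1/eqP: e1; rewrite e0 expr0n add0r sqrf_eq1 => /orP[] /eqP ->; [left|right].
  have en u : `|e.2 * u| = `|u| by rewrite normrM; case: e2 => ->; rewrite ?normrN normr1 mul1r.
  have ee : e.2 * e.2 = 1 by case: e2 => ->; ring.
  exists n, e.2, (- (e.2 * v)); split => //; first by rewrite normrN en.
  move=> x xr; rewrite -addrA hz; last first.
    by apply: le_lt_trans (ler_normD _ _) _; rewrite normrN en; rlra.
  congr E; rewrite /mv /= e0 mulr0 addr0; congr pair.
  by transitivity (v * (1 - e.2 * e.2) + e.2 * x); [ring|rewrite ee; ring].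
have [n1 [p1 [v1 [_ q1 w1 k1]]]] := key 0%N.
have [n2 [p2 [v2 [m2 q2 w2 k2]]]] := key n1.+1.
have [n3 [p3 [v3 [m3 q3 w3 k3]]]] := key n2.+1.
have nat12 : n1%:R + 1 <= n2%:R :> R by rewrite natr1 ler_nat.
have nat23 : n2%:R + 1 <= n3%:R :> R by rewrite natr1 ler_nat.
have fin (n m : nat) (p v v' : R) : n%:R + 1 <= m%:R :> R -> `|v| < r / 32 -> `|v'| < r / 32 ->
    (forall x : R, `|x| < r / 8 -> g (n%:R + 2 + v + x) = E (0, p * x)) ->
    (forall x : R, `|x| < r / 8 -> g (m%:R + 2 + v' + x) = E (0, p * x)) -> False.
  move=> nm hv hv' h1 h2.
  have := ler_norm v; have := ler_norm (- v); have := ler_norm v'; have := ler_norm (- v'); rewrite !normrN => *.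
  have n0 : 0 <= n%:R :> R by [].
  have T0 : 0 < m%:R - n%:R + v' - v by rlra.
  have t1 : 1 <= n%:R + 2 + v by rlra.
  have r80 : 0 < r / 8 by rlra.
  apply: (gp t1 T0 r80) => x xr; rewrite h1 // -h2 //; congr g; ring.
have eq3 : p1 = p2 \/ p2 = p3 \/ p1 = p3.
  by case: q1 => ->; case: q2 => ->; case: q3 => ->; auto.
case: eq3 => [e|[e|e]].
- by subst p2; apply: (fin _ _ _ _ _ nat12 w1 w2 k1 k2).
- by subst p3; apply: (fin _ _ _ _ _ nat23 w2 w3 k2 k3).
- by subst p3; apply: (fin _ _ _ _ _ _ w1 w3 k1 k3); rlra.
Qed.

(** A leaf passes the centre of a box upwards or downwards; of three passages two agree, and
    [leaf_period] applies. *)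
Lemma leaf_three ga (s1 s2 s3 : R) : leaf ga -> s1 < s2 -> s2 < s3 -> ga s1 = ga s2 -> ga s2 = ga s3 -> False.
Proof.
move=> lg h12 h23 e12 e23.
have [E [r [b [_ bx]]]] := box_ex (leaf_Lim s2 lg) (ltr01 : (0 : R) < 1).
have [r0 r8] := box_gt0 bx.
have [t1 [q1 k1]] := box_center bx lg e12.
have [t2 [q2 k2]] := box_center bx lg erefl.
have [t3 [q3 k3]] := box_center bx lg (esym e23).
have r4 : 0 < r / 4 by rlra.
have eq3 : t1 = t2 \/ t2 = t3 \/ t1 = t3.
  by case: q1 => ->; case: q2 => ->; case: q3 => ->; auto.
case: eq3 => [e|[e|e]].
- by apply: (leaf_period lg h12); exists (r / 4) => // x xr; rewrite k1 // k2 // e.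
- by apply: (leaf_period lg h23); exists (r / 4) => // x xr; rewrite k2 // k3 // e.
- by apply: (leaf_period lg (lt_trans h12 h23)); exists (r / 4) => // x xr; rewrite k1 // k3 // e.
Qed.
(** * Free balls *)

Hypothesis Vfin : exists (n : nat) (f : nat -> X), forall v : X, V v -> exists i : nat, (i < n)%N /\ f i = v.
Hypothesis geo : forall x y (t e : R), 0 <= t <= d x y -> 0 < e -> exists m, d x m <= t /\ d m y <= d x y - t + e.

Lemma uf_fin (T : Type) (F : set_system T) (uF : UltraFilter F) (P : nat -> T -> Prop) (n : nat) :
  F (fun t : T => exists i : nat, (i < n)%N /\ P i t) -> exists i : nat, F (P i).
Proof.
elim: n => [|n IH] h; first by have [t [i [/=]]] := uf_ex uF h; rewrite ltn0.
have : F (fun t : T => (exists i : nat, (i < n)%N /\ P i t) \/ P n t).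
  apply: (uf_mono uF _ h) => t [i []]; rewrite ltnS leq_eqVlt => /orP[/eqP ->|hi] hP; first by right.
  by left; exists i.
by move=> /(uf_or uF)[/IH|h']; last by exists n.
Qed.

Lemma V_pigeon (f : nat -> X) : (forall n, V (f n)) -> exists v : X, forall N : nat, exists n : nat, (N <= n)%N /\ f n = v.
Proof.
move=> hf; have [n [h hh]] := Vfin.
have [F [uF sF]] := @ultraFilterLemma _ (\oo%classic : set_system nat) _.
have [i hi] := @uf_fin _ F uF (fun i k => h i = f k) n (uf_all uF (fun k => hh _ (hf k))).
exists (h i) => N; have hN : F (fun n : nat => (N <= n)%N) by apply: sF; exists N.
by have [k [h1 h2]] := uf_ex uF (uf_and uF hN hi); exists k.
Qed.

Lemma V_closed p : (forall e : R, 0 < e -> exists q, V q /\ d p q < e) -> V p.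
Proof.
move=> h; have hx (n : nat) : exists q, V q /\ d p q < n.+1%:R^-1 by apply: h; rewrite invr_gt0.
have [f hf] := choice hx.
have [v hv] := V_pigeon (fun n => proj1 (hf n)).
suff <- : v = p by have [n [_ <-]] := hv 0%N; case: (hf n).
apply: d_lt_eq => e e0; have [N hN] := small_inv e0; have [n [Nn <-]] := hv N.
by rewrite dC; have [_ h1] := hf n; exact: lt_trans h1 (hN n Nn).
Qed.

Lemma V_isolated (v : X) : exists2 e : R, 0 < e & forall v' : X, V v' -> d v v' < e -> v' = v.
Proof.
have [//|hn] := EM (exists2 e : R, 0 < e & forall v' : X, V v' -> d v v' < e -> v' = v).
exfalso; have hx (n : nat) : exists v' : X, [/\ V v', d v v' < n.+1%:R^-1 & v' <> v].
  have [//|h] := EM (exists v' : X, [/\ V v', d v v' < n.+1%:R^-1 & v' <> v]).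
  exfalso; apply: hn; exists (n.+1%:R^-1); first by rewrite invr_gt0.
  by move=> v' Vv' hv'; have [//|ne] := EM (v' = v); exfalso; apply: h; exists v'.
have [f hf] := choice hx.
have [w hw] := V_pigeon (fun n => let: And3 h _ _ := hf n in h).
have ww : v = w.
  apply: d_lt_eq => e e0; have [N hN] := small_inv e0; have [n [Nn <-]] := hw N.
  by have [_ h1 _] := hf n; exact: lt_trans h1 (hN n Nn).
by have [n [_ e]] := hw 0%N; have [_ _] := hf n; rewrite e -ww.
Qed.

Lemma geo_ex x y (t : R) : 0 <= t <= d x y -> exists m, d x m = t /\ d m y = d x y - t.
Proof.
move=> ht; have hx (n : nat) : exists m, d x m <= t /\ d m y <= d x y - t + n.+1%:R^-1.
  by apply: geo => //; rewrite invr_gt0.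
have [f hf] := choice hx; have [m hm] := cluster f.
have h1 : d x m <= t.
  rewrite leNgt; apply/negP => h; have e0 : 0 < d x m - t by rewrite subr_gt0.
  have [n [_ hn]] := hm _ e0 0%N; have [h1 _] := hf n; have := dtri (f n) x m; rlra.
have h2 : d m y <= d x y - t.
  rewrite leNgt; apply/negP => h; have e0 : 0 < (d m y - (d x y - t)) / 2 by rewrite divr_gt0 // subr_gt0.
  have [N hN] := small_inv e0; have [n [Nn hn]] := hm _ e0 N; have [_ h2] := hf n; have h3 := hN n Nn.
  have := dtri (f n) m y; rewrite (dC m (f n)); move: h2 h3; set q := _^-1 => h2 h3; rlra.
by exists m; have := dtri m x y; split; rlra.
Qed.

(* The open ball of radius [a] centred at [x] is free: disjoint from the limit set, with [p] on its boundary. *)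
Definition St (p x : X) (a : R) := [/\ 0 < a, d x p = a & forall l, Lim l -> a <= d x l].

(** The new centre lies on a shortest path from [x] to [p], so the smaller ball is inside the larger
    one and still touches [p]. *)
Lemma St_shrink p x (a a' : R) : St p x a -> 0 < a' <= a -> exists x', St p x' a' /\ d x x' = a - a'.
Proof.
move=> [a0 hp hl] /andP[a'0 aa].
have [|m [h1 h2]] := @geo_ex x p (a - a'); first by rewrite hp; apply/andP; split; rlra.
exists m; split => //; split => //; first by rlra.
by move=> l /hl h; have := dtri m x l; rlra.
Qed.

Lemma Lim_ne : exists p, Lim p.
Proof.
have [p hp] := cluster (fun n : nat => g n%:R); exists p => e T e0.
have [n [h1 h2]] := hp e e0 (Num.bound `|T|).
exists n%:R; split => //; apply: (lt_le_trans (y := (Num.bound `|T|)%:R)); last by rewrite ler_nat.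
by apply: le_lt_trans (ler_norm T) _; apply: archi_boundP.
Qed.

Lemma box_false_vertex y E r b : box y E r b -> V y -> b = false.
Proof.
move=> bx Vy; have [r0 _] := box_gt0 bx; case: b bx => // bx; exfalso; apply: (V_notflat Vy).
by exists E, (0, 0); split; [apply: (bx_good bx); [left|rewrite nm00]|exact: (bx_0 bx)].
Qed.

Lemma box_axis_Lim y E r b (u : R) : box y E r b -> Lim y -> `|u| < r / 4 -> Lim (E (0, u)).
Proof.
move=> bx Ly ur; have [ga [tau [lg _ ht h]]] := box_axis bx Ly.
have e : tau * (tau * u) = u by rewrite mulrA (_ : tau * tau = 1) ?mul1r //; case: ht => ->; ring.
rewrite -e -h; first exact: leaf_Lim.
by rewrite normrM; case: ht => ->; rewrite ?normrN normr1 mul1r.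
Qed.

(** A maximal free ball around [x0] touches the limit set at some [q]. If [q] is a vertex, a
    shrunken ball has its centre at [(a, 0)] in the box, since it avoids the axis. From
    [(a, a / 2)], still inside the free ball, the axis is at distance at most [a] while [q] is
    farther: the nearest limit point is another one, too close to [q] to be a vertex. *)
Lemma edge_flat : (exists x, ~ Lim x) -> exists p x a, [/\ Lim p, ~ V p & St p x a].
Proof.
move=> [x0 nL]; have [p0 Lp0] := Lim_ne.
have [q [Lq hq]] := nearest Lim_closed x0 Lp0.
have a0 : 0 < d x0 q.
  rewrite lt_neqAle d_ge0 andbT eq_sym; apply/eqP => h; apply: nL; by rewrite (deq h).
have sq : St q x0 (d x0 q) by split.
have [Vq|nVq] := EM (V q); last by exists q, x0, (d x0 q).
have [E [r [b [_ bx]]]] := box_ex Lq (ltr01 : (0 : R) < 1).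
have bf := box_false_vertex bx Vq; have [r0 r8] := box_gt0 bx.
have [e e0 he] := V_isolated q.
pose a := Num.min (d x0 q) (Num.min (r / 16) (e / 4)).
have ap : 0 < a by rewrite !lt_min a0 !divr_gt0.
have [a1 a2 a3] : [/\ a <= d x0 q, a <= r / 16 & a <= e / 4] by split; rewrite /a !ge_min lexx ?orbT.
have [|x [[_ dxq fx] _]] := St_shrink (a' := a) sq; first by rewrite ap.
have dqx : d q x < r by rewrite dC dxq; rlra.
case: (bx_cov bx dqx) => [[w [cw nw Ew]]|[u [ur hu _]]]; last first.
  exfalso; have : a <= d x (E (0, u)).
    apply: fx; apply: (box_axis_Lim bx) => //.
    rewrite -nm_0u -(bx_nm bx) ?nm_0u //; last by right.
    apply: le_lt_trans (dtri x _ _) _; rewrite (dC q x) dxq in hu *; rlra.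
  by rewrite (dC q x) dxq in hu; rlra.
rewrite (dC q x) dxq in nw.
have w1 : 0 <= w.1 by case: cw; rewrite ?bf.
have cax u : clO b (0, u) by right.
have wa : a <= w.1.
  have hw2 : `|w.2| < r / 4 by apply: le_lt_trans (nm_snd w) _; rlra.
  apply: le_trans (fx _ (box_axis_Lim bx Lq hw2)) _; rewrite -Ew.
  apply: le_trans (bx_le bx cw (cax _) _ _) _; rewrite ?nm_0u; [rlra|rlra|].
  by rewrite /pd /= subrr subr0 nm_r0.
have w2 : w.2 = 0.
  have : w.1 ^+ 2 + w.2 ^+ 2 = a ^+ 2 by rewrite -nm_sqr nw.
  have : a ^+ 2 <= w.1 ^+ 2 by rewrite ler_sqr ?nnegrE // ltW.
  move=> h1 h2; apply/eqP; rewrite -sqrf_eq0 eq_le sqr_ge0 andbT; rlra.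
have wE : w = (a, 0).
  have : w.1 <= a by rewrite -nw; apply: le_trans (ler_norm _) (nm_fst w).
  by move=> h1; rewrite (surjective_pairing w) w2; congr pair; rlra.
subst w; have cz : clO b (a, a / 2) by right; exact: ltW.
have nz : nm (a, a / 2) < r.
  by apply: le_lt_trans (nm_le_sum _) _; rewrite /= !gtr0_norm; rlra.
have nz' : a < nm (a, a / 2).
  rewrite ltNge nm_le ?(ltW ap) //= -ltNge ltrDl exprn_gt0 //; rlra.
have nz2 : nm (a, a / 2) <= 2 * a.
  by apply: le_trans (nm_le_sum _) _; rewrite /= !gtr0_norm; rlra.
have [p [Lp hp]] := nearest Lim_closed (E (a, a / 2)) Lp0.
have ar4 : `|a / 2| < r / 4 by rewrite gtr0_norm; rlra.
have da : d (E (a, a / 2)) p <= a.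
  apply: le_trans (hp _ (box_axis_Lim bx Lq ar4)) _.
  apply: le_trans (bx_le bx cz (cax _) nz _) _; rewrite ?nm_0u; first by rlra.
  by rewrite /pd /= subrr subr0 nm_r0 // ltW.
exists p, (E (a, a / 2)), (d (E (a, a / 2)) p); split => //.
  move=> Vp; have dq : d q (E (a, a / 2)) = nm (a, a / 2) by apply: (bx_nm bx).
  have pq : p = q.
    by apply: he => //; apply: le_lt_trans (dtri (E (a, a / 2)) _ _) _; rewrite dq; rlra.
  by rewrite pq dC dq in da; rlra.
split => //; rewrite lt_neqAle d_ge0 andbT eq_sym; apply/eqP => h.
have := fx p Lp; rewrite -(deq h) -Ew.
have ca0 : clO b (a, 0) by right; exact: ltW.
have na0 : nm (a, 0) < r by rewrite nm_r0 ?(ltW ap) //; rlra.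
have := bx_le bx ca0 cz na0 nz.
by rewrite /pd /= subrr sub0r -[X in nm (X, _)]oppr0 (nmN (0, a / 2)) nm_0u gtr0_norm; rlra.
Qed.

(** Arbitrarily late passages through finitely many vertices would include three through the same
    one. *)
Lemma vertex_times ga : leaf ga -> exists S : R, forall s, V (ga s) -> s <= S.
Proof.
move=> lg; have [//|hn] := EM (exists S : R, forall s, V (ga s) -> s <= S).
exfalso; have hx (n : nat) : exists s, V (ga s) /\ n%:R < s.
  have [//|h] := EM (exists s, V (ga s) /\ n%:R < s); exfalso; apply: hn; exists n%:R => s Vs.
  by rewrite leNgt; apply/negP => hs; apply: h; exists s.
have [f hf] := choice hx.
have [v hv] := V_pigeon (fun n => proj1 (hf n)).
have nxt (n : nat) : exists m : nat, f n < f m /\ ga (f m) = v.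
  have [m [h1 h2]] := hv (Num.bound `|f n|); exists m; split => //.
  have [_ h3] := hf m; apply: lt_trans h3; apply: (lt_le_trans (y := (Num.bound `|f n|)%:R)); last by rewrite ler_nat.
  by apply: le_lt_trans (ler_norm _) _; apply: archi_boundP.
have [n1 [_ e1]] := nxt 0%N; have [n2 [h2 e2]] := nxt n1; have [n3 [h3 e3]] := nxt n2.
by apply: (leaf_three lg h2 h3); rewrite ?e1 ?e2 ?e3.
Qed.

(** If the leaf of [edge_flat] meets a vertex at a time [s >= 0], let [s1] be the last such time.
    Either the leaf returns along itself there, and the point of tangency is visited again after
    [s1]; or the sector left out at the vertex contains the centre of a free ball tangent to the
    leaf just after [s1]. *)
Lemma edge_ray : (exists x, ~ Lim x) -> exists ga s1 u1 x a,
  [/\ leaf ga, forall u : R, 0 < u -> ~ V (ga (s1 + u)), 0 < u1 & St (ga (s1 + u1)) x a].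
Proof.
move=> hL; have [p [x [a [Lp nVp sp]]]] := edge_flat hL.
have [ga lg g0] := leaf_ex Lp; have [S hS] := vertex_times lg.
pose Z := [set s : R | 0 <= s /\ V (ga s)].
have [hZ|nZ] := EM (exists s, Z s); last first.
  have [//|hn] := EM (exists2 e : R, 0 < e & forall s, `|s| < e -> ~ V (ga s)); last first.
    exfalso; apply: nVp; apply: V_closed => e e0.
    have [//|h] := EM (exists q, V q /\ d p q < e); exfalso; apply: hn; exists e => // s hs Vs; apply: h.
    by exists (ga s); split => //; rewrite -g0; apply: le_lt_trans (leaf_lip _ _ lg) _; rewrite sub0r normrN.
  move=> [e e0 he]; exists ga, (- (e / 2)), (e / 2), x, a; split => //; last by rewrite addNr g0.
  - move=> u u0; have [h|h] := leP 0 (- (e / 2) + u).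
      by move=> Vu; apply: nZ; exists (- (e / 2) + u).
    by apply: he; rewrite ltr0_norm //; rlra.
  - rlra.
have sZ : has_sup Z by split => //; exists S => s [_ /hS].
pose s1 := sup Z.
have Zs1 s : Z s -> s <= s1 by move=> Zs; apply: ub_le_sup => //; case: sZ.
have Vs1 : V (ga s1).
  apply: V_closed => e e0; have [s Zs hs] := sup_adherent e0 sZ.
  exists (ga s); split; first by case: Zs.
  apply: le_lt_trans (leaf_lip _ _ lg) _; have := Zs1 _ Zs; rewrite -/s1 in hs => h.
  by rewrite ger0_norm; rlra.
have s10 : 0 <= s1 by have [s Zs] := hZ; apply: le_trans (Zs1 _ Zs); case: Zs.
have s1p : 0 < s1.
  by rewrite lt_neqAle s10 andbT; apply/eqP => h; move: Vs1; rewrite -h g0.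
have nV u : 0 < u -> ~ V (ga (s1 + u)).
  move=> u0 Vu; have : s1 + u <= s1 by apply: Zs1; split => //; rlra.
  rlra.
have [E [r [b [_ bx]]]] := box_ex (leaf_Lim s1 lg) (ltr01 : (0 : R) < 1).
have bf := box_false_vertex bx Vs1; have [r0 r8] := box_gt0 bx.
have [tau [ht hE]] := box_center bx lg erefl.
case: (bx_alt bx bf) => [solo|corner].
  have fold (y : R) : `|y| < r / 4 -> ga (s1 - y) = ga (s1 + y).
    move=> yr; have yr' : `|- y| < r / 4 by rewrite normrN.
    rewrite (hE _ yr') (hE _ yr) mulrN solo //; rewrite normrM; case: ht => ->; rewrite ?normrN normr1 mul1r; rlra.
  exists ga, s1, s1, x, a; split => //.
  suff -> : ga (s1 + s1) = p by [].
  have [h|h] := ltP s1 (r / 4); first by rewrite -fold ?subrr // gtr0_norm.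
  have r80 : 0 < r / 8 by rlra.
  have U0 : 0 <= s1 - r / 8 by rlra.
  have nl y : 0 <= y -> flat (ga (s1 + (r / 8 + y))) by move=> y0; apply: flV; apply: nV; rlra.
  (* The outgoing half is a geodesic through flat points; the incoming one could a priori meet
     vertices, which is the asymmetry that [uniq] allows. *)
  have [||||||dl dl0 hdl] := @uniq (fun y => ga (s1 - (r / 8 + y))) (fun y => ga (s1 + (r / 8 + y))) (s1 - r / 8) U0 _ _ _ _ _ (s1 - r / 8).
  - move=> y _; apply: lip_lcont => y1 y2; apply: le_trans (leaf_lip _ _ lg) _.
    by rewrite -normrN; rewrite (_ : - (s1 - (r / 8 + y1) - (s1 - (r / 8 + y2))) = y1 - y2) //; ring.
  - move=> y _ fl; have := tl_opp (leaf_tl lg : tl ga (s1 - (r / 8 + y))) => h1.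
    have h2 : lgeo (fun x => ga (- x)) (- (s1 - r / 8) + y).
      by rewrite (_ : - (s1 - r / 8) + y = - (s1 - (r / 8 + y))); [apply: tl_lgeo => //; rewrite opprK|ring].
    have := lgeo_shift h2; congr lgeo; apply: funext => y'; congr ga; ring.
  - move=> y /andP[y0 _]; have h1 : lgeo ga ((s1 + r / 8) + y).
      by apply: tl_lgeo; [exact: leaf_tl|rewrite -addrA; exact: nl].
    by have := lgeo_shift h1; congr lgeo; apply: funext => y'; congr ga; ring.
  - by move=> y /andP[y0 _]; exact: nl.
  - exists (r / 8) => // y yr; rewrite !add0r; apply: fold.
    by apply: le_lt_trans (ler_normD _ _) _; rewrite gtr0_norm; rlra.
  - by rewrite U0 lexx.
  have := hdl 0; rewrite normr0 addr0 => /(_ dl0).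
  by rewrite (_ : r / 8 + (s1 - r / 8) = s1); [rewrite subrr g0|ring].
have r80 : 0 < r / 8 by rlra.
have [u [a' [q [/andP[u0 ur] /andP[a'0 a'r] dq da hq]]]] := corner tau (r / 8) ht r80.
exists ga, s1, u, q, a'; split => //; split => //.
  by rewrite hE //; rewrite gtr0_norm //; rlra.
(* A limit point near the vertex lies on a leaf, hence in the closed half disc, where [hq] applies;
   the others are too far from [q]. *)
move=> l Ll; have [hl|hl] := ltP (d (ga s1) l) (r / 4).
  have [gl' lgl gl0] := leaf_ex Ll.
  have hl' : d (ga s1) (gl' 0) < r / 4 by rewrite gl0.
  have [z [e [[cz nz _ _] hz]]] := box_leaf bx lgl hl'.
  have r40 : `|0 : R| < r / 4 by rewrite normr0; rlra.
  have := hz 0 r40; rewrite addr0 mv0 gl0 => ->; apply: hq => //; rewrite nz; rlra.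
have := dtri q (ga s1) l; rlra.
Qed.
Implicit Types (z w e f : R * R).
Lemma steep_dot e f : nm e = 1 -> nm f = 1 -> `|e.1| <= 1 / 2 -> `|f.1| <= 1 / 16 -> 1 / 2 <= `|dotp e f|.
Proof.
move=> /nm_eq1 e1 /nm_eq1 f1 he hf.
have h1 : 3 / 4 <= `|e.2|.
  rewrite -ler_sqr ?nnegrE // real_normK ?num_real //.
  have : `|e.1| ^+ 2 <= (1 / 2) ^+ 2 by rewrite ler_sqr ?nnegrE.
  rewrite real_normK ?num_real //; rlra.
have h2 : 3 / 4 <= `|f.2|.
  rewrite -ler_sqr ?nnegrE // real_normK ?num_real //.
  have : `|f.1| ^+ 2 <= (1 / 16) ^+ 2 by rewrite ler_sqr ?nnegrE.
  rewrite real_normK ?num_real //; rlra.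
have h3 : 3 / 4 * (3 / 4) <= `|e.2 * f.2| by rewrite normrM; apply: ler_pM => //; rlra.
have h4 : `|e.1 * f.1| <= 1 / 2 * (1 / 16) by rewrite normrM; apply: ler_pM.
have := lerB_normD (e.2 * f.2) (e.1 * f.1); rewrite (addrC (e.2 * _)) -/(dotp e f); rlra.
Qed.

(** * Free balls in a strip along a leaf *)

Section Window.
Variables (y : X) (E : R * R -> X) (r : R) (b : bool) (k : R -> X) (z e : R * R) (U : R).
Hypothesis bx : box y E r b.
Hypothesis Ly : Lim y.
Hypothesis oz : Om b z.
Hypothesis zr : nm z < r / 64.
Hypothesis e1 : nm e = 1.
Hypothesis st : `|e.1| <= 4 * `|z.1| / r.
Hypothesis hk : forall x : R, `|x| < r / 4 -> k x = E (mv z x e).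
Hypothesis ktl : forall x : R, tl k x.
Hypothesis kL : forall x : R, Lim (k x).
Hypothesis U0 : 0 < U.
Hypothesis Ur : 512 * U <= r.

Lemma W_r : [/\ 0 < r, r <= 1 / 8, nm z < r / 64, 0 < U & 512 * U <= r].
Proof. by have [] := box_gt0 bx; split. Qed.

Definition sgn (si : bool) : R := if si then 1 else -1.
Definition nrm (si : bool) : R * R := (sgn si * e.2, - (sgn si * e.1)).
(** Fermi coordinates along the segment of leaf, the normal being taken on the side [si]. *)
Definition xi si (u al : R) : R * R := mv (mv z u e) al (nrm si).
Definition Sw si (u al : R) := clO b (xi si u al) /\ forall l, Lim l -> al <= d (E (xi si u al)) l.

Lemma sgn_sqr si : sgn si * sgn si = 1. Proof. by case: si; rewrite /sgn; ring. Qed.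
Lemma e_sqr : e.1 ^+ 2 + e.2 ^+ 2 = 1. Proof. by apply/nm_eq1. Qed.
Lemma nm_nrm si : nm (nrm si) = 1.
Proof.
apply: nm_eq => //; rewrite /nrm /=.
transitivity ((sgn si * sgn si) * (e.1 ^+ 2 + e.2 ^+ 2)); first by ring.
by rewrite sgn_sqr e_sqr; ring.
Qed.

Lemma k_Om (u : R) : `|u| < r / 4 -> Om b (mv z u e).
Proof. by have [? ? ? _ _] := W_r; move=> ur; apply: (Om_mv bx) => //; rlra. Qed.

Lemma xi_pd si (u al u' al' : R) : pd (xi si u al) (xi si u' al') <= `|u - u'| + `|al - al'|.
Proof.
apply: le_trans (pd_tri (mv (mv z u' e) al (nrm si)) _ _) _; apply: lerD.
  by have := pd_mv_mv (mv z u e) (mv z u' e) al (nrm si) (nrm si); rewrite pdzz mulr0 addr0 pd_mv1.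
by rewrite pd_mv1 // nm_nrm.
Qed.

Lemma xi0 si (u : R) : xi si u 0 = mv z u e. Proof. by rewrite /xi mv0. Qed.

Lemma xi_z si (u al : R) : pd (xi si u al) z <= `|u| + `|al|.
Proof. by have := xi_pd si u al 0 0; rewrite xi0 mv0 !subr0. Qed.

Lemma xi_nm si (u al : R) : `|u| <= U -> 0 <= al <= U -> nm (xi si u al) < r / 32.
Proof.
move=> uU /andP[a0 aU]; have [? ? ? ? ?] := W_r.
have := nm_pd (xi si u al) z; have := xi_z si u al; rewrite (ger0_norm a0); rlra.
Qed.

Lemma axis_near xw : b = false -> 0 <= xw.1 -> nm xw < r / 4 -> Lim (E (0, xw.2)) /\ d (E xw) (E (0, xw.2)) <= xw.1.
Proof.
move=> hb x0 xr; have [? ? ? ? ?] := W_r.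
have x2 : `|xw.2| < r / 4 by apply: le_lt_trans (nm_snd xw) xr.
split; first exact: box_axis_Lim bx Ly x2.
apply: le_trans (bx_le bx _ _ _ _) _; rewrite ?nm_0u; try by [right|rlra].
by rewrite /pd /= subrr subr0 nm_r0.
Qed.

Lemma Sw_St si (u al : R) : `|u| <= U -> 0 < al <= U -> Sw si u al -> St (k u) (E (xi si u al)) al.
Proof.
move=> uU /andP[a0 aU] [c f]; have [r0 r8 zr' U0' Ur'] := W_r.
have u4 : `|u| < r / 4 by rlra.
split => //; apply/eqP; rewrite eq_le f ?andbT //.
have al0 : 0 <= al <= U by rewrite ltW.
have al00 : 0 <= (0 : R) <= U by rewrite lexx ltW.
have n1 := xi_nm si uU al0; have n2 := xi_nm si uU al00.
rewrite xi0 in n2; rewrite hk //; apply: le_trans (bx_le bx c (Om_clO (k_Om u4)) _ _) _; [rlra|rlra|].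
by have := xi_pd si u al u 0; rewrite xi0 subrr normr0 add0r subr0 gtr0_norm.
Qed.

(** The leaf itself avoids the free ball, so [k u] is the foot of the centre, which therefore lies
    on the normal. A centre outside the chart, or not seen at its distance in the chart, is excluded
    because a point of the axis would be nearer. *)
Lemma St_Sw (u al : R) x : `|u| <= U -> 0 < al <= U -> St (k u) x al -> exists si, Sw si u al /\ x = E (xi si u al).
Proof.
move=> uU /andP[a0 aU] [_ dx fx]; have [r0 r8 zr' U0' Ur'] := W_r.
have u4 : `|u| < r / 4 by rlra.
pose z' := mv z u e; have oz' : Om b z' := k_Om u4.
have ku : k u = E z' by exact: hk.
have nz' : nm z' < r / 32 by have := nm_mv z u e1; rewrite -/z'; rlra.
have dyz : d y (E z') = nm z' by apply: (bx_nm bx); [exact: Om_clO|rlra].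
have dyx : d y x < r / 16 by apply: le_lt_trans (dtri (E z') _ _) _; rewrite (dC (E z')) -ku dx ku dyz; rlra.
have dyx' : d y x < r by rlra.
case: (bx_cov bx dyx') => [[w [cw nw Ew]]|[u0 [u0r hy hu]]]; last first.
  exfalso; have nz1 : nm z' < r by rlra.
  have h1 := hu z' oz' nz1; rewrite -ku dx in h1.
  have c0 : clO b (0, u0) by right.
  have u0n : `|u0| < r / 4.
    rewrite -nm_0u -(bx_nm bx c0) ?nm_0u //; apply: le_lt_trans (dtri x _ _) _; rlra.
  by have := fx _ (box_axis_Lim bx Ly u0n); rlra.
have wr : nm w < r by rlra.
have zr1 : nm z' < r by rlra.
have pdw : pd w z' = al.
  rewrite -dx ku -Ew; case: (bx_pd bx cw (Om_clO oz') wr zr1) => [-> //|[hb h]].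
  exfalso; have z1 : 0 < z'.1 by case: oz'; rewrite ?hb.
  have w0 : 0 <= w.1 by case: cw; rewrite ?hb.
  have [|L1 L2] := axis_near hb w0; first by rlra.
  by have := fx _ L1; rewrite -Ew => h2; rewrite Ew -ku dx in h; rlra.
have dot0 : (w.1 - z'.1) * e.1 + (w.2 - z'.2) * e.2 = 0.
  apply: (@perp_foot R w z' e (r / 8)) => //; first by rlra.
  move=> x' xr; rewrite pdw.
  have ux4 : `|u + x'| < r / 4 by apply: le_lt_trans (ler_normD _ _) _; rlra.
  apply: le_trans (fx _ (kL (u + x'))) _; rewrite hk // -mvD -/z' -Ew.
  apply: (bx_le bx) => //; first by rewrite mvD; apply: Om_clO; exact: k_Om.
  by have := nm_mv z' x' e1; rlra.
pose H := (w.1 - z'.1) * e.2 - (w.2 - z'.2) * e.1.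
have e2 := e_sqr.
have w1 : w.1 = z'.1 + H * e.2.
  transitivity (z'.1 + (w.1 - z'.1) * (e.1 ^+ 2 + e.2 ^+ 2) - ((w.1 - z'.1) * e.1 + (w.2 - z'.2) * e.2) * e.1).
    by rewrite e2 dot0; ring.
  by rewrite /H; ring.
have w2 : w.2 = z'.2 - H * e.1.
  transitivity (z'.2 + (w.2 - z'.2) * (e.1 ^+ 2 + e.2 ^+ 2) - ((w.1 - z'.1) * e.1 + (w.2 - z'.2) * e.2) * e.2).
    by rewrite e2 dot0; ring.
  by rewrite /H; ring.
have Ha : `|H| = al.
  have d1 : w.1 - z'.1 = H * e.2 by rewrite w1; ring.
  have d2 : w.2 - z'.2 = - H * e.1 by rewrite w2; ring.
  rewrite -pdw /pd d1 d2; apply/esym; apply: nm_eq => //=; rewrite real_normK ?num_real //.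
  by transitivity (H ^+ 2 * (e.1 ^+ 2 + e.2 ^+ 2)); [ring|rewrite e2 mulr1].
pose si := 0 <= H.
have sH : H = al * sgn si.
  rewrite -Ha /sgn /si; case: ifP => h; first by rewrite ger0_norm // mulr1.
  by rewrite ltr0_norm ?mulrN1 ?opprK // ltNge h.
have wE : w = xi si u al.
  rewrite (surjective_pairing w) w1 w2 sH /xi -/z' /mv /nrm /=; congr pair; ring.
by exists si; rewrite /Sw -wE Ew.
Qed.

Lemma Sw_lip si (u al u' al' : R) : `|u| <= U -> `|u'| <= U -> 0 <= al <= U -> 0 <= al' <= U ->
  Sw si u al -> Sw si u' al' -> d (E (xi si u al)) (E (xi si u' al')) <= `|u - u'| + `|al - al'|.
Proof.
move=> uU uU' aU aU' [c _] [c' _]; have [r0 r8 zr' U0' Ur'] := W_r.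
have n1 := xi_nm si uU aU; have n2 := xi_nm si uU' aU'.
apply: le_trans (bx_le bx c c' _ _) _; [rlra|rlra|exact: xi_pd].
Qed.

Lemma Sw_axis si (u al : R) : `|u| <= U -> 0 <= al <= U -> Sw si u al -> b = false -> al <= (xi si u al).1.
Proof.
move=> uU aU [c f] hb; have [r0 r8 zr' U0' Ur'] := W_r.
have n1 := xi_nm si uU aU; have x0 : 0 <= (xi si u al).1 by case: c; rewrite ?hb.
have [|L1 L2] := axis_near hb x0; first by rlra.
exact: le_trans (f _ L1) L2.
Qed.

(** The centres are at heights [al] and [al'] on opposite sides of a line; if their distance is not
    the one in the chart, each abscissa is already at least the radius. *)
Lemma Sw_sides si (u al u' al' : R) : `|u| <= U -> `|u'| <= U -> 0 <= al <= U -> 0 <= al' <= U ->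
  Sw si u al -> Sw (~~ si) u' al' -> al + al' <= d (E (xi si u al)) (E (xi (~~ si) u' al')).
Proof.
move=> uU uU' aU aU' s1 s2; have [r0 r8 zr' U0' Ur'] := W_r.
have n1 := xi_nm si uU aU; have n2 := xi_nm (~~ si) uU' aU'.
have [c f] := s1; have [c' f'] := s2.
have n1' : nm (xi si u al) < r by rlra.
have n2' : nm (xi (~~ si) u' al') < r by rlra.
case: (bx_pd bx c c' n1' n2') => [->|[hb]].
  have := dotp_le ((xi si u al).1 - (xi (~~ si) u' al').1, (xi si u al).2 - (xi (~~ si) u' al').2) (nrm si).
  rewrite nm_nrm mulr1 -/(pd _ _); apply: le_trans.
  rewrite /dotp /xi /mv /nrm /=.
  have -> : sgn (~~ si) = - sgn si by case: si {s1 s2 n1 n2 c c' f f' n1' n2'}; rewrite /sgn /= ?opprK.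
  rewrite le_eqVlt; apply/orP; left; apply/eqP.
  transitivity ((al + al') * (sgn si * sgn si) * (e.1 ^+ 2 + e.2 ^+ 2)); last by ring.
  by rewrite sgn_sqr e_sqr !mulr1.
by have := Sw_axis uU aU s1 hb; have := Sw_axis uU' aU' s2 hb; rlra.
Qed.

Lemma Sw_closed si (u al : R) : `|u| <= U -> 0 <= al <= U ->
  (forall ep, 0 < ep -> exists al', [/\ 0 <= al' <= U, `|al' - al| < ep & Sw si u al']) -> Sw si u al.
Proof.
move=> uU aU h; have [r0 r8 zr' U0' Ur'] := W_r.
have c : clO b (xi si u al).
  have [hb|hb] := EM b; [by left|right]; rewrite leNgt; apply/negP => hneg.
  have hp : 0 < - (xi si u al).1 by rewrite oppr_gt0.
  have [al' [a1 a2 [[//|c'] _]]] := h _ hp.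
  have := pd_fst (xi si u al') (xi si u al); have := xi_pd si u al' u al; rewrite subrr normr0 add0r.
  have := ler_norm ((xi si u al').1 - (xi si u al).1); rlra.
split => // l Ll; rewrite leNgt; apply/negP => hlt.
have e0 : 0 < (al - d (E (xi si u al)) l) / 2 by rewrite divr_gt0 // subr_gt0.
have [al' [a1 a2 s']] := h _ e0; have [c' f'] := s'.
have n1 := xi_nm si uU aU; have n2 := xi_nm si uU a1.
have h1 : d (E (xi si u al')) (E (xi si u al)) <= `|al' - al|.
  apply: le_trans (bx_le bx c' c _ _) _; [rlra|rlra|].
  by have := xi_pd si u al' u al; rewrite subrr normr0 add0r.
have := f' l Ll; have := dtri (E (xi si u al)) (E (xi si u al')) l.
have := ler_norm (- (al' - al)); rewrite normrN; rlra.
Qed.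

Lemma Sw0 si (u : R) : `|u| <= U -> Sw si u 0.
Proof.
move=> uU; have [r0 r8 zr' U0' Ur'] := W_r; split; last by move=> l _; exact: d_ge0.
by rewrite xi0; apply: Om_clO; apply: k_Om; rlra.
Qed.

(** What a leaf looks like in the window: a line of the chart, oriented along [e]. The curve [k'] is
    kept in order to exclude crossings with [k]. *)
Definition ln w f := [/\ nm f = 1, pd w z <= 3 * U, 1 / 2 <= dotp f e & exists k', (forall x : R, tl k' x) /\
  forall x : R, `|x| < r / 8 -> [/\ Lim (k' x), clO b (mv w x f) & k' x = E (mv w x f)]].
(** The signed height, over the point [u] of the leaf, of the line through [w] directed by [f],
    multiplied by [dotp f e] to clear the denominator. *)
Definition hA si w f (u : R) : R := dotp f e * dotp (w.1 - z.1, w.2 - z.2) (nrm si)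
  + (u - dotp (w.1 - z.1, w.2 - z.2) e) * dotp f (nrm si).

(** A change of sign gives a zero [u0] of the affine height between the two parameters: a crossing
    of two leaves inside the box, transversal since the slope is not zero. *)
Lemma line_noncross si w f (u u' : R) : ln w f -> `|u| <= 3 * U -> `|u'| <= 3 * U -> 0 < hA si w f u -> 0 < hA si w f u'.
Proof.
move=> [f1 wz fe [k' [k'tl hk']]] uU uU' hp; have [r0 r8 zr' U0' Ur'] := W_r.
rewrite ltNge; apply/negP => hn.
set fn := dotp f (nrm si); set le := dotp (w.1 - z.1, w.2 - z.2) e; set H := dotp (w.1 - z.1, w.2 - z.2) (nrm si).
have hAff v v' : hA si w f v - hA si w f v' = (v - v') * fn by rewrite /hA -/fn -/le; ring.
have huu := hAff u u'.
have fn0 : fn != 0 by apply/eqP => h0; move: huu; rewrite h0 mulr0; rlra.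
pose u0 := u - hA si w f u / fn.
have h0 : hA si w f u0 = 0.
  have := hAff u0 u; rewrite (_ : u0 - u = - (hA si w f u / fn)); last by rewrite /u0; ring.
  by rewrite mulNr divfK //; rlra.
have u0U : `|u0| <= 3 * U.
  have hx : 0 <= hA si w f u <= (u - u') * fn by apply/andP; split; rlra.
  move: hx uU uU'; rewrite /u0; move: (hA si w f u) => h /andP[h1 h2] k1 k2.
  have := ler_norm u; have := ler_norm (- u); have := ler_norm u'; have := ler_norm (- u'); rewrite !normrN => *.
  have [fp|fneg] := ltP 0 fn.
    have : 0 <= h / fn <= u - u' by rewrite divr_ge0 ?(ltW fp) //= ler_pdivrMr.
    by move=> /andP[q1 q2]; rewrite ler_norml; apply/andP; split; rlra.
  have fl : fn < 0 by rewrite lt_neqAle fn0.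
  have : u - u' <= h / fn <= 0.
    by rewrite ler_ndivlMr // h2 /= mulr_ge0_le0 // invr_le0.
  by move=> /andP[q1 q2]; rewrite ler_norml; apply/andP; split; rlra.
have le3 : `|le| <= 3 * U.
  by apply: le_trans (dotp_norm _ _) _; rewrite e1 mulr1.
have fe0 : 0 < dotp f e by rlra.
pose x0 := (u0 - le) / dotp f e.
have x0r : `|x0| < r / 16.
  rewrite normrM normfV (gtr0_norm fe0) ltr_pdivrMr //.
  have h1 := ler_normB u0 le.
  have : r / 16 * (1 / 2) <= r / 16 * dotp f e by rewrite ler_pM2l //; rlra.
  rlra.
have e2 := e_sqr; have ss := sgn_sqr si.
have meet : mv w x0 f = mv z u0 e.
  have hx : x0 * dotp f e = u0 - le by rewrite /x0 divfK // gt_eqF.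
  have hh : H + x0 * fn = 0.
    have : dotp f e * (H + x0 * fn) = 0.
      rewrite -h0 /hA -/le -/H -/fn -hx; ring.
    by move/eqP; rewrite mulf_eq0 (gt_eqF fe0) => /eqP.
  have d1 : (mv w x0 f).1 - (mv z u0 e).1 = (le + x0 * dotp f e - u0) * e.1 + (H + x0 * fn) * (nrm si).1.
    rewrite /le /H /fn /dotp /nrm /mv /=.
    transitivity (((w.1 - z.1) + x0 * f.1 ) * (e.1 ^+ 2 + (sgn si * sgn si) * e.2 ^+ 2) - u0 * e.1 + ((w.2 - z.2) + x0 * f.2) * (e.1 * e.2) * (1 - sgn si * sgn si)); last by ring.
    by rewrite ss mul1r e2; ring.
  have d2 : (mv w x0 f).2 - (mv z u0 e).2 = (le + x0 * dotp f e - u0) * e.2 + (H + x0 * fn) * (nrm si).2.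
    rewrite /le /H /fn /dotp /nrm /mv /=.
    transitivity (((w.2 - z.2) + x0 * f.2 ) * (e.2 ^+ 2 + (sgn si * sgn si) * e.1 ^+ 2) - u0 * e.2 + ((w.1 - z.1) + x0 * f.1) * (e.1 * e.2) * (1 - sgn si * sgn si)); last by ring.
    by rewrite ss mul1r (addrC (e.2 ^+ 2)) e2; ring.
  have z0 : le + x0 * dotp f e - u0 = 0 by rewrite hx; ring.
  rewrite hh z0 !mul0r addr0 in d1 d2.
  by apply: pd_eq0; rewrite /pd d1 d2; exact: nm00.
have u04 : `|u0| < r / 4 by rlra.
have gp' : good E (mv z u0 e).
  by apply: (bx_good bx); [exact: k_Om|have := nm_mv z u0 e1; rlra].
have k0 : 0 < r / 16 by rlra.
have l1 : line_at k u0 E (mv z u0 e) e (r / 16).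
  by move=> x hx; rewrite hk ?mvD //; apply: le_lt_trans (ler_normD _ _) _; rlra.
have l2 : line_at k' x0 E (mv z u0 e) f (r / 16).
  move=> x hx; have [|_ _ ->] := hk' (x0 + x); first by apply: le_lt_trans (ler_normD _ _) _; rlra.
  by rewrite -mvD meet.
have n0 : `|0 : R| < r / 16 by rewrite normr0.
have p1 : k u0 = E (mv z u0 e) by have := l1 0 n0; rewrite addr0 mv0.
have p2 : k' x0 = E (mv z u0 e) by have := l2 0 n0; rewrite addr0 mv0.
move/eqP: fn0; apply.
have := cross (@ktl u0) (k'tl x0) gp' p1 p2 e1 f1 k0 k0 l1 l2.
by rewrite /fn /dotp /nrm /= => -[] -> /=; ring.
Qed.

(** Pythagoras. The component perpendicular to the line is affine in [u] and [al] jointly, which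
    makes freeness of balls a convex condition. *)
Lemma pd_line si w f (u al x : R) : nm f = 1 ->
  pd (xi si u al) (mv w x f) ^+ 2 = (hA si w f u - al * dotp f e) ^+ 2
    + (dotp ((xi si u al).1 - w.1, (xi si u al).2 - w.2) f - x) ^+ 2.
Proof.
move=> /nm_eq1 f1; have e2 := e_sqr; have ss := sgn_sqr si.
set D1 := (xi si u al).1 - w.1; set D2 := (xi si u al).2 - w.2.
have cr : (hA si w f u - al * dotp f e) ^+ 2 = (D1 * f.2 - D2 * f.1) ^+ 2.
  have -> : hA si w f u - al * dotp f e = - sgn si * (D1 * f.2 - D2 * f.1).
    rewrite /hA /D1 /D2 /xi /mv /nrm /dotp /=.
    set s := sgn si in ss *; set A := w.1 - z.1; set B := w.2 - z.2.
    have -> : z.1 + u * e.1 + al * (s * e.2) - w.1 = u * e.1 + al * s * e.2 - A by rewrite /A; ring.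
    have -> : z.2 + u * e.2 + al * - (s * e.1) - w.2 = u * e.2 - al * s * e.1 - B by rewrite /B; ring.
    transitivity ((- s * ((u * e.1) * f.2 - (u * e.2) * f.1) - al * (f.1 * e.1 + f.2 * e.2)) + s * (A * f.2 - B * f.1) * (e.1 ^+ 2 + e.2 ^+ 2)).
      by ring.
    rewrite e2; transitivity (- s * (u * e.1 * f.2 - u * e.2 * f.1 - (A * f.2 - B * f.1)) - (s * s) * al * (e.2 * f.2 + e.1 * f.1)); last by ring.
    rewrite ss; ring.
  by rewrite exprMn sqrrN (expr2 (sgn si)) ss mul1r.
rewrite cr pd_sqr /mv /=.
have -> : (xi si u al).1 - (w.1 + x * f.1) = D1 - x * f.1 by rewrite /D1; ring.
have -> : (xi si u al).2 - (w.2 + x * f.2) = D2 - x * f.2 by rewrite /D2; ring.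
rewrite /dotp /=.
transitivity ((D1 ^+ 2 + D2 ^+ 2) * (f.1 ^+ 2 + f.2 ^+ 2) - 2 * x * (D1 * f.1 + D2 * f.2) + x ^+ 2 * (f.1 ^+ 2 + f.2 ^+ 2)).
  by rewrite f1; transitivity (D1 ^+ 2 + D2 ^+ 2 - 2 * x * (D1 * f.1 + D2 * f.2) + x ^+ 2 * (f.1 ^+ 2 + f.2 ^+ 2)); [ring|rewrite f1; ring].
by rewrite f1; transitivity ((D1 ^+ 2 + D2 ^+ 2) * (f.1 ^+ 2 + f.2 ^+ 2) - 2 * x * (D1 * f.1 + D2 * f.2) + x ^+ 2); [rewrite f1|]; ring.
Qed.


Lemma pd_axis (q : R * R) : 0 <= q.1 -> pd q (0, q.2) = q.1.
Proof. by move=> q0; rewrite /pd /= subrr subr0 nm_r0. Qed.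

Lemma mv_axis (a x tau : R) : mv (0, a) x (0, tau) = (0, a + tau * x).
Proof. by rewrite /mv /= mulr0 addr0 mulrC. Qed.

Lemma ln_orient w f0 (k0 : R -> X) : nm f0 = 1 -> `|f0.1| <= 1 / 2 -> pd w z <= 3 * U -> (forall x : R, tl k0 x) ->
  (forall x : R, `|x| < r / 8 -> [/\ Lim (k0 x), clO b (mv w x f0) & k0 x = E (mv w x f0)]) -> exists f, ln w f.
Proof.
move=> f01 fs wz ktl0 hk0; have [r0 r8 zr' U0' Ur'] := W_r.
have es : `|e.1| <= 1 / 16.
  apply: (le_trans st); rewrite ler_pdivrMr //; have := nm_fst z; rlra.
have := steep_dot f01 e1 fs es.
have [h|h] := leP 0 (dotp f0 e).
  by rewrite (ger0_norm h) => h2; exists f0; split => //; exists k0.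
rewrite (ltr0_norm h) => h2; exists (- f0.1, - f0.2); split => //; first by rewrite nmN.
  by rewrite /dotp /= in h2 *; rlra.
exists (fun x => k0 (- x)); split.
  by move=> x; have := tl_opp (@ktl0 (- x)); rewrite opprK.
by move=> x xr; rewrite mvN; apply: hk0; rewrite normrN.
Qed.

(** The line is the leaf through [l]; if [l] is not seen at its distance in the chart, the axis is
    no farther and is used instead. *)
Lemma near_line si (u al : R) l : `|u| <= U -> 0 <= al <= U -> clO b (xi si u al) -> Lim l ->
  d (E (xi si u al)) l < al -> exists w f, ln w f /\ pd (xi si u al) w < al.
Proof.
move=> uU aU c Ll dl; have [r0 r8 zr' U0' Ur'] := W_r.
have n1 := xi_nm si uU aU; have [a0 aU'] := andP aU.
have n1' : nm (xi si u al) < r by rlra.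
have dxi := bx_nm bx c n1'.
have dyl : d y l < r / 16 by apply: le_lt_trans (dtri (E (xi si u al)) _ _) _; rewrite dxi; rlra.
have [la lla la0] := leaf_ex Ll.
have dyla : d y (la 0) < r / 4 by rewrite la0; rlra.
have [w0 [f0 [[cw nw f01 st0] hw0]]] := box_leaf bx lla dyla.
have r40 : `|0 : R| < r / 4 by rewrite normr0; rlra.
have El : l = E w0 by have := hw0 0 r40; rewrite addr0 mv0 la0.
rewrite la0 in nw.
have wr : nm w0 < r by rlra.
have xz : pd (xi si u al) z <= 2 * U by have := xi_z si u al; rewrite (ger0_norm a0); rlra.
have wz w : pd (xi si u al) w < al -> pd w z <= 3 * U.
  by move=> h; apply: le_trans (pd_tri (xi si u al) _ _) _; rewrite (pdC w); rlra.
rewrite El in dl; case: (bx_pd bx c cw n1' wr) => [h|[hb h]].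
  rewrite h in dl; exists w0.
  have [||f hf] := @ln_orient w0 f0 la f01 _ (wz _ dl) (fun x => leaf_tl lla).
  - by apply: (le_trans st0); rewrite ler_pdivrMr //; have := nm_fst w0; rlra.
  - move=> x xr; have x4 : `|x| < r / 4 by rlra.
    rewrite -hw0 // add0r; split => //; first exact: leaf_Lim.
    have w4 : nm w0 < r / 4 by rlra.
    by have [] := clO_mv bx cw w4 f01 st0 x4.
  by exists f.
have w1 : 0 <= w0.1 by case: cw; rewrite ?hb.
have x1 : 0 <= (xi si u al).1 by case: c; rewrite ?hb.
have [ka [tau [lka ka0 ht hka]]] := box_axis bx Ly.
have tn : `|tau| = 1 by case: ht => ->; rewrite ?normrN normr1.
have t2 : tau * tau = 1 by case: ht => ->; ring.
pose w : R * R := (0, (xi si u al).2).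
have pdw : pd (xi si u al) w < al.
  rewrite /w pd_axis //; rlra.
have x2r := le_lt_trans (nm_snd (xi si u al)) n1.
have [||||f hf] := @ln_orient w (0, tau) (fun x => ka (tau * (xi si u al).2 + x)) _ _ (wz _ pdw).
- by rewrite nm_0u.
- by rewrite /= normr0; rlra.
- by move=> x; apply: tl_shift; exact: leaf_tl.
- move=> x xr; have e3 : tau * (tau * (xi si u al).2 + x) = (xi si u al).2 + tau * x by rewrite mulrDr mulrA t2 mul1r.
  have mvx : mv w x (0, tau) = (0, (xi si u al).2 + tau * x) by rewrite /w mv_axis.
  rewrite mvx; split; [exact: leaf_Lim|by right|].
  rewrite hka ?e3 //; apply: le_lt_trans (ler_normD _ _) _; rewrite normrM tn; rlra.
by exists w, f.
Qed.

(** The distance from the centre to the line is at least [al]. Of the two signs of the perpendicular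
    component, one would put the line on the other side of the leaf; the other is the inequality. *)
Lemma Sw_line si (u al : R) w f : `|u| <= U -> 0 <= al <= U -> Sw si u al -> ln w f -> 0 < hA si w f u ->
  al * (1 + dotp f e) <= hA si w f u.
Proof.
move=> uU aU [c fr'] [f1 wz fe [k' [k'tl hk']]] hp; have [r0 r8 zr' U0' Ur'] := W_r.
have [a0 aU'] := andP aU; have n1 := xi_nm si uU aU.
set x1 := dotp ((xi si u al).1 - w.1, (xi si u al).2 - w.2) f.
have xz : pd (xi si u al) z <= 2 * U by have := xi_z si u al; rewrite (ger0_norm a0); rlra.
have xw : pd (xi si u al) w <= 5 * U by apply: le_trans (pd_tri z _ _) _; rewrite (pdC z); rlra.
have x1r : `|x1| <= 5 * U by apply: le_trans (dotp_norm _ _) _; rewrite f1 mulr1.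
have [|L1 c1 E1] := hk' x1; first by rlra.
have nw : nm (mv w x1 f) < r by have := nm_mv w x1 f1; have := nm_pd w z; rlra.
have n1' : nm (xi si u al) < r by rlra.
have key : al <= `|hA si w f u - al * dotp f e|.
  apply: le_trans (fr' _ L1) _; rewrite E1; apply: le_trans (bx_le bx c c1 n1' nw) _.
  by rewrite -ler_sqr ?nnegrE ?pd_ge0 // pd_line // -/x1 subrr expr0n addr0 real_normK ?num_real.
have fe1 : dotp f e <= 1 by have := dotp_le f e; rewrite f1 e1 mulr1.
have afe : al * dotp f e <= al by rewrite ler_piMr.
rewrite mulrDr mulr1; have [h|h] := leP 0 (hA si w f u - al * dotp f e).
  by rewrite (ger0_norm h) in key; rlra.
by rewrite (ltr0_norm h) in key; rlra.
Qed.

Lemma hA_affine si w f (u u' la : R) : hA si w f (la * u + (1 - la) * u') = la * hA si w f u + (1 - la) * hA si w f u'.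
Proof. by rewrite /hA; ring. Qed.

(** A line entering the intermediate ball is somewhere on the side [si] of the leaf, hence, as
    leaves do not cross, over the whole window. It then obeys the affine inequality of [Sw_line] at
    both ends, so also in between, and misses the ball. *)
Lemma Sw_conv si (u al u' al' la : R) : `|u| <= U -> `|u'| <= U -> 0 <= al <= U -> 0 <= al' <= U -> 0 <= la <= 1 ->
  Sw si u al -> Sw si u' al' -> Sw si (la * u + (1 - la) * u') (la * al + (1 - la) * al').
Proof.
move=> uU uU' aU aU' /andP[l0 l1] s1 s2; have [r0 r8 zr' U0' Ur'] := W_r.
have l1' : 0 <= 1 - la by rewrite subr_ge0.
have conv (x y' M : R) : x <= M -> y' <= M -> la * x + (1 - la) * y' <= M.
  by move=> h1 h2; have := ler_wpM2l l0 h1; have := ler_wpM2l l1' h2; rlra.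
set u2 := la * u + _; set al2 := la * al + _.
have u2U : `|u2| <= U.
  apply: le_trans (ler_normD _ _) _; rewrite !normrM (ger0_norm l0) (ger0_norm l1'); exact: conv.
have [a0 a1] := andP aU; have [a0' a1'] := andP aU'.
have a2U : 0 <= al2 <= U.
  by apply/andP; split; [rewrite addr_ge0 // mulr_ge0|exact: conv].
have c2 : clO b (xi si u2 al2).
  have [[hb|h1] _] := s1; first by left.
  have [[hb|h2] _] := s2; first by left.
  right; have -> : (xi si u2 al2).1 = la * (xi si u al).1 + (1 - la) * (xi si u' al').1.
    by rewrite /u2 /al2 /xi /mv /=; ring.
  by rewrite addr_ge0 // mulr_ge0.
split => // l Ll; rewrite leNgt; apply/negP => hlt.
have [w [f [hl pw]]] := near_line u2U a2U c2 Ll hlt.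
have [f1 wz fe _] := hl; have [a20 a2U'] := andP a2U.
have al20 : 0 < al2 by apply: le_lt_trans pw; exact: pd_ge0.
set lw := dotp (w.1 - z.1, w.2 - z.2) e.
have lwU : `|lw| <= 3 * U by apply: le_trans (dotp_norm _ _) _; rewrite e1 mulr1.
have fe0 : 0 < dotp f e by rlra.
have Hp : 0 < hA si w f lw.
  rewrite /hA -/lw subrr mul0r addr0; apply: mulr_gt0 => //.
  have h1 := dotp_le ((xi si u2 al2).1 - w.1, (xi si u2 al2).2 - w.2) (nrm si).
  rewrite nm_nrm mulr1 -/(pd _ _) in h1.
  have : dotp ((xi si u2 al2).1 - w.1, (xi si u2 al2).2 - w.2) (nrm si) = al2 - dotp (w.1 - z.1, w.2 - z.2) (nrm si).
    rewrite /dotp /xi /mv /nrm /=.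
    transitivity (al2 * (sgn si * sgn si) * (e.1 ^+ 2 + e.2 ^+ 2) - ((w.1 - z.1) * (sgn si * e.2) + (w.2 - z.2) * - (sgn si * e.1))); first by ring.
    by rewrite sgn_sqr e_sqr; ring.
  rlra.
have p1 : 0 < hA si w f u by apply: (line_noncross hl lwU) => //; rlra.
have p2 : 0 < hA si w f u' by apply: (line_noncross hl lwU) => //; rlra.
have q1 := Sw_line uU aU s1 hl p1; have q2 := Sw_line uU' aU' s2 hl p2.
have q3 : al2 * (1 + dotp f e) <= hA si w f u2.
  rewrite hA_affine; have := ler_wpM2l l0 q1; have := ler_wpM2l l1' q2.
  rewrite (_ : al2 * (1 + dotp f e) = la * (al * (1 + dotp f e)) + (1 - la) * (al' * (1 + dotp f e))); last by rewrite /al2; ring.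
  rlra.
have := pd_line si w u2 al2 0 f1; rewrite mv0 => q4.
have q5 : al2 ^+ 2 <= (hA si w f u2 - al2 * dotp f e) ^+ 2 by rewrite ler_sqr ?nnegrE; rlra.
have q6 : pd (xi si u2 al2) w ^+ 2 < al2 ^+ 2 by rewrite ltr_sqr ?nnegrE ?pd_ge0.
by have := sqr_ge0 (dotp ((xi si u2 al2).1 - w.1, (xi si u2 al2).2 - w.2) f - 0); rlra.
Qed.

End Window.
(* Around the point [c v] of a leaf, [S si u al] says that the ball of radius [al] tangent to the leaf at
   [c (v + u)], on the side [si], contains no point of the limit set; [Xc si u al] is its centre. *)
Record win (c : R -> X) (v U : R) (S : bool -> R -> R -> Prop) (Xc : bool -> R -> R -> X) : Prop := Win {
  w_0 : forall si (u : R), `|u| <= U -> S si u 0;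
  w_conv : forall si (u al u' al' la : R), `|u| <= U -> `|u'| <= U -> 0 <= al <= U -> 0 <= al' <= U -> 0 <= la <= 1 ->
    S si u al -> S si u' al' -> S si (la * u + (1 - la) * u') (la * al + (1 - la) * al');
  w_St : forall si (u al : R), `|u| <= U -> 0 < al <= U -> S si u al -> St (c (v + u)) (Xc si u al) al;
  w_ex : forall (u al : R) x, `|u| <= U -> 0 < al <= U -> St (c (v + u)) x al -> exists si, S si u al /\ x = Xc si u al;
  w_lip : forall si (u al u' al' : R), `|u| <= U -> `|u'| <= U -> 0 <= al <= U -> 0 <= al' <= U ->
    S si u al -> S si u' al' -> d (Xc si u al) (Xc si u' al') <= `|u - u'| + `|al - al'|;
  w_sides : forall si (u al u' al' : R), `|u| <= U -> `|u'| <= U -> 0 <= al <= U -> 0 <= al' <= U ->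
    S si u al -> S (~~ si) u' al' -> al + al' <= d (Xc si u al) (Xc (~~ si) u' al');
  w_closed : forall si (u al : R), `|u| <= U -> 0 <= al <= U ->
    (forall ep, 0 < ep -> exists al', [/\ 0 <= al' <= U, `|al' - al| < ep & S si u al']) -> S si u al }.

(** * Free balls along a half leaf without vertices *)

Section Ray.
Variables (ga : R -> X) (s1 u1 : R).
Hypothesis lg : leaf ga.
Hypothesis nV : forall u : R, 0 < u -> ~ V (ga (s1 + u)).
Hypothesis u10 : 0 < u1.

(** [U] comes from [box_cover], with boxes no larger than [u1] so that a window at [v >= u1] does
    not reach back to [s1]. After [s1] the leaf meets no vertex, so it is never the axis of a half
    disc. *)
Lemma win_ex : exists2 U : R, 0 < U & forall v, u1 <= v -> exists S Xc, win (fun u => ga (s1 + u)) v U S Xc.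
Proof.
have [p0 Lp0] := Lim_ne.
have [rho rho0 hc] := @box_cover Lim p0 (fun p h => h) Lim_closed (fun ga s s' l _ => leaf_Lim s' l) u1 u10.
exists (rho / 8); first by rlra.
move=> v uv; have u10' := u10; have [y [E [r [b [Ly bx hq hr ru]]]]] := hc _ (leaf_Lim (s1 + v) lg).
have [r0 r8] := box_gt0 bx.
have hq4 : d y (ga (s1 + v)) < r / 4 by rlra.
have [z [e [[cz nz e1 st] hz]]] := box_leaf bx lg hq4.
have zr : nm z < r / 64 by rewrite nz.
have oz : Om b z.
  case: cz => [hb|z0]; [by left|]; have [z1|z1] := ltP 0 z.1; first by right.
  have z10 : z.1 = 0 by rlra.
  have [hb|hb] := boolP b; first by left.
  have e10 : e.1 = 0.
    by apply/eqP; rewrite -normr_eq0 eq_le normr_ge0 andbT; move: st; rewrite z10 normr0 mulr0 mul0r.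
  have e2 : e.2 * e.2 = 1 by move/nm_eq1: e1; rewrite e10 expr0n add0r expr2.
  have e2n : `|e.2| <= 1 by rewrite -e1; exact: nm_snd.
  have z2 := le_lt_trans (nm_snd z) zr.
  have x0n : `|- (z.2 * e.2)| <= `|z.2| by rewrite normrN normrM ler_piMr.
  exfalso; apply: (nV (u := v - z.2 * e.2)).
    by have := ler_norm (z.2 * e.2); rewrite -normrN; rlra.
  have x0r : `|- (z.2 * e.2)| < r / 4 by rlra.
  rewrite addrA (hz _ x0r).
  have -> : mv z (- (z.2 * e.2)) e = (0, 0).
    rewrite /mv z10 e10 mulr0 addr0; congr pair.
    by transitivity (z.2 * (1 - e.2 * e.2)); [ring|rewrite e2; ring].
  by rewrite (bx_0 bx); apply: (bx_b bx); exact: negbTE.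
have U0 : 0 < rho / 8 by rlra.
have Ur : 512 * (rho / 8) <= r by rlra.
have hk (x : R) : `|x| < r / 4 -> ga (s1 + (v + x)) = E (mv z x e) by move=> /hz; rewrite addrA.
have ktl (x : R) : tl (fun x => ga (s1 + (v + x))) x.
  have := tl_shift (leaf_tl lg : tl ga ((s1 + v) + x)).
  by rewrite (_ : (fun x => ga (s1 + v + x)) = (fun x => ga (s1 + (v + x)))) //; apply: funext => x'; rewrite addrA.
have kL (x : R) : Lim (ga (s1 + (v + x))) := leaf_Lim _ lg.
exists (Sw E b z e), (fun si u al => E (xi z e si u al)); split.
- by move=> si u; exact: (Sw0 bx Ly oz zr e1 st hk ktl kL U0 Ur).
- by move=> si u al u' al' la; exact: (Sw_conv bx Ly oz zr e1 st hk ktl kL U0 Ur).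
- by move=> si u al; exact: (Sw_St bx Ly oz zr e1 st hk ktl kL U0 Ur).
- by move=> u al x; exact: (St_Sw bx Ly oz zr e1 st hk ktl kL U0 Ur).
- by move=> si u al u' al'; exact: (Sw_lip bx Ly oz zr e1 st hk ktl kL U0 Ur).
- by move=> si u al u' al'; exact: (Sw_sides bx Ly oz zr e1 st hk ktl kL U0 Ur).
- by move=> si u al; exact: (Sw_closed bx Ly oz zr e1 st hk ktl kL U0 Ur).
Qed.

Variable U : R.
Hypothesis U0 : 0 < U.
Local Notation c := (fun u => ga (s1 + u)).
Hypothesis hwin : forall v, u1 <= v -> exists S Xc, win c v U S Xc.

(* A maximal free ball tangent to the leaf at [c v], larger ones existing just before [v]. *)
Definition cs (v a mu : R) := [/\ u1 <= v, 0 < a <= U & exists x, [/\ St (c v) x a,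
  forall x' (a' : R), a < a' <= U -> St (c v) x' a' -> a <= d x x' &
  exists2 ep : R, 0 < ep & forall h : R, 0 < h < ep -> exists xh (ah : R), [/\ a + mu * h <= ah, ah <= U, St (c (v - h)) xh ah & d xh x < a]]].

Lemma win_down v S Xc si (u al al' : R) : win c v U S Xc -> `|u| <= U -> 0 < al <= U -> 0 <= al' <= al -> S si u al -> S si u al'.
Proof.
move=> W uU /andP[a0 aU] /andP[b0 ba] s; have U0' := U0.
have h := w_conv W uU uU (la := al' / al) (al := al) (al' := 0) _ _ _ s (w_0 W si uU).
have e1 : al' / al * u + (1 - al' / al) * u = u by ring.
have e2 : al' / al * al + (1 - al' / al) * 0 = al' by rewrite mulr0 addr0 divfK // gt_eqF.
rewrite e1 e2 in h; apply: h.
- by rewrite ltW.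
- by rewrite lexx ltW.
- by rewrite divr_ge0 ?(ltW a0) //= ler_pdivrMr // mul1r.
Qed.

(** [a] is the largest free radius on the side [si] at [v + dl]. By convexity the pairs between
    [(0, al)] and [(dl, a)] are free, which gives the slope just before; balls on the other side are
    kept away by [w_sides]. *)
Lemma win_step v S Xc si (al dl : R) : u1 <= v -> win c v U S Xc -> 0 < al <= U -> 0 < dl <= U / 2 ->
  S si 0 al -> ~ S si dl al -> exists a, [/\ 0 < a < al, S si dl a & cs (v + dl) a ((al - a) / dl)].
Proof.
move=> uv W /andP[al0 alU] /andP[dl0 dlU] s0 ns; have U0' := U0.
have n0 : `|0 : R| <= U by rewrite normr0 ltW.
have nd : `|dl| <= U by rewrite gtr0_norm //; rlra.
have nU : `|U| <= U by rewrite gtr0_norm.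
pose A := [set a : R | 0 <= a <= U /\ S si dl a].
(* The radius guaranteed by convexity with the pair [(U, 0)]; it makes the supremum positive. *)
pose aa := (1 - dl / U) * al.
have q0 : 1 / 2 <= 1 - dl / U.
  have : dl / U <= 1 / 2 by rewrite ler_pdivrMr //; rlra.
  rlra.
have q1 : 1 - dl / U <= 1 by rewrite gerBl divr_ge0 // ltW.
have aa0 : 0 < aa by rewrite mulr_gt0 //; rlra.
have aal : aa <= al by rewrite /aa ler_piMl // ltW.
have Aaa : A aa.
  split; first by rewrite (ltW aa0); rlra.
  have h := w_conv W n0 nU (la := 1 - dl / U) (al := al) (al' := 0) _ _ _ s0 (w_0 W si nU).
  have e1 : (1 - dl / U) * 0 + (1 - (1 - dl / U)) * U = dl by field; rewrite gt_eqF.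
  have e2 : (1 - dl / U) * al + (1 - (1 - dl / U)) * 0 = aa by rewrite /aa; ring.
  rewrite e1 e2 in h; apply: h; [by rewrite ltW|by rewrite lexx ltW|by apply/andP; split; rlra].
have sA : has_sup A by split; [exists aa|exists U => x [/andP[_ ?] _]].
pose a := sup A.
have ub x : A x -> x <= a by move=> Ax; apply: ub_le_sup => //; case: sA.
have aa_a : aa <= a by exact: ub.
have a0 : 0 < a by rlra.
have aU : a <= U by apply: ge_sup; [exists aa|move=> x [/andP[_ ?] _]].
have Sa : S si dl a.
  apply: (w_closed W) => //; first by rewrite (ltW a0).
  move=> ep ep0; have [x Ax hx] := sup_adherent ep0 sA; have [x1 x2] := Ax.
  exists x; split => //; have := ub _ Ax; rewrite -/a in hx => h; rewrite ltr_norml; apply/andP; split; rlra.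
have aal' : a < al.
  rewrite ltNge; apply/negP => h; apply: ns; apply: (win_down W nd _ _ Sa); first by rewrite a0.
  by rewrite (ltW al0).
exists a; split => //; first by rewrite a0.
have a0U : 0 <= a <= U by rewrite (ltW a0).
have mu0 : 0 < (al - a) / dl by rewrite divr_gt0 // subr_gt0.
set mu := (al - a) / dl in mu0 *.
split; [by rlra|by rewrite a0|exists (Xc si dl a); split].
- by apply: (w_St W); rewrite ?a0.
- move=> x' a' /andP[h1 h2] sx.
  have a'0 : 0 < a' <= U by apply/andP; split; rlra.
  have a'0' : 0 <= a' <= U by apply/andP; split; rlra.
  have [si' [Ss' ->]] := w_ex W nd a'0 sx.
  have [es|es] := eqVneq si' si.
    have a'a : a' <= a by apply: ub; split => //; rewrite -es.
    rlra.
  have e2 : si' = ~~ si by case: si' si {s0 ns A Aaa sA a ub aa_a a0 aU Sa aal' a0U mu0 mu Ss' h1 sx} es => -[].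
  by subst si'; have := w_sides W nd nd a0U a'0' Sa Ss'; rlra.
- exists (Num.min dl (a / (1 + mu))); first by rewrite lt_min dl0 divr_gt0 //; rlra.
  move=> h /andP[h0]; rewrite lt_min => /andP[h1 h2].
  have hd : 0 <= h / dl <= 1 by rewrite divr_ge0 ?(ltW h0) ?(ltW dl0) //= ler_pdivrMr // mul1r ltW.
  have alU' : 0 <= al <= U by rewrite (ltW al0).
  have hS := w_conv W n0 nd alU' a0U hd s0 Sa.
  have e1 : h / dl * 0 + (1 - h / dl) * dl = dl - h by field; rewrite gt_eqF.
  have e2 : h / dl * al + (1 - h / dl) * a = a + mu * h by rewrite /mu; field; rewrite gt_eqF.
  rewrite e1 e2 in hS.
  have muh : mu * h <= al - a.
    by rewrite (_ : al - a = mu * dl); [rewrite ler_pM2l // ltW|rewrite /mu divfK // gt_eqF].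
  have muh0 : 0 < mu * h by rewrite mulr_gt0.
  have ndh : `|dl - h| <= U by rewrite ger0_norm; rlra.
  have ahU : 0 < a + mu * h <= U by apply/andP; split; rlra.
  have ahU' : 0 <= a + mu * h <= U by apply/andP; split; rlra.
  exists (Xc si (dl - h) (a + mu * h)), (a + mu * h); split => //.
  + by case/andP: ahU.
  + by have := w_St W ndh ahU hS; rewrite (addrA v dl).
  + apply: le_lt_trans (w_lip W ndh nd ahU' a0U hS Sa) _.
    rewrite (_ : dl - h - dl = - h); last by ring.
    rewrite (_ : a + mu * h - a = mu * h); last by ring.
    rewrite normrN !gtr0_norm //; rewrite ltr_pdivlMr in h2; rlra.
Qed.

(** The largest radius is concave, so its decrease continues at least as fast: a ball too large at
    [v + U / 2], combined with one just before [v], would beat the maximal ball at [v]. *)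
Lemma chain_step v a mu : cs v a mu -> 0 < mu -> exists a' mu', [/\ cs (v + U / 2) a' mu', mu <= mu' & a' <= a - mu * (U / 2)].
Proof.
move=> [uv /andP[a0 aU] [x [sx hmax [ep ep0 hb]]]] mu0; have U0' := U0.
have [S [Xc W]] := hwin uv.
have n0 : `|0 : R| <= U by rewrite normr0 ltW.
have aU0 : 0 < a <= U by rewrite a0.
have aU1 : 0 <= a <= U by rewrite (ltW a0).
have sx' : St (c (v + 0)) x a by rewrite addr0.
have [si [Sa xE]] := w_ex W n0 aU0 sx'.
pose dl := U / 2; have dl0 : 0 < dl by rewrite /dl; rlra.
have nd : `|dl| <= U by rewrite gtr0_norm // /dl; rlra.
have claim (al : R) : 0 <= al <= U -> S si dl al -> al <= a - mu * dl.
  move=> alU Sal; rewrite leNgt; apply/negP => hlt.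
  pose h := Num.min (ep / 2) dl.
  have h0 : 0 < h by rewrite lt_min dl0 divr_gt0.
  have [h1 h2] : h <= ep / 2 /\ h <= dl by split; rewrite /h ge_min lexx ?orbT.
  have [|xh [ah [k1 k2 k3 k4]]] := hb h; first by rewrite h0; rlra.
  have muh : 0 < mu * h by rewrite mulr_gt0.
  have ahU : 0 < ah <= U by apply/andP; split; rlra.
  have ahU' : 0 <= ah <= U by apply/andP; split; rlra.
  have nh : `|- h| <= U by rewrite normrN gtr0_norm // /dl in h2 *; rlra.
  have [si' [Ss' xhE]] := w_ex W nh ahU k3.
  (* Centres on opposite sides would be at least [ah + a] apart, but these are closer than [a]. *)
  have es : si' = si.
    have [//|es] := eqVneq si' si.
    have e2 : si = ~~ si' by case: (si') es; case: (si).
    rewrite e2 in Sa xE; have := w_sides W nh n0 ahU' aU1 Ss' Sa; rewrite -xhE -xE; lra.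
  subst si'; have dh : 0 < dl + h by rlra.
  pose la := dl / (dl + h).
  have la01 : 0 <= la <= 1 by rewrite divr_ge0 ?(ltW dl0) ?(ltW dh) //= ler_pdivrMr // mul1r lerDl ltW.
  have hS := w_conv W nh nd ahU' alU la01 Ss' Sal.
  have e1 : la * - h + (1 - la) * dl = 0 by rewrite /la; field; rewrite gt_eqF.
  rewrite e1 in hS; set al2 := la * ah + _ in hS.
  have al2a : a < al2.
    rewrite -subr_gt0; have -> : al2 - a = (dl * (ah - (a + mu * h)) + h * (al - (a - mu * dl))) / (dl + h).
      by rewrite /al2 /la; field; rewrite gt_eqF.
    by rewrite divr_gt0 // ltr_wpDl ?mulr_ge0 ?mulr_gt0 ?subr_gt0 ?subr_ge0 // ltW.
  have al2U : al2 <= U.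
    case/andP: la01 => l0 l1; case/andP: alU => _ alU; case/andP: ahU => _ ahU.
    have l1' : 0 <= 1 - la by rewrite subr_ge0.
    by have := ler_wpM2l l0 ahU; have := ler_wpM2l l1' alU; rewrite /al2; rlra.
  (* Capped so that the new centre is within [a / 2] of [x], against the maximality clause of
     [cs]. *)
  pose al3 := Num.min al2 (3 / 2 * a).
  have al3a : a < al3 by rewrite lt_min al2a; rlra.
  have [m1 m2] : al3 <= al2 /\ al3 <= 3 / 2 * a by split; rewrite /al3 ge_min lexx ?orbT.
  have al20 : 0 < al2 <= U by apply/andP; split; rlra.
  have al30 : 0 < al3 <= U by apply/andP; split; rlra.
  have al30' : 0 <= al3 <= U by apply/andP; split; rlra.
  have S3 : S si 0 al3 by apply: (win_down W n0 al20 _ hS); apply/andP; split; rlra.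
  have hr : a < al3 <= U by rewrite al3a; case/andP: al30.
  have := w_St W n0 al30 S3; rewrite addr0 => /(hmax _ _ hr).
  have := w_lip W n0 n0 aU1 al30' Sa S3; rewrite -xE subrr normr0 add0r distrC gtr0_norm; rlra.
have mud : 0 < mu * dl by rewrite mulr_gt0.
have nS : ~ S si dl a by move=> /(claim _ aU1); rlra.
have dlh : 0 < dl <= U / 2 by rewrite dl0 /dl lexx.
have [a2 [/andP[a20 a2a] Sa2 hcs]] := win_step uv W aU0 dlh Sa nS.
have ha2 : a2 <= a - mu * dl by apply: claim => //; apply/andP; split; rlra.
exists a2, ((a - a2) / dl); split => //.
by rewrite ler_pdivlMr //; rlra.
Qed.

(** Every step costs at least [mu * (U / 2)] of radius, so finitely many steps exhaust it. *)
Lemma no_chain v a mu : cs v a mu -> 0 < mu -> False.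
Proof.
move=> h mu0; have U0' := U0.
have H (n : nat) : exists v' a' mu', [/\ cs v' a' mu', mu <= mu' & a' <= a - n%:R * (mu * (U / 2))].
  elim: n => [|n [v' [a' [mu' [h1 h2 h3]]]]]; first by exists v, a, mu; rewrite mul0r subr0.
  have mu'0 : 0 < mu' by rlra.
  have [a2 [mu2 [k1 k2 k3]]] := chain_step h1 mu'0.
  exists (v' + U / 2), a2, mu2; split => //; first exact: le_trans h2 k2.
  have : mu * (U / 2) <= mu' * (U / 2) by rewrite ler_pM2r //; rlra.
  have -> : n.+1%:R = n%:R + 1 :> R by rewrite natr1.
  rewrite mulrDl mul1r; move: h3 k3; set q := mu * _; set q' := mu' * _; set w := n%:R * q.
  rlra.
have m0 : 0 < mu * (U / 2) by rewrite mulr_gt0 //; rlra.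
have [_ /andP[a0 _] _] := h.
have := archi_boundP (divr_ge0 (ltW a0) (ltW m0)); set n := Num.bound _ => hn.
rewrite ltr_pdivrMr // in hn.
by have [v' [a' [mu' [[_ /andP[a'0 _] _] _ h3]]]] := H n; rlra.
Qed.

(** If the radius [a] were lost somewhere, the largest radius would have begun to decrease, against
    [no_chain]; and limits of free balls are free. *)
Lemma persist x0 (a : R) : 0 < a <= U -> St (c u1) x0 a -> forall u, u1 <= u -> exists x, St (c u) x a.
Proof.
move=> aU s0 u uu; have U0' := U0; have [a0 aU'] := andP aU.
have h0 : 0 <= u - u1 by rlra.
have -> : u = u1 + (u - u1) by ring.
apply: (real_induction (U := u - u1) (Q := fun t => exists x, St (c (u1 + t)) x a) h0) => //; last by rewrite lexx h0.
- by exists x0; rewrite addr0.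
- move=> t /andP[t0 tu] ht; have [x sx] := ht t (ltac:(by rewrite t0 lexx)).
  have uv : u1 <= u1 + t by rlra.
  have [S [Xc W]] := hwin uv.
  have n0 : `|0 : R| <= U by rewrite normr0 ltW.
  have [|si [Sa xE]] := w_ex W n0 aU (x := x); first by rewrite addr0.
  exists (U / 2); first by rlra.
  move=> v /andP[v1 v2] _.
  have dl : 0 < v - t <= U / 2 by apply/andP; split; rlra.
  have nd : `|v - t| <= U by rewrite gtr0_norm; rlra.
  have [Sd|nS] := EM (S si (v - t) a).
    exists (Xc si (v - t) a); have := w_St W nd aU Sd.
    by rewrite (_ : u1 + t + (v - t) = u1 + v) //; ring.
  have [a2 [/andP[a20 a2a] _ hcs]] := win_step uv W aU dl Sa nS.
  exfalso; apply: (no_chain hcs); apply: divr_gt0; rlra.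
- move=> t /andP[t0 tu] ht.
  have hx (n : nat) : exists x, St (c (u1 + (t - t / n.+1%:R))) x a.
    apply: ht; have n1 : 1 <= n.+1%:R :> R by rewrite ler1n.
    have n2 : 0 < n.+1%:R :> R by rlra.
    have h1 : 0 < t / n.+1%:R by rewrite divr_gt0.
    have h2 : t / n.+1%:R <= t by rewrite ler_pdivrMr // ler_peMr // ltW.
    move: (t / n.+1%:R) h1 h2 {n1 n2} => y h1 h2.
    by apply/andP; split; rlra.
  have [f hf] := choice hx; have [x hx'] := cluster f.
  exists x.
  have near (e : R) : 0 < e -> exists n, d (f n) x < e /\ d (c (u1 + (t - t / n.+1%:R))) (c (u1 + t)) < e.
    move=> e0; have et : 0 < e / t by rewrite divr_gt0.
    have [N hN] := small_inv et; have [n [Nn hn]] := hx' e e0 N.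
    exists n; split => //; apply: le_lt_trans (leaf_lip _ _ lg) _.
    have n2 : 0 < n.+1%:R :> R by rewrite ltr0n.
    rewrite (_ : s1 + (u1 + (t - t / n.+1%:R)) - (s1 + (u1 + t)) = - (t / n.+1%:R)); last by ring.
    rewrite normrN gtr0_norm ?divr_gt0 //; have := hN n Nn; rewrite ltr_pdivlMr //.
    by rewrite mulrC.
  split => //.
    have eqlim (y y' : R) : (forall ep, 0 < ep -> `|y - y'| < ep) -> y = y'.
      move=> h; apply/eqP; rewrite -subr_eq0 -normr_le0 leNgt; apply/negP => h1.
      by have := h _ h1; rewrite ltxx.
    apply: eqlim => e e0; have e2 : 0 < e / 2 by rlra.
    have [n [k1 k2]] := near _ e2; have [_ k3 _] := hf n.
    have q1 := dtri (f n) x (c (u1 + t)); have q2 := dtri (c (u1 + (t - t / n.+1%:R))) (f n) (c (u1 + t)).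
    have q3 := dtri x (f n) (c (u1 + (t - t / n.+1%:R))); have q4 := dtri (c (u1 + t)) x (c (u1 + (t - t / n.+1%:R))).
    rewrite (dC x (f n)) in q1; rewrite (dC (c (u1 + t)) (c (u1 + (t - t / n.+1%:R)))) in q4.
    by rewrite ltr_norml; apply/andP; split; rlra.
  move=> l Ll; rewrite leNgt; apply/negP => hlt.
  have e0 : 0 < a - d x l by rewrite subr_gt0.
  have [n [k1 _]] := near _ e0; have [_ _ k3] := hf n.
  by have := k3 l Ll; have := dtri x (f n) l; rlra.
Qed.

End Ray.
Lemma min3_ex (x y z : R) : 0 < x -> 0 < y -> 0 < z -> exists a : R, [/\ 0 < a, a <= x, a <= y & a <= z].
Proof.
move=> x0 y0 z0; exists (Num.min (Num.min x y) z); split; first by rewrite !lt_min x0 y0.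
- by rewrite !ge_min lexx.
- by rewrite !ge_min lexx orbT.
- by rewrite ge_min lexx orbT.
Qed.

(** Abscissas only: [z + w] belongs to the leaf farther from the axis, and lies beyond [z'] but
    closer than [a]; the ball tangent at [z'] has its centre at [z' + a * s], on that same far side,
    and covers it. *)
Lemma far_side (z z' w s a : R) : 0 < a -> 0 < z * z' -> `|z'| <= `|z| / 4 -> `|w| <= `|z| / 2 -> `|z| < a / 4 ->
  0 < s * z' -> `|s| <= 1 -> `|z' + a * s - (z + w)| < a.
Proof.
move=> a0 zz zs te za ss sn.
have as1 : `|a * s| <= a by rewrite normrM gtr0_norm // ger_pMr.
have := ler_norm (a * s); have := ler_norm (- (a * s)); have := ler_norm w; have := ler_norm (- w); rewrite !normrN.
have [zpos|zneg] := ltP 0 z.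
  have z'pos : 0 < z' by rewrite pmulr_rgt0 in zz.
  have s0 : 0 < s by rewrite pmulr_lgt0 in ss.
  have as0 : 0 < a * s by rewrite mulr_gt0.
  rewrite (gtr0_norm zpos) in zs te za; rewrite (gtr0_norm z'pos) in zs => *.
  by rewrite ltr_norml; apply/andP; split; rlra.
have z0 : z != 0 by apply/eqP => h; move: zz; rewrite h mul0r ltxx.
have zlt : z < 0 by rewrite lt_neqAle z0.
have z'neg : z' < 0 by rewrite nmulr_rgt0 in zz.
have s0 : s < 0 by rewrite nmulr_lgt0 in ss.
have as0 : a * s < 0 by rewrite pmulr_rlt0.
rewrite (ltr0_norm zlt) in zs te za; rewrite (ltr0_norm z'neg) in zs => *.
by rewrite ltr_norml; apply/andP; split; rlra.
Qed.

Lemma three_signs (x y z : R) : x != 0 -> y != 0 -> z != 0 -> [\/ 0 < x * y, 0 < y * z | 0 < x * z].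
Proof.
have sg (u v : R) : u != 0 -> v != 0 -> (0 < u) = (0 < v) -> 0 < u * v.
  move=> u0 v0; have [up /esym vp|un /esym vn] := ltP 0 u; first by rewrite mulr_gt0.
  by rewrite nmulr_rgt0 // lt_neqAle ?u0 ?v0 //= leNgt vn.
move=> x0 y0 z0; have [/sg h|h] := eqVneq (0 < x) (0 < y); first by constructor 1; apply: h.
have [/sg h'|h'] := eqVneq (0 < y) (0 < z); first by constructor 2; apply: h'.
by constructor 3; apply: sg => //; move: h h'; do 3 case: (_ < _).
Qed.

(** A ball on the near side would cover a point of the axis, so the normal towards the centre points
    away from the axis. *)
Lemma box_free_side y E r b k z e x (a : R) : box y E r b -> Lim y -> Om b z -> nm z < r / 64 -> nm e = 1 ->
  `|e.1| <= 4 * `|z.1| / r -> (forall x : R, `|x| < r / 4 -> k x = E (mv z x e)) -> (forall x : R, tl k x) ->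
  (forall x : R, Lim (k x)) -> 0 < a -> 512 * a <= r -> St (k 0) x a -> z.1 != 0 -> `|z.1| < a ->
  exists si, [/\ x = E (xi z e si 0 a), clO b (xi z e si 0 a), 0 < sgn si * e.2 * z.1 & nm (xi z e si 0 a) < r / 32].
Proof.
move=> bx Ly oz zr e1 st hk ktl kL a0 ar sx z0 za; have [r0 r8] := box_gt0 bx.
have n0 : `|0 : R| <= a by rewrite normr0 ltW.
have aa : 0 < a <= a by rewrite a0 lexx.
have aa' : 0 <= a <= a by rewrite ltW // lexx.
have [si [Ss xE]] := St_Sw bx Ly oz zr e1 st hk ktl kL a0 ar n0 aa sx.
have nx := xi_nm bx Ly oz zr e1 st hk ktl kL a0 ar si n0 aa'.
exists si; split => //; first by case: Ss.
have [cx fx] := Ss.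
have x1 : (xi z e si 0 a).1 = z.1 + a * (sgn si * e.2) by rewrite /xi /mv /nrm /=; ring.
have sn : `|sgn si * e.2| <= 1 by rewrite normrM /sgn; case: (si); rewrite ?normrN normr1 mul1r -e1; exact: nm_snd.
have zp : 0 < `|z.1| by rewrite normr_gt0.
have far : a <= `|(xi z e si 0 a).1|.
  have x2r : `|(xi z e si 0 a).2| < r / 4 by apply: le_lt_trans (nm_snd _) _; rlra.
  apply: le_trans (fx _ (box_axis_Lim bx Ly x2r)) _.
  have ca : clO b (0, (xi z e si 0 a).2) by right.
  apply: le_trans (bx_le bx cx ca _ _) _; rewrite ?nm_0u; [rlra|rlra|].
  by rewrite /pd /= subrr subr0; apply: le_trans (nm_le_sum _) _; rewrite /= normr0 addr0.
rewrite x1 in far; move: far sn; set s := sgn si * e.2 => far sn.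
have as1 : `|a * s| <= a by rewrite normrM gtr0_norm // ger_pMr.
rewrite ltNge; apply/negP => neg; move: far; apply/negP; rewrite -ltNge.
have := ler_norm (a * s); have := ler_norm (- (a * s)); rewrite normrN => m1 m2.
have [zpos|zneg] := ltP 0 z.1.
  rewrite (gtr0_norm zpos) in za; have s0 : s <= 0 by rewrite leNgt; apply/negP => s0; have := mulr_gt0 s0 zpos; rlra.
  have as0 : a * s <= 0 by rewrite mulr_ge0_le0 // ltW.
  by rewrite ltr_norml; apply/andP; split; rlra.
have zlt : z.1 < 0 by rewrite lt_neqAle z0.
rewrite (ltr0_norm zlt) in za; have s0 : 0 <= s by rewrite leNgt; apply/negP => s0; have := nmulr_rgt0 z.1 s0; rewrite zlt; rlra.
have as0 : 0 <= a * s by rewrite mulr_ge0 // ltW.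
by rewrite ltr_norml; apply/andP; split; rlra.
Qed.

Lemma all_Lim x : Lim x.
Proof.
have [//|nL] := EM (Lim x); exfalso.
have [ga [s1 [u1 [x1 [a1 [lg nV u10 sx]]]]]] := edge_ray (ex_intro _ x nL).
have [U U0 hw] := win_ex lg nV u10.
(* Times one unit apart, so that shifts below [1 / 4] keep different passages distinct. *)
have [f0 hf0] : exists f : nat -> R, forall n, f n = u1 + n%:R by exists (fun n => u1 + n%:R).
have [p hp] := cluster (fun n => ga (s1 + f0 n)).
have Lp : Lim p.
  by apply: Lim_closed => e e0; have [n [_ hn]] := hp e e0 0%N; exists (ga (s1 + f0 n)); rewrite dC; split => //; exact: leaf_Lim.
have [E [r [b [_ bx]]]] := box_ex Lp (ltr01 : (0 : R) < 1).
have [r0 r8] := box_gt0 bx.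
have [a10 _ _] := sx.
have r5 : 0 < r / 512 by rlra.
have [a [a0 m1 m2 m3]] := min3_ex a10 U0 r5.
have [|x2 [sx2 _]] := St_shrink (a' := a) sx; first by rewrite a0.
have aU : 0 < a <= U by rewrite a0.
have hst n : exists y, St (ga (s1 + f0 n)) y a.
  have un : u1 <= u1 + n%:R by rewrite lerDl.
  by rewrite hf0; exact: (persist lg nV u10 U0 hw aU sx2 un).
pose near n := d p (ga (s1 + f0 n)) < Num.min (a / 4) (r / 64).
have [a4 r64] : 0 < a / 4 /\ 0 < r / 64 by split; rlra.
have mm : 0 < Num.min (a / 4) (r / 64) by rewrite lt_min a4.
pose line n (z e : R * R) := [/\ clO b z, nm z = d p (ga (s1 + f0 n)), nm e = 1, `|e.1| <= 4 * `|z.1| / r &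
  forall x : R, `|x| < r / 4 -> ga (s1 + f0 n + x) = E (mv z x e)].
have hline n : near n -> exists z e, line n z e.
  rewrite /near lt_min => /andP[_ h]; have h4 : d p (ga (s1 + f0 n)) < r / 4 by rlra.
  by have [z [e [[h1 h2 h3 h5] h6]]] := box_leaf bx lg h4; exists z, e.
have side n z e : near n -> line n z e -> z.1 != 0 -> exists si y, [/\ St (ga (s1 + f0 n)) y a, y = E (xi z e si 0 a),
    clO b (xi z e si 0 a), 0 < sgn si * e.2 * z.1 & nm (xi z e si 0 a) < r / 32].
  rewrite /near lt_min => /andP[ha hr] [cz nz e1 st hz] z0.
  have [y sy] := hst n.
  have oz : Om b z by case: cz => [|z1]; [left|right; rewrite lt_neqAle eq_sym z0].
  have zr : nm z < r / 64 by rewrite nz.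
  have za : `|z.1| < a by apply: le_lt_trans (nm_fst z) _; rewrite nz; rlra.
  have ktl (x' : R) : tl (fun x => ga (s1 + f0 n + x)) x' by apply: tl_shift; exact: leaf_tl.
  have kL (x' : R) : Lim (ga (s1 + f0 n + x')) := leaf_Lim _ lg.
  have ar : 512 * a <= r by rlra.
  have sy' : St (ga (s1 + f0 n + 0)) y a by rewrite addr0.
  have [si [q1 q2 q3 q4]] := box_free_side bx Lp oz zr e1 st hz ktl kL a0 ar sy' z0 za.
  by exists si, y.
(* Two leaves on the same side of the axis cannot both keep a free ball on the far side. *)
have two n m z e z' e' : near n -> near m -> line n z e -> line m z' e' -> 0 < z.1 * z'.1 -> `|z'.1| <= `|z.1| / 4 -> False.
  move=> nn nm' ln lm zz zs.
  have z0 : z.1 != 0 by apply/eqP => h; move: zz; rewrite h mul0r ltxx.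
  have z'0 : z'.1 != 0 by apply/eqP => h; move: zz; rewrite h mulr0 ltxx.
  have [si [y [sy yE cx ss nx]]] := side _ _ _ nm' lm z'0.
  have [cz nz e1 st hz] := ln; have [cz' nz' e1' st' hz'] := lm.
  move: nn nm'; rewrite /near !lt_min => /andP[na nr] /andP[ma mr].
  have e2 : 1 / 2 <= `|e.2|.
    have h1 : `|e.1| <= 1 / 2 by apply: (le_trans st); rewrite ler_pdivrMr //; have := nm_fst z; rlra.
    by have := nm_le_sum e; rewrite e1; rlra.
  have e2n : e.2 != 0 by rewrite -normr_gt0; rlra.
  pose q := xi z' e' si 0 a; pose t := (q.2 - z.2) / e.2.
  have zr : nm z < r / 64 by rewrite nz.
  have tr : `|t| < r / 8.
    rewrite normrM normfV ltr_pdivrMr; last by rlra.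
    have h1 := ler_normB q.2 z.2; have h2 := nm_snd q; have h3 := nm_snd z; rewrite -/q in nx.
    have : r / 8 * (1 / 2) <= r / 8 * `|e.2| by rewrite ler_pM2l //; rlra.
    rlra.
  have te : `|t * e.1| <= `|z.1| / 2.
    rewrite normrM; apply: (le_trans (y := r / 8 * (4 * `|z.1| / r))); first by apply: ler_pM => //; exact: ltW.
    by rewrite (_ : r / 8 * (4 * `|z.1| / r) = `|z.1| / 2) //; field; rewrite gt_eqF.
  have t4 : `|t| < r / 4 by rlra.
  have z4 : nm z < r / 4 by rlra.
  have [cm nmv] := clO_mv bx cz z4 e1 st t4.
  have mv2 : (mv z t e).2 = q.2 by rewrite /mv /t /= divfK //; ring.
  have [_ _ fy] := sy.
  have q1 : q.1 = z'.1 + a * (sgn si * e'.2) by rewrite /q /xi /mv /nrm /=; ring.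
  have zp : 0 < `|z.1| by rewrite normr_gt0.
  have zp' : 0 < `|z'.1| by rewrite normr_gt0.
  have za : `|z.1| < a / 4 by apply: le_lt_trans (nm_fst z) _; rewrite nz.
  have sn : `|sgn si * e'.2| <= 1 by rewrite normrM /sgn; case: (si); rewrite ?normrN normr1 mul1r -e1'; exact: nm_snd.
  have := fy _ (leaf_Lim (s1 + f0 n + t) lg); apply/negP; rewrite -ltNge yE -/q (hz _ t4).
  have q32 : nm q < r by rewrite -/q in nx; rlra.
  have nmr : nm (mv z t e) < r by rlra.
  apply: le_lt_trans (bx_le bx cx cm q32 nmr) _.
  apply: le_lt_trans (nm_le_sum _) _; rewrite [(_, _).2]/= mv2 subrr normr0 addr0 [(_, _).1]/=.
  rewrite mul0r addr0; exact: far_side.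
(* Otherwise three nonzero abscissas can be chosen, each at most a quarter of the preceding one; two
   of them have the same sign, which [two] excludes. *)
have axis N : exists n, [/\ (N <= n)%N, near n & exists z e, line n z e /\ z.1 = 0].
  have [//|hn] := EM (exists n, [/\ (N <= n)%N, near n & exists z e, line n z e /\ z.1 = 0]).
  exfalso; have nz n z e : (N <= n)%N -> near n -> line n z e -> z.1 != 0.
    by move=> h1 h2 h3; apply/eqP => h4; apply: hn; exists n; split => //; exists z, e.
  have pick (eps : R) : 0 < eps -> exists n z e, [/\ near n, line n z e, z.1 != 0 & `|z.1| < eps].
    move=> e0; have m0 : 0 < Num.min eps (Num.min (a / 4) (r / 64)) by rewrite lt_min e0.
    have [n [Nn hn']] := hp _ m0 N; rewrite dC lt_min in hn'; have [h1 h2] := andP hn'.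
    have nn : near n by [].
    have [z [e hl]] := hline n nn; exists n, z, e; split => //; first exact: nz hl.
    by have [_ h3 _ _ _] := hl; apply: le_lt_trans (nm_fst z) _; rewrite h3.
  have [n1 [z1 [e1 [k1 l1 z10 _]]]] := pick 1 ltr01.
  have p1 : 0 < `|z1.1| / 4 by rewrite divr_gt0 // normr_gt0.
  have [n2 [z2 [e2 [k2 l2 z20 q2]]]] := pick _ p1.
  have p2 : 0 < `|z2.1| / 4 by rewrite divr_gt0 // normr_gt0.
  have [n3 [z3 [e3 [k3 l3 z30 q3]]]] := pick _ p2.
  have [h|h|h] := three_signs z10 z20 z30.
  - by apply: (two _ _ _ _ _ _ k1 k2 l1 l2 h); exact: ltW.
  - by apply: (two _ _ _ _ _ _ k2 k3 l2 l3 h); exact: ltW.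
  - by apply: (two _ _ _ _ _ _ k1 k3 l1 l3 h); rlra.
(* At abscissa zero the leaf runs along the axis, hence through [p] itself. *)
have hit N : exists (n : nat) (v : R), [/\ (N <= n)%N, `|v| < 1 / 4 & ga (s1 + f0 n + v) = p].
  have [n [Nn nn [z [e [[cz nz e1 st hz] z10]]]]] := axis N.
  move: nn; rewrite /near lt_min => /andP[_ nr].
  have e10 : e.1 = 0.
    by apply/eqP; rewrite -normr_eq0 eq_le normr_ge0 andbT; move: st; rewrite z10 normr0 mulr0 mul0r.
  have e2 : e.2 * e.2 = 1 by move/nm_eq1: e1; rewrite e10 expr0n add0r expr2.
  have e2n : `|e.2| <= 1 by rewrite -e1; exact: nm_snd.
  have z2 : `|z.2| < r / 64 by apply: le_lt_trans (nm_snd z) _; rewrite nz.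
  have vn : `|- (z.2 * e.2)| <= `|z.2| by rewrite normrN normrM ler_piMr.
  exists n, (- (z.2 * e.2)); split => //; first by rlra.
  rewrite hz; last by rlra.
  have -> : mv z (- (z.2 * e.2)) e = (0, 0).
    rewrite /mv z10 e10 mulr0 addr0; congr pair.
    by transitivity (z.2 * (1 - e.2 * e.2)); [ring|rewrite e2; ring].
  exact: (bx_0 bx).
have [n1 [v1 [_ w1 h1]]] := hit 0%N.
have [n2 [v2 [k2 w2 h2]]] := hit n1.+1.
have [n3 [v3 [k3 w3 h3]]] := hit n2.+1.
have lt (n m : nat) (v v' : R) : (n < m)%N -> `|v| < 1 / 4 -> `|v'| < 1 / 4 -> s1 + f0 n + v < s1 + f0 m + v'.
  move=> nm hv hv'; have : n%:R + 1 <= m%:R :> R by rewrite natr1 ler_nat.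
  have := ler_norm v; have := ler_norm (- v'); rewrite normrN !hf0; rlra.
by apply: (leaf_three lg (lt _ _ _ _ k2 w1 w2) (lt _ _ _ _ k3 w2 w3)); rewrite ?h1 ?h2 ?h3.
Qed.
End Metric.
(** * Distances on a cone *)

Section ConeDistance.
Context (R : realType).
Implicit Types (a b c f h k : R).

(* The distance in the universal cover of the punctured plane, completed at the apex. *)
Definition cd a f b h : R := pd (pol a 0) (pol b (Num.min `|f - h| pi)).

Lemma min_pi_range (x : R) : 0 <= Num.min `|x| pi <= pi.
Proof. by rewrite le_min normr_ge0 pi_ge0 ge_min lexx orbT. Qed.


Lemma pol_mono a b x y : 0 <= a -> 0 <= b -> 0 <= x -> x <= y -> y <= pi -> pd (pol a 0) (pol b x) <= pd (pol a 0) (pol b y).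
Proof.
move=> a0 b0 x0 xy yp; rewrite -ler_sqr ?nnegrE ?pd_ge0 // !pd_pol_sqr !sub0r !cosN.
have c1 := cos_le x0 yp xy.
have : 0 <= 2 * a * b * (cos x - cos y) by rewrite mulr_ge0 ?subr_ge0 // !mulr_ge0.
lra.
Qed.

Lemma cd_mono a f b h f' h' : 0 <= a -> 0 <= b -> `|f - h| <= `|f' - h'| -> cd a f b h <= cd a f' b h'.
Proof.
move=> a0 b0 fh; have /andP[m1 _] := min_pi_range (f - h); have /andP[_ m2] := min_pi_range (f' - h').
by apply: pol_mono => //; rewrite le_min !ge_min fh lexx orbT.
Qed.

Lemma cd_small a f b h : `|f - h| <= pi -> cd a f b h = pd (pol a f) (pol b h).
Proof. by move=> fh; apply: pd_pol_eq; rewrite // min_l // sub0r cosN cos_norm. Qed.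

Lemma cd_big a f b h : 0 <= a -> 0 <= b -> pi <= `|f - h| -> cd a f b h = a + b.
Proof.
move=> a0 b0 fh; apply/eqP; rewrite -(eqrXn2 (n := 2)) ?pd_ge0 ?addr_ge0 // /cd min_r //.
by rewrite pd_pol_sqr sub0r cosN cospi; apply/eqP; ring.
Qed.

Lemma cdC a f b h : cd a f b h = cd b h a f.
Proof. by rewrite /cd distrC pdC; apply: pd_pol_eq; rewrite // subr0 sub0r cosN. Qed.

Lemma cd_refl a f : cd a f a f = 0.
Proof. by rewrite cd_small ?subrr ?normr0 ?pi_ge0 // pdzz. Qed.

Lemma cd_le_add a f b h : 0 <= a -> 0 <= b -> cd a f b h <= a + b.
Proof.
move=> a0 b0; apply: le_trans (pd_tri (0, 0) _ _) _.
by rewrite (pdC (0, 0)) !pd0 !nm_pol.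
Qed.

Lemma cd_radius a f b h : 0 <= a -> 0 <= b -> b <= a + cd a f b h.
Proof.
move=> a0 b0; have := nm_pd (pol b (Num.min `|f - h| pi)) (pol a 0).
by rewrite !nm_pol // pdC.
Qed.

Lemma cd_tri a f b h c k : 0 <= a -> 0 <= b -> 0 <= c -> cd a f c k <= cd a f b h + cd b h c k.
Proof.
move=> a0 b0 c0; have p0 := pi_ge0 R.
have h1 := cd_le_add f k a0 c0.
have [s1|s1] := leP pi `|f - h|.
  by rewrite [in X in _ <= X](cd_big a0 b0 s1); have := cd_radius h k b0 c0; lra.
have [s2|s2] := leP pi `|h - k|.
  by rewrite [X in _ <= _ + X](cd_big b0 c0 s2); have := cd_radius h f b0 a0; rewrite [cd b h a f]cdC; lra.
have e1 : cd a f b h = pd (pol a `|f - h|) (pol b 0).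
  by rewrite cd_small ?ltW //; apply: pd_pol_eq; rewrite // subr0 cos_norm.
have key (y : R) : 0 <= y -> y <= `|h - k| -> y + `|f - h| <= pi ->
    pd (pol a 0) (pol c (y + `|f - h|)) <= cd a f b h + cd b h c k.
  move=> y0 yh yp; apply: (le_trans (y := pd (pol a `|f - h|) (pol b 0) + pd (pol b 0) (pol c (- y)))).
    rewrite [X in X <= _](_ : _ = pd (pol a `|f - h|) (pol c (- y))); first exact: pd_tri.
    by apply: pd_pol_eq => //; rewrite sub0r cosN opprK addrC.
  rewrite e1 lerD2l (_ : pd _ (pol c (- y)) = pd (pol b 0) (pol c y)); last by apply: pd_pol_eq; rewrite // opprK sub0r cosN add0r.
  by apply: pol_mono; rewrite // ?min_l // ltW.
have fk : `|f - k| <= `|h - k| + `|f - h|.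
  by rewrite (_ : f - k = (h - k) + (f - h)) ?ler_normD //; ring.
have [s3|s3] := leP (`|h - k| + `|f - h|) pi.
  apply: le_trans (key _ (normr_ge0 _) (lexx _) s3).
  by apply: pol_mono; rewrite // ?le_min ?normr_ge0 ?p0 // ge_min fk.
have := key (pi - `|f - h|); rewrite subrK => /(_ _ _ (lexx _)) h2.
apply: le_trans (h2 _ _); last 2 first; [lra|lra|].
by have /andP[m1 m2] := min_pi_range (f - k); apply: pol_mono.
Qed.

Lemma pd_comb z w (l : R) : 0 <= l <= 1 ->
  pd z ((1 - l) * z.1 + l * w.1, (1 - l) * z.2 + l * w.2) + pd ((1 - l) * z.1 + l * w.1, (1 - l) * z.2 + l * w.2) w = pd z w.
Proof.
move=> /andP[l0 l1].
have e1 : pd z ((1 - l) * z.1 + l * w.1, (1 - l) * z.2 + l * w.2) = l * pd z w.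
  rewrite -[in RHS](ger0_norm l0) /pd -[RHS](nmZ l (z.1 - w.1, z.2 - w.2)) /=; congr nm; congr pair; ring.
have l1' : 0 <= 1 - l by lra.
have e2 : pd ((1 - l) * z.1 + l * w.1, (1 - l) * z.2 + l * w.2) w = (1 - l) * pd z w.
  rewrite -[in RHS](ger0_norm l1') /pd -[RHS](nmZ (1 - l) (z.1 - w.1, z.2 - w.2)) /=; congr nm; congr pair; ring.
by rewrite e1 e2; ring.
Qed.

(** The segment crosses every ray between its ends; [l] divides it in the ratio of the distances of
    the ends to the ray. *)
Lemma pol_between a b f h k (r : R) : 0 <= a < r -> 0 <= b < r -> f <= h -> h <= k -> k - f < pi ->
  exists c, 0 <= c < r /\ pd (pol a f) (pol c h) + pd (pol c h) (pol b k) = pd (pol a f) (pol b k).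
Proof.
move=> /andP[a0 ar] /andP[b0 br] fh hk kf; have r0 : 0 < r by apply: le_lt_trans ar.
have p00 x : pol 0 x = (0, 0) :> R * R by rewrite /pol !mul0r.
have [/eqP <-|fh'] := boolP (f == h); first by exists a; rewrite a0 ar pdzz add0r.
have [/eqP ->|hk'] := boolP (h == k); first by exists b; rewrite b0 br pdzz addr0.
have [->|a0'] := eqVneq a 0; first by exists 0; rewrite lexx r0 !p00 pdzz add0r.
have [->|b0'] := eqVneq b 0; first by exists 0; rewrite lexx r0 !p00 pdzz addr0.
have ap : 0 < a by rewrite lt_neqAle eq_sym a0'.
have bp : 0 < b by rewrite lt_neqAle eq_sym b0'.
have lt1 : f < h by rewrite lt_neqAle fh'.
have lt2 : h < k by rewrite lt_neqAle hk'.
have s1 : 0 < sin (h - f) by apply: sin_gt0_pi; apply/andP; split; lra.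
have s2 : 0 < sin (k - h) by apply: sin_gt0_pi; apply/andP; split; lra.
have s3 : 0 < sin (k - f) by apply: sin_gt0_pi; apply/andP; split; lra.
pose D := a * sin (h - f) + b * sin (k - h).
have D1 : 0 < a * sin (h - f) by rewrite mulr_gt0.
have D2 : 0 < b * sin (k - h) by rewrite mulr_gt0.
have D0 : 0 < D by rewrite addr_gt0.
pose l := a * sin (h - f) / D; pose c := a * b * sin (k - f) / D.
have l01 : 0 <= l <= 1.
  by apply/andP; split; rewrite /l ?ler_pdivrMr ?mul1r ?lerDl ?divr_ge0 // ltW.
have c0 : 0 <= c by rewrite divr_ge0 ?ltW // !mulr_gt0.
have ec : pol c h = ((1 - l) * (pol a f).1 + l * (pol b k).1, (1 - l) * (pol a f).2 + l * (pol b k).2).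
  have Dn : D != 0 by rewrite gt_eqF.
  have -> : 1 - l = b * sin (k - h) / D by rewrite /l -{1}(divff Dn) -mulrBl /D addrAC subrr add0r.
  by rewrite /pol /c /l /= !sinB; congr pair; field.
exists c; split; last by rewrite ec; exact: pd_comb.
rewrite c0 -(nm_pol h c0) ec; apply: le_lt_trans (nmD (_, _) (_, _)) _.
move: l01 => /andP[l0 l1].
rewrite (nmZ (1 - l) (pol a f)) (nmZ l (pol b k)) !nm_pol // !ger0_norm ?subr_ge0 //.
have [e|l1'] := eqVneq l 1; first by rewrite e subrr mul0r add0r mul1r.
have l2 : 0 < 1 - l by rewrite subr_gt0 lt_neqAle l1'.
have : (1 - l) * a < (1 - l) * r by rewrite ltr_pM2l.
have : l * b <= l * r by rewrite ler_wpM2l // ltW.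
lra.
Qed.

End ConeDistance.
Section EuclideanNorm.
Context (R : realType).
Implicit Types (a x y : R) (u v : 'rV[R]_2).

Lemma enorm_ge0 n (u : 'rV[R]_n) : 0 <= enorm u. Proof. exact: sqrtr_ge0. Qed.

Lemma enorm0 : enorm (0 : 'rV[R]_2) = 0.
Proof. by rewrite /enorm /edot big1 ?sqrtr0 // => i _; rewrite mxE mul0r. Qed.

Lemma enormZ u a : enorm (a *: u) = `|a| * enorm u.
Proof.
rewrite /enorm -sqrtr_sqr -sqrtrM ?sqr_ge0 //; congr Num.sqrt.
by rewrite /edot mulr_sumr; apply: eq_bigr => i _; rewrite !mxE; ring.
Qed.

Lemma enormN u : enorm (- u) = enorm u.
Proof. by rewrite -scaleN1r enormZ normrN normr1 mul1r. Qed.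

Lemma enorm_nm u : enorm u = nm (u 0 0, u 0 1).
Proof. by rewrite /enorm /edot !big_ord_recl big_ord0 addr0 /nm /= !expr2; congr (Num.sqrt (_ + u 0 _ * u 0 _)); exact: val_inj. Qed.

Lemma enormD u v : enorm (u + v) <= enorm u + enorm v.
Proof. by rewrite !enorm_nm !mxE; exact: (nmD (u 0 0, u 0 1) (v 0 0, v 0 1)). Qed.

Definition orthonormal u v := [/\ edot u u = 1, edot v v = 1 & edot u v = 0].

Lemma enorm_frame u v x y : orthonormal u v -> enorm (x *: u + y *: v) = nm (x, y).
Proof.
move=> [uu vv uv]; congr Num.sqrt; rewrite /=.
transitivity (x ^+ 2 * edot u u + y ^+ 2 * edot v v + 2 * x * y * edot u v); last by rewrite uu vv uv; ring.
by rewrite /edot !big_ord_recl !big_ord0 !mxE; ring.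
Qed.

Lemma frame_inj u v x y x' y' : orthonormal u v -> x *: u + y *: v = x' *: u + y' *: v -> x = x' /\ y = y'.
Proof.
move=> o h; have : enorm ((x - x') *: u + (y - y') *: v) = 0.
  have -> : (x - x') *: u + (y - y') *: v = (x *: u + y *: v) - (x' *: u + y' *: v) by rewrite !scalerBl opprD addrACA.
  by rewrite h subrr enorm0.
rewrite enorm_frame // => /nm0 [h1 h2]; split; apply/eqP; rewrite -subr_eq0; exact/eqP.
Qed.

End EuclideanNorm.

(** * Polylines and distances on the glued surface *)

Section Gluings.
Context (R : realType) (S : gluing R).
Implicit Types (p q : face S * 'rV[R]_2).

Lemma glued_along_edgeC p q : glued_along_edge p q -> glued_along_edge q p.
Proof.
move=> [e [s [/andP[s0 s1] -> ->]]]; exists (mate e), (if flip e then 1 - s else s).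
rewrite mateK flip_mate; split => //; first by case: ifP => _; apply/andP; split; lra.
by case: (flip e) => //; rewrite opprB addrCA subrr addr0.
Qed.

Lemma edge_pt_in (e : face S * 'I_3) (s : R) : 0 <= s <= 1 -> in_face e.1 (edge_pt e s).
Proof.
move=> /andP[s0 s1]; have en : ordS e.2 != e.2.
  by rewrite -val_eqE /=; case: e => t [[|[|[|]]]].
exists (fun i => if i == e.2 then 1 - s else if i == ordS e.2 then s else 0); split.
- by move=> i; case: ifP => _; [lra|case: ifP].
- rewrite (bigD1 e.2) //= eqxx (bigD1 (ordS e.2)) //= (negPf en) eqxx big1 ?addr0 ?subrK //.
  by move=> i /andP[/negPf -> /negPf ->].
- rewrite (bigD1 e.2) //= eqxx (bigD1 (ordS e.2)) //= (negPf en) eqxx big1 ?addr0 //.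
  by move=> i /andP[/negPf -> /negPf ->]; rewrite scale0r.
Qed.

Lemma glued_inv (Q : face S * 'rV[R]_2 -> Prop) :
  (forall p q, glued_along_edge p q -> Q p -> Q q) -> forall p q, glued p q -> Q p <-> Q q.
Proof.
move=> h p q; elim=> {p q} [p q g|p|p q _ IH|p q w _ IH1 _ IH2] //.
- by split; apply: h => //; exact: glued_along_edgeC.
- by rewrite IH.
- by rewrite IH1.
Qed.

Lemma glued_in p q : glued p q -> in_face p.1 p.2 -> in_face q.1 q.2.
Proof.
move=> g; apply: (proj1 (glued_inv (Q := fun p => in_face p.1 p.2) _ g)) => {p q g} p q [e [s [s01 -> ->]]] _ /=.
by apply: edge_pt_in; move: s01; case: ifP => _ /andP[s0 s1]; apply/andP; split; lra.
Qed.

Lemma polyline_ge0 p q (l : R) : polyline p q l -> 0 <= l.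
Proof. by elim=> // *; rewrite addr_ge0 // enorm_ge0. Qed.

Lemma polyline_in p q (l : R) : polyline p q l -> in_face p.1 p.2 -> in_face q.1 q.2.
Proof. by elim=> {p q l} // [p q w l g _ IH hp|t a b w l _ hb _ IH _]; apply: IH => //; exact: glued_in g hp. Qed.


Lemma in_face_comb t (u v : 'rV[R]_2) (a : R) : 0 <= a <= 1 -> in_face t u -> in_face t v -> in_face (S := S) t ((1 - a) *: u + a *: v).
Proof.
move=> /andP[a0 a1] [w [w0 w1 ->]] [w' [w'0 w'1 ->]]; exists (fun i => (1 - a) * w i + a * w' i); split.
- by move=> i; rewrite addr_ge0 ?mulr_ge0 ?subr_ge0.
- by rewrite big_split /= -!mulr_sumr w1 w'1 !mulr1 subrK.
- by rewrite !scaler_sumr -big_split; apply: eq_bigr => i _; rewrite /= !scalerA -scalerDl.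
Qed.

Lemma polyline_cut p q (l t : R) : polyline p q l -> in_face p.1 p.2 -> 0 <= t <= l ->
  exists2 m, in_face m.1 m.2 & polyline p m t /\ polyline m q (l - t).
Proof.
move=> h; elim: h t => {p q l} [p|p q w l g hq IH|f a b w l ha hb h IH] t hp /andP[t0 tl].
- have -> : t = 0 by lra.
  by exists p => //; rewrite subr0; split; exact: polyline_refl.
- have [|m hm [h1 h2]] := IH t (glued_in g hp); first by rewrite t0.
  by exists m => //; split => //; exact: polyline_glue g h1.
have [tn|nt] := leP t (enorm (b - a)); last first.
  have [|m hm [h1 h2]] := IH (t - enorm (b - a)) hb; first by apply/andP; split; lra.
  exists m => //; split; last by rewrite (_ : _ + l - t = l - (t - enorm (b - a))) //; ring.
  by rewrite -(subrK (enorm (b - a)) t) addrC; exact: polyline_segment.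
have [n0|n0] := eqVneq (enorm (b - a)) 0.
  have -> : t = 0 by lra.
  exists (f, a) => //; rewrite subr0; split; first exact: polyline_refl.
  exact: polyline_segment.
have np : 0 < enorm (b - a) by rewrite lt_neqAle eq_sym n0 enorm_ge0.
pose s := t / enorm (b - a); have s01 : 0 <= s <= 1.
  by apply/andP; split; rewrite /s ?ler_pdivrMr ?mul1r ?divr_ge0 // ltW.
have st : s * enorm (b - a) = t by rewrite divfK.
have hm := in_face_comb s01 ha hb; have [s0 s1] := andP s01.
exists (f, (1 - s) *: a + s *: b) => //; split.
  have -> : t = enorm ((1 - s) *: a + s *: b - a) + 0.
    rewrite addr0 (_ : _ - a = s *: (b - a)) ?enormZ ?ger0_norm //.
    by apply/rowP => i; rewrite !mxE; ring.
  by apply: polyline_segment => //; exact: polyline_refl.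
have -> : enorm (b - a) + l - t = enorm (b - ((1 - s) *: a + s *: b)) + l.
  rewrite (_ : b - (_ + _) = (1 - s) *: (b - a)); last by apply/rowP => i; rewrite !mxE; ring.
  by rewrite enormZ ger0_norm ?subr_ge0 // mulrBl st; ring.
exact: polyline_segment.
Qed.

End Gluings.

Section Polyhedra.
Context (R : realType) (P : polyhedron R).
Implicit Types (t : face (pieces P)) (p q : 'rV[R]_2).

Lemma mdist_le t t' p p' (l : R) : in_face t p -> polyline (t, p) (t', p') l -> mdist (proj t p) (proj t' p') <= l.
Proof.
move=> hp h; have hp' := polyline_in h hp.
by rewrite -lee_fin (proj_dist hp hp'); apply: ereal_inf_lbound; exists l.
Qed.

Lemma mdist_ge t t' p p' (m : R) : in_face t p -> in_face t' p' ->
  (forall l, polyline (t, p) (t', p') l -> m <= l) -> m <= mdist (proj t p) (proj t' p').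
Proof.
move=> hp hp' h; rewrite -lee_fin (proj_dist hp hp'); apply: le_ereal_inf_tmp => _ [l hl <-].
by rewrite lee_fin; exact: h.
Qed.

Lemma mdist_segment t p q : in_face t p -> in_face t q -> mdist (proj t p) (proj t q) <= enorm (q - p).
Proof.
move=> hp hq; apply: mdist_le => //; rewrite -[enorm _]addr0.
by apply: polyline_segment => //; exact: polyline_refl.
Qed.

Lemma polyline_ex t t' p p' (m : R) : in_face t p -> in_face t' p' -> mdist (proj t p) (proj t' p') < m ->
  exists2 l, polyline (t, p) (t', p') l & l < m.
Proof.
move=> hp hp' h; have [//|n] := EM (exists2 l, polyline (t, p) (t', p') l & l < m).
exfalso; have : m <= mdist (proj t p) (proj t' p').
  by apply: mdist_ge => // l hl; rewrite leNgt; apply/negP => lm; apply: n; exists l.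
lra.
Qed.

Lemma mdist_geo (x y : P) (t e : R) : 0 <= t <= mdist x y -> 0 < e ->
  exists m, mdist x m <= t /\ mdist m y <= mdist x y - t + e.
Proof.
have [tx [px [hx <-]]] := proj_surj x; have [ty [py [hy <-]]] := proj_surj y.
move=> /andP[t0 td] e0; have [|l hl le] := polyline_ex (m := mdist (proj tx px) (proj ty py) + e) hx hy; first by lra.
have dl := mdist_le hx hl.
have [|[tm pm] hm [h1 h2]] := polyline_cut (t := t) hl hx; first by apply/andP; split; lra.
exists (proj tm pm); split; first exact: mdist_le h1.
by apply: le_trans (mdist_le hm h2) _; lra.
Qed.

End Polyhedra.

(** * From local polar coordinates to a cone *)

Section LocalModel.
Context (R : realType) (P : polyhedron R).
(** [Rep t z a f] reads: the point [z] of the triangle [t] has polar coordinates [a] and [f] around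
    [x]. The hypotheses make this compatible with the gluing, let segments of a triangle be followed
    in polar coordinates, and realize points at nearby angles in one triangle. *)
Variables (x : P) (r th : R) (Rep : face (pieces P) -> 'rV[R]_2 -> R -> R -> Prop).
Hypothesis r0 : 0 < r.
Hypothesis th0 : 0 < th.
Hypothesis thl : th <= 2 * pi.
Hypothesis RepF : forall t z a f, Rep t z a f -> in_face t z /\ 0 <= a < r.
Hypothesis RepE : forall a f, 0 <= a < r -> exists t z, Rep t z a f.
Hypothesis RepW : forall t z t' z' a f, Rep t z a f -> Rep t' z' a f -> proj t z = proj t' z'.
Hypothesis RepP : forall t z a f, Rep t z a (f + th) <-> Rep t z a f.
Hypothesis RepU : forall t z a f b h, Rep t z a f -> Rep t z b h -> a = b /\ (a = 0 \/ exists m : int, h = f + m%:~R * th).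
Hypothesis RepG : forall t z t' z' a f, Rep t z a f -> glued_along_edge (t, z) (t', z') -> Rep t' z' a f.
Hypothesis RepL : forall t z z' a f, Rep t z a f -> in_face t z' -> a + enorm (z' - z) < r ->
  exists b h, Rep t z' b h /\ cd a f b h <= enorm (z' - z).
Hypothesis RepA : forall f, exists2 dl : R, 0 < dl & forall h, f - dl <= h <= f + dl ->
  forall a b, 0 <= a < r -> 0 <= b < r ->
  exists t z z', [/\ Rep t z a f, Rep t z' b h & enorm (z' - z) = pd (pol a f) (pol b h)].
Hypothesis RepX : forall t z f, Rep t z 0 f -> proj t z = x.

Lemma Rep_glued p q : glued p q -> forall a f, Rep p.1 p.2 a f <-> Rep q.1 q.2 a f.
Proof.
move=> g a f; apply: (glued_inv (Q := fun p => Rep p.1 p.2 a f) _ g) => {p q g} [[t z] [t' z']] g h.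
exact: RepG h g.
Qed.

(** A polyline shorter than [r - a] cannot leave the disc, so it lifts to the universal cover
    segment by segment, where the triangle inequality for [cd] adds up the pieces. *)
Lemma Rep_lift p q (l : R) : polyline p q l -> forall a f, Rep p.1 p.2 a f -> a + l < r ->
  exists b h, Rep q.1 q.2 b h /\ cd a f b h <= l.
Proof.
elim=> {p q l} [p|p q w l g _ IH|t z z' w l hz hz' pl IH] a f ra al.
- by exists a, f; rewrite cd_refl.
- exact: IH ((Rep_glued g a f).1 ra) al.
- have l0 := polyline_ge0 pl.
  have [|b [h [rb cb]]] := RepL ra hz'; first by rewrite /=; lra.
  have [_ /andP[a0 ar]] := RepF ra; have [_ /andP[b0 br]] := RepF rb.
  have hb := cd_radius f h a0 b0.
  have [|c [k [rc cc]]] := IH b h rb; first by lra.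
  exists c, k; split => //; have [_ /andP[c0 cr]] := RepF rc.
  have := cd_tri f h k a0 b0 c0; lra.
Qed.

Definition Phi (a f : R) : P := xget x [set y | exists t z, Rep t z a f /\ proj t z = y].

Lemma PhiE t z a f : Rep t z a f -> Phi a f = proj t z.
Proof.
move=> h; rewrite /Phi; case: xgetP => [y _ [t' [z' [h' <-]]]|/(_ (proj t z))]; first exact: RepW h' h.
by case; exists t, z.
Qed.

Lemma Phi0 f : Phi 0 f = x.
Proof.
have [|t [z h]] := @RepE 0 f; first by rewrite lexx.
by rewrite (PhiE h); exact: RepX h.
Qed.

Lemma PhiD a f : Phi a (f + th) = Phi a f.
Proof. by rewrite /Phi; congr xget; apply/seteqP; split=> y [t [z [h hy]]]; exists t, z; split => //; exact/RepP. Qed.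

Lemma Phi_loc f : exists2 dl : R, 0 < dl & forall h, f - dl <= h <= f + dl -> forall a b, 0 <= a < r -> 0 <= b < r ->
  mdist (Phi a f) (Phi b h) <= pd (pol a f) (pol b h).
Proof.
have [dl dl0 hd] := RepA f; exists dl => // h hh a b ha hb.
have [t [z [z' [h1 h2 <-]]]] := hd h hh a b ha hb.
by rewrite (PhiE h1) (PhiE h2); apply: mdist_segment; [case: (RepF h1)|case: (RepF h2)].
Qed.

Lemma Phi_x a f : 0 <= a < r -> mdist (Phi a f) x <= a.
Proof.
move=> ha; have [dl dl0 hd] := Phi_loc f; rewrite -{1}(Phi0 f).
apply: le_trans (hd f _ a 0 ha _) _; [by apply/andP; split; lra|by rewrite lexx|].
by rewrite {2}/pol !mul0r pd0 nm_pol //; case/andP: ha.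
Qed.

(** The plane segment is cut by intermediate rays, as in [pol_between], into pieces between nearby
    angles, for which [Phi_loc] suffices. *)
Lemma Phi_le_pos f h : f <= h -> h - f < pi -> forall a b, 0 <= a < r -> 0 <= b < r ->
  mdist (Phi a f) (Phi b h) <= pd (pol a f) (pol b h).
Proof.
move=> fh hp.
have h0 : 0 <= h - f by lra.
suff key : forall u, 0 <= u <= h - f -> forall a b, 0 <= a < r -> 0 <= b < r ->
    mdist (Phi a f) (Phi b (f + u)) <= pd (pol a f) (pol b (f + u)).
  by have := key (h - f); rewrite lexx h0 addrC subrK; apply.
apply: (real_induction h0).
- have [dl dl0 hd] := Phi_loc f; move=> a b ha hb; apply: hd => //; apply/andP; split; lra.
- move=> u /andP[u0 uh] IH; have [dl dl0 hd] := Phi_loc (f + u).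
  exists dl => // v /andP[uv vd] vh a b ha hb.
  have [k1 k2 k3] : [/\ f <= f + u, f + u <= f + v & f + v - f < pi] by split; lra.
  have [c [hc <-]] := pol_between ha hb k1 k2 k3.
  apply: le_trans (metric_triangle _ (Phi c (f + u)) _) _; apply: lerD.
    by apply: IH => //; rewrite u0 lexx.
  by apply: hd => //; apply/andP; split; lra.
- move=> u /andP[u0 uh] IH a b ha hb; have [dl dl0 hd] := Phi_loc (f + u).
  have [v [v0 vu vd]] : exists v, [/\ 0 <= v, v < u & u - dl <= v].
    have [h1|h1] := leP dl u; first by exists (u - dl); split; lra.
    by exists 0; split; lra.
  have [k1 k2 k3] : [/\ f <= f + v, f + v <= f + u & f + u - f < pi] by split; lra.
  have [c [hc <-]] := pol_between ha hb k1 k2 k3.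
  apply: le_trans (metric_triangle _ (Phi c (f + v)) _) _; apply: lerD.
    by apply: IH => //; rewrite v0 vu.
  rewrite metric_sym pdC; apply: hd => //; apply/andP; split; lra.
Qed.

Lemma Phi_le f h a b : `|f - h| <= pi -> 0 <= a < r -> 0 <= b < r ->
  mdist (Phi a f) (Phi b h) <= pd (pol a f) (pol b h).
Proof.
move=> fh ha hb; have [e|n] := eqVneq `|f - h| pi.
  have [/andP[a0 _] /andP[b0 _]] := (ha, hb).
  rewrite -cd_small // cd_big ?e //; apply: le_trans (metric_triangle _ x _) _.
  by apply: lerD; [|rewrite metric_sym]; exact: Phi_x.
have lt : `|f - h| < pi by rewrite lt_neqAle n.
have [le|ge] := leP f h.
  by apply: Phi_le_pos => //; rewrite distrC ger0_norm ?subr_ge0 // in lt.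
rewrite metric_sym pdC; apply: Phi_le_pos => //; first exact: ltW.
by rewrite ger0_norm // subr_ge0 ltW in lt.
Qed.

(** A polyline too long to be lifted is longer than [a + b], which is why the radii are below
    [r / 3]. Any other lifts, ending at the angle [h] up to a multiple of [th], hence no closer to
    [f] than [h] is. *)
Lemma Phi_ge f h a b : `|f - h| <= th / 2 -> 0 <= a < r / 3 -> 0 <= b < r / 3 ->
  pd (pol a f) (pol b h) <= mdist (Phi a f) (Phi b h).
Proof.
move=> fh /andP[a0 a3] /andP[b0 b3]; have r0' := r0; have th0' := th0; have thl' := thl.
have ar : 0 <= a < r by apply/andP; split; lra.
have br : 0 <= b < r by apply/andP; split; lra.
have [t [z hz]] := RepE f ar; have [t' [z' hz']] := RepE h br.
have [fz _] := RepF hz; have [fz' _] := RepF hz'.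
have fp : `|f - h| <= pi by lra.
rewrite (PhiE hz) (PhiE hz') -cd_small //; apply: mdist_ge => // l pl.
have [lr|rl] := ltP (a + l) r; last by have := cd_le_add f h a0 b0; lra.
have [c [k [hc cc]]] := Rep_lift pl hz lr; apply: le_trans cc.
have [eb] := RepU hz' hc; rewrite -eb => -[b00|[m hk]].
  have n2 : nm (pol b (Num.min `|f - h| pi)) = 0 by rewrite nm_pol // b00.
  by rewrite /cd b00 /pol !mul0r.
rewrite hk; apply: cd_mono => //.
have [->|m0] := eqVneq m 0; first by rewrite mul0r addr0.
have m1 : 1 <= `|m%:~R : R| by rewrite -intr_norm ler1z; move: m0; case: (m) => [[]|].
have : th <= `|m%:~R * th| by rewrite normrM (gtr0_norm th0) ler_peMl // ltW.
have := ler_normB (f - h) (f - (h + m%:~R * th)).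
rewrite (_ : f - h - (f - (h + m%:~R * th)) = m%:~R * th); last by ring.
lra.
Qed.

Lemma model_cone : cone (fun p q : P => mdist p q) x th (r / 3) Phi.
Proof.
have r0' := r0; have thl' := thl; have r3 : r / 3 <= r by lra.
split; [lra|exact: th0|exact: Phi0|exact: PhiD|split].
  move=> a b f h ha hb fh; have fp : `|f - h| <= pi by lra.
  apply/eqP; rewrite eq_le Phi_ge // andbT; apply: Phi_le => //.
    by case/andP: ha => -> /=; lra.
  by case/andP: hb => -> /=; lra.
move=> p; have [t [z [fz <-]]] := proj_surj p.
have [|t0 [z0 h0]] := @RepE 0 0; first by rewrite lexx.
have [fz0 _] := RepF h0; rewrite -(RepX h0) => hd.
have [l pl lr] := polyline_ex fz0 fz hd.
have l0 := polyline_ge0 pl.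
have [|b [h [hb cb]]] := Rep_lift pl h0; first by rewrite add0r; lra.
have [_ /andP[b0 br]] := RepF hb; have := cd_radius 0 h (lexx 0) b0.
exists b, h; split; last exact: PhiE.
by rewrite b0 /=; lra.
Qed.

End LocalModel.
(** * Cone charts from gluings *)

Section Sectors.
Context (R : realType) (S : gluing R).
Implicit Types (e : face S * 'I_3) (s a b ps : R) (z u v : 'rV[R]_2).

Definition elen e : R := enorm (corner e.1 (ordS e.2) - corner e.1 e.2).

(* A direction along an edge at one of its points: the edge, the parameter of the point, and
   whether the parameter decreases. *)
Definition ray_germ := ((face S * 'I_3) * R * bool)%type.
Definition gpar (g : ray_germ) a : R := g.1.2 + (if g.2 then - a else a) / elen g.1.1.
Definition gpt (g : ray_germ) a := edge_pt g.1.1 (gpar g a).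
Definition gmate (g : ray_germ) : ray_germ := (mate g.1.1, if flip g.1.1 then 1 - g.1.2 else g.1.2, g.2 (+) flip g.1.1).

Lemma gpar_mate (g : ray_germ) a : gpar (gmate g) a = if flip g.1.1 then 1 - gpar g a else gpar g a.
Proof.
case: g => -[e s] b; rewrite /gpar /gmate /= /elen mate_length -/(elen e).
by case: (flip e) b => -[] /=; ring.
Qed.

Lemma gmateK (g : ray_germ) : gmate (gmate g) = g.
Proof.
case: g => -[e s] b; rewrite /gmate /= mateK flip_mate -addbA addbb addbF.
by case: (flip e) => //; rewrite opprB addrCA subrr addr0.
Qed.

Lemma gmate_glued (g : ray_germ) a : 0 <= gpar g a <= 1 -> glued_along_edge (g.1.1.1, gpt g a) ((gmate g).1.1.1, gpt (gmate g) a).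
Proof. by move=> h; exists g.1.1, (gpar g a); rewrite /gpt gpar_mate. Qed.

(* Face, apex, orthonormal frame, angle, first and last side. *)
Record sector := Sector { sF : face S; sp : 'rV[R]_2; su : 'rV[R]_2; sv : 'rV[R]_2; sw : R; sA : ray_germ; sB : ray_germ }.

Definition spt (c : sector) a ps := sp c + (a * cos ps) *: su c + (a * sin ps) *: sv c.

(** Within [r] of the apex the triangle is the sector, with sides along [sA] and [sB], and no other
    edge comes so near. The apex can be a corner, or an inner point of an edge with angle [pi]. *)
Definition sector_ok (r : R) (c : sector) :=
  [/\ orthonormal (su c) (sv c), 0 < sw c <= pi, (sA c).1.1.1 = sF c & (sB c).1.1.1 = sF c] /\
  [/\ forall a, 0 <= a < r -> gpt (sA c) a = spt c a 0 /\ 0 <= gpar (sA c) a <= 1,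
      forall a, 0 <= a < r -> gpt (sB c) a = spt c a (sw c) /\ 0 <= gpar (sB c) a <= 1,
      forall z, enorm (z - sp c) < r -> in_face (sF c) z <-> exists2 ps, 0 <= ps <= sw c & z = spt c (enorm (z - sp c)) ps &
      forall e s, e.1 = sF c -> 0 <= s <= 1 -> enorm (edge_pt e s - sp c) < r -> exists2 a, 0 <= a < r &
        ((sA c).1.1 = e /\ s = gpar (sA c) a) \/ ((sB c).1.1 = e /\ s = gpar (sB c) a)].

(** The sectors around a point, as a sequence of period [n] so that an angle may exceed a full turn;
    [adj] glues consecutive ones and [sep] keeps different ones in the same triangle apart. *)
Variables (r : R) (sg : nat -> sector) (n : nat).
Hypothesis r0 : 0 < r.
Hypothesis n0 : (0 < n)%N.
Hypothesis ok : forall k, sector_ok r (sg k).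
Hypothesis per : forall k, sg (k + n) = sg k.
Hypothesis adj : forall k, gmate (sB (sg k)) = sA (sg k.+1).
Hypothesis sep : forall k l, sF (sg k) = sF (sg l) -> k = l %[mod n] \/ 2 * r <= enorm (sp (sg k) - sp (sg l)).

Let o k : orthonormal (su (sg k)) (sv (sg k)). Proof. by have [[]] := ok k. Qed.
Let w0 k : 0 < sw (sg k). Proof. by have [[_ /andP[]]] := ok k. Qed.
Let wp k : sw (sg k) <= pi. Proof. by have [[_ /andP[]]] := ok k. Qed.

Lemma spt_dist k a b ps qs : enorm (spt (sg k) b qs - spt (sg k) a ps) = pd (pol a ps) (pol b qs).
Proof.
rewrite pdC /pd /= -(enorm_frame _ _ (o k)) /spt; congr enorm.
by apply/rowP => i; rewrite !mxE; ring.
Qed.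

Lemma spt_0 k ps : spt (sg k) 0 ps = sp (sg k).
Proof. by rewrite /spt !mul0r !scale0r !addr0. Qed.

Lemma spt_nm k a ps : 0 <= a -> enorm (spt (sg k) a ps - sp (sg k)) = a.
Proof. by move=> a0; rewrite -(spt_0 k 0) spt_dist pdC /pol !mul0r pd0 -/(pol a ps) nm_pol. Qed.

Lemma spt_inj k a b ps qs : 0 <= a -> 0 <= b -> 0 <= ps <= pi -> 0 <= qs <= pi ->
  spt (sg k) a ps = spt (sg k) b qs -> a = b /\ (a = 0 \/ ps = qs).
Proof.
move=> a0 b0 hp hq h; have ab : a = b by rewrite -(spt_nm k ps a0) h spt_nm.
split => //; have [->|an] := eqVneq a 0; [by left|right].
move: h; rewrite -ab /spt -!addrA => /addrI /(frame_inj (o k)) [/(mulfI an) h _].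
by rewrite -[ps]cosK ?inE ?h // -[RHS]cosK ?inE.
Qed.

Definition turn k : R := \sum_(i < k) sw (sg i).
Local Notation Th := (turn n).

Lemma StS k : turn k.+1 = turn k + sw (sg k). Proof. exact: big_ord_recr. Qed.

Lemma StDn k : turn (k + n) = turn k + Th.
Proof. by elim: k => [|k IH]; rewrite ?addSn ?add0n ?StS ?IH ?per; [rewrite /(turn 0) big_ord0 add0r|ring]. Qed.

Lemma StDmn k m : turn (k + m * n) = turn k + m%:R * Th.
Proof. by elim: m => [|m IH]; [rewrite mul0n addn0 mul0r addr0|rewrite mulSn addnCA addnC StDn IH -natr1; ring]. Qed.

Lemma sgDmn k m : sg (k + m * n) = sg k.
Proof. by elim: m => [|m IH]; [rewrite mul0n addn0|rewrite mulSn addnCA addnC per]. Qed.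

Lemma St_mono k l : (k <= l)%N -> turn k <= turn l.
Proof. by move=> /subnKC <-; elim: (l - k)%N => [|j IH]; rewrite ?addn0 // addnS StS; have := w0 (k + j); lra. Qed.

Lemma Th_gt0 : 0 < Th.
Proof. by rewrite -(prednK n0) StS; have := w0 n.-1; have := St_mono (leq0n n.-1); rewrite {1}/turn big_ord0; lra. Qed.

Lemma St_mod k l : k = l %[mod n] -> sg k = sg l /\ exists m : int, turn l = turn k + m%:~R * Th.
Proof.
move=> h; rewrite (divn_eq k n) (divn_eq l n) h ![(_ * n + _)%N]addnC !sgDmn !StDmn; split => //.
by exists ((l %/ n)%:Z - (k %/ n)%:Z); rewrite intrD mulrNz; ring.
Qed.

Lemma St_unbounded (y : R) : exists k, y < turn k.
Proof.
have T0 := Th_gt0; have [m hm] : exists m : nat, y / Th < m%:R.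
  by exists (Num.bound `|y / Th|); exact: le_lt_trans (ler_norm _) (archi_boundP (normr_ge0 _)).
exists (0 + m * n)%N; rewrite StDmn {1}/turn big_ord0 add0r; move: hm; rewrite ltr_pdivrMr //.
Qed.

Lemma St_right (y : R) : 0 <= y -> exists k, turn k <= y < turn k.+1.
Proof.
move=> y0; case: (ex_minnP (St_unbounded y)) => -[|k] hk hm; first by move: hk; rewrite /turn big_ord0; lra.
exists k; rewrite hk andbT leNgt; apply/negP => /hm; rewrite ltnn //.
Qed.

Lemma St_left (y : R) : 0 < y -> exists k, turn k < y <= turn k.+1.
Proof.
move=> y0; have ex : exists k, y <= turn k by have [k /ltW hk] := St_unbounded y; exists k.
case: (ex_minnP ex) => -[|k] hk hm; first by move: hk; rewrite /turn big_ord0; lra.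
exists k; rewrite hk andbT ltNge; apply/negP => /hm; rewrite ltnn //.
Qed.

(* At the apex (a = 0) every angle is allowed. *)
Definition sRep (t : face S) z a (f : R) := exists k m ps, [/\ t = sF (sg k), 0 <= a < r, 0 <= ps <= sw (sg k),
  z = spt (sg k) a ps & a = 0 \/ f = turn k + ps - m%:R * Th].

Let ps_pi k ps : 0 <= ps <= sw (sg k) -> 0 <= ps <= pi.
Proof. by move=> /andP[-> h] /=; exact: le_trans h (wp k). Qed.

Let in_sec k a ps : 0 <= a < r -> 0 <= ps <= sw (sg k) -> in_face (sF (sg k)) (spt (sg k) a ps).
Proof.
move=> /andP[a0 ar] hp; have [_ [_ _ h _]] := ok k; apply/h; first by rewrite spt_nm.
by exists ps; rewrite ?spt_nm.
Qed.

Lemma sRepF t z a f : sRep t z a f -> in_face t z /\ 0 <= a < r.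
Proof. by move=> [k [m [ps [-> ha hp -> _]]]]; split => //; exact: in_sec. Qed.

Lemma sRepP t z a f : sRep t z a (f + Th) <-> sRep t z a f.
Proof.
split=> -[k [m [ps [-> ha hp -> h]]]].
  by exists k, m.+1, ps; split => //; case: h => h; [left|right; rewrite -natr1 -[f](addrK Th) h; ring].
exists (k + n)%N, m, ps; rewrite per; split => //; case: h => h; [by left|right; rewrite h StDn; ring].
Qed.

(** Different sectors of a triangle have apexes [2 * r] apart, so no point is within [r] of both. *)
Lemma sRepU t z a f b h : sRep t z a f -> sRep t z b h -> a = b /\ (a = 0 \/ exists m : int, h = f + m%:~R * Th).
Proof.
move=> [k [m [ps [-> /andP[a0 ar] hp -> hf]]]] [l [m' [qs [ht /andP[b0 br] hq hz hh]]]].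
have [kl|far] := sep ht; last first.
  have e1 : enorm (spt (sg k) a ps - sp (sg l)) = b by rewrite hz spt_nm.
  have h4 : enorm (sp (sg k) - spt (sg k) a ps) = a by rewrite -opprB enormN spt_nm.
  by have := enormD (sp (sg k) - spt (sg k) a ps) (spt (sg k) a ps - sp (sg l)); rewrite subrKA h4 e1; lra.
have [es [i hi]] := St_mod kl; rewrite -es in hq hz.
have [abE ab] := spt_inj a0 b0 (ps_pi hp) (ps_pi hq) hz; split => //; rewrite abE; rewrite abE in ab hf.
have [b00|bn] := eqVneq b 0; [by left|right].
case: ab => [/eqP|psq]; first by rewrite (negPf bn).
case: hh => [/eqP|->]; first by rewrite (negPf bn).
case: hf => [/eqP|->]; first by rewrite (negPf bn).
exists (i + m%:Z - m'%:Z); rewrite hi psq !intrD mulrNz -!pmulrn; ring.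
Qed.

(** Near the apex an edge point is on the first or the last side, and the gluing leads to the
    previous or the next sector; for the previous one a full turn is added, so that the index stays
    natural. *)
Lemma sRepG t z t' z' a f : sRep t z a f -> glued_along_edge (t, z) (t', z') -> sRep t' z' a f.
Proof.
move=> [k [m [ps [-> /andP[a0 ar] hp -> hf]]]] [e [s [s01 [ht hz] [-> ->]]]].
have [_ [hA hB _ hE]] := ok k.
have [|b /andP[b0 br] hb] := hE e s (esym ht) s01; first by rewrite -hz spt_nm.
have ar' : 0 <= a < r by rewrite a0.
have br' : 0 <= b < r by rewrite b0.
have mateE (g : ray_germ) : g.1.1 = e -> s = gpar g b -> edge_pt (mate e) (if flip e then 1 - s else s) = gpt (gmate g) b.
  by move=> ge sb; rewrite /gpt gpar_mate -sb /= ge.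
case: hb => -[he sE].
  have [h1 h2] := hA b br'; rewrite /gpt he -sE -hz in h1.
  have hw : 0 <= (0 : R) <= sw (sg k) by rewrite lexx ltW ?w0.
  have [ab ap] := spt_inj a0 b0 (ps_pi hp) (ps_pi hw) h1.
  exists (k + n).-1, m.+1, (sw (sg (k + n).-1)).
  have kn : (k + n).-1.+1 = (k + n)%N by rewrite prednK // addn_gt0 n0 orbT.
  have aj := adj (k + n).-1; rewrite kn per in aj.
  have gg : gmate (sA (sg k)) = sB (sg (k + n).-1) by rewrite -aj gmateK.
  have [_ [_ hB' _ _]] := ok (k + n).-1; have [h3 _] := hB' b br'.
  have [[_ _ _ F2] _] := ok (k + n).-1.
  split; rewrite ?a0 ?lexx ?ltW ?w0 //.
  - by rewrite -F2 -gg /= he.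
  - by rewrite (mateE (sA (sg k))) // gg h3 ab.
  - case: hf => [->|hf]; first by left.
    case: ap => [->|ap]; first by left.
    by right; have E := StDn k; rewrite -{1}kn StS in E; rewrite hf ap E -natr1; ring.
have [h1 h2] := hB b br'; rewrite /gpt he -sE -hz in h1.
have hw : 0 <= sw (sg k) <= sw (sg k) by rewrite lexx ltW ?w0.
have [ab ap] := spt_inj a0 b0 (ps_pi hp) (ps_pi hw) h1.
have [_ [hA' _ _ _]] := ok k.+1; have [h3 _] := hA' b br'.
have [[_ _ F1 _] _] := ok k.+1.
exists k.+1, m, 0; split; rewrite ?a0 ?lexx ?ltW ?w0 //.
- by rewrite -F1 -adj /= he.
- by rewrite (mateE (sB (sg k))) // adj h3 ab.
- case: hf => [->|hf]; first by left.
  case: ap => [->|ap]; first by left.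
  by right; rewrite hf ap StS; ring.
Qed.

Lemma sRepL t z z' a f : sRep t z a f -> in_face t z' -> a + enorm (z' - z) < r ->
  exists b h, sRep t z' b h /\ cd a f b h <= enorm (z' - z).
Proof.
move=> [k [m [ps [-> /andP[a0 ar] hp -> hf]]]] hz' lr; have [_ [_ _ h _]] := ok k.
have nb : enorm (z' - sp (sg k)) < r.
  rewrite -[z' - _](subrKA (spt (sg k) a ps)); apply: le_lt_trans (enormD _ _) _.
  by rewrite spt_nm // addrC.
have [qs hq zE] := (h _ nb).1 hz'.
set b := enorm _ in zE nb; have b0 : 0 <= b := enorm_ge0 _.
have rb (g : R) : g = turn k + qs - m%:R * Th -> sRep (sF (sg k)) z' b g.
  by move=> ge; exists k, m, qs; split => //; [rewrite b0|right].
have e0 : a = 0 -> enorm (z' - spt (sg k) a ps) = b by move=> ->; rewrite spt_0.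
exists b, (turn k + qs - m%:R * Th); split; first exact: rb.
case: hf => [a00|->].
  by rewrite (e0 a00) a00; have := cd_le_add f (turn k + qs - m%:R * Th) (lexx 0) b0; rewrite add0r.
rewrite cd_small.
  rewrite [in leRHS]zE spt_dist le_eqVlt (_ : pd _ _ = pd (pol a ps) (pol b qs)) ?eqxx //.
  by apply: pd_pol_eq => //; congr cos; ring.
rewrite (_ : _ - _ = ps - qs); last by ring.
have /andP[p1 p2] := ps_pi hp; have /andP[q1 q2] := ps_pi hq.
by rewrite ler_norml; apply/andP; split; lra.
Qed.

Lemma sRepA f : exists2 dl : R, 0 < dl & forall h, f - dl <= h <= f + dl ->
  forall a b, 0 <= a < r -> 0 <= b < r ->
  exists t z z', [/\ sRep t z a f, sRep t z' b h & enorm (z' - z) = pd (pol a f) (pol b h)].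
Proof.
have T0 := Th_gt0; pose m := Num.bound (`|f| / Th).
have fm : 0 < f + m%:R * Th.
  have : `|f| / Th < m%:R by apply: archi_boundP; rewrite divr_ge0 // ltW.
  by rewrite ltr_pdivrMr //; have := ler_norm (- f); rewrite normrN; lra.
(* A sector for the angles just above [y] and one for those just below; they differ when [y] is the
   angle of a common side. *)
have [k /andP[k1 k2]] := St_right (ltW fm); have [l /andP[l1 l2]] := St_left fm.
rewrite StS in k2; rewrite StS in l2.
set y := f + _ in fm k1 k2 l1 l2.
exists (Num.min (turn k + sw (sg k) - y) (y - turn l)); first by rewrite lt_min; apply/andP; split; lra.
move=> h hh a b ha hb; have {hh}[h1 h2 h3] : [/\ f - (y - turn l) <= h, h <= f + (turn k + sw (sg k) - y) & True].
  by case/andP: hh; rewrite lerBlDr -lerBlDl addrC; rewrite ?ge_min ?le_min => x1 x2; split => //;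
    [have : Num.min (turn k + sw (sg k) - y) (y - turn l) <= y - turn l by rewrite ge_min lexx orbT|
     have : Num.min (turn k + sw (sg k) - y) (y - turn l) <= turn k + sw (sg k) - y by rewrite ge_min lexx]; lra.
have key j : 0 <= y - turn j <= sw (sg j) -> 0 <= h + m%:R * Th - turn j <= sw (sg j) ->
    exists t z z', [/\ sRep t z a f, sRep t z' b h & enorm (z' - z) = pd (pol a f) (pol b h)].
  move=> j1 j2; exists (sF (sg j)), (spt (sg j) a (y - turn j)), (spt (sg j) b (h + m%:R * Th - turn j)); split.
  - by exists j, m, (y - turn j); split => //; right; rewrite /y; ring.
  - by exists j, m, (h + m%:R * Th - turn j); split => //; right; ring.
  - by rewrite spt_dist; apply: pd_pol_eq => //; congr cos; rewrite /y; ring.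
have yE : y = f + m%:R * Th by [].
have [hf|hf] := leP f h.
  by apply: (key k); apply/andP; split; lra.
by apply: (key l); apply/andP; split; lra.
Qed.

End Sectors.
Section SectorCone.
Context (R : realType) (P : polyhedron R).
Variables (x : P) (r : R) (sg : nat -> sector (pieces P)) (n : nat).
Hypothesis r0 : 0 < r.
Hypothesis n0 : (0 < n)%N.
Hypothesis ok : forall k, sector_ok r (sg k).
Hypothesis per : forall k, sg (k + n) = sg k.
Hypothesis adj : forall k, gmate (sB (sg k)) = sA (sg k.+1).
Hypothesis sep : forall k l, sF (sg k) = sF (sg l) -> k = l %[mod n] \/ 2 * r <= enorm (sp (sg k) - sp (sg l)).
Hypothesis hx : proj (sF (sg 0)) (sp (sg 0)) = x.

Local Notation Rep := (sRep r sg n).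

Lemma sRep_sec k a (ps : R) : 0 <= a < r -> 0 <= ps <= sw (sg k) -> Rep (sF (sg k)) (spt (sg k) a ps) a (turn sg k + ps).
Proof. by move=> ha hp; exists k, 0%N, ps; split => //; right; rewrite mul0r subr0. Qed.

Lemma sector_step k a : 0 <= a < r -> proj (sF (sg k)) (spt (sg k) a (sw (sg k))) = proj (sF (sg k.+1)) (spt (sg k.+1) a 0).
Proof.
move=> ha; have [[_ /andP[w0 _] _ FB] [_ hB _ _]] := ok k; have [[_ /andP[w0' _] FA _] [hA _ _ _]] := ok k.+1.
have hw : 0 <= sw (sg k) <= sw (sg k) by rewrite lexx ltW.
have hw' : 0 <= (0 : R) <= sw (sg k.+1) by rewrite lexx ltW.
have [f1 _] := sRepF r0 n0 ok per adj sep (sRep_sec ha hw).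
have [f2 _] := sRepF r0 n0 ok per adj sep (sRep_sec ha hw').
apply/(proj_glued f1 f2); apply: rst_step.
have [h1 h2] := hB a ha; have [h3 _] := hA a ha.
by have := gmate_glued h2; rewrite adj h1 h3 FA FB.
Qed.

Lemma sector_apex k : proj (sF (sg k)) (sp (sg k)) = x.
Proof.
elim: k => // k IH; rewrite -IH -(spt_0 r0 n0 ok per adj sep k (sw (sg k))) sector_step ?lexx ?r0 //.
by rewrite (spt_0 r0 n0 ok per adj sep).
Qed.

(** After whole turns the angles agree, so the sectors are equal or consecutive, and in the latter
    case the point is on their common side. *)
Lemma sRepW t z t' z' a f : Rep t z a f -> Rep t' z' a f -> proj t z = proj t' z'.
Proof.
move=> [k [m [ps [-> ha hp -> hf]]]] [l [m' [qs [-> _ hq -> hf']]]].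
have [a0|an] := eqVneq a 0.
  by rewrite a0 !(spt_0 r0 n0 ok per adj sep) !sector_apex.
have {hf hf'} E : turn sg (k + m' * n) + ps = turn sg (l + m * n) + qs.
  rewrite !(StDmn r0 n0 ok per adj sep).
  case: hf => [/eqP|hf]; first by rewrite (negPf an).
  by case: hf' => [/eqP|]; [rewrite (negPf an)|rewrite hf => ?; lra].
rewrite -(sgDmn r0 n0 ok per adj sep k m') -(sgDmn r0 n0 ok per adj sep l m).
rewrite -(sgDmn r0 n0 ok per adj sep k m') in hp; rewrite -(sgDmn r0 n0 ok per adj sep l m) in hq.
move: (k + _)%N (l + _)%N hp hq E => i j hp hq E {k l m m'}.
wlog ij : i j ps qs hp hq E / (i <= j)%N.
  by move=> W; case/orP: (leq_total i j) => h; [exact: W|apply/esym; apply: W].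
case: (ltngtP i j) ij => // [ij _|ij _]; last first.
  by move: E; rewrite ij => /addrI ->.
have /andP[p0 p1] := hp; have /andP[q0 q1] := hq.
have := St_mono r0 n0 ok per adj sep ij; rewrite (StS r0 n0 ok per adj sep) => h1.
case: (ltngtP i.+1 j) ij => // [ij2 _|ij2 _].
  have h2 := St_mono r0 n0 ok per adj sep ij2; rewrite (StS r0 n0 ok per adj sep) (StS r0 n0 ok per adj sep) in h2.
  by have [[_ /andP[w0' _] _ _] _] := ok i.+1; exfalso; lra.
have [pE qE] : ps = sw (sg i) /\ qs = 0.
  by rewrite -ij2 (StS r0 n0 ok per adj sep) in E; split; lra.
by rewrite pE qE -ij2; exact: sector_step.
Qed.

Lemma sRepX t z f : Rep t z 0 f -> proj t z = x.
Proof. by move=> [k [m [ps [-> _ _ -> _]]]]; rewrite (spt_0 r0 n0 ok per adj sep) sector_apex. Qed.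

Lemma sectors_cone : turn sg n <= 2 * pi -> exists Phi, cone (fun p q : P => mdist p q) x (turn sg n) (r / 3) Phi.
Proof.
move=> le2pi; have ex a f : 0 <= a < r -> exists t z, Rep t z a f.
  move=> ha; have [dl dl0 h] := sRepA r0 n0 ok per adj sep f.
  have [|t [z [z' [h1 _ _]]]] := h f _ a a ha ha; last by exists t, z.
  by apply/andP; split; lra.
exists (Phi x Rep); apply: model_cone => //.
- exact: (Th_gt0 r0 n0 ok per adj sep).
- exact: (sRepF r0 n0 ok per adj sep).
- exact: sRepW.
- exact: (sRepP r0 n0 ok per adj sep).
- exact: (sRepU r0 n0 ok per adj sep).
- exact: (sRepG r0 n0 ok per adj sep).
- exact: (sRepL r0 n0 ok per adj sep).
- exact: (sRepA r0 n0 ok per adj sep).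
- exact: sRepX.
Qed.

(** Having radius 0 is invariant under the gluing, so every preimage of [x] is an apex: the sectors
    exhaust the corners at a point. *)
Lemma sector_preimages t z : in_face t z -> proj t z = x -> exists k, t = sF (sg k) /\ z = sp (sg k).
Proof.
move=> hz; have [[_ /andP[w0 _] _ _] _] := ok 0.
have h00 : 0 <= (0 : R) < r by rewrite lexx.
have hw : 0 <= (0 : R) <= sw (sg 0) by rewrite lexx ltW.
have h0 := sRep_sec h00 hw; have [f0 _] := sRepF r0 n0 ok per adj sep h0.
rewrite -(sector_apex 0) -(spt_0 r0 n0 ok per adj sep 0 0) => /esym /(proj_glued f0 hz) gl.
have [|k [m [ps [/= h1 _ _ h2 _]]]] := (glued_inv (Q := fun p => Rep p.1 p.2 0 (turn sg 0 + 0)) _ gl).1 h0.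
  by move=> [t1 z1] [t2 z2] g h; exact: (sRepG r0 n0 ok per adj sep) h g.
by exists k; rewrite h1 h2 (spt_0 r0 n0 ok per adj sep).
Qed.

End SectorCone.
Lemma ordS3 (i : 'I_3) : ordS (ordS (ordS i)) = i.
Proof. by apply/val_inj; case: i => -[|[|[|]]]. Qed.

Lemma ordS_neq (i : 'I_3) : ordS i != i.
Proof. by rewrite -val_eqE /=; case: i => -[|[|[|]]]. Qed.

Lemma ordSS_neq (i : 'I_3) : ordS (ordS i) != i.
Proof. by rewrite -val_eqE /=; case: i => -[|[|[|]]]. Qed.

Lemma ord3_cases (i j : 'I_3) : [\/ j = i, j = ordS i | j = ordS (ordS i)].
Proof.
by case: i j => -[|[|[|]]] // hi [[|[|[|]]] // hj];
  [constructor 1|constructor 2|constructor 3|constructor 3|constructor 1|constructor 2|constructor 2|constructor 3|constructor 1];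
  apply/val_inj.
Qed.

Lemma sum3 (V : nmodType) (i : 'I_3) (F : 'I_3 -> V) : \sum_j F j = F i + F (ordS i) + F (ordS (ordS i)).
Proof.
rewrite (bigD1 i) //= (bigD1 (ordS i)) ?ordS_neq //= (bigD1 (ordS (ordS i))) /=; last by rewrite ordSS_neq ordS_neq.
rewrite big1 ?addr0 ?addrA // => j /andP[/andP[h1 h2] h3].
by case: (ord3_cases i j) h1 h2 h3 => ->; rewrite eqxx.
Qed.

(** * Triangles as sectors *)

Section Triangles.
Context (R : realType) (S : gluing R).
Implicit Types (t : face S) (i j : 'I_3) (s a b ps : R) (z u v p : 'rV[R]_2).

Definition cr u v : R := u 0 0 * v 0 1 - u 0 1 * v 0 0.

Lemma corner_cr t i : cr (corner t (ordS i) - corner t i) (corner t (ordS (ordS i)) - corner t i) != 0.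
Proof.
set c := corner t; have base : cr (c (ordS ord0) - c ord0) (c (ordS (ordS ord0)) - c ord0) != 0.
  have := cornerP t; rewrite row_free_unit unitmxE unitfE (expand_det_row _ ord0) !big_ord_recl big_ord0 /cofactor !det_mx11 !mxE /= -/c.
  have e0 : lift (ord0 : 'I_3) (ord0 : 'I_2) = ordS ord0 by apply/val_inj.
  have e1 : lift (ord0 : 'I_3) (lift (ord0 : 'I_2) (0 : 'I_1)) = ordS (ordS ord0) by apply/val_inj.
  have e2 : lift (ord0 : 'I_2) (0 : 'I_1) = 1 by apply/val_inj.
  have e3 : lift (1 : 'I_2) (0 : 'I_1) = 0 by apply/val_inj.
  have e4 : lift (ord0 : 'I_2) (ord0 : 'I_1) = 1 by apply/val_inj.
  have e5 : (ord0 : 'I_2) = 0 by apply/val_inj.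
  rewrite ?e0 ?e1 ?e2 ?e4 ?e3 ?e5 /bump /= => hd; rewrite /cr !mxE; apply: contra_neq hd => hz.
  by rewrite -[RHS]hz addn0 expr0 expr1; ring.
have cyc j : cr (c (ordS j) - c j) (c (ordS (ordS j)) - c j) =
    cr (c (ordS (ordS j)) - c (ordS j)) (c (ordS (ordS (ordS j))) - c (ordS j)).
  by rewrite ordS3 /cr !mxE; ring.
by have [->|->|->] := ord3_cases ord0 i; rewrite // -?cyc.
Qed.

Lemma in_faceP t i z : in_face t z <-> exists a b, [/\ 0 <= a, 0 <= b, a + b <= 1 &
  z = corner t i + a *: (corner t (ordS i) - corner t i) + b *: (corner t (ordS (ordS i)) - corner t i)].
Proof.
split=> [[w [w0 w1 ->]]|[a [b [a0 b0 ab ->]]]].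
  exists (w (ordS i)), (w (ordS (ordS i))); move: w1; rewrite !(sum3 i) => w1; split=> //.
    by have := w0 i; lra.
  have -> : w i = 1 - w (ordS i) - w (ordS (ordS i)) by lra.
  by apply/rowP => k; rewrite !mxE; ring.
exists (fun j => if j == i then 1 - a - b else if j == ordS i then a else b); split.
- by move=> j; case: ifP => _; [lra|case: ifP].
- by rewrite (sum3 i) eqxx (negPf (ordS_neq i)) eqxx (negPf (ordSS_neq i)) (negPf (ordS_neq (ordS i))); ring.
- rewrite (sum3 i) eqxx (negPf (ordS_neq i)) eqxx (negPf (ordSS_neq i)) (negPf (ordS_neq (ordS i))).
  by apply/rowP => k; rewrite !mxE; ring.
Qed.

(** The sign of the cross product chooses the orientation of the frame, so that a triangle lies
    above its first side whichever way its corners turn. *)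
Lemma frame_ex U V : cr U V != 0 -> exists u v L x y, [/\ orthonormal u v, 0 < L, 0 < y, U = L *: u & V = x *: u + y *: v] /\ L = enorm U.
Proof.
move=> h; pose L := enorm U; pose D := cr U V.
have LL : U 0 0 ^+ 2 + U 0 1 ^+ 2 = L ^+ 2 by rewrite /L enorm_nm nm_sqr.
have L0 : 0 < L.
  rewrite lt_neqAle enorm_ge0 andbT eq_sym; apply: contra_neq h => l0.
  by move: LL; rewrite l0 expr0n => /eqP; rewrite paddr_eq0 ?sqr_ge0 // !sqrf_eq0 /cr => /andP[/eqP -> /eqP ->]; ring.
have Ln : L != 0 by rewrite gt_eqF.
pose sg : R := if 0 < D then 1 else -1.
have sg2 : sg * sg = 1 by rewrite /sg; case: ifP => _; ring.
have sD : sg * D = `|D|.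
  rewrite /sg; case: ifP => d0; first by rewrite gtr0_norm // mul1r.
  by rewrite ler0_norm ?mulN1r // leNgt d0.
pose u : 'rV[R]_2 := L^-1 *: U.
pose v : 'rV[R]_2 := \row_k (if k == 0 then - sg * u 0 1 else sg * u 0 0).
have uu : u 0 0 ^+ 2 + u 0 1 ^+ 2 = 1.
  by rewrite !mxE !exprMn -mulrDr LL exprVn mulVf // expf_neq0.
have e2 (p q : 'rV[R]_2) : edot p q = p 0 0 * q 0 0 + p 0 1 * q 0 1.
  by rewrite /edot !big_ord_recl big_ord0 addr0; congr (_ + p 0 _ * q 0 _); exact: val_inj.
have v0 : v 0 0 = - sg * u 0 1 by rewrite mxE eqxx.
have v1 : v 0 1 = sg * u 0 0 by rewrite mxE.
exists u, v, L, (edot U V / L), (`|D| / L); split; last by [].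
split => //.
- split; rewrite e2 ?v0 ?v1; [by rewrite -!expr2| |by ring].
  by transitivity (sg * sg * (u 0 0 ^+ 2 + u 0 1 ^+ 2)); [ring|rewrite sg2 uu mulr1].
- by rewrite divr_gt0 // normr_gt0.
- by rewrite /u scalerA divff // scale1r.
- have E : L * L = U 0 0 * U 0 0 + U 0 1 * U 0 1 by rewrite -!expr2 LL.
  apply/rowP => k; rewrite [RHS]mxE [X in X + _]mxE [X in _ + X]mxE e2 -sD /D /cr.
  have [->|->] : k = 0 \/ k = 1 by case: k => -[|[|]] // hk; [left|right]; exact: val_inj.
    rewrite v0 !mxE; transitivity ((L * L) * V 0 0 / (L * L)); first by field.
    transitivity (((U 0 0 * V 0 0 + U 0 1 * V 0 1) * U 0 0 - (sg * sg) * (U 0 0 * V 0 1 - U 0 1 * V 0 0) * U 0 1) / (L * L)); last by field.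
    by rewrite sg2 E; congr (_ / _); ring.
  rewrite v1 !mxE; transitivity ((L * L) * V 0 1 / (L * L)); first by field.
  transitivity (((U 0 0 * V 0 0 + U 0 1 * V 0 1) * U 0 1 + (sg * sg) * (U 0 0 * V 0 1 - U 0 1 * V 0 0) * U 0 0) / (L * L)); last by field.
  by rewrite sg2 E; congr (_ / _); ring.
Qed.

End Triangles.

Section Wedge.
Context (R : realType).

Lemma wedgeP (w X Y : R) : 0 < w <= pi ->
  0 <= Y /\ 0 <= X * sin w - Y * cos w <-> exists2 ps, 0 <= ps <= w & (X, Y) = pol (nm (X, Y)) ps.
Proof.
move=> /andP[w0 wp]; split=> [[Y0 h]|[ps /andP[p0 p1] e]].
  have [n0|n0] := eqVneq (nm (X, Y)) 0.
    by exists 0; rewrite ?lexx ?ltW // (nm0 n0) nm00 /pol !mul0r.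
  have np : 0 < nm (X, Y) by rewrite lt_neqAle eq_sym n0 nm_ge0.
  have E := pol_arg (X, Y); set ps := arg _ in E; have r1 := arg_range (X, Y); rewrite -/ps in r1.
  have ps0 : 0 <= ps by rewrite /ps /arg /= Y0; apply: acos_ge0; exact: (nm_div (X, Y)).
  exists ps => //; rewrite ps0 leNgt /=; apply/negP => wps.
  rewrite ger0_norm // in r1.
  have s0 : 0 < sin (ps - w) by apply: sin_gt0_pi; apply/andP; split; lra.
  move: h; rewrite leNgt => /negP; apply.
  have [eX eY] : nm (X, Y) * cos ps = X /\ nm (X, Y) * sin ps = Y by case: E.
  rewrite -[X in X * sin w]eX -[X in _ - X * cos w]eY; move: (nm (X, Y)) np => k k0.
  rewrite (_ : _ - _ = - (k * sin (ps - w))); last by rewrite sinB; ring.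
  by rewrite oppr_lt0 mulr_gt0.
have k0 := nm_ge0 (X, Y); move: (nm (X, Y)) k0 e => k k0 [-> ->]; split.
  by rewrite mulr_ge0 // sin_ge0_pi // p0 (le_trans p1).
rewrite (_ : _ - _ = k * sin (w - ps)); last by rewrite sinB; ring.
by rewrite mulr_ge0 // sin_ge0_pi //; apply/andP; split; lra.
Qed.

End Wedge.
Section TriangleSectors.
Context (R : realType) (S : gluing R).
Implicit Types (t : face S) (i j : 'I_3) (s a b ps : R) (z u v p : 'rV[R]_2) (g : ray_germ S).

(** The same sector read from its last side. A gluing may reverse orientation, so sectors have to be
    traversed in both senses. *)
Definition sector_flip (c : sector S) : sector S :=
  Sector (sF c) (sp c) (cos (sw c) *: su c + sin (sw c) *: sv c) (sin (sw c) *: su c - cos (sw c) *: sv c) (sw c) (sB c) (sA c).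

Lemma spt_flip c a ps : spt (sector_flip c) a ps = spt c a (sw c - ps).
Proof. by rewrite /spt /= cosB sinB; apply/rowP => k; rewrite !mxE; ring. Qed.

Lemma edot_comb u v (x y x' y' : R) : orthonormal u v -> edot (x *: u + y *: v) (x' *: u + y' *: v) = x * x' + y * y'.
Proof.
move=> [uu vv uv]; transitivity (x * x' * edot u u + y * y' * edot v v + (x * y' + y * x') * edot u v); last by rewrite uu vv uv; ring.
by rewrite /edot !big_ord_recl !big_ord0 !mxE; ring.
Qed.

Lemma sector_flip_ok (r : R) c : sector_ok r c -> sector_ok r (sector_flip c).
Proof.
move=> [[on /andP[w0 wp] FA FB] [hA hB hz he]]; have cs := cos2Dsin2 (sw c).
split; split => //=.
- split.
  + by rewrite edot_comb // -!expr2.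
  + by rewrite -scaleNr edot_comb // mulrNN -!expr2 addrC.
  + by rewrite -scaleNr edot_comb //; ring.
- by rewrite w0.
- by move=> a ha; rewrite spt_flip subr0; exact: hB.
- by move=> a ha; rewrite spt_flip subrr; exact: hA.
- move=> z zr; rewrite hz //; split=> -[ps /andP[p0 p1] e].
    by exists (sw c - ps); [apply/andP; split; lra|rewrite spt_flip opprB addrCA subrr addr0].
  by exists (sw c - ps); [apply/andP; split; lra|rewrite -spt_flip].
- by move=> e s h1 h2 h3; have [a ha h] := he e s h1 h2 h3; exists a => //; case: h; [right|left].
Qed.

Section Frame.
Variables (t : face S) (i : 'I_3) (u v : 'rV[R]_2) (L x y s : R).
Let ci := corner t i.
Let p := edge_pt (t, i) s.
Hypothesis o : orthonormal u v.
Hypothesis L0 : 0 < L.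
Hypothesis y0 : 0 < y.
Hypothesis hU : corner t (ordS i) - corner t i = L *: u.
Hypothesis hV : corner t (ordS (ordS i)) - corner t i = x *: u + y *: v.
(** A bound for the passage from the frame to affine coordinates of the triangle: it converts a
    radius into a bound on [ca] and [Y / y]. *)
Let kp := (1 + `|x| / y) / L + y^-1.

Lemma elenE : elen (t, i) = L.
Proof. by rewrite /elen /= hU -[L *: u]addr0 -(scale0r v) enorm_frame //; apply: nm_eq; [exact: ltW|rewrite /=; ring]. Qed.

Lemma kappa_gt0 : 0 < kp. Proof. by rewrite addr_gt0 ?invr_gt0 // divr_gt0 // ltr_pwDl // divr_ge0 // ltW. Qed.

Lemma kappaL : L^-1 <= kp.
Proof.
have y0' : 0 <= y^-1 by rewrite invr_ge0 ltW.
have : 0 <= `|x| / y / L by rewrite !divr_ge0 // ltW.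
rewrite /kp mulrDl mul1r; lra.
Qed.

Lemma kappay : y^-1 <= kp.
Proof. by rewrite lerDr divr_ge0 ?addr_ge0 ?divr_ge0 // ltW. Qed.

Definition ca (X Y : R) := (X - (Y / y) * x) / L.

Lemma ca_small X Y r : nm (X, Y) < r -> `|ca X Y| + `|Y / y| < r * kp.
Proof.
move=> h; have X1 : `|X| < r by apply: le_lt_trans h; exact: (nm_fst (X, Y)).
have Y1 : `|Y| < r by apply: le_lt_trans h; exact: (nm_snd (X, Y)).
have Li : 0 < L^-1 by rewrite invr_gt0.
have yi : 0 < y^-1 by rewrite invr_gt0.
have h1 : `|Y / y| < r / y by rewrite normrM (gtr0_norm yi) ltr_pM2r.
have h2 : `|ca X Y| <= (r + r / y * `|x|) / L.
  rewrite /ca normrM (gtr0_norm Li) ler_pM2r //; apply: le_trans (ler_normB _ _) _.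
  by apply: lerD; [exact: ltW|rewrite normrM ler_wpM2r // ltW].
have e : r * kp = (r + r / y * `|x|) / L + r / y by rewrite /kp; field; rewrite !gt_eqF.
by rewrite e; lra.
Qed.

Lemma frame_coord z : exists X Y, z = p + X *: u + Y *: v.
Proof.
have [uu vv uv] := o.
suff [X [Y e]] : exists X Y, z - p = X *: u + Y *: v by exists X, Y; rewrite -addrA -e addrC subrK.
move: (z - p) => q.
have e2 (w w' : 'rV[R]_2) : edot w w' = w 0 0 * w' 0 0 + w 0 1 * w' 0 1.
  by rewrite /edot !big_ord_recl big_ord0 addr0; congr (_ + w 0 _ * w' 0 _); exact: val_inj.
rewrite !e2 in uu vv uv.
pose D := u 0 0 * v 0 1 - u 0 1 * v 0 0.
have D2 : D * D = 1.
  transitivity ((u 0 0 * u 0 0 + u 0 1 * u 0 1) * (v 0 0 * v 0 0 + v 0 1 * v 0 1) - (u 0 0 * v 0 0 + u 0 1 * v 0 1) ^+ 2); first by rewrite /D; ring.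
  by rewrite uu vv uv; ring.
exists (D * (q 0 0 * v 0 1 - q 0 1 * v 0 0)), (D * (u 0 0 * q 0 1 - u 0 1 * q 0 0)).
apply/rowP => k; have [->|->] : k = 0 \/ k = 1 by case: k => -[|[|]] // hk; [left|right]; exact: val_inj.
  by rewrite !mxE -[LHS]mul1r -D2 {2}/D; ring.
by rewrite !mxE -[LHS]mul1r -D2 {2}/D; ring.
Qed.

Lemma frame_pt X Y : p + X *: u + Y *: v = ci + (s + ca X Y) *: (corner t (ordS i) - ci) + (Y / y) *: (corner t (ordS (ordS i)) - ci).
Proof.
have Ln : L != 0 by rewrite gt_eqF.
have yn : y != 0 by rewrite gt_eqF.
rewrite hV hU /p /edge_pt /=; have -> : corner t (ordS i) = ci + L *: u by rewrite -hU addrC subrK.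
by apply/rowP => k; rewrite !mxE /ca; field; rewrite Ln yn.
Qed.

Lemma coord_uniq a b a' b' : ci + a *: (corner t (ordS i) - ci) + b *: (corner t (ordS (ordS i)) - ci) =
   ci + a' *: (corner t (ordS i) - ci) + b' *: (corner t (ordS (ordS i)) - ci) -> a = a' /\ b = b'.
Proof.
rewrite hU hV -!addrA => /addrI; rewrite !scalerDr !scalerA !addrA -!scalerDl => /(frame_inj o) [h1 h2].
have yn : y != 0 by rewrite gt_eqF.
have Ln : L != 0 by rewrite gt_eqF.
have bb : b = b' := mulIf yn h2; split => //.
by move: h1; rewrite bb => /addIr /(mulIf Ln).
Qed.

Lemma frame_in X Y : in_face t (p + X *: u + Y *: v) <-> [/\ 0 <= s + ca X Y, 0 <= Y & s + ca X Y + Y / y <= 1].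
Proof.
have yi : 0 < y^-1 by rewrite invr_gt0.
rewrite frame_pt (in_faceP t i); split=> [[a [b [a0 b0 ab]]]|[h1 h2 h3]].
  by move=> /coord_uniq [-> e]; rewrite e; split => //; rewrite -(pmulr_lge0 _ yi) e.
by exists (s + ca X Y), (Y / y); split => //; rewrite divr_ge0 // ltW.
Qed.

Lemma edge_coord j (s' : R) : exists a b, edge_pt (t, j) s' = ci + a *: (corner t (ordS i) - ci) + b *: (corner t (ordS (ordS i)) - ci) /\
  [\/ [/\ j = i, a = s' & b = 0], [/\ j = ordS i, a = 1 - s' & b = s'] | [/\ j = ordS (ordS i), a = 0 & b = 1 - s']].
Proof.
have [->|->|->] := ord3_cases i j.
- exists s', 0; split; last by constructor 1.
  by apply/rowP => k; rewrite !mxE /=; ring.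
- exists (1 - s'), s'; split; last by constructor 2.
  by apply/rowP => k; rewrite !mxE /=; ring.
- exists 0, (1 - s'); split; last by constructor 3.
  by rewrite /edge_pt /= ordS3; apply/rowP => k; rewrite !mxE /=; ring.
Qed.

End Frame.
End TriangleSectors.
Section LocalSectors.
Context (R : realType) (S : gluing R).
Implicit Types (t : face S) (i j : 'I_3) (s a b ps : R) (z u v p : 'rV[R]_2) (c : sector S).

Lemma edge_pt0 t i : edge_pt (t, i) 0 = corner t i.
Proof. by rewrite /edge_pt subr0 scale1r scale0r addr0. Qed.

Lemma spt_frame c a ps : spt c a ps = sp c + (pol a ps).1 *: su c + (pol a ps).2 *: sv c.
Proof. by []. Qed.

Lemma sector_wedge c (r X Y : R) : orthonormal (su c) (sv c) -> 0 < sw c <= pi ->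
  (0 <= Y /\ 0 <= X * sin (sw c) - Y * cos (sw c)) <->
  exists2 ps, 0 <= ps <= sw c & sp c + X *: su c + Y *: sv c = spt c (nm (X, Y)) ps.
Proof.
move=> on hw; rewrite (wedgeP X Y hw); split=> -[ps hp e]; exists ps => //; first by rewrite spt_frame -e.
move: e; rewrite spt_frame -!addrA => /addrI /(frame_inj on) [h1 h2].
by rewrite [RHS]surjective_pairing -h1 -h2.
Qed.

Lemma frame_norm u v p (X Y : R) : orthonormal u v -> enorm (p + X *: u + Y *: v - p) = nm (X, Y).
Proof. by move=> on; rewrite -(addrA p) [p + _]addrC addrK enorm_frame. Qed.

Lemma edge_sector t i s : 0 < s < 1 -> exists c,
  [/\ sF c = t, sp c = edge_pt (t, i) s, sw c = pi, sA c = ((t, i), s, false) & sB c = ((t, i), s, true)] /\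
  exists2 r0 : R, 0 < r0 & forall r : R, 0 < r <= r0 -> sector_ok r c.
Proof.
move=> /andP[s0 s1]; have [u [v [L [x [y [[on L0 y0 hU hV] _]]]]]] := frame_ex S (corner_cr t i).
pose c := Sector t (edge_pt (t, i) s) u v pi ((t, i), s, false) ((t, i), s, true).
exists c; split=> //.
have k0 := kappa_gt0 s on L0 y0 hU hV; have kL := kappaL s on L0 y0 hU hV; move: k0 kL; set kp := _ + _ => k0 kL.
(* Below the radius [m / kp] the affine coordinates move by less than [m], so the other two edges
   are not reached. *)
pose m := Num.min s (1 - s).
have m0 : 0 < m by rewrite lt_min s0 subr_gt0.
have [m1 m2] : m <= s /\ m <= 1 - s by rewrite /m !ge_min !lexx orbT.
exists (m / kp); first by rewrite divr_gt0.
move=> r /andP[r0 rm]; have {rm}rk : r * kp <= m by rewrite -ler_pdivlMr.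
have Ln : L != 0 by rewrite gt_eqF.
have yn : y != 0 by rewrite gt_eqF.
have el : elen (t, i) = L := elenE s on L0 y0 hU hV.
have aL (a : R) : 0 <= a < r -> 0 <= a / L < m.
  move=> /andP[a0 ar]; rewrite divr_ge0 ?(ltW L0) //=; apply: lt_le_trans rk.
  have Li : 0 < L^-1 by rewrite invr_gt0.
  apply: (lt_le_trans (y := r * L^-1)); first by rewrite ltr_pM2r.
  by rewrite ler_pM2l.
have hp : edge_pt (t, i) s + 0 = edge_pt (t, i) s by rewrite addr0.
have ept (q : R) : edge_pt (t, i) (s + q / L) = edge_pt (t, i) s + q *: u.
  have cE : corner t (ordS i) = corner t i + L *: u by rewrite -hU addrC subrK.
  by rewrite /edge_pt /= cE; apply/rowP => k; rewrite !mxE; field.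
split; split => //.
- by rewrite pi_gt0 lexx.
- move=> a ha; have /andP[h1 h2] := aL a ha; rewrite /gpt /gpar /= el.
  by rewrite ept /spt /= cos0 sin0 mulr1 mulr0 scale0r addr0; split => //; apply/andP; split; lra.
- move=> a ha; have /andP[h1 h2] := aL a ha; rewrite /gpt /gpar /= el.
  rewrite ept /spt /= cospi sinpi mulrN1 mulr0 scale0r addr0; split => //.
  by rewrite mulNr; apply/andP; split; lra.
- move=> z; have [X [Y ->]] := frame_coord s on L0 y0 hU hV z.
  rewrite /= (frame_norm _ _ _ on) => nr.
  have sm := ca_small s on L0 y0 hU hV nr; rewrite -/kp in sm.
  rewrite (frame_in s on L0 y0 hU hV) -(@sector_wedge c r) //=; last by rewrite pi_gt0 lexx.
  rewrite sinpi cospi mulr0 mulrN1 opprK add0r.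
  split=> [[_ Y0 _] //|[Y0 _]]; split => //.
    by have := ler_norm (- ca L x y X Y); rewrite normrN; have := normr_ge0 (Y / y); lra.
  by have := ler_norm (ca L x y X Y); have := ler_norm (Y / y); lra.
- move=> [t' j] s' /= -> s'01.
  have [a [b [eE cs]]] := edge_coord s on L0 y0 hU hV j s'.
  have [X [Y pE]] := frame_coord s on L0 y0 hU hV (edge_pt (t, j) s').
  rewrite pE (frame_norm _ _ _ on) => nr.
  have sm := ca_small s on L0 y0 hU hV nr; rewrite -/kp in sm.
  have := pE; rewrite eE (frame_pt s on L0 y0 hU hV) => /(coord_uniq s on L0 y0 hU hV) [aE bE].
  have q1 := ler_norm (ca L x y X Y); have q2 := ler_norm (- ca L x y X Y); have q3 := ler_norm (Y / y).
  have q4 := normr_ge0 (Y / y); rewrite normrN in q2.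
  case: cs => -[jE a1 b1]; [|exfalso; lra|exfalso; lra].
  have Y0 : Y = 0 by apply/eqP; have/eqP := bE; rewrite b1 eq_sym mulf_eq0 invr_eq0 (negPf yn) orbF.
  have sX : s' = s + X / L by rewrite -a1 aE /ca Y0 mul0r mul0r subr0.
  have XL : `|X| < r by apply: le_lt_trans nr; exact: (nm_fst (X, Y)).
  exists `|X|; first by rewrite normr_ge0.
  have [X0|X0] := leP 0 X; [left|right]; rewrite jE; split => //; rewrite sX /gpar /= el.
    by rewrite ger0_norm.
  by rewrite ltr0_norm // opprK.
Qed.

Lemma corner_sector t i : exists c,
  [/\ sF c = t, sp c = corner t i, sw c = corner_angle (t, i), sA c = ((t, i), 0, false) & sB c = ((t, ordS (ordS i)), 1, true)] /\
  exists2 r0 : R, 0 < r0 & forall r : R, 0 < r <= r0 -> sector_ok r c.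
Proof.
have [u [v [L [x [y [[on L0 y0 hU hV] LE]]]]]] := frame_ex S (corner_cr t i).
pose w := corner_angle (t, i); pose M := nm (x, y).
have ME : enorm (corner t (ordS (ordS i)) - corner t i) = M by rewrite hV enorm_frame.
have M0 : 0 < M by rewrite lt_neqAle nm_ge0 andbT eq_sym; apply: contraTneq y0 => /nm0 [_ ->]; rewrite ltxx.
have Mn : M != 0 by rewrite gt_eqF.
have Ln : L != 0 by rewrite gt_eqF.
have yn : y != 0 by rewrite gt_eqF.
have wE : w = arg (x, y).
  rewrite /w /corner_angle /arg /= (ltW y0) ME -LE hU hV -[L *: u]addr0 -(scale0r v) edot_comb //.
  by rewrite mul0r addr0 -mulf_div divff // mul1r.
have [xE yE] : x = M * cos w /\ y = M * sin w.
  by have := pol_arg (x, y); rewrite -wE -/M => -[-> ->].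
have w01 : 0 <= w <= pi.
  by rewrite wE /arg /= (ltW y0) acos_ge0 ?acos_lepi //; exact: (nm_div (x, y)).
have w0 : 0 < w <= pi.
  have /andP[w1 w2] := w01; rewrite w2 andbT lt_neqAle w1 andbT eq_sym.
  by apply: contraTneq y0 => w00; rewrite yE w00 sin0 mulr0 ltxx.
pose c := Sector t (corner t i) u v w ((t, i), 0, false) ((t, ordS (ordS i)), 1, true).
exists c; split=> //.
have k0 := kappa_gt0 0 on L0 y0 hU hV; have kL := kappaL 0 on L0 y0 hU hV; have ky := kappay 0 on L0 y0 hU hV.
move: k0 kL ky; set kp := _ + y^-1 => k0 kL ky.
exists kp^-1; first by rewrite invr_gt0.
move=> r /andP[r0 rm]; have {rm}rk : r * kp <= 1 by rewrite -ler_pdivlMr // div1r.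
have el : elen (t, i) = L := elenE 0 on L0 y0 hU hV.
have el2 : elen (t, ordS (ordS i)) = M by rewrite /elen /= ordS3 -opprB enormN.
have aL (a : R) : 0 <= a < r -> 0 <= a / L <= 1.
  move=> /andP[a0 ar]; rewrite divr_ge0 ?(ltW L0) //=; apply: le_trans rk.
  by apply: ler_pM => //; [rewrite invr_ge0 ltW|exact: ltW].
have yM : y <= M by apply: le_trans (ler_norm y) _; exact: (nm_snd (x, y)).
have aM (a : R) : 0 <= a < r -> 0 <= a / M <= 1.
  move=> /andP[a0 ar]; rewrite divr_ge0 ?(ltW M0) //=; apply: le_trans rk.
  have My : M^-1 <= y^-1 by rewrite lef_pV2.
  by apply: ler_pM; [|rewrite invr_ge0 ltW|exact: ltW|exact: le_trans ky].
have cV : corner t (ordS (ordS i)) = corner t i + (x *: u + y *: v) by rewrite -hV addrC subrK.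
have p0 := edge_pt0 t i.
split; split => //.
- move=> a ha; have /andP[h1 h2] := aL a ha; rewrite /gpt /gpar /= el add0r h1 h2; split => //.
  have cE : corner t (ordS i) = corner t i + L *: u by rewrite -hU addrC subrK.
  rewrite /edge_pt /spt /= cE cos0 sin0 mulr1 mulr0 scale0r addr0.
  by apply/rowP => k; rewrite !mxE; field.
- move=> a ha; have /andP[h1 h2] := aM a ha; rewrite /gpt /gpar /= el2 mulNr; split; last by apply/andP; split; lra.
  rewrite /edge_pt /spt /= ordS3 cV.
  have -> : a * cos w = a / M * x by rewrite {1}xE; field.
  have -> : a * sin w = a / M * y by rewrite {1}yE; field.
  by apply/rowP => k; rewrite !mxE; field.
- move=> z; have [X [Y ->]] := frame_coord 0 on L0 y0 hU hV z.
  rewrite p0 /= (frame_norm _ _ _ on) => nr.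
  have sm := ca_small 0 on L0 y0 hU hV nr; rewrite -/kp in sm.
  have := frame_in 0 on L0 y0 hU hV X Y; rewrite p0 => ->; rewrite -(@sector_wedge c r) //= add0r.
  have caE : ca L x y X Y = (X * sin w - Y * cos w) * (M / (y * L)).
    rewrite /ca {1}xE; transitivity ((X * y - Y * (M * cos w)) / (y * L)); first by field; rewrite yn Ln.
    by rewrite {1}yE; field; rewrite yn Ln.
  have cp : 0 < M / (y * L) by rewrite divr_gt0 // mulr_gt0.
  rewrite caE pmulr_lge0 // -caE.
  split=> [[h1 h2 _] //|[h1 h2]]; split => //.
  by have := ler_norm (ca L x y X Y); have := ler_norm (Y / y); lra.
- move=> [t' j] s' /= -> /andP[s'0 s'1].
  have [a [b [eE cs]]] := edge_coord 0 on L0 y0 hU hV j s'.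
  have [X [Y pE]] := frame_coord 0 on L0 y0 hU hV (edge_pt (t, j) s').
  rewrite pE p0 (frame_norm _ _ _ on) => nr.
  have sm := ca_small 0 on L0 y0 hU hV nr; rewrite -/kp in sm.
  have := pE; rewrite eE (frame_pt 0 on L0 y0 hU hV) add0r => /(coord_uniq 0 on L0 y0 hU hV) [aE bE].
  have q1 := ler_norm (ca L x y X Y); have q3 := ler_norm (Y / y).
  case: cs => -[jE a1 b1]; [|exfalso; lra|].
    have Y0 : Y = 0 by apply/eqP; have/eqP := bE; rewrite b1 eq_sym mulf_eq0 invr_eq0 (negPf yn) orbF.
    have sX : s' = X / L by rewrite -a1 aE /ca Y0 mul0r mul0r subr0.
    have X0 : 0 <= X by rewrite -(divfK Ln X) -sX mulr_ge0 // ltW.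
    have XL : X < r by apply: le_lt_trans nr; apply: le_trans (ler_norm _) _; exact: (nm_fst (X, Y)).
    by exists X; [rewrite X0|left; rewrite jE /gpar /= el add0r sX].
  have XE : X = Y / y * x.
    by have /eqP := aE; rewrite a1 eq_sym /ca mulf_eq0 invr_eq0 (negPf Ln) orbF subr_eq0 => /eqP.
  have YE : Y = Y / y * y by rewrite divfK.
  have b0 : 0 <= Y / y by rewrite -bE b1 subr_ge0.
  have nE : nm (X, Y) = Y / y * M.
    by rewrite XE {2}YE -(ger0_norm b0) (nmZ (`|Y / y|) (x, y)) normr_id.
  exists (nm (X, Y)); first by rewrite nm_ge0.
  by right; rewrite jE /gpar /= el2 nE mulNr mulfK // -bE b1; split => //; ring.
Qed.

End LocalSectors.
Lemma finite_radius (R : realType) (T : finType) (Q : T -> R -> Prop) :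
  (forall i, exists2 r0 : R, 0 < r0 & forall r : R, 0 < r <= r0 -> Q i r) ->
  exists2 r0 : R, 0 < r0 & forall r : R, 0 < r <= r0 -> forall i, Q i r.
Proof.
move=> h; suff H (s : seq T) : exists2 r0 : R, 0 < r0 & forall r : R, 0 < r <= r0 -> forall i, i \in s -> Q i r.
  by have [r0 r00 hr] := H (enum T); exists r0 => // r rr i; apply: hr; rewrite // mem_enum.
elim: s => [|i s [r1 r10 h1]]; first by exists 1.
have [r2 r20 h2] := h i; exists (Num.min r1 r2); first by rewrite lt_min r10.
move=> r /andP[r0]; rewrite le_min => /andP[rr1 rr2] j; rewrite inE => /orP[/eqP ->|js].
  by apply: h2; rewrite r0.
by apply: h1; rewrite ?r0.
Qed.

Section LocalCones.
Context (R : realType) (P : polyhedron R).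
Local Notation S := (pieces P).

Lemma sectors_radius (sg : nat -> sector S) n : (0 < n)%N -> (forall k, sg (k + n)%N = sg k) ->
  (forall k, exists2 r0 : R, 0 < r0 & forall r : R, 0 < r <= r0 -> sector_ok r (sg k)) ->
  (forall k l, sF (sg k) = sF (sg l) -> sp (sg k) = sp (sg l) -> k = l %[mod n]) ->
  exists r : R, [/\ 0 < r, forall k, sector_ok r (sg k) &
   forall k l, sF (sg k) = sF (sg l) -> k = l %[mod n] \/ 2 * r <= enorm (sp (sg k) - sp (sg l))].
Proof.
move=> n0 per ok inj.
have sgm k : sg (k %% n)%N = sg k.
  by rewrite [in RHS](divn_eq k n); elim: (k %/ n)%N => [|j IH]; rewrite ?mul0n // mulSn -addnA addnC per.
have [r1 r10 h1] := @finite_radius R 'I_n (fun k r => sector_ok r (sg k)) (fun k => ok k).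
have [|r2 r20 h2] := @finite_radius R ('I_n * 'I_n)%type (fun kl r => sF (sg kl.1) = sF (sg kl.2) -> kl.1 = kl.2 \/ 2 * r <= enorm (sp (sg kl.1) - sp (sg kl.2))).
  move=> [k l] /=; have [hF|nF] := pselect (sF (sg k) = sF (sg l)); last by exists 1.
  have [/inj h|np] := pselect (sp (sg k) = sp (sg l)).
    by exists 1 => // r _ _; left; apply/val_inj; have := h hF; rewrite /= !modn_small.
  have e0 : 0 < enorm (sp (sg k) - sp (sg l)).
    rewrite lt_neqAle enorm_ge0 andbT eq_sym enorm_nm; apply/eqP => /nm0 [q1 q2]; apply: np.
    apply/eqP; rewrite -subr_eq0; apply/eqP/rowP => j; rewrite [RHS]mxE.
    by have [->|->] : j = 0 \/ j = 1 by case: j => -[|[|]] // hj; [left|right]; exact: val_inj.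
  exists (enorm (sp (sg k) - sp (sg l)) / 2); first by rewrite divr_gt0.
  by move=> r /andP[r0 rr] _; right; lra.
exists (Num.min r1 r2); have m0 : 0 < Num.min r1 r2 by rewrite lt_min r10.
have [m1 m2] : Num.min r1 r2 <= r1 /\ Num.min r1 r2 <= r2 by rewrite !ge_min !lexx orbT.
split => // [k|k l].
  by rewrite -sgm; apply: (h1 _ _ (Ordinal (ltn_pmod k n0))); rewrite m0.
rewrite -(sgm k) -(sgm l) => hF.
have := h2 (Num.min r1 r2) _ (Ordinal (ltn_pmod k n0), Ordinal (ltn_pmod l n0)) hF; rewrite m0 m2 => /(_ isT) [[e]|]; last by right.
by left.
Qed.

Lemma edge_pt_inj (t : face S) i j (s s' : R) : 0 < s < 1 -> 0 < s' < 1 -> edge_pt (t, i) s = edge_pt (t, j) s' -> i = j.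
Proof.
move=> /andP[s0 s1] /andP[s0' s1'].
have [u [v [L [x [y [[on L0 y0 hU hV] _]]]]]] := frame_ex S (corner_cr t i).
have [a [b [-> h1]]] := edge_coord s on L0 y0 hU hV i s.
have [a' [b' [-> h2]]] := edge_coord s on L0 y0 hU hV j s'.
move=> /(coord_uniq s on L0 y0 hU hV) [aa bb].
have [a1 b1] : a = s /\ b = 0.
  case: h1 => -[e] -> ->; [by []|by have := ordS_neq i; rewrite -e eqxx|by have := ordSS_neq i; rewrite -e eqxx].
by case: h2 => -[-> a2 b2]; [|exfalso; lra|exfalso; lra].
Qed.

Lemma edge_cone (e : face S * 'I_3) (s : R) : 0 < s < 1 ->
  exists r Phi, cone (fun p q : P => mdist p q) (proj e.1 (edge_pt e s)) (2 * pi) r Phi.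
Proof.
case: e => t i s01 /=; have /andP[s0 s1] := s01.
have [c0 [[F0 p0 w0 A0 B0] ok0]] := edge_sector t i s01.
pose e : face S * 'I_3 := (t, i); pose s' := if flip e then 1 - s else s.
have s'01 : 0 < s' < 1 by rewrite /s'; case: (flip e) => //; apply/andP; split; lra.
(* If the gluing keeps the parameter of the edge, the second sector is reversed, so that its first
   side is glued to the last side of [c0]. *)
have [c1 [[F1 p1 w1 A1 B1] ok1]] : exists c1, [/\ sF c1 = (mate e).1, sp c1 = edge_pt (mate e) s', sw c1 = pi,
    sA c1 = (mate e, s', ~~ flip e) & sB c1 = (mate e, s', flip e)] /\
    exists2 r0 : R, 0 < r0 & forall r : R, 0 < r <= r0 -> sector_ok r c1.
  have [c [[Fc pc wc Ac Bc] [r0 r00 okc]]] := edge_sector (mate e).1 (mate e).2 s'01.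
  rewrite -surjective_pairing in pc Ac Bc.
  case: (flip e); first by exists c; split => //; exists r0.
  by exists (sector_flip c); split => //; exists r0 => // r /okc; exact: sector_flip_ok.
pose sg k := if odd k then c1 else c0.
have per k : sg (k + 2)%N = sg k by rewrite /sg oddD addbF.
have odd2 k l : odd k = odd l -> k = l %[mod 2] by rewrite !modn2 => ->.
have me : mate e != e := mate_neq e.
have ne01 : sF c0 = sF c1 -> sp c0 = sp c1 -> False.
  rewrite F0 F1 p0 p1 => tE; rewrite [mate e]surjective_pairing -tE.
  by move=> /(edge_pt_inj s01 s'01) iE; move: me; rewrite [mate e]surjective_pairing -tE -iE eqxx.
have ok k : exists2 r0 : R, 0 < r0 & forall r : R, 0 < r <= r0 -> sector_ok r (sg k) by rewrite /sg; case: (odd k).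
have inj k l : sF (sg k) = sF (sg l) -> sp (sg k) = sp (sg l) -> k = l %[mod 2].
  move=> h1 h2; apply: odd2; move: h1 h2; rewrite /sg.
  by case: (odd k) (odd l) => -[] // h1 h2; exfalso; apply: ne01.
have [r [r0 okr sep]] := sectors_radius (ltn0Sn 1) per ok inj.
have adj k : gmate (sB (sg k)) = sA (sg k.+1).
  rewrite /sg /=; case: (odd k) => /=; rewrite ?A0 ?A1 ?B0 ?B1 /gmate /= ?mateK ?flip_mate.
    by rewrite -/e addbb /s'; case: (flip e) => //; rewrite opprB addrCA subrr addr0.
  by [].
have St2 : turn sg 2 = 2 * pi by rewrite /turn !big_ord_recl big_ord0 /= /sg /= w0 w1; ring.
have [Phi hPhi] : exists Phi, cone (fun p q : P => mdist p q) (proj t (edge_pt (t, i) s)) (turn sg 2) (r / 3) Phi.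
  by apply: (sectors_cone r0 (ltn0Sn 1) okr per adj sep); rewrite ?St2 // /sg /= F0 p0.
by exists (r / 3), Phi; rewrite -St2.
Qed.

End LocalCones.
(* A dart is an edge with one of its ends. [dturn] passes to the other dart of the same corner,
   [dmate] to the glued dart; composing them turns around the point. *)
Section Darts.
Context (R : realType) (S : gluing R).
Definition dart := ((face S * 'I_3) * bool)%type.
Implicit Types (D : dart) (k l : nat).

Definition dcor D : face S * 'I_3 := (D.1.1, if D.2 then ordS D.1.2 else D.1.2).
Definition dturn D : dart := if D.2 then ((D.1.1, ordS D.1.2), false) else ((D.1.1, ordS (ordS D.1.2)), true).
Definition dmate D : dart := (mate D.1, D.2 (+) flip D.1).
Definition dnext D := dmate (dturn D).
Definition dgerm D : ray_germ S := (D.1, if D.2 then 1 else 0, D.2).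

Lemma dturnK : involutive dturn.
Proof. by case=> -[t i] [] /=; rewrite /dturn /= ordS3. Qed.

Lemma dmateK : involutive dmate.
Proof. by case=> e b; rewrite /dmate /= mateK flip_mate -addbA addbb addbF. Qed.

Lemma dnext_inj : injective dnext.
Proof. exact: inj_comp (can_inj dmateK) (can_inj dturnK). Qed.

Lemma dturn_neq D : dturn D <> D.
Proof. by case: D => -[t i] []. Qed.

Lemma dmate_neq D : dmate D <> D.
Proof. by case: D => e b [me _]; have := mate_neq e; rewrite me eqxx. Qed.


Lemma gmate_dgerm D : gmate (dgerm D) = dgerm (dmate D).
Proof.
by case: D => e []; rewrite /gmate /dgerm /dmate /=; case: (flip e); rewrite /= ?subrr ?subr0.
Qed.

Lemma dcor_eq D D' : dcor D = dcor D' -> D = D' \/ D = dturn D'.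
Proof.
have oi (i j : 'I_3) : ordS i = ordS j -> i = j by move=> h; rewrite -(ordS3 i) -(ordS3 j) h.
case: D D' => -[t i] b [[t' j] b'] /= [-> /=]; case: b b' => -[] /= h.
- by left; rewrite (oi _ _ h).
- by right; rewrite /dturn /= -h ordS3.
- by right; rewrite /dturn /= h.
- by left; rewrite h.
Qed.

(* Turning around a point never comes back to a corner with the opposite orientation: a coincidence
   could be moved towards the middle, to a fixed point of one of the two involutions. *)
Lemma dturn_orbit D k l : iter k dnext D <> dturn (iter l dnext D).
Proof.
wlog kl : k l / (k <= l)%N.
  move=> W; case/orP: (leq_total k l) => h; first exact: W.
  by move=> e; apply: (W l k h); rewrite e dturnK.
have [m lm] : exists m, (l - k <= m)%N by exists (l - k)%N.
elim: m k l kl lm => [|m IH] k l kl lm E.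
  have kE : k = l by apply/eqP; rewrite eqn_leq kl -subn_eq0 -leqn0.
  by rewrite kE in E; exact: (dturn_neq (esym E)).
case: (ltngtP k l) kl => // [kl _|kE _]; last by rewrite kE in E; exact: (dturn_neq (esym E)).
case: l kl lm E => // l kl lm E.
have E2 : iter k.+1 dnext D = dturn (iter l dnext D).
  by rewrite iterS E /dnext dturnK iterS dmateK.
rewrite ltnS in kl; case: (ltngtP k l) kl => // [kl _|kE _].
  by apply: (IH k.+1 l kl _ E2); apply: leq_trans (leq_sub2l l (leqnSn k)) _; move: lm; rewrite subSn ?ltnS // ltnW.
move: E2; rewrite kE iterS /dnext => E2; exact: (dmate_neq E2).
Qed.

Lemma dart_sector D : exists c, [/\ sF c = D.1.1, sp c = corner (dcor D).1 (dcor D).2, sw c = corner_angle (dcor D),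
   sA c = dgerm D & sB c = dgerm (dturn D)] /\ exists2 r0 : R, 0 < r0 & forall r : R, 0 < r <= r0 -> sector_ok r c.
Proof.
case: D => -[t i] [].
  have [c [[h1 h2 h3 h4 h5] [r0 r00 h]]] := corner_sector t (ordS i).
  exists (sector_flip c); split; last by exists r0 => // r /h; exact: sector_flip_ok.
  by split; rewrite //= ?h5 ?h4 /dgerm /= ?ordS3.
by have [c [[h1 h2 h3 h4 h5] [r0 r00 h]]] := corner_sector t i; exists c; split => //; exists r0.
Qed.

End Darts.

Section CornerCones.
Context (R : realType) (P : polyhedron R).
Local Notation S := (pieces P).

Lemma corner_inj (t : face S) : injective (corner t).
Proof.
move=> i j; have [->|->|->] // := ord3_cases i j => h; have := corner_cr t i; rewrite /cr.
  by rewrite -h !subrr !mxE; rewrite !(mul0r, mulr0) subrr eqxx.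
by rewrite -h !subrr !mxE; rewrite !(mul0r, mulr0) subrr eqxx.
Qed.

(** The darts met when turning around the corner form an orbit of the injective map [dnext], whose
    length is the period. They are at different corners by [dturn_orbit], and by [sector_preimages]
    no corner at [x] is missed, so the angles add up to the sum in [curvature]. *)
Lemma corner_cone (x : P) : is_corner x -> 0 <= curvature x ->
  exists r Phi, cone (fun p q : P => mdist p q) x (2 * pi - curvature x) r Phi.
Proof.
move=> [[t0 i0] /= hx] cx; pose D0 : dart S := ((t0, i0), false).
have [sec hsec] := choice (@dart_sector R S).
pose E k := iter k (@dnext R S) D0; pose sg k := sec (E k).
have inj := @dnext_inj R S; pose n := order (@dnext R S) D0.
have n0 : (0 < n)%N := order_gt0 _ _.
have En k : E (k + n)%N = E k by rewrite /E iterD (iter_order inj).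
have Em k : E (k %% n)%N = E k.
  by rewrite [in RHS](divn_eq k n); elim: (k %/ n)%N => [|j IH]; rewrite ?mul0n // mulSn -addnA addnC En.
have Einj k l : E k = E l -> k = l %[mod n].
  rewrite -(Em k) -(Em l) => h.
  by rewrite -(findex_iter (ltn_pmod k n0)) -(findex_iter (ltn_pmod l n0)) -/(E _) h.
have per k : sg (k + n)%N = sg k by rewrite /sg En.
have ok k : exists2 r0 : R, 0 < r0 & forall r : R, 0 < r <= r0 -> sector_ok r (sg k) by have [] := hsec (E k).
have adj k : gmate (sB (sg k)) = sA (sg k.+1).
  by have [[_ _ _ _ ->] _] := hsec (E k); have [[_ _ _ -> _] _] := hsec (E k.+1); rewrite gmate_dgerm.
have corE k l : dcor (E k) = dcor (E l) -> k = l %[mod n].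
  by move=> /dcor_eq [/Einj //|/dturn_orbit].
have sinj k l : sF (sg k) = sF (sg l) -> sp (sg k) = sp (sg l) -> k = l %[mod n].
  have [[F1 p1 _ _ _] _] := hsec (E k); have [[F2 p2 _ _ _] _] := hsec (E l).
  rewrite F1 F2 p1 p2 => hF hp; apply: corE.
  by rewrite [LHS]surjective_pairing [RHS]surjective_pairing; move: hp; rewrite /= hF => /corner_inj ->.
have [r [r0 okr sep]] := sectors_radius n0 per ok sinj.
have sx : proj (sF (sg 0%N)) (sp (sg 0%N)) = x.
  by have [[F1 p1 _ _ _] _] := hsec (E 0%N); rewrite F1 p1.
have ap := sector_apex r0 n0 okr per adj sep sx.
have StE : turn sg n = 2 * pi - curvature x.
  rewrite /curvature opprB addrCA subrr addr0 /turn.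
  rewrite (eq_bigr (fun k : 'I_n => corner_angle (dcor (E k)))); last by move=> k _; have [[_ _ e _ _] _] := hsec (E k).
  pose h (k : 'I_n) := dcor (E k).
  have hinj : injective h.
    by move=> k l /corE e; apply/val_inj; move: e; rewrite /= !modn_small.
  have B := @big_imset _ _ _ _ _ h 'I_n (fun c => corner_angle c) (in2W hinj).
  transitivity (\sum_(i in 'I_n) corner_angle (h i)); first by apply: eq_bigl => k; rewrite inE.
  rewrite -B; apply: eq_bigl.
  move=> c; apply/imsetP/eqP => [[k _ ->]|cE].
    by have [[F1 p1 _ _ _] _] := hsec (E k); rewrite -[RHS](ap k) /sg F1 p1.
  have ci : in_face c.1 (corner c.1 c.2).
    by rewrite -edge_pt0 -surjective_pairing; apply: edge_pt_in; rewrite lexx ler01.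
  have [k [h1 h2]] := sector_preimages r0 n0 okr per adj sep sx ci cE.
  exists (Ordinal (ltn_pmod k n0)) => //; rewrite /h /= Em.
  have [[F1 p1 _ _ _] _] := hsec (E k); move: h1 h2; rewrite /sg F1 p1.
  case: c {cE ci} => t i /= -> /corner_inj iE; by rewrite [RHS]surjective_pairing /= -iE.
have St2 : turn sg n <= 2 * pi by rewrite StE; lra.
have [Phi hPhi] := sectors_cone r0 n0 okr per adj sep sx St2.
by exists (r / 3), Phi; rewrite -StE.
Qed.

End CornerCones.
Section PolarUniqueness.
Context (R : realType).

Lemma pol_mod (a f h : R) : 0 < a -> pol a f = pol a h -> exists m : int, h = f + m%:~R * (2 * pi).
Proof.
move=> a0 [/(mulfI (lt0r_neq0 a0)) ec /(mulfI (lt0r_neq0 a0)) es].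
have p0 := pi_gt0 R; have p2 : 0 < 2 * pi :> R by lra.
have [k hk] := near_int (f - h) p2.
exists k; set dl := f - h + _ in hk.
suff d0 : dl = 0 by move: d0; rewrite /dl; lra.
have dp : `|dl| <= pi by lra.
have cd : cos dl = 1.
  rewrite /dl (periodic_int (f := cos)) => [|y]; last by rewrite mulr2n mulrDl mul1r cosD2pi.
  by rewrite cosB ec es -!expr2 cos2Dsin2.
apply/normr0_eq0/eqP; rewrite eq_le normr_ge0 andbT.
by apply: (cos_le_abs dp); [rewrite lexx ltW|rewrite cd cos0].
Qed.

End PolarUniqueness.

(** * Discs inside a triangle *)

Section FlatPoints.
Context (R : realType) (P : polyhedron R).
Local Notation S := (pieces P).
Implicit Types (t : face S) (z p : 'rV[R]_2).

Definition vec (q : R * R) : 'rV[R]_2 := \row_k (if k == 0 then q.1 else q.2).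


Lemma vec_dist (q w : R * R) : enorm (vec q - vec w) = pd q w.
Proof. by rewrite enorm_nm !mxE. Qed.

Lemma vec_onto z : exists q, vec q = z.
Proof.
exists (z 0 0, z 0 1); apply/rowP => k; rewrite mxE.
by have [->|->] : k = 0 \/ k = 1 by case: k => -[|[|]] // hk; [left|right]; exact: val_inj.
Qed.

Lemma interior_ball t i (a b : R) : 0 < a -> 0 < b -> a + b < 1 ->
  let p := corner t i + a *: (corner t (ordS i) - corner t i) + b *: (corner t (ordS (ordS i)) - corner t i) in
  exists2 r : R, 0 < r & forall z, enorm (z - p) < r -> in_face t z /\ forall j (s : R), z <> edge_pt (t, j) s.
Proof.
move=> a0 b0 ab p; have [u [v [L [x [y [[on L0 y0 hU hV] _]]]]]] := frame_ex S (corner_cr t i).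
have k0 := kappa_gt0 0 on L0 y0 hU hV; set kp := _ + _ in k0.
have [m [m0 m1 m2 m3]] : exists m : R, [/\ 0 < m, m <= a, m <= b & m <= 1 - a - b].
  exists (Num.min (Num.min a b) (1 - a - b)); split; first by rewrite !lt_min a0 b0 /=; lra.
  - by rewrite !ge_min lexx.
  - by rewrite !ge_min lexx orbT.
  - by rewrite ge_min lexx orbT.
exists (m / kp); first by rewrite divr_gt0.
move=> z zr; have [X0 [Y0 pE]] := frame_coord 0 on L0 y0 hU hV p.
have [X [Y zE]] := frame_coord 0 on L0 y0 hU hV z.
have := pE; rewrite (frame_pt 0 on L0 y0 hU hV) add0r => /(coord_uniq 0 on L0 y0 hU hV) [aE bE].
have zp : z - p = (X - X0) *: u + (Y - Y0) *: v.
  by rewrite zE pE; apply/rowP => k; rewrite !mxE; ring.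
have := ca_small (r := m / kp) 0 on L0 y0 hU hV (X := X - X0) (Y := Y - Y0).
rewrite -/kp divfK ?gt_eqF // -(enorm_frame _ _ on) -zp => /(_ zr).
have -> : ca L x y (X - X0) (Y - Y0) = ca L x y X Y - a by rewrite aE /ca; ring.
have -> : (Y - Y0) / y = Y / y - b by rewrite bE; ring.
move=> sm; have h1 := ler_norm (ca L x y X Y - a); have h2 := ler_norm (- (ca L x y X Y - a)).
have h3 := ler_norm (Y / y - b); have h4 := ler_norm (- (Y / y - b)).
rewrite !normrN in h2 h4; have h5 := normr_ge0 (ca L x y X Y - a); have h6 := normr_ge0 (Y / y - b).
split.
  rewrite zE; apply/(frame_in 0 on L0 y0 hU hV); rewrite add0r; split; [lra| |lra].
  have Yy : 0 < Y / y by lra.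
  by rewrite -(divfK (lt0r_neq0 y0) Y) mulr_ge0 // ltW.
move=> j s zs; have [a' [b' [eE cs]]] := edge_coord 0 on L0 y0 hU hV j s.
have := zs; rewrite eE zE (frame_pt 0 on L0 y0 hU hV) add0r => /(coord_uniq 0 on L0 y0 hU hV) [a1 b1].
by case: cs => -[_ a2 b2]; lra.
Qed.

Definition discRep (t0 : face S) p (r : R) t z (a f : R) := [/\ t = t0, 0 <= a < r & z = p + vec (pol a f)].

(** No edge point is near, so nothing is glued there and Euclidean polar coordinates satisfy the
    local model. *)
Lemma disc_cone t p (r : R) : 0 < r -> (forall z, enorm (z - p) < r -> in_face t z /\ forall j (s : R), z <> edge_pt (t, j) s) ->
  exists r' Phi, cone (fun p q : P => mdist p q) (proj t p) (2 * pi) r' Phi.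
Proof.
move=> r0 hb; have p0 := pi_gt0 R; have p2 : 0 < 2 * pi :> R by lra.
have vd (q w : R * R) : enorm (p + vec q - (p + vec w)) = pd q w by rewrite opprD addrACA subrr add0r vec_dist.
have vp (a f : R) : 0 <= a -> enorm (p + vec (pol a f) - p) = a.
  move=> a0; have := vd (pol a f) (0, 0); rewrite pd0 nm_pol // (_ : vec (0, 0) = 0) ?addr0 //.
  by apply/rowP => k; rewrite !mxE if_same.
exists (r / 3), (Phi (proj t p) (discRep t p r)); apply: model_cone => //.
- move=> t' z a f [-> /andP[a0 ar] ->]; split; last by rewrite a0.
  by have [] := hb (p + vec (pol a f)); rewrite // vp.
- by move=> a f ha; exists t, (p + vec (pol a f)).
- by move=> t1 z1 t2 z2 a f [-> _ ->] [-> _ ->].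
- by move=> t' z a f; rewrite /discRep /pol mulr2n mulrDl mul1r cosD2pi sinD2pi.
- move=> t' z a f b h [_ /andP[a0 ar] ->] [_ /andP[b0 br] e].
  have ab : a = b by rewrite -(vp a f a0) e vp.
  split => //; have [->|an] := eqVneq a 0; [by left|right].
  apply: (@pol_mod _ a); first by rewrite lt_neqAle eq_sym an.
  by apply: pd_eq0; rewrite -vd e ab vd pdzz.
- move=> t1 z1 t2 z2 a f [t1E /andP[a0 ar] z1E] [[t' j] [s [_ [tE zE] _]]].
  exfalso; have [_ h] := hb z1 (ltac:(by rewrite z1E vp)).
  by apply: (h j s); rewrite zE -t1E tE.
- move=> t' z z' a f [-> /andP[a0 ar] ->] hz' lr.
  have [w wE] := vec_onto (z' - p); have zE : z' = p + vec w by rewrite wE addrC subrK.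
  have [k hk] := near_int (arg w - f) p2.
  have wp : pol (nm w) (arg w + k%:~R * (2 * pi)) = w.
    rewrite -[RHS]pol_arg /pol (periodic_int (f := cos)) ?(periodic_int (f := sin)) // => y; rewrite mulr2n mulrDl mul1r ?cosD2pi ?sinD2pi //.
  exists (nm w), (arg w + k%:~R * (2 * pi)); split.
    split => //; last by rewrite wp.
    rewrite nm_ge0 /=; have := nm_pd w (pol a f); rewrite nm_pol // -vd -zE; lra.
  rewrite cd_small; first by rewrite wp pdC -vd -zE.
  by rewrite distrC addrAC; lra.
- move=> f; exists 1 => // h _ a b ha hb'; exists t, (p + vec (pol a f)), (p + vec (pol b h)).
  by rewrite vd pdC.
- by move=> t' z f [-> _ ->]; rewrite /pol !mul0r (_ : vec (0, 0) = 0) ?addr0 //; apply/rowP => k; rewrite !mxE if_same.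
Qed.

End FlatPoints.
(** * Convex polyhedra *)

Lemma sphere_compact (R : realType) : compact [set u : 'rV[R]_3 | enorm u = 1].
Proof.
pose f (u : 'rV[R]_3) : R := u 0 ord0 * u 0 ord0 + u 0 (ordS ord0) * u 0 (ordS ord0) + u 0 (ordS (ordS ord0)) * u 0 (ordS (ordS ord0)).
have fc : continuous f.
  have cj j (u : 'rV[R]_3) : {for u, continuous (fun u : 'rV[R]_3 => u 0 j)} by exact: (@coord_continuous R 1 3 0 j u).
  have cm j : continuous (fun u : 'rV[R]_3 => u 0 j * u 0 j) by move=> u; exact: continuousM (cj j u) (cj j u).
  by move=> u; exact: cvgD (cvgD (cm _ u) (cm _ u)) (cm _ u).
have eE : (fun u : 'rV[R]_3 => enorm u) = Num.sqrt \o f.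
  by apply/funext => u; rewrite /enorm /edot (sum3 ord0).
have ec : continuous (fun u : 'rV[R]_3 => enorm u).
  by rewrite eE => u; apply: continuous_comp; [exact: fc|exact: sqrt_continuous].
apply: bounded_closed_compact; last first.
  by apply: (@closed_comp _ _ (fun u : 'rV[R]_3 => enorm u) [set 1]) => [u _|]; [exact: ec|exact: closed_eq].
exists 1; split => [|M M1 u /= u1]; first exact: num_real.
have co k : `|u 0 k| <= 1.
  rewrite -(@ler_pXn2r _ 2) ?nnegrE // expr1n real_normK ?num_real //.
  have e2 : edot u u = 1.
    have e0 : 0 <= edot u u by apply: sumr_ge0 => i _; rewrite -expr2 sqr_ge0.
    by rewrite -[LHS]sqr_sqrtr // -/(enorm u) u1 expr1n.
  rewrite -e2 /edot (bigD1 k) //= -expr2 lerDl; apply: sumr_ge0 => i _; by rewrite -expr2 sqr_ge0.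
by rewrite /Num.norm /= mx_normrE; apply: bigmax_le => [|[i k] _]; [lra|rewrite /= ord1; apply: le_trans (co k) (ltW M1)].
Qed.

Section PolyhedronGeometry.
Context (R : realType) (P : polyhedron R).
Local Notation S := (pieces P).
Let d (x y : P) : R := mdist x y.

(** For the total angle [2 * pi] polar coordinates give an isometry from a plane disc; the cut along
    the negative axis is bridged by shifting one angle by a period. *)
Lemma cone_flat (x : P) (r : R) Phi : cone d x (2 * pi) r Phi -> flat d x.
Proof.
move=> cP; have [r0 th0 h0 hth [hd hs]] := cP.
have E0 : Phi (nm (0, 0)) (arg (0, 0)) = x by rewrite nm00 h0.
have nr (a : R * R) : pd a (0, 0) < r -> 0 <= nm a < r by rewrite pd0 nm_ge0.
exists (fun z => Phi (nm z) (arg z)), (0, 0); split => //; exists r => //; split.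
  move=> a b /nr ha /nr hb; have [k hk] := near_int (arg a - arg b) th0.
  rewrite -(periodic_int (f := Phi (nm a)) (hth (nm a)) k (arg a)) hd //; last by rewrite addrAC.
  rewrite -[RHS](_ : pd (pol (nm a) (arg a)) (pol (nm b) (arg b)) = _); last by rewrite !pol_arg.
  by apply: pd_pol_eq => //; rewrite addrAC (periodic_int (f := cos)) // => y; rewrite mulr2n mulrDl mul1r cosD2pi.
rewrite E0 => p /hs [a [f [ha <-]]]; have [a0 ar] := andP ha.
exists (pol a f); first by rewrite pd0 nm_pol.
have [->|an] := eqVneq a 0; first by rewrite nm_pol // !h0.
have ap : 0 < a by rewrite lt_neqAle eq_sym an.
have := pol_arg (pol a f); rewrite nm_pol // => e.
have [m fE] := pol_mod ap e.
by rewrite [in RHS]fE (periodic_int (f := Phi a) (hth a)).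
Qed.

Lemma point_cone (x : P) : ~ is_corner x -> exists r Phi, cone d x (2 * pi) r Phi.
Proof.
move=> nc; have [t [p [hp px]]] := proj_surj x; have i : 'I_3 := ord0.
have [a [b [a0 b0 ab pE]]] := (in_faceP t i p).1 hp.
have edge (e : face S * 'I_3) (s : R) : t = e.1 -> p = edge_pt e s -> 0 <= s <= 1 -> exists r Phi, cone d x (2 * pi) r Phi.
  move=> te pe /andP[s0 s1]; rewrite -px te pe; apply: edge_cone.
  rewrite !lt_neqAle s0 s1 !andbT eq_sym; apply/andP; split; apply/eqP => se; apply: nc.
    by exists e; rewrite -px te pe se /edge_pt subr0 scale1r scale0r addr0.
  by exists (e.1, ordS e.2); rewrite -px te pe se /edge_pt subrr scale1r scale0r add0r.
have [a1|a1] := eqVneq a 0.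
  apply: (edge (t, ordS (ordS i)) (1 - b)) => //; last by apply/andP; split; lra.
  by rewrite pE a1 /edge_pt /= ordS3; apply/rowP => k; rewrite !mxE; ring.
have [b1|b1] := eqVneq b 0.
  apply: (edge (t, i) a) => //; last by apply/andP; split; lra.
  by rewrite pE b1 /edge_pt /=; apply/rowP => k; rewrite !mxE; ring.
have [ab1|ab1] := eqVneq (a + b) 1.
  apply: (edge (t, ordS i) b) => //; last by apply/andP; split; lra.
  have aE : a = 1 - b by lra.
  by rewrite pE aE /edge_pt /=; apply/rowP => k; rewrite !mxE; ring.
have a2 : 0 < a by rewrite lt_neqAle eq_sym a1.
have b2 : 0 < b by rewrite lt_neqAle eq_sym b1.
have ab2 : a + b < 1 by rewrite lt_neqAle ab1.
have [r r0 hr] := interior_ball t i a2 b2 ab2.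
by rewrite -px pE; exact: (disc_cone r0 hr).
Qed.

Lemma vertex_finite (x0 : P) : exists (n : nat) (f : nat -> P), forall v, is_vertex v -> exists i, (i < n)%N /\ f i = v.
Proof.
pose s := [seq proj c.1 (corner c.1 c.2) : P | c <- enum {: face S * 'I_3}].
exists (size s), (nth x0 s) => v [[c <-] _].
have cs : proj c.1 (corner c.1 c.2) \in s by apply: map_f; rewrite mem_enum.
by exists (index (proj c.1 (corner c.1 c.2) : P) s); rewrite index_mem nth_index.
Qed.

Hypothesis convex : convex_polyhedron P.

Lemma curvature_ge0 (x : P) : is_corner x -> 0 <= curvature x.
Proof.
move=> cx; have [->|n] := eqVneq (curvature x) 0; first by [].
by apply: ltW; apply: (proj2 convex).
Qed.

Lemma vertex_cone (v : P) : is_vertex v -> exists (th r : R) Phi, th < 2 * pi /\ cone d v th r Phi.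
Proof.
move=> vv; have [cv _] := vv; have c0 : 0 < curvature v := proj2 convex v vv.
have [r [Phi h]] := corner_cone cv (ltW c0).
by exists (2 * pi - curvature v), r, Phi; split => //; lra.
Qed.

Lemma flat_point (x : P) : ~ is_vertex x -> flat d x.
Proof.
move=> nv; have [cx|/point_cone[r [Phi h]]] := EM (is_corner x); last exact: cone_flat h.
have c0 : curvature x = 0 by apply/eqP/negPn/negP => n; exact: nv.
by have [r [Phi]] := corner_cone cx (curvature_ge0 cx); rewrite c0 subr0 => /cone_flat.
Qed.

(** The surface is a continuous image of the sphere, hence compact. *)
Lemma ultra_limit (T : Type) (F : set_system T) : UltraFilter F -> forall f : T -> P,
  exists p, forall e : R, 0 < e -> F (fun i => d (f i) p < e).
Proof.
move=> uF f; have [[phi [g [_ gc n1 gK _]]] _] := convex.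
have cT : compact [set: P].
  have -> : [set: P] = g @` [set u | enorm u = 1].
    by apply/seteqP; split=> // x _; exists (phi x); rewrite /= ?n1 ?gK.
  exact: continuous_compact gc (@sphere_compact R).
have pF := @ultra_proper _ _ uF.
have [p [_ cl]] := cT (f @ F) _ filterT.
exists p => e e0; have [//|nb] := in_ultra_setVsetC (fun i => d (f i) p < e) uF.
have [y [/= h1 h2]] := cl (fun y => ~ d y p < e) (ball p e) nb (nbhsx_ballx _ _ e0).
by exfalso; apply: h1; rewrite /d metric_sym; move: h2; rewrite ballEmdist.
Qed.

End PolyhedronGeometry.

(** * Application to the geodesic ray *)

Section DenseRay.
Context (R : realType) (P : polyhedron R).
Variables (I : set R) (G : R -> P) (a sg : R).
Hypothesis convex : convex_polyhedron P.
Hypothesis geoG : geodesic I G.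
Hypothesis simpleG : simple_geodesic I G.
Hypothesis aperiodic : ~ periodic_geodesic I G.
Hypothesis sg1 : sg = 1 \/ sg = -1.
Hypothesis hI : forall t : R, 0 <= t -> I (a + sg * t).

Let d (x y : P) : R := mdist x y.
Let h (t : R) : P := G (a + sg * t).
Let J (t : R) : Prop := I (a + sg * t).
(** The shift by 1 makes [g] geodesic on both sides of every [t >= 0], also when [a] is the end of
    [I]. *)
Let g (t : R) : P := h (1 + t).

Let dxx x : d x x = 0. Proof. exact: mdistxx. Qed.
Let dC x y : d x y = d y x. Proof. exact: metric_sym. Qed.
Let dtri y x z : d x z <= d x y + d y z. Proof. exact: metric_triangle. Qed.
Let deq x y : d x y = 0 -> x = y. Proof. exact: mdist_positivity. Qed.

Let sgn_norm (x : R) : `|sg * x| = `|x|.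
Proof. by case: sg1 => ->; rewrite ?mul1r ?mulN1r ?normrN. Qed.

Let sg2 (x : R) : sg * (sg * x) = x.
Proof. by case: sg1 => ->; ring. Qed.

Lemma J_up (t u : R) : J t -> t <= u -> J u.
Proof.
move=> Jt tu; have [u0|u0] := leP 0 u; first exact: hI.
have [iI _] := geoG; have I0 := hI (lexx 0); rewrite mulr0 addr0 in I0.
rewrite /J; case: sg1 => e; rewrite /J e in Jt *.
  by apply: (iI _ _ Jt I0); apply/andP; split; lra.
by apply: (iI _ _ I0 Jt); apply/andP; split; lra.
Qed.

Lemma h_geo (t : R) : J t -> exists2 e : R, 0 < e & forall s u : R, J s -> J u -> `|s - t| < e -> `|u - t| < e -> d (h s) (h u) = `|s - u|.
Proof.
move=> Jt; have [_ /(_ _ Jt) [e e0 he]] := geoG; exists e => // s u Js Ju hs hu.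
have E (x y : R) : a + sg * x - (a + sg * y) = sg * (x - y) by ring.
by rewrite /d /h he ?E ?sgn_norm.
Qed.

Lemma h_lgeo (b t : R) : J b -> b < t -> lgeo d h t.
Proof.
move=> Jb bt; have [e e0 he] := h_geo (J_up Jb (ltW bt)).
exists (Num.min e (t - b)); first by rewrite lt_min e0 subr_gt0.
move=> s u; rewrite !lt_min => /andP[s1 s2] /andP[u1 u2].
by apply: he => //; apply: (J_up Jb); [move: s2|move: u2]; rewrite ltr_norml => /andP[]; lra.
Qed.

Lemma lgeo_comp (al si u : R) : si = 1 \/ si = -1 -> lgeo d h (al + si * u) -> lgeo d (fun v => h (al + si * v)) u.
Proof.
move=> s1 [e e0 he]; exists e => // s v hs hv.
have E (x y : R) : `|al + si * x - (al + si * y)| = `|x - y|.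
  by rewrite opprD addrACA subrr add0r -mulrBr; case: s1 => ->; rewrite ?mul1r ?mulN1r ?normrN.
by rewrite he E.
Qed.

Let J0 : J 0. Proof. exact: hI. Qed.

Lemma ray_lgeo (t : R) : 0 <= t -> lgeo d g t.
Proof.
by move=> t0; apply: (lgeo_shift dxx dC dtri deq); apply: (h_lgeo J0); lra.
Qed.

(** [E] recentred at [z] is a flat chart, and the directions of [G] in it are those of [g]
    multiplied by [sg]. *)
Lemma ray_simple (E : R * R -> P) (z : R * R) (t1 t2 : R) (e1 e2 : R * R) (dl : R) : 0 <= t1 -> 0 <= t2 -> 0 < dl ->
  good d E z -> nm e1 = 1 -> nm e2 = 1 -> line_at g t1 E z e1 dl -> line_at g t2 E z e2 dl -> e1 = e2.
Proof.
move=> t10 t20 dl0 [r r0 [hi ho]] n1 n2 l1 l2; have [//|ne] := EM (e1 = e2).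
exfalso; apply: simpleG.
pose phi (u : 'rV[R]_2) := E (z.1 + u 0 0, z.2 + u 0 1).
pose v (e : R * R) := vec (sg * e.1, sg * e.2).
have phi0 : phi 0 = E z by rewrite /phi !mxE !addr0 -surjective_pairing.
have at0 t e : line_at g t E z e dl -> g t = E z by move=> /(_ 0); rewrite normr0 addr0 mv0; apply.
have pn (u : 'rV[R]_2) : pd (z.1 + u 0 0, z.2 + u 0 1) z = enorm u by rewrite enorm_nm /pd /= !(addrAC _ _ (- _)) !subrr !add0r.
have dir t e : line_at g t E z e dl -> has_direction phi I G (a + sg * (1 + t)) (v e).
  move=> l; apply/nbhs_ballP; exists dl => //= x; rewrite /ball /= sub0r normrN => xd _.
  have -> : a + sg * (1 + t) + x = a + sg * (1 + (t + sg * x)) by rewrite !mulrDr sg2 !addrA.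
  rewrite -[G _]/(g (t + sg * x)) l ?sgn_norm //.
  by rewrite /phi /mv !mxE /=; congr (E (_, _)); ring.
exists (a + sg * (1 + t1)), (a + sg * (1 + t2)), phi, (v e1), (v e2); split.
- by split; apply: hI; lra.
- by rewrite -[LHS]/(g t1) -[RHS]/(g t2) (at0 _ _ l1) (at0 _ _ l2).
- rewrite -[G _]/(g t1) (at0 _ _ l1); exists r; split => // [u w hu hw|y hy].
    rewrite -[LHS]/(d _ _) /phi hi ?pn // enorm_nm /pd !mxE /=; congr nm; congr pair; ring.
  have [w hw <-] := ho y hy; exists (vec (w.1 - z.1, w.2 - z.2)).
    by rewrite enorm_nm !mxE.
  by rewrite /phi !mxE /= ![_ + (_ - _)]addrC !subrK -surjective_pairing.
- by split; exact: dir.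
- move=> ve; apply: ne; have h0 := congr1 (fun q : 'rV[R]_2 => q 0 0) ve; have h1 := congr1 (fun q : 'rV[R]_2 => q 0 1) ve.
  rewrite !mxE /= in h0 h1.
  by rewrite [LHS]surjective_pairing [RHS]surjective_pairing -(sg2 e1.1) -(sg2 e1.2) h0 h1 !sg2.
Qed.

Lemma h_flat (b t : R) : J b -> b < t -> flat d (h t).
Proof.
move=> Jb bt; apply: (flat_point convex) => hv.
exact: (V_nogeo dxx dC dtri deq ray_lgeo ray_simple (ultra_limit convex) (vertex_cone convex) hv (h_lgeo Jb bt)).
Qed.

(** A coincidence near [t] spreads both ways by [uniq]. If [I] contains its end, where [h] is
    geodesic on one side only, that end is reached by continuity. *)
Lemma h_periodic (t T dl : R) : 1 <= t -> 0 < T -> 0 < dl -> (forall x : R, `|x| < dl -> h (t + x + T) = h (t + x)) ->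
  forall b, J b -> h (b + T) = h b.
Proof.
move=> t1 T0 dl0 hx.
have int b b' : J b' -> b' < b -> h (b + T) = h b.
  move=> Jb bb; have [b0 [Jb0 b0b b0t]] : exists b0 : R, [/\ J b0, b0 < b & b0 < t].
    have [le|lt] := leP b' 0; first by exists b'; split => //; lra.
    by exists 0; split => //; lra.
  pose si : R := if t <= b then 1 else -1.
  have s1 : si = 1 \/ si = -1 by rewrite /si; case: ifP; [left|right].
  have U0 : 0 <= si * (b - t) by rewrite /si; have [tb|tb] := leP t b; rewrite ?mul1r ?mulN1r; lra.
  have siK : si * (si * (b - t)) = b - t by case: s1 => ->; ring.
  have low (u : R) : 0 <= u <= si * (b - t) -> b0 < t + si * u.
    by move=> /andP[u0]; rewrite /si; have [tb|tb] := leP t b; rewrite ?mul1r ?mulN1r; lra.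
  have l1 u : 0 <= u <= si * (b - t) -> lgeo d (fun u => h (t + T + si * u)) u.
    by move=> hu; apply: (lgeo_comp s1); apply: (h_lgeo Jb0); have := low u hu; lra.
  have := @uniq _ _ _ dxx dC dtri deq (fun u => h (t + T + si * u)) (fun u => h (t + si * u)) (si * (b - t)) U0.
  move=> /(_ _ _ _ _ _ (si * (b - t))) -/(_ (fun u hu => lgeo_lcont dxx dC dtri deq (l1 u hu)) (fun u hu _ => l1 u hu)).
  case=> [u hu|u hu|||dl' dl'0 hd].
  - by apply: (lgeo_comp s1); apply: (h_lgeo Jb0); exact: low.
  - by apply: (h_flat Jb0); exact: low.
  - exists dl => // x xd; rewrite !add0r -(hx (si * x)); last by case: s1 => ->; rewrite ?mul1r ?mulN1r ?normrN.
    by congr h; ring.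
  - by rewrite U0 lexx.
  - have := hd 0; rewrite normr0 addr0 siK => /(_ dl'0).
    by rewrite (_ : t + T + (b - t) = b + T) 1?(_ : t + (b - t) = b) //; ring.
(* The possible end point is compared with [b + m / 4], where the equality is known; two distances
   [m / 4] cannot make up the supposed distance. *)
move=> b Jb; apply: deq; apply/eqP; rewrite eq_le {1}/d mdist_ge0 andbT leNgt; apply/negP => D0.
have [e1 e10 h1] := h_geo Jb; have JbT : J (b + T) by apply: (J_up Jb); lra.
have [e2 e20 h2] := h_geo JbT.
pose m := Num.min (Num.min e1 e2) (d (h (b + T)) (h b)).
have m0 : 0 < m by rewrite !lt_min e10 e20.
have [m1 m2 m3] : [/\ m <= e1, m <= e2 & m <= d (h (b + T)) (h b)].
  by rewrite /m; split; rewrite !ge_min lexx ?orbT.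
move: m m0 m1 m2 m3 => m m0 m1 m2 m3.
have x0 : 0 <= m / 4 by lra.
have J1 : J (b + m / 4) by apply: (J_up Jb); lra.
have J2 : J (b + m / 4 + T) by apply: (J_up Jb); lra.
have q1 : d (h (b + m / 4)) (h b) = m / 4.
  by rewrite h1 ?subrr ?normr0 // addrAC subrr add0r ger0_norm //; lra.
have q2 : d (h (b + T)) (h (b + m / 4 + T)) = m / 4.
  have e : b + m / 4 + T - (b + T) = m / 4 by ring.
  by rewrite dC h2 ?e ?subrr ?normr0 // ger0_norm //; lra.
have q3 := int (b + m / 4) b Jb; rewrite q3 in q2; last by lra.
have := dtri (h (b + m / 4)) (h (b + T)) (h b); rewrite q1 q2; lra.
Qed.

Lemma ray_aperiodic (t T dl : R) : 1 <= t -> 0 < T -> 0 < dl -> (forall x : R, `|x| < dl -> g (t + T + x) = g (t + x)) -> False.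
Proof.
move=> t1 T0 dl0 hx; apply: aperiodic; exists T => // s Is IsT.
have per : forall b, J b -> h (b + T) = h b.
  apply: (@h_periodic (1 + t) T dl) => // [|x xd]; first by lra.
  have E := hx x xd; rewrite /g in E.
  by rewrite -(addrA 1 t x) -E; congr h; ring.
case: sg1 => e.
  have Js : J (s - a) by rewrite /J e mul1r addrC subrK.
  have := per _ Js; rewrite /h e !mul1r => E.
  have e1 : s + T = a + (s - a + T) by ring.
  have e2 : s = a + (s - a) by ring.
  by rewrite [in LHS]e1 [in RHS]e2 E.
have Js : J (a - (s + T)) by rewrite /J e mulN1r opprB addrC subrK.
have := per _ Js; rewrite /h e !mulN1r => E.
have e1 : s + T = a + - (a - (s + T)) by ring.
have e2 : s = a + - (a - (s + T) + T) by ring.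
by rewrite [in LHS]e1 [in RHS]e2 E.
Qed.

Lemma ray_dense : dense (G @` I).
Proof.
move=> O [x Ox] oO; have [e /= e0 he] := (nbhs_ballP x O).1 (open_nbhs_nbhs (conj oO Ox)).
have [t [t0 ht]] := all_Lim dxx dC dtri deq ray_lgeo ray_simple (ultra_limit convex) (vertex_cone convex)
  (flat_point convex) ray_aperiodic (vertex_finite (G a)) (@mdist_geo R P) x 0 e0.
exists (g t); split; last by exists (a + sg * (1 + t)) => //; apply: hI; lra.
by apply: he; rewrite ballEmdist /= metric_sym.
Qed.

End DenseRay.

Theorem theorem2 (R : realType) (P : polyhedron R) (I : set R) (G : R -> P) :
  convex_polyhedron P ->
  geodesic_ray I G ->
  simple_geodesic I G ->
  ~ periodic_geodesic I G ->
  dense (G @` I).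
Proof.
move=> cP [gG _ nb] sG aG; have [iI _] := gG.
(* The ray is traversed in an unbounded direction of [I]: forwards here, backwards if [I] is bounded
   above. *)
have [ub|nub] := EM (has_ubound I); last first.
  have far (M : R) : exists2 y, I y & M < y.
    have [//|n] := EM (exists2 y, I y & M < y); exfalso; apply: nub; exists M => y Iy.
    by rewrite leNgt; apply/negP => My; apply: n; exists y.
  have [a Ia _] := far 0; apply: (@ray_dense R P I G a 1) => // [|t t0]; first by left.
  have [y Iy ty] := far (a + 1 * t); apply: (iI _ _ Ia Iy); apply/andP; split; lra.
have nlb : ~ has_lbound I by move=> lb; apply: nb.
have far (M : R) : exists2 y, I y & y < M.
  have [//|n] := EM (exists2 y, I y & y < M); exfalso; apply: nlb; exists M => y Iy.
  by rewrite leNgt; apply/negP => My; apply: n; exists y.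
have [a Ia _] := far 0; apply: (@ray_dense R P I G a (-1)) => // [|t t0]; first by right.
have [y Iy ty] := far (a + -1 * t); apply: (iI _ _ Iy Ia); apply/andP; split; lra.
Qed.
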